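(* Let \[ \mathcal{F}(c,\eta)=\sum_{n=1}^{\infty}\frac{2^{1-2n}-1}{2n(2n-1)}\,B_{2n}\,(c\,\eta)^{1-2n},\qquad \mathcal{G}(c,\eta)=\sum_{n=1}^{\infty}\frac{B_{2n}}{2n(2n-1)}\,(c\,\eta)^{1-2n}, \] where $B_{2n}$ are the Bernoulli numbers defined by $\frac{w}{e^w-1}=1-\frac{w}{2}+\sum_{n\ge1}\frac{B_{2n}}{(2n)!}w^{2n}$, and let $c_p=\frac{c_\infty+c_0}{2}$, $c_m=\frac{c_\infty-c_0}{2}$. Then for a path $\Gamma(\tau,0_{c_*})$ ($*=\infty$ or $0$) from a turning point (or the simple-pole) $\tau$ to the double-pole $0_{c_*}$, the Voros coefficients of $(P_{\rm III'})_{D_6}$ are \[ W_{0_{c_\infty,\pm}}(\mathbf{c},\eta)=\pm\big\{\mathcal{F}(c_p,\eta)+\mathcal{F}(c_m,\eta)-3\,\mathcal{G}(c_\infty,\eta)\big\}, \] \[ W_{0_{c_0,\pm}}(\mathbf{c},\eta)=\pm\big\{\mathcal{F}(c_p,\eta)-\mathcal{F}(c_m,\eta)-3\,\mathcal{G}(c_0,\eta)\big\}. \]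
   Context: Let $\eta>0$ be a large parameter and $\mathbf{c}=(c_\infty,c_0)\in\mathbb{C}^2$ with $c_\infty,\ c_0,\ c_\infty^2-c_0^2,\ c_\infty^2+c_0^2$ all nonzero. The third Painlevé equation $(P_{\rm III'})_{D_6}$ is \[ \frac{d^2\lambda}{dt^2}=\frac1\lambda\Big(\frac{d\lambda}{dt}\Big)^2-\frac1t\frac{d\lambda}{dt}+\eta^2F(\lambda,t,\mathbf{c}),\qquad F(\lambda,t,\mathbf{c})=\frac{\lambda^3}{t^2}-\frac{c_\infty\lambda^2}{t^2}+\frac{c_0}{t}-\frac1\lambda . \] Let $\lambda_0(t,\mathbf{c})$ be a branch of the algebraic function defined by $F(\lambda_0,t,\mathbf{c})=0$ and $\Delta(t,\mathbf{c})=\partial_\lambda F(\lambda_0,t,\mathbf{c})$. A turning point is a zero $\tau\ne0$ of $\Delta$. At $t=0$ the branch $\lambda_0=\pm\sqrt{c_0/c_\infty}\,t^{1/2}(1+O(t^{1/2}))$ gives the simple-pole $\tau_{sp}$. Let $\lambda^{(0)}=\sum_{\ell\ge0}\eta^{-\ell}\lambda^{(0)}_\ell$ with $\lambda^{(0)}_0=\lambda_0$ be the formal power series solution of $(P_{\rm III'})_{D_6}$. The Riccati equation \[ R^2+\frac{dR}{dt}=\Big(\frac{2}{\lambda^{(0)}}\frac{d\lambda^{(0)}}{dt}-\frac1t\Big)R+\eta^2\Big\{\partial_\lambda F(\lambda^{(0)},t,\mathbf{c})-\eta^{-2}\Big(\frac{1}{\lambda^{(0)}}\frac{d\lambda^{(0)}}{dt}\Big)^2\Big\}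 \] has two formal solutions $R_\pm=\pm\eta\sqrt\Delta+O(1)$; set $R_{\rm odd}=\frac12(R_+-R_-)=\sum_{n\ge0}\eta^{1-2n}R_{2n-1}$, $R_{-1}=\sqrt\Delta$. Integrals from a turning point or simple-pole $\tau$ are one half of contour integrals on the Riemann surface of $\sqrt\Delta$ encircling $\tau$. For a path $\Gamma(\tau,0_{c_*})$ the Voros coefficient is the formal power series $W_{0_{c_*}}(\mathbf{c},\eta)=\int_{\Gamma(\tau,0_{c_*})}(R_{\rm odd}-\eta R_{-1})\,dt$ (termwise; the integrals of $R_{2n-1}$, $n\ge1$, converge at the endpoint). The endpoint symbols mean: as $t\to0_{c_\infty,\pm}$, $\lambda_0=c_\infty(1+O(t))$ and $R_{-1}=\pm\frac{c_\infty}{t}(1+O(t))$; as $t\to0_{c_0,\pm}$, $\lambda_0=\frac{t}{c_0}(1+O(t))$ and $R_{-1}=\pm\frac{c_0}{t}(1+O(t))$. *)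

(* Defs.v *)
From Stdlib Require Import Reals ClassicalEpsilon List.
From Coquelicot Require Import Coquelicot.
Import ListNotations.
Set Implicit Arguments.
Open Scope R_scope.

Definition Cholo (f : C -> C) (z : C) : Prop :=
  ex_derive (K := C_AbsRing) (V := C_NormedModule) f z.

(* the complex derivative f'(z) (meaningful where f is holomorphic) *)
Definition Cderiv (f : C -> C) (z : C) : C :=
  epsilon (inhabits (RtoC 0))
    (fun l : C => is_derive (K := C_AbsRing) (V := C_NormedModule) f z l).

Definition pderiv (p : R -> C) (s : R) : C :=
  (Derive (fun u => Re (p u)) s, Derive (fun u => Im (p u)) s).

Definition CRInt (g : R -> C) (a b : R) : C :=
  (RInt (fun x => Re (g x)) a b, RInt (fun x => Im (g x)) a b).

Fixpoint Cpow (c : C) (m : nat) : C :=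
  match m with O => RtoC 1 | S k => Cmult c (Cpow c k) end.

(* Formal power series in eta^{-1}: coefficient sequences nat -> C     *)

Fixpoint csum (f : nat -> C) (n : nat) : C :=
  match n with O => f O | S m => Cplus (csum f m) (f (S m)) end.

Definition smul (a b : nat -> C) (k : nat) : C :=
  csum (fun j => Cmult (a j) (b (k - j)%nat)) k.

(* coefficients b_n, ..., b_0 of the inverse series 1/a (a 0 <> 0) *)
Fixpoint inv_upto (a : nat -> C) (n : nat) : list C :=
  match n with
  | O => [Cinv (a O)]
  | S m =>
      let l := inv_upto a m in
      Cmult (Copp (Cinv (a O)))
            (csum (fun j => match j with
                            | O => RtoC 0
                            | S i => Cmult (a j) (nth i l (RtoC 0)) end) (S m))
      :: l
  end.

Definition sinv (a : nat -> C) (n : nat) : C := hd (RtoC 0) (inv_upto a n).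

Definition Fv (cinf c0 l t : C) : C :=
  (l * l * l / (t * t) - cinf * (l * l) / (t * t) + c0 / t - / l)%C.

Definition dFv (cinf c0 l t : C) : C :=
  (RtoC 3 * (l * l) / (t * t) - RtoC 2 * cinf * l / (t * t) + / (l * l))%C.

(* Coefficient of eta^{-m} of F(lambda^(0), t) at the point t = z, where
   lambda^(0) = sum_l eta^{-l} lam l (each lam l a function of t). *)
Definition Fser (cinf c0 : C) (lam : nat -> C -> C) (z : C) (m : nat) : C :=
  let L := fun k => lam k z in
  let I := sinv L in
  (smul (smul L L) L m / (z * z) - cinf * smul L L m / (z * z)
   + (match m with O => c0 / z | _ => RtoC 0 end) - I m)%C.

Definition dFser (cinf c0 : C) (lam : nat -> C -> C) (z : C) (m : nat) : C :=
  let L := fun k => lam k z in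
  let I := sinv L in
  (RtoC 3 * smul L L m / (z * z) - RtoC 2 * cinf * L m / (z * z)
   + smul I I m)%C.

(* lambda^(0) = sum eta^{-l} lam l is a formal solution of (P_III')_{D6}
   at the point t = z:  comparing the coefficients of eta^{2-m} in
   eta^2 F(lambda) = lambda'' - (lambda')^2/lambda + lambda'/t. *)
Definition painleve_eq (cinf c0 : C) (lam : nat -> C -> C) (z : C) : Prop :=
  let L := fun k => lam k z in
  let L1 := fun k => Cderiv (lam k) z in
  let L2 := fun k => Cderiv (Cderiv (lam k)) z in
  let I := sinv L in
  forall m : nat,
    Fser cinf c0 lam z m =
    match m with
    | O | S O => RtoC 0
    | S (S j) => (L2 j - smul (smul L1 L1) I j + L1 j / z)%C
    end.

(* R = sum_{k>=0} eta^{1-k} rho k is a formal solution at t = z of the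
   Riccati equation
   R^2 + R' = (2 lambda'/lambda - 1/t) R
              + eta^2 { dF(lambda) - eta^{-2} (lambda'/lambda)^2 },
   lambda = lambda^(0):  comparing the coefficients of eta^{2-m}. *)
Definition riccati_eq (cinf c0 : C) (lam rho : nat -> C -> C) (z : C) : Prop :=
  let L := fun k => lam k z in
  let L1 := fun k => Cderiv (lam k) z in
  let I := sinv L in
  let B := smul L1 I in
  let A := fun j => (RtoC 2 * B j - match j with O => / z | _ => RtoC 0 end)%C in
  let P := fun k => rho k z in
  let P1 := fun k => Cderiv (rho k) z in
  forall m : nat,
    (smul P P m + match m with O => RtoC 0 | S j => P1 j end)%C =
    (match m with O => RtoC 0 | S j => smul A P j end
     + dFser cinf c0 lam z m
     - match m with O | S O => RtoC 0 | S (S j) => smul B B j end)%C.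

(* An analytic continuation along the path p (parameter u ranging in the
   set I) of the whole data: for every u we are given germs at p u
   (functions holomorphic on a disc around p u)
     lam u l  : the coefficient lambda^(0)_l,
     rp u k   : the coefficient of eta^{1-k} of R_+ (so rp u 0 = sqrt Delta),
     rm u k   : the coefficient of eta^{1-k} of R_- (rm u 0 = - sqrt Delta),
   satisfying the defining equations on that disc (t <> 0, Delta <> 0),
   and the germs of lambda_0 and sqrt Delta at nearby parameters agree
   (this is analytic continuation along p; the other germs are then
   determined by the recursions). *)
Definition lift_ok (cinf c0 : C) (p : R -> C) (I : R -> Prop)
    (lam rp rm : R -> nat -> C -> C) : Prop :=
  (forall u, I u -> exists d, 0 < d /\
     forall z : C, Cmod (z - p u)%C < d ->
       z <> RtoC 0 /\
       (forall l, Cholo (lam u l) z /\ Cholo (rp u l) z /\ Cholo (rm u l) z) /\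
       lam u O z <> RtoC 0 /\ rp u O z <> RtoC 0 /\
       rm u O z = Copp (rp u O z) /\
       Cmult (rp u O z) (rp u O z) = dFv cinf c0 (lam u O z) z /\
       painleve_eq cinf c0 (lam u) z /\
       riccati_eq cinf c0 (lam u) (rp u) z /\
       riccati_eq cinf c0 (lam u) (rm u) z) /\
  (forall u, I u -> exists e, 0 < e /\
     forall u', I u' -> Rabs (u' - u) < e ->
       exists d, 0 < d /\ forall z : C, Cmod (z - p u')%C < d ->
         lam u' O z = lam u O z /\ rp u' O z = rp u O z).

(* R_{2n-1} = coefficient of eta^{1-2n} of R_odd = (R_+ - R_-)/2 *)
Definition Rodd (rp rm : nat -> C -> C) (n : nat) (z : C) : C :=
  ((rp (2 * n)%nat z - rm (2 * n)%nat z) / RtoC 2)%C.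

Inductive dpole := Pinf | P0.

Definition sgn (plus : bool) : C := if plus then RtoC 1 else RtoC (-1).

(* behaviour of the continued data along Gam as s -> 1^- (t = Gam s -> 0):
   0_{c_inf,+-}: lambda_0 = c_inf (1 + O(t)), R_{-1} = +- (c_inf/t)(1 + O(t));
   0_{c_0,+-}  : lambda_0 = (t/c_0)(1 + O(t)), R_{-1} = +- (c_0/t)(1 + O(t)). *)
Definition endpoint_cond (cinf c0 : C) (e : dpole) (plus : bool)
    (Gam : R -> C) (lam rp : R -> nat -> C -> C) : Prop :=
  exists K d, 0 < d /\ forall s, 1 - d < s < 1 ->
    let t := Gam s in
    match e with
    | Pinf =>
        Cmod (lam s O t - cinf)%C <= K * Cmod t /\
        Cmod (t * rp s O t - sgn plus * cinf)%C <= K * Cmod t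
    | P0 =>
        Cmod (lam s O t - t / c0)%C <= K * (Cmod t * Cmod t) /\
        Cmod (t * rp s O t - sgn plus * c0)%C <= K * Cmod t
    end.

(* no turning point of any branch (and not the origin) at z *)
Definition regular_point (cinf c0 z : C) : Prop :=
  z <> RtoC 0 /\
  forall l : C, l <> RtoC 0 -> Fv cinf c0 l z = RtoC 0 -> dFv cinf c0 l z <> RtoC 0.

Definition circ (tau w : C) (k : Z) (th : R) : C :=
  (tau + w * (cos (2 * PI * IZR k * th), sin (2 * PI * IZR k * th)))%C.

Definition bern_gen (w : R) : R :=
  if Req_EM_T w 0 then 1 else w / (exp w - 1).

(* B_m = m! * (m-th Taylor coefficient of w/(e^w-1) at 0) *)
Definition bernoulli (m : nat) : R := Derive_n bern_gen m 0.

(* coefficient of eta^{1-2n} in calF(c, eta) and calG(c, eta) *)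
Definition calF_coef (c : C) (n : nat) : C :=
  Cmult (RtoC ((/ 2 ^ (2 * n - 1) - 1) / (INR (2 * n) * INR (2 * n - 1))
               * bernoulli (2 * n)))
        (Cinv (Cpow c (2 * n - 1))).

Definition calG_coef (c : C) (n : nat) : C :=
  Cmult (RtoC (bernoulli (2 * n) / (INR (2 * n) * INR (2 * n - 1))))
        (Cinv (Cpow c (2 * n - 1))).

Definition voros_rhs (cinf c0 : C) (e : dpole) (plus : bool) (n : nat) : C :=
  let cp := ((cinf + c0) / RtoC 2)%C in
  let cm := ((cinf - c0) / RtoC 2)%C in
  match e with
  | Pinf => (sgn plus * (calF_coef cp n + calF_coef cm n
                         - RtoC 3 * calG_coef cinf n))%C
  | P0 => (sgn plus * (calF_coef cp n - calF_coef cm n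
                       - RtoC 3 * calG_coef c0 n))%C
  end.

(* Main.v *)
(* Put h = 1/eta, D = t d/dt, s = t/lambda, e = D log lambda.  The equation becomes
   the system D lambda = e lambda, D s = (1 - e) s,
   h^2 D e = lambda^2 - c_inf lambda - s^2 + c_0 s, and its linearisation is the
   Riccati equation sigma^2 + h D sigma = 2 lambda^2 - c_inf lambda + 2 s^2 - c_0 s
   with sigma_odd = h t R_odd; all of this is symmetric under
   (lambda, s, c_inf, c_0) <-> (s, lambda, c_0, c_inf).

   The formal solution has a Backlund transformation T = exp (h d) with
   d = d/dc_m at fixed t and c_p, that is c_m -> c_m + h (the image under (s, c_0) -> (-s, -c_0)
   shifts c_p instead).  It acts on WKB solutions, and (T - 1) sigma_odd is h D of
   the logarithm of an explicit algebraic expression.  Inverting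
   (exp (h d) - 1) / (h d) by the Bernoulli series shows that every second
   derivative of sigma_odd along c_m, c_p is D of an explicit element; since
   sigma_odd is homogeneous of degree 1 in (c_inf, c_0, t^(1/2), 1/eta), Euler's
   relation turns this into a primitive of each R_{2n-1} dt that is algebraic in t.
   The primitive changes sign with sqrt Delta, so half the integral over
   the circle around tau equals its value at the starting point of the remaining
   path, and at the double pole it takes the stated value.

   Elements are treated as polynomials in generators modulo relations, so that the
   derivatives along c_m, c_p make sense and values at a point are obtained by
   evaluating the generators. *)

From Stdlib Require Import Reals ZArith List Lia Lra.
From Stdlib Require Import FunctionalExtensionality PropExtensionality ProofIrrelevance ClassicalEpsilon.
From Coquelicot Require Import Coquelicot.
Require Import Defs.
Open Scope R_scope.

(** * Commutative C-algebras *)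

(** The data are germs in t at one fixed pair (c_inf, c_0), so nothing in them can be differentiated
    in c_m or c_p. The calculus is therefore done once, in abstract algebras with three commuting
    derivations; germs enter only through evaluation, and order-by-order uniqueness identifies the
    given coefficients with the evaluated ones. Second derivatives appear because the logarithm in
    (T - 1) sigma_odd = h D log(...) is not in the algebra, while its derivative along c_m or c_p
    is. Euler's relation, applied twice to the coefficient of h^k, which has degree 1 - k, then
    costs a division by k (k - 1): with k = 2n this is the denominator 2n (2n - 1). The obstacle is
    the pole. There the factor N of sigma_+ vanishes together with X, so the primitive is built from
    sigma_- alone, which hides its behaviour under the exchange of sheets. Oddness is proved where X
    is invertible, from N_+ N_- T sigma_odd = (X Y)^2 sigma_odd, and the value is taken in a
    quotient ring at the pole, where D = 0. Hence three rings, with homomorphisms out of the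
    first. *)

Record calg := CAlg {
  car :> Type;
  azero : car; aone : car;
  aadd : car -> car -> car; amul : car -> car -> car;
  asub : car -> car -> car; aopp : car -> car;
  ath : ring_theory azero aone aadd amul asub aopp (@eq car);
  inj : C -> car;
  inj1 : inj (RtoC 1) = aone;
  injD : forall a b, inj (a + b)%C = aadd (inj a) (inj b);
  injM : forall a b, inj (a * b)%C = amul (inj a) (inj b) }.

Declare Scope ca_scope.
Delimit Scope ca_scope with A.
Notation "0" := (azero _) : ca_scope.
Notation "1" := (aone _) : ca_scope.
Notation "x + y" := (aadd _ x y) : ca_scope.
Notation "x * y" := (amul _ x y) : ca_scope.
Notation "x - y" := (asub _ x y) : ca_scope.
Notation "- x" := (aopp _ x) : ca_scope.
Arguments inj {_} _.
Bind Scope ca_scope with car.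

Section Basics.
Local Open Scope ca_scope.
Variable A : calg.
Add Ring Ar : (ath A).

Lemma inj0 : inj (RtoC 0) = 0 :> A.
Proof.
  assert (H := injD A (RtoC 0) (RtoC 0)). rewrite Cplus_0_l in H.
  transitivity (inj (RtoC 0) + inj (RtoC 0) - inj (RtoC 0) : A); [ring|].
  rewrite <- H. ring.
Qed.

Lemma injN c : inj (- c)%C = - inj c :> A.
Proof.
  assert (H := injD A c (- c)%C). rewrite Cplus_opp_r, inj0 in H.
  transitivity (inj c + inj (- c)%C - inj c : A); [ring|]. rewrite <- H. ring.
Qed.

Lemma injB a b : inj (a - b)%C = inj a - inj b :> A.
Proof. unfold Cminus. rewrite injD, injN. ring. Qed.

Lemma inj2 : inj (RtoC 2) = 1 + 1 :> A.
Proof. replace (RtoC 2) with (RtoC 1 + RtoC 1)%C by (rewrite <- RtoC_plus; f_equal; lra).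
  now rewrite injD, inj1. Qed.

Definition half : A := inj (/ RtoC 2)%C.

Lemma half2 : half + half = 1.
Proof. unfold half. rewrite <- injD, <- inj1. f_equal. field. Qed.

Definition nR (n : nat) : A := inj (RtoC (INR (S n))).
Definition nI (n : nat) : A := inj (RtoC (/ INR (S n))).

Lemma nIR n : nI n * nR n = 1.
Proof. unfold nI, nR. rewrite <- injM, <- RtoC_mult, Rinv_l, inj1; [easy|apply not_0_INR; lia]. Qed.

Lemma nRS n : nR (S n) = nR n + 1.
Proof. unfold nR. rewrite (S_INR (S n)), RtoC_plus, injD, inj1. easy. Qed.

Lemma nR0 : nR 0 = 1.
Proof. unfold nR. simpl. apply inj1. Qed.

Lemma nRcancel n (x y : A) : nR n * x = nR n * y -> x = y.
Proof. intro H. transitivity (nI n * nR n * x); [rewrite nIR; ring|].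
  transitivity (nI n * (nR n * x)); [ring|]. rewrite H.
  transitivity (nI n * nR n * y); [ring| rewrite nIR; ring]. Qed.

Lemma unit_cancel (u v x y : A) : u * v = 1 -> u * x = u * y -> x = y.
Proof. intros Hu H. transitivity (u * v * x); [rewrite Hu; ring|].
  transitivity (v * (u * x)); [ring|]. rewrite H.
  transitivity (u * v * y); [ring|rewrite Hu; ring]. Qed.

Lemma sub_eq0 (x y : A) : x - y = 0 -> x = y.
Proof. intro H. transitivity (x - y + y); [ring|rewrite H; ring]. Qed.

End Basics.
Arguments half {A}. Arguments nR {A} n. Arguments nI {A} n.

(** * Derivations *)

Record deriv (A : calg) := Deriv {
  dv :> A -> A;
  dvD : forall a b, dv (a + b)%A = (dv a + dv b)%A;
  dvM : forall a b, dv (a * b)%A = (dv a * b + a * dv b)%A;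
  dvI : forall c, dv (inj c) = 0%A }.
Arguments dv {A} _ _. Arguments dvD {A} _ _ _. Arguments dvM {A} _ _ _. Arguments dvI {A} _ _.

Section Derivations.
Local Open Scope ca_scope.
Variable A : calg.
Add Ring Ar : (ath A).

Lemma dv1 (d : deriv A) : d 1 = 0.
Proof. rewrite <- inj1. apply dvI. Qed.
Lemma dv0 (d : deriv A) : d 0 = 0.
Proof. assert (H := dvI d (RtoC 0)). now rewrite inj0 in H. Qed.
Lemma dvZ (d : deriv A) c x : d (inj c * x) = inj c * d x.
Proof. rewrite dvM, dvI. ring. Qed.
Lemma dvN (d : deriv A) x : d (- x) = - d x.
Proof. transitivity (d (inj (RtoC (-1)) * x)).
  - f_equal. replace (RtoC (-1)) with (- RtoC 1)%C by (rewrite <- RtoC_opp; easy). rewrite injN, inj1. ring.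
  - rewrite dvZ. replace (RtoC (-1)) with (- RtoC 1)%C by (rewrite <- RtoC_opp; easy). rewrite injN, inj1. ring. Qed.
Lemma dvB (d : deriv A) x y : d (x - y) = d x - d y.
Proof. transitivity (d (x + - y)); [f_equal; ring|]. rewrite dvD, dvN. ring. Qed.

Lemma dv_inv (d : deriv A) u v : u * v = 1 -> d v = - (v * v * d u).
Proof. intro H. apply unit_cancel with u v; trivial.
  assert (E : d (u * v) = 0) by (rewrite H; apply dv1). rewrite dvM in E.
  transitivity (d u * v + u * d v - d u * v * 1); [ring|]. rewrite E, <- H. ring. Qed.

(* The logarithmic derivative turns commuting derivations into a closed form. *)
Lemma dlog_comm (d e : deriv A) u v : (forall x, d (e x) = e (d x)) -> u * v = 1 ->
  d (e u * v) = e (d u * v).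
Proof. intros H Hu. rewrite !dvM, H, (dv_inv d _ _ Hu), (dv_inv e _ _ Hu). ring. Qed.

End Derivations.

(** * Formal power series *)

Section PowerSeries.
Local Open Scope ca_scope.
Variable A : calg.
Add Ring Ar : (ath A).
Implicit Types f g : nat -> A.

Definition psder f : nat -> A := fun n => nR n * f (S n).
Definition psadd f g : nat -> A := fun n => f n + g n.
Definition psopp f : nat -> A := fun n => - f n.
Definition pssub f g : nat -> A := fun n => f n - g n.
Definition pszero : nat -> A := fun n => 0.
Definition pscst (a : A) : nat -> A := fun n => match n with O => a | _ => 0 end.

(* The Cauchy product, computed from (n+1) (fg)_{n+1} = (f'g + fg')_n. *)
Fixpoint psmuln (n : nat) f g : A :=
  match n with
  | O => f O * g O
  | S m => nI m * (psmuln m (psder f) g + psmuln m f (psder g))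
  end.
Definition psmul f g : nat -> A := fun n => psmuln n f g.

Lemma psder_add f g : psder (psadd f g) = psadd (psder f) (psder g).
Proof. extensionality n. unfold psder, psadd. ring. Qed.

Lemma psder_mul f g : psder (psmul f g) = psadd (psmul (psder f) g) (psmul f (psder g)).
Proof. extensionality n.
  change (nR n * (nI n * (psmuln n (psder f) g + psmuln n f (psder g))) = psmuln n (psder f) g + psmuln n f (psder g)).
  transitivity (nI n * nR n * (psmuln n (psder f) g + psmuln n f (psder g))); [ring|].
  rewrite nIR. ring. Qed.

Lemma psmuln_comm n : forall f g, psmuln n f g = psmuln n g f.
Proof. induction n; intros; simpl; [ring|]. rewrite (IHn (psder f) g), (IHn f (psder g)). ring. Qed.

Lemma psmuln_add n : forall f g k, psmuln n (psadd f g) k = psmuln n f k + psmuln n g k.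
Proof. induction n; intros; simpl; [unfold psadd; ring|]. rewrite psder_add, !IHn. ring. Qed.

(** Both sides obey the Leibniz rule, hence the same recursion in the order; the induction leaves
    all three series free because differentiation changes them. *)
Lemma psmuln_assoc n : forall f g k, psmuln n f (psmul g k) = psmuln n (psmul f g) k.
Proof. induction n; intros; simpl; [unfold psmul; simpl; ring|].
  rewrite !psder_mul, (psmuln_comm n f (psadd _ _)), !psmuln_add.
  rewrite (psmuln_comm n (psmul (psder g) k) f), (psmuln_comm n (psmul g (psder k)) f), !IHn. ring. Qed.

Lemma psder_cst a : psder (pscst a) = pszero.
Proof. extensionality n. unfold psder, pscst, pszero. ring. Qed.

Lemma psmuln_0 n : forall g, psmuln n pszero g = 0.
Proof. induction n; intros; simpl; [unfold pszero; ring|].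
  replace (psder pszero) with pszero by (extensionality m; unfold psder, pszero; ring).
  rewrite !IHn. ring. Qed.

Lemma psmuln_cst n : forall a g, psmuln n (pscst a) g = a * g n.
Proof. induction n; intros; simpl; [easy|]. rewrite psder_cst, psmuln_0, IHn. unfold psder.
  transitivity (nI n * nR n * (a * g (S n))); [ring|]. rewrite nIR. ring. Qed.

Lemma ps_th : ring_theory pszero (pscst 1) psadd psmul pssub psopp (@eq (nat -> A)).
Proof.
  split; intros; extensionality n; unfold psadd, psmul, pssub, psopp, pszero; try ring.
  - rewrite psmuln_cst. ring.
  - apply psmuln_comm.
  - apply psmuln_assoc.
  - apply psmuln_add.
Qed.

Definition psA : calg.
Proof.
  apply (@CAlg (nat -> A) pszero (pscst 1) psadd psmul pssub psopp ps_th (fun c => pscst (inj c))).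
  - now rewrite inj1.
  - intros a b. extensionality n. destruct n; unfold psadd; simpl; [apply injD | ring].
  - intros a b. extensionality n. unfold psmul. rewrite psmuln_cst. destruct n; simpl; [apply injM|ring].
Defined.

End PowerSeries.
Arguments psA _ : simpl never.
Arguments psder {A}. Arguments psmuln {A}. Arguments pscst {A}.

Section PowerSeries2.
Local Open Scope ca_scope.
Variable A : calg.
Add Ring Ar : (ath A).
Notation P := (psA A).
Add Ring Pr : (ath P).
Implicit Types f g : P.

Definition cst (a : A) : P := pscst a.
(** The series variable, in the role of h = 1/eta. *)
Definition hh : P := fun n => match n with 1%nat => 1 | _ => 0 end.
Definition pstail (f : P) : P := fun n => f (S n).

Lemma psM f g n : (f * g) n = psmuln n f g. Proof. easy. Qed.
Lemma psD f g n : (f + g) n = f n + g n. Proof. easy. Qed.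
Lemma psB f g n : (f - g) n = f n - g n. Proof. easy. Qed.
Lemma psN f n : (- f) n = - f n. Proof. easy. Qed.
Lemma psM0 f g : (f * g) O = f O * g O. Proof. easy. Qed.
Lemma psderM f g : psder (f * g) = (psder f : P) * g + f * psder g.
Proof. apply psder_mul. Qed.

Lemma cstM_n a f n : (cst a * f) n = a * f n.
Proof. apply psmuln_cst. Qed.
Lemma cstD a b : cst (a + b) = cst a + cst b.
Proof. extensionality n. rewrite psD. destruct n; simpl; [easy|ring]. Qed.
Lemma cstM a b : cst (a * b) = cst a * cst b.
Proof. extensionality n. rewrite cstM_n. destruct n; simpl; [easy|ring]. Qed.
Lemma cstB a b : cst (a - b) = cst a - cst b.
Proof. extensionality n. rewrite psB. destruct n; simpl; [easy|ring]. Qed.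
Lemma cst0 : cst 0 = 0. Proof. extensionality n. now destruct n. Qed.
Lemma cst1 : cst 1 = 1. Proof. easy. Qed.
Lemma cst_inj c : cst (inj c) = inj c. Proof. easy. Qed.
Lemma injM_n c f n : (inj c * f) n = inj c * f n.
Proof. apply (cstM_n (inj c)). Qed.

Lemma psder_hh : psder hh = (1 : P).
Proof. extensionality n. unfold psder, hh. destruct n; simpl; [rewrite nR0; ring | ring]. Qed.

Lemma hhM0 f : (hh * f) O = 0.
Proof. rewrite psM0. unfold hh. ring. Qed.
Lemma hhMS n : forall f, (hh * f) (S n) = f n.
Proof.
  induction n as [|n IH]; intro f.
  - apply nRcancel with O. change (nR 0 * (hh * f) 1%nat) with (psder (hh * f) O).
    rewrite psderM, psD, psder_hh, hhM0, psM0. simpl. rewrite nR0. ring.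
  - apply nRcancel with (S n). change (nR (S n) * (hh * f) (S (S n))) with (psder (hh * f) (S n)).
    rewrite psderM, psD, psder_hh, IH.
    rewrite (psM 1 f). change (aone P) with (pscst (1:A)). rewrite psmuln_cst. unfold psder. rewrite nRS. ring.
Qed.

Lemma pstailE f : f = cst (f O) + hh * pstail f.
Proof. extensionality n. rewrite psD. destruct n; [rewrite hhM0|rewrite hhMS]; simpl; unfold pstail; ring. Qed.

Lemma hh_cancel f g : hh * f = hh * g -> f = g.
Proof. intro H. extensionality n. now rewrite <- (hhMS n f), <- (hhMS n g), H. Qed.

Definition agree (n : nat) f g := forall k, (k < n)%nat -> f k = g k.

Lemma agree_muln k : forall f f' g g', agree (S k) f f' -> agree (S k) g g' ->
  psmuln k f g = psmuln k f' g'.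
Proof.
  induction k; intros f f' g g' Hf Hg; simpl.
  - rewrite (Hf O), (Hg O); auto.
  - rewrite (IHk (psder f) (psder f') g g'), (IHk f f' (psder g) (psder g')); trivial;
    intros j Hj; unfold psder; try rewrite (Hf (S j)); try rewrite (Hg (S j));
    auto; try apply Hf; try apply Hg; lia.
Qed.

Lemma agree_mul n f f' g g' : agree n f f' -> agree n g g' -> agree n (f * g) (f' * g').
Proof. intros Hf Hg k Hk. rewrite !psM. apply agree_muln; intros j Hj; [apply Hf|apply Hg]; lia. Qed.
Lemma agree_add n f f' g g' : agree n f f' -> agree n g g' -> agree n (f + g) (f' + g').
Proof. intros Hf Hg k Hk. rewrite !psD. now rewrite Hf, Hg. Qed.
Lemma agree_sub n f f' g g' : agree n f f' -> agree n g g' -> agree n (f - g) (f' - g').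
Proof. intros Hf Hg k Hk. rewrite !psB. now rewrite Hf, Hg. Qed.
Lemma agree_refl n f : agree n f f. Proof. easy. Qed.
Lemma agree_hh n f g : agree n f g -> agree (S n) (hh * f) (hh * g).
Proof. intros H [|k] Hk; [now rewrite !hhM0|]. rewrite !hhMS. apply H. lia. Qed.
Lemma agree_weak n f g : agree (S n) f g -> agree n f g.
Proof. intros H k Hk. apply H. lia. Qed.
Lemma agree_all f g : (forall n, agree n f g) -> f = g.
Proof. intro H. extensionality n. apply (H (S n)). lia. Qed.

(** [agree n] is congruence modulo h^n. A map that gains one order has stable iterates: the
    coefficient of h^k no longer changes after k + 1 steps, and the fixed point collects these
    values. *)
Lemma contraction_fix (F : P -> P) :
  (forall n f g, agree n f g -> agree (S n) (F f) (F g)) -> exists f, F f = f.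
Proof.
  intro HF. set (it := fun n => Nat.iter n F 0).
  assert (H1 : forall n, agree n (it n) (it (S n))).
  { induction n; [intros k Hk; lia|]. apply HF, IHn. }
  assert (H2 : forall m n, agree n (it n) (it (m + n)%nat)).
  { induction m; intros n; [easy|]. intros k Hk. rewrite IHm by easy.
    apply (H1 (m + n)%nat). lia. }
  exists (fun k => it (S k) k). extensionality k.
  assert (Hag : agree k (fun j => it (S j) j) (it k)).
  { intros j Hj. replace k with ((k - S j) + S j)%nat by lia. apply H2. lia. }
  apply HF in Hag. rewrite (Hag k) by lia. easy.
Qed.

Lemma contraction_zero (e : P) : (forall n, agree n e 0 -> agree (S n) e 0) -> e = 0.
Proof. intro H. apply agree_all. induction n; [intros k Hk; lia|auto]. Qed.

Lemma ps_inverse (u : P) v : u O * v = 1 -> exists w, u * w = 1.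
Proof.
  intro Hu. destruct (contraction_fix (fun w => cst v * (1 - hh * (pstail u * w)))) as [w Hw].
  - intros n f g H. apply agree_mul; [apply agree_refl|]. apply agree_sub; [apply agree_refl|].
    apply agree_hh, agree_mul; [apply agree_refl|easy].
  - exists w. rewrite (pstailE u).
    assert (E : cst (u O) * cst v = 1) by (rewrite <- cstM, Hu; easy).
    transitivity (cst (u O) * w + hh * (pstail u * w)); [ring|].
    rewrite <- Hw at 1. transitivity (cst (u O) * cst v * (1 - hh * (pstail u * w)) + hh * (pstail u * w)); [ring|].
    rewrite E. ring.
Qed.

Lemma agree_unit n (u v e : P) : u * v = 1 -> agree n (u * e) 0 -> agree n e 0.
Proof. intros Hu H. replace e with (v * (u * e)) by (transitivity (u * v * e); [ring|rewrite Hu; ring]).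
  replace (0 : P) with (v * 0) by ring. apply agree_mul; [apply agree_refl|easy]. Qed.

Definition pd (d : deriv A) : deriv P.
Proof.
  apply (@Deriv P (fun f n => d (f n))).
  - intros f g. extensionality n. rewrite !psD. apply dvD.
  - intros f g. extensionality n. rewrite psD, !psM. revert f g.
    induction n as [|n IH]; intros f g; simpl; [apply dvM|].
    unfold nI. rewrite dvZ, dvD, !IH.
    assert (E : forall k, (fun m => d (psder k m)) = psder (fun m => d (k m))).
    { intro k. extensionality m. unfold psder, nR. apply dvZ. }
    rewrite !E. ring.
  - intro c. extensionality n. destruct n; simpl; [apply dvI|apply dv0].
Defined.

Lemma pdE (d : deriv A) f n : pd d f n = d (f n). Proof. easy. Qed.
Lemma pd_hh d : pd d hh = 0.
Proof. extensionality n. rewrite pdE. unfold hh. destruct n as [|[|n]]; simpl; [apply dv0|apply dv1|apply dv0]. Qed.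
Lemma pd_cst d a : pd d (cst a) = cst (d a).
Proof. extensionality n. rewrite pdE. destruct n; simpl; [easy|apply dv0]. Qed.
Lemma agree_pd d n f g : agree n f g -> agree n (pd d f) (pd d g).
Proof. intros H k Hk. rewrite !pdE, H; easy. Qed.
Lemma pd_comm (d e : deriv A) : (forall x, d (e x) = e (d x)) -> forall f, pd d (pd e f) = pd e (pd d f).
Proof. intros H f. extensionality n. apply H. Qed.
Lemma pd_psder d f : pd d (psder f) = psder (pd d f).
Proof. extensionality n. rewrite pdE. unfold psder, nR. apply dvZ. Qed.

(** Differentiation in h with the coefficients held fixed. It commutes with every [pd d], and series
    with equal leading terms and equal h-derivatives coincide. *)
Definition hder : deriv P.
Proof.
  apply (@Deriv P psder).
  - apply psder_add.
  - apply psder_mul.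
  - intro c. apply psder_cst.
Defined.

Lemma hderE f n : hder f n = nR n * f (S n). Proof. easy. Qed.
Lemma hder_hh : hder hh = 1. Proof. apply psder_hh. Qed.
Lemma hder_cst a : hder (cst a) = 0. Proof. apply (psder_cst A a). Qed.
Lemma pd_hder d f : pd d (hder f) = hder (pd d f). Proof. apply pd_psder. Qed.

End PowerSeries2.
Arguments cst {A}. Arguments hh {A}. Arguments pstail {A}. Arguments agree {A}. Arguments pd {A}. Arguments hder {A}.

(** * Differential operators in h d *)

Lemma C_th : ring_theory (RtoC 0) (RtoC 1) Cplus Cmult Cminus Copp (@eq C).
Proof. split; intros; ring. Qed.

Definition CA : calg := CAlg C (RtoC 0) (RtoC 1) Cplus Cmult Cminus Copp C_th (fun c => c)
  eq_refl (fun a b => eq_refl) (fun a b => eq_refl).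
Arguments CA : simpl never.

Section Operators.
Local Open Scope ca_scope.
Variable A : calg.
Add Ring Ar : (ath A).
Notation P := (psA A).
Add Ring Pr : (ath P).
Notation K := (psA CA).
Add Ring Kr : (ath K).
Variable d : deriv A.
Implicit Types (c : K) (f g : P).

(* [op c] is the operator [sum_k c_k (h d)^k]. *)
Fixpoint opn (n : nat) c f : A :=
  match n with
  | O => inj (c O) * f O
  | S m => inj (c O) * f (S m) + d (opn m (pstail c) f)
  end.
Definition op c f : P := fun n => opn n c f.

Lemma opE c f : op c f = inj (c O) * f + hh * pd d (op (pstail c) f).
Proof. extensionality n. rewrite psD, injM_n. destruct n; [rewrite hhM0|rewrite hhMS]; simpl; [ring|].
  easy. Qed.

Lemma opn_addf n : forall c f g, opn n c (f + g) = opn n c f + opn n c g.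
Proof. induction n; intros; cbn [opn]; rewrite psD; [ring|]. rewrite IHn, dvD. ring. Qed.
Lemma op_addf c f g : op c (f + g) = op c f + op c g.
Proof. extensionality n. apply opn_addf. Qed.
Lemma opn_addc n : forall c c' f, opn n (c + c') f = opn n c f + opn n c' f.
Proof. induction n; intros; cbn [opn]; rewrite (psD CA); change (aadd CA) with Cplus; rewrite injD; [ring|].
  replace (pstail (c + c')) with (pstail c + pstail c' : K) by easy. rewrite IHn, dvD. ring. Qed.
Lemma op_addc c c' f : op (c + c') f = op c f + op c' f.
Proof. extensionality n. apply opn_addc. Qed.
Lemma opn_scal n : forall (a : C) c f, opn n ((inj a : K) * c) f = inj a * opn n c f.
Proof. induction n; intros; cbn [opn]; rewrite (injM_n CA); change (amul CA) with Cmult; change (@inj CA a) with a; rewrite injM; [ring|].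
  replace (pstail ((inj a : K) * c)) with ((inj a : K) * pstail c).
  - rewrite IHn, dvZ. ring.
  - extensionality k. unfold pstail. now rewrite !(injM_n CA). Qed.
Lemma op_scal a c f : op ((inj a : K) * c) f = inj a * op c f.
Proof. extensionality n. rewrite injM_n. apply opn_scal. Qed.
Lemma opn_scalf n : forall (a : C) c f, opn n c (inj a * f) = inj a * opn n c f.
Proof. induction n; intros; cbn [opn]; rewrite injM_n; [ring|]. rewrite IHn, dvZ. ring. Qed.
Lemma op_scalf a c f : op c (inj a * f) = inj a * op c f.
Proof. extensionality n. rewrite injM_n. apply opn_scalf. Qed.
Lemma op_subf c f g : op c (f - g) = op c f - op c g.
Proof.
  replace (f - g) with (f + inj (- RtoC 1)%C * g) by (rewrite injN, inj1; ring).
  rewrite op_addf, op_scalf, injN, inj1. ring. Qed.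

Lemma opn_comm (e : deriv A) (He : forall x, e (d x) = d (e x)) n :
  forall c f, e (opn n c f) = opn n c (pd e f).
Proof. induction n; intros; cbn [opn]; [apply dvZ|]. rewrite dvD, dvZ, He, IHn. easy. Qed.
Lemma op_comm (e : deriv A) c f : (forall x, e (d x) = d (e x)) -> pd e (op c f) = op c (pd e f).
Proof. intro He. extensionality n. now apply opn_comm. Qed.
Lemma op_d c f : pd d (op c f) = op c (pd d f).
Proof. now apply op_comm. Qed.

Lemma op_hc c f : op (hh * c) f = hh * pd d (op c f).
Proof. rewrite opE, hhM0. replace (pstail (hh * c)) with c.
  - change (azero CA) with (RtoC 0). rewrite inj0. ring.
  - extensionality n. unfold pstail. now rewrite hhMS. Qed.

Lemma opn_hf n : forall c f, opn n c (hh * f) = (hh * op c f) n.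
Proof. induction n; intros; cbn [opn]; [rewrite !hhM0; ring|]. rewrite IHn, !hhMS.
  destruct n; [rewrite hhM0, dv0; simpl; unfold op; simpl; ring|].
  rewrite hhMS. easy. Qed.
Lemma op_hf c f : op c (hh * f) = hh * op c f.
Proof. extensionality n. apply opn_hf. Qed.

Lemma op_1 f : op 1 f = f.
Proof. rewrite opE. change ((1 : K) O) with (RtoC 1). rewrite inj1.
  assert (H : forall n g, opn n (0 : K) g = 0).
  { induction n; intros; cbn [opn]; change (azero K O) with (RtoC 0); rewrite inj0; [ring|].
    change (pstail (azero K)) with (azero K). rewrite IHn, dv0. ring. }
  replace (op (pstail (1 : K)) f) with (0 : P).
  - rewrite dv0. ring.
  - extensionality n. symmetry. apply H. Qed.

(** The symbols have constant coefficients, which commute with d, so peeling off the lowest term of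
    the left symbol reduces to a coefficient of one order less. *)
Lemma op_op c : forall c' f, op c (op c' f) = op (c * c') f.
Proof.
  assert (H : forall n c c' f, opn n c (op c' f) = opn n (c * c') f); [|intros; extensionality n; apply H].
  induction n; intros c0 c' f; cbn [opn].
  - rewrite psM0. change (amul CA) with Cmult. rewrite injM. unfold op. simpl. ring.
  - change (op c0 (op c' f) (S n) = op (c0 * c') f (S n)).
    rewrite (pstailE _ c0) at 2.
    replace ((cst (c0 O) + hh * pstail c0) * c') with ((inj (c0 O) : K) * c' + hh * (pstail c0 * c'))
      by (change (cst (c0 O)) with (inj (c0 O) : K); ring).
    rewrite op_addc, op_scal, op_hc, opE, !psD, !hhMS, !pdE. unfold op at 2. rewrite IHn. easy.
Qed.

(** In c(h d) f the variable h enters through the operator as well as through f, and the derivative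
    of c(h d) in h is d c'(h d); this is the second summand. *)
Lemma hder_op c : forall f, hder (op c f) = op c (hder f) + pd d (op (hder c) f).
Proof.
  assert (H : forall n c f, hder (op c f) n = op c (hder f) n + pd d (op (hder c) f) n);
    [|intros; extensionality n; rewrite psD; apply H].
  assert (E : forall c : K, hder c = pstail c + hh * hder (pstail c)).
  { intro k. rewrite (pstailE _ k) at 1. rewrite dvD, dvM, hder_hh, hder_cst. ring. }
  assert (E2 : forall c f, hder (op c f) = inj (c O) * hder f + pd d (op (pstail c) f) + hh * pd d (hder (op (pstail c) f))).
  { intros k f. rewrite opE at 1. rewrite dvD, dvZ, dvM, hder_hh, pd_hder. ring. }
  induction n; intros k f; rewrite E2, E, op_addc, op_hc, dvD, !psD, (opE k (hder f)), psD.
  - rewrite !hhM0, (pdE _ d (hh * _) O), hhM0, dv0. ring.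
  - rewrite !hhMS, (pdE _ d (hh * _) (S n)), hhMS, !(pdE _ d _ n), IHn, dvD, (pdE _ d (op (hder (pstail k)) f) n). ring.
Qed.

(* [tshift x] is the Taylor translation [exp (x h d)]. *)
Definition expser (x : C) : K := fun n => (Cpow x n * RtoC (/ INR (fact n)))%C.
Definition tshift x f : P := op (expser x) f.

Lemma expser0 x : expser x O = RtoC 1.
Proof. unfold expser. simpl. rewrite Rinv_1. ring. Qed.
Lemma expser1 x : expser x 1%nat = x.
Proof. unfold expser. simpl. rewrite Rinv_1. ring. Qed.

Lemma expser_der x : hder (expser x) = inj x * expser x.
Proof. extensionality n. rewrite (injM_n CA). rewrite hderE; unfold nR, expser. change (amul CA) with Cmult.
  change (@inj CA) with (fun c : C => c); cbv beta; cbn [Cpow]. change (fact (S n)) with (S n * fact n)%nat. rewrite mult_INR, Rinv_mult, RtoC_mult.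
  rewrite !RtoC_inv by (apply INR_fact_neq_0 || now apply not_0_INR).
  match goal with |- @eq _ ?a ?b => change (@eq C a b) end. field.
  split; intro E; apply RtoC_inj in E; revert E; [apply INR_fact_neq_0 | now apply not_0_INR].
Qed.

Lemma hder_shift x f : hder (tshift x f) = tshift x (hder f) + inj x * pd d (tshift x f).
Proof. unfold tshift. rewrite hder_op, expser_der, op_scal, dvZ. easy. Qed.

Lemma shift_0 x f : tshift x f O = f O.
Proof. unfold tshift, op. cbn [opn]. rewrite expser0, inj1. ring. Qed.

(** The exponential of a derivation is multiplicative. In place of binomial sums, both sides are
    shown to solve the same flow equation in h, [hder_shift], with the same leading term. *)
Lemma shiftM x f g : tshift x (f * g) = tshift x f * tshift x g.
Proof.
  extensionality n. revert f g. induction n; intros f g.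
  - rewrite psM0, !shift_0. easy.
  - apply nRcancel with n. change (hder (tshift x (f * g)) n = hder (tshift x f * tshift x g) n).
    rewrite dvM, !hder_shift, dvM, psD, injM_n, pdE, IHn.
    assert (E : tshift x (hder f * g + f * hder g) n =
       (tshift x (hder f) * tshift x g + tshift x f * tshift x (hder g)) n).
    { unfold tshift. rewrite op_addf. rewrite !psD. f_equal; apply IHn. }
    rewrite E.
    change (d ((tshift x f * tshift x g) n)) with (pd d (tshift x f * tshift x g) n).
    rewrite <- injM_n, <- psD, dvM. apply (f_equal (fun F : P => F n)). ring.
Qed.
Lemma shiftD x f g : tshift x (f + g) = tshift x f + tshift x g.
Proof. apply op_addf. Qed.
Lemma shiftB x f g : tshift x (f - g) = tshift x f - tshift x g.
Proof. apply op_subf. Qed.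
Lemma shift_cst x a : d a = 0 -> tshift x (cst a) = cst a.
Proof. intro H. unfold tshift. rewrite opE, op_d.
  replace (pd d (cst a)) with (inj (RtoC 0) * (0 : P)).
  - rewrite op_scalf, inj0, expser0, inj1. ring.
  - rewrite pd_cst, H, inj0, cst0. ring. Qed.
Lemma shift_inj x a : tshift x (inj a) = inj a.
Proof. apply (shift_cst x (inj a)). apply dvI. Qed.
Lemma shift_1 x : tshift x 1 = 1.
Proof. rewrite <- inj1. apply shift_inj. Qed.
Lemma shift_zero x : tshift x 0 = 0.
Proof. assert (H := shift_inj x (RtoC 0)). now rewrite inj0 in H. Qed.
Lemma shiftN x f : tshift x (- f) = - tshift x f.
Proof. replace (- f) with (0 - f : P) by ring. rewrite shiftB, shift_zero. ring. Qed.
Lemma shift_hh x : tshift x hh = hh.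
Proof. replace (hh : P) with (hh * 1 : P) at 1 by ring. unfold tshift. rewrite op_hf.
  change (op (expser x) 1) with (tshift x 1). rewrite shift_1. ring. Qed.
Lemma shift_comm (e : deriv A) x f : (forall x, e (d x) = d (e x)) -> pd e (tshift x f) = tshift x (pd e f).
Proof. apply op_comm. Qed.
Lemma shift_lin x u b : d u = inj b -> tshift x (cst u) = cst u + inj (x * b)%C * hh.
Proof. intro H. unfold tshift. rewrite opE, op_d, pd_cst, H, cst_inj.
  replace (op (pstail (expser x)) (inj b)) with (inj (x * b)%C : P).
  - rewrite expser0, inj1. ring.
  - rewrite opE. unfold pstail at 1. rewrite expser1, op_d.
    change (inj b : P) with (cst (inj b : A)). rewrite pd_cst, dvI.
    assert (Z : cst (0 : A) = (inj (RtoC 0) * (0 : P))) by (rewrite inj0, cst0; ring).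
    rewrite Z, op_scalf, inj0, cst_inj, <- injM. ring.
Qed.

Lemma op_cst c a n : op c (cst a) n = inj (c n) * Nat.iter n d a.
Proof. revert c. induction n; intro c0; [easy|]. rewrite opE, psD, injM_n, hhMS, pdE, IHn, dvZ. simpl. unfold pstail. ring. Qed.

End Operators.

(** * Formal solutions *)

Section Identities.
Local Open Scope ca_scope.
Variable A : calg.
Add Ring Ar : (ath A).

(** [potG] is the right side of h^2 D e. [quadQ] is its derivative in log l at fixed l s = t, that
    is l d/dl - s d/ds applied to [potG]; on the curve it equals t^2 Delta. *)
Definition quadQ (ci c0 l s : A) : A := (1 + 1) * (l * l) - ci * l + (1 + 1) * (s * s) - c0 * s.
Definition potG (ci c0 l s : A) : A := l * l - ci * l - s * s + c0 * s.

(* The polynomial identity behind the Backlund transformation of the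
   linearised equation; [de] plays the role of [h D]. *)
Lemma wkb_shift_id (de : deriv A) (h ci c0 l s e lh sh eh sg Y Yi N : A) :
  let M := e - l - s in let X := M + ci in let kap := ci - c0 + h in
  Y = M + c0 - h -> Y * Yi = 1 -> lh * X = s * Y -> sh * Y = l * X ->
  eh = h - M - lh - sh ->
  de h = 0 -> de ci = 0 -> de c0 = 0 ->
  de l = e * l -> de s = (h - e) * s -> de e = potG ci c0 l s ->
  de eh = potG (ci + h) (c0 - h) lh sh ->
  de sg = quadQ ci c0 l s - sg * sg ->
  N = kap * (sg - l + s) - X * Y ->
  let a := sg + eh - h + e - (1 + 1) * (de Y * Yi) in
  (a * a + de a - quadQ (ci + h) (c0 - h) lh sh) * N + (1 + 1) * a * de N + de (de N) = 0.
Proof.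
  intros M X kap HY HYi Hlh Hsh Heh Hh Hci Hc0 Hl Hs He Hdeh Hsg HN a.
  assert (HX : X = Y + kap) by (rewrite HY; unfold X, kap; ring).
  assert (HdM : de M = s * Y - l * X).
  { unfold M. rewrite !dvB, Hl, Hs, He, HX, HY. unfold potG, kap, M. ring. }
  assert (HdY : de Y = s * Y - l * X) by (rewrite HY, dvB, dvD, HdM, Hc0, Hh; rewrite <- HY; ring).
  assert (HdX : de X = s * Y - l * X) by (unfold X; rewrite dvD, HdM, Hci; unfold X; ring).
  assert (Hdk : de kap = 0) by (unfold kap; rewrite dvD, dvB, Hci, Hc0, Hh; ring).
  assert (HdYi : de Yi = - (Yi * Yi * (s * Y - l * X))) by (rewrite (dv_inv A de Y Yi HYi), HdY; ring).
  assert (Hsh' : sh = l * X * Yi) by (rewrite <- Hsh; ring [HYi]).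
  assert (HdN : de N = kap * (quadQ ci c0 l s - sg * sg - e * l + (h - e) * s) - (X + Y) * (s * Y - l * X)).
  { rewrite HN, dvB, !dvM, dvD, dvB, Hdk, Hsg, Hl, Hs, HdX, HdY. ring. }
  rewrite HdN. unfold a.
  rewrite ?dvB, ?dvD, ?dvM, ?dvB, ?dvD, ?dvM.
  assert (H2 : de (1 + 1) = 0) by (rewrite dvD, !dv1; ring).
  unfold quadQ. rewrite ?dvB, ?dvD, ?dvM, ?dvB, ?dvD, ?dvM, ?dv1, ?H2.
  rewrite Hdeh, Hsg, ?Hci, ?Hc0, ?Hh, ?Hl, ?Hs, ?He, ?Hdk, ?HdX, ?HdY, ?HdYi, ?dvB, ?dvM, ?HdX, ?HdY, ?Hl, ?Hs.
  rewrite HN, Heh, Hsh'. unfold potG, quadQ.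
  (* Eliminating c_inf, c_0 and e in favour of Y, kap and M leaves only the relations for [lh * kap]
     and [Y * Yi], modulo which the claim, the Riccati equation for a + N'/N multiplied by N, is a
     polynomial identity. *)
  assert (Eci : ci = Y + kap - M) by (rewrite <- HX; unfold X; ring).
  assert (Ec0 : c0 = Y - M + h) by (rewrite HY; ring).
  assert (Ee : e = M + l + s) by (unfold M; ring).
  rewrite HX in Hlh |- *.
  clearbody X kap M. subst ci c0 e.
  assert (HR : lh * kap = s * Y - lh * Y) by (rewrite <- Hlh; ring).
  clear -HR HYi.
  ring [HR HYi].
Qed.

(** The left side is the determinant of the operator n0 + kap * de on the solutions of y'' = Q y,
    the factor by which it multiplies their Wronskian. The factor N of the Backlund transformation
    is n0 + kap * sg. *)
Lemma wronskian_id (de : deriv A) (h ci c0 l s e : A) :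
  let M := e - l - s in let X := M + ci in let Y := M + c0 - h in let kap := ci - c0 + h in
  let n0 := kap * (s - l) - X * Y in
  de h = 0 -> de ci = 0 -> de c0 = 0 ->
  de l = e * l -> de s = (h - e) * s -> de e = potG ci c0 l s ->
  n0 * n0 - kap * de n0 - kap * kap * quadQ ci c0 l s = X * X * (Y * Y).
Proof.
  intros M X Y kap n0 Hh Hci Hc0 Hl Hs He.
  unfold n0, X, Y, kap, M.
  rewrite ?dvB, ?dvD, ?dvM, ?dvB, ?dvD, ?dvM, ?dvB, ?dvD, ?dvB, Hl, Hs, He, Hh, Hci, Hc0.
  unfold potG, quadQ. ring.
Qed.

Definition dscale (u : A) (d : deriv A) : deriv A.
Proof.
  apply (@Deriv A (fun x => u * d x)).
  - intros. rewrite dvD. ring.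
  - intros. rewrite dvM. ring.
  - intros. rewrite dvI. ring.
Defined.
Lemma dscaleE u d x : dscale u d x = u * d x. Proof. easy. Qed.

End Identities.
Arguments potG {A}. Arguments quadQ {A}.

Section Formal.
Local Open Scope ca_scope.
Variable A : calg.
Add Ring Ar : (ath A).
Notation P := (psA A).
Add Ring Pr : (ath P).
Variable D : deriv A.
Notation hD := (dscale P hh (pd D)).

Definition formal_painleve (ci c0 l s e : P) : Prop :=
  pd D l = e * l /\ pd D s = (1 - e) * s /\ hh * (hh * pd D e) = potG ci c0 l s.
Definition formal_riccati (ci c0 l s sg : P) : Prop :=
  sg * sg + hh * pd D sg = quadQ ci c0 l s.

Lemma agree_mul0 n (u e : P) : agree n e 0 -> agree n (u * e) 0.
Proof. intro H. replace (0 : P) with (u * 0) by ring. apply agree_mul; [easy|easy]. Qed.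
Lemma agree_hh0 n (e : P) : agree n e 0 -> agree (S n) (hh * e) 0.
Proof. intro H. replace (0 : P) with ((hh : P) * 0) by ring. now apply agree_hh. Qed.
Lemma agree_D0 n (e : P) : agree n e 0 -> agree (S n) (hh * pd D e) 0.
Proof. intro H. replace (0 : P) with (hh * pd D 0) by (rewrite dv0; ring). now apply agree_hh, agree_pd. Qed.

(** h D gains an order while a unit preserves it, so vanishing modulo h^n improves to vanishing
    modulo h^(n+1). This singular perturbation is why every formal solution below is fixed by its
    leading term. *)
Lemma linear_unique1 (u e : P) v : u O * v = 1 -> u * e = hh * pd D e -> e = 0.
Proof.
  intros Hv He. destruct (ps_inverse A u v Hv) as [w Hw].
  apply contraction_zero. intros n Hn. apply (agree_unit A _ u w _ Hw). rewrite He. now apply agree_D0.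
Qed.

(** Cramer's rule isolates each unknown up to the determinant, a unit; the gain of an order then
    works as for one equation. *)
Lemma linear_unique2 (a b c f e1 e2 : P) v :
  (a * f - b * c) O * v = 1 ->
  hh * pd D e1 = a * e1 + b * e2 -> hh * pd D e2 = c * e1 + f * e2 -> e1 = 0 /\ e2 = 0.
Proof.
  intros Hv H1 H2. destruct (ps_inverse A _ v Hv) as [w Hw].
  assert (H : forall n, agree n e1 0 /\ agree n e2 0).
  { induction n as [|n [I1 I2]]; [split; intros k Hk; lia|].
    apply agree_D0 in I1, I2. rewrite H1 in I1. rewrite H2 in I2.
    split; apply (agree_unit A _ _ w _ Hw).
    - replace ((a * f - b * c) * e1) with (f * (a * e1 + b * e2) - b * (c * e1 + f * e2)) by ring.
      replace (0 : P) with (0 - 0 : P) by ring. apply agree_sub; now apply agree_mul0.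
    - replace ((a * f - b * c) * e2) with (a * (c * e1 + f * e2) - c * (a * e1 + b * e2)) by ring.
      replace (0 : P) with (0 - 0 : P) by ring. apply agree_sub; now apply agree_mul0. }
  split; apply agree_all; apply H.
Qed.

(** The difference satisfies a homogeneous linear equation with symbol - (sg + sg'), whose leading
    term is minus twice that of [sg]. *)
Lemma riccati_unique ci c0 l s sg sg' w :
  formal_riccati ci c0 l s sg -> formal_riccati ci c0 l s sg' ->
  sg O = sg' O -> sg O * w = 1 -> sg = sg'.
Proof.
  intros H H' H0 Hw. unfold formal_riccati in *.
  apply sub_eq0, (linear_unique1 (- (sg + sg')) _ (- (half * w))).
  - rewrite psN, psD, <- H0. transitivity ((half + half) * (sg O * w)); [ring|]. rewrite half2, Hw. ring.
  - rewrite dvB. rewrite <- H in H'.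
    transitivity (sg' * sg' + hh * pd D sg' - sg * sg - hh * pd D sg' : P); [ring|]. rewrite H'. ring.
Qed.

Lemma riccati_exists ci c0 l s w wi :
  @quadQ P ci c0 l s O = w * w -> w * wi = 1 ->
  exists sg, formal_riccati ci c0 l s sg /\ sg O = w.
Proof.
  intros Hq Hw. set (Q := @quadQ P ci c0 l s) in *.
  (* With sg = w + h tau the equation reads 2 w tau = tail(Q) - D w - h (tau^2 + D tau), a
     contraction in tau. *)
  destruct (contraction_fix A (fun tau => cst (half * wi) *
     (pstail Q - cst (D w)) - cst (half * wi) * (hh * (tau * tau) + hh * pd D tau))) as [tau Ht].
  - intros n f g H. apply agree_sub; [easy|]. apply agree_mul; [easy|].
    apply agree_add; apply agree_hh; [now apply agree_mul | now apply agree_pd].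
  - exists (cst w + hh * tau). split; [|rewrite psD, hhM0; simpl; ring].
    unfold formal_riccati. fold Q. rewrite (pstailE A Q), Hq, cstM, dvD, dvM, pd_hh, pd_cst.
    assert (E : cst w * cst (half * wi) * (1 + 1) = (1 : P)).
    { rewrite <- cstM, <- cst1, <- cstD, <- cstM. f_equal.
      transitivity ((half + half) * (w * wi)); [ring|]. rewrite half2, Hw. ring. }
    assert (E2 : (1 + 1) * cst w * tau = pstail Q - cst (D w) - (hh * (tau * tau) + hh * pd D tau)).
    { rewrite <- Ht at 1. set (R := pstail Q - cst (D w)) in *. set (S := hh * (tau * tau) + hh * pd D tau) in *.
      transitivity (cst w * cst (half * wi) * (1 + 1) * (R - S)); [ring|]. rewrite E. ring. }
    transitivity (cst w * cst w + hh * ((1 + 1) * cst w * tau + (hh * (tau * tau) + hh * pd D tau) + cst (D w))); [ring|].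
    rewrite E2. ring.
Qed.

(* Two solutions with proportional leading terms: the ratio r satisfies a linear equation whose symbol is Q. *)
Lemma painleve_unique ci c0 l s e l' s' e' li q :
  formal_painleve ci c0 l s e -> formal_painleve ci c0 l' s' e' ->
  l O = l' O -> s O = s' O -> l O * li = 1 -> l * s = l' * s' -> @quadQ P ci c0 l s O * q = 1 ->
  l = l' /\ s = s' /\ e = e'.
Proof.
  intros (Hl & Hs & He) (Hl' & Hs' & He') H0 H0s Hli Hls HQ.
  destruct (ps_inverse A l li Hli) as [u Hu].
  assert (Hli' : l' O * li = 1) by (now rewrite <- H0).
  destruct (ps_inverse A l' li Hli') as [u' Hu'].
  set (dl := l' * u - 1).
  assert (El : l' = l * (1 + dl)) by (unfold dl; transitivity (l * u * l'); [rewrite Hu; ring|ring]).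
  set (p := l * u').
  assert (Hp : (1 + dl) * p = 1) by (unfold dl, p; transitivity ((l * u) * (l' * u')); [ring | rewrite Hu, Hu'; ring]).
  assert (Es : s' = s * p).
  { unfold p. transitivity (l * s * u'); [|ring]. rewrite Hls. transitivity (s' * (l' * u')); [rewrite Hu'; ring|ring]. }
  assert (Ep : p = 1 - dl * p) by (rewrite <- Hp; ring).
  assert (Ee : e' - e = pd D dl * p).
  { assert (E1 : pd D l' = pd D l * (1 + dl) + l * pd D dl) by (rewrite El, dvM, dvD, dv1; ring).
    rewrite Hl, Hl' in E1. apply (unit_cancel P l' u' _ _ Hu').
    transitivity (e' * l' - e * l'); [ring|]. rewrite E1. rewrite El at 1 2.
    transitivity (l * pd D dl * ((1 + dl) * p)); [rewrite Hp; ring|]. ring. }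
  (* U is the difference of the two values of [potG] divided by the relative perturbation [dl]; its
     leading term is that of [quadQ]. *)
  set (U := l * l * (1 + 1 + dl) - ci * l + s * s * p * (1 + p) - c0 * s * p).
  assert (EU : hh * (hh * pd D (pd D dl * p)) = U * dl).
  { rewrite <- Ee, dvB. transitivity (hh * (hh * pd D e') - hh * (hh * pd D e)); [ring|].
    rewrite He, He'. unfold potG, U. rewrite El, Es.
    transitivity (dl * (l * l * (1 + 1 + dl) - ci * l) - s * s * (p * p - 1) + c0 * s * (p - 1)); [ring|].
    replace (p - 1) with (- (dl * p)) by (rewrite Ep at 2; ring).
    replace (p * p - 1) with (- (dl * p * (1 + p))).
    - ring.
    - transitivity ((p - 1) * (p + 1)); [|ring]. replace (p - 1) with (- (dl * p)) by (rewrite Ep at 2; ring). ring. }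
  assert (Z : dl O = 0).
  { unfold dl. rewrite psB, psM0. rewrite <- H0.
    transitivity ((l * u) O - (1 : P) O); [rewrite psM0; ring|]. rewrite Hu. ring. }
  assert (Hdl : dl = 0).
  { assert (HU0 : U O * q = 1).
    { rewrite <- HQ. f_equal. unfold U, quadQ. repeat rewrite ?psB, ?psD, ?psM0.
      assert (p O = 1). { rewrite Ep, psB, psM0, Z. change ((1 : P) O) with (1 : A). ring. }
      rewrite Z, H. change ((1 : P) O) with (1 : A). ring. }
    destruct (ps_inverse A U q HU0) as [v Hv].
    apply contraction_zero. intros n Hn. apply (agree_unit A _ U v _ Hv). rewrite <- EU.
    apply agree_weak, agree_hh0, agree_D0.
    replace (0 : P) with (pd D 0 * p) by (rewrite dv0; ring). apply agree_mul; [now apply agree_pd|easy]. }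
  assert (p = 1) by (rewrite Ep, Hdl; ring).
  repeat split.
  - rewrite El, Hdl. ring.
  - rewrite Es, H. ring.
  - symmetry. apply sub_eq0. rewrite Ee, Hdl, dv0. ring.
Qed.

Lemma painleve_exists ci c0 l0 s0 e0 q :
  D l0 = e0 * l0 -> D s0 = (1 - e0) * s0 -> potG ci c0 l0 s0 = 0 -> quadQ ci c0 l0 s0 * q = 1 ->
  exists r p : P, r * p = 1 /\ r O = 1 /\ exists e : P, e O = e0 /\
    formal_painleve (cst ci) (cst c0) (cst l0 * r) (cst s0 * p) e.
Proof.
  intros Hl Hs HG HQ.
  (* The ansatz is l = l0 r, s = s0 / r with r = 1 + h rho, which keeps l s equal to l0 s0. Choosing
     the inverse as a function of the series makes the iteration a map of rho alone. *)
  set (inv := fun u : P => epsilon (inhabits (0 : P)) (fun w => u * w = 1)).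
  assert (Hinv : forall rho, (1 + hh * rho) * inv (1 + hh * rho) = 1).
  { intro rho. apply (epsilon_spec (inhabits (0 : P)) (fun w => (1 + hh * rho) * w = 1)).
    apply (ps_inverse A _ 1). rewrite psD, hhM0. change ((1 : P) O) with (1 : A). ring. }
  assert (Hag : forall n f g, agree n f g -> agree n (inv (1 + hh * f)) (inv (1 + hh * g))).
  { intros n f g H. replace (inv (1 + hh * f)) with
      (inv (1 + hh * g) + inv (1 + hh * f) * inv (1 + hh * g) * (hh * g - hh * f)).
    - replace (inv (1 + hh * g)) with (inv (1 + hh * g) + inv (1 + hh * f) * inv (1 + hh * g) * (hh * g - hh * g)) at 3 by ring.
      apply agree_add; [easy|]. apply agree_mul; [easy|]. apply agree_sub; [easy|]. now apply agree_weak, agree_hh.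
    - transitivity (inv (1 + hh * g) + inv (1 + hh * f) * ((1 + hh * g) * inv (1 + hh * g))
        - inv (1 + hh * g) * ((1 + hh * f) * inv (1 + hh * f))); [ring|]. rewrite !Hinv. ring. }
  (* Quadratic remainder: with x = h rho and p = 1 / (1 + x), [potG] at (l0 r, s0 p) is its value at
     (l0, s0) plus x [quadQ] plus x^2 W(p). *)
  set (W := fun p : P => cst (l0 * l0) - cst (s0 * s0) * ((1 + 1) * p + p * p) + cst (c0 * s0) * p).
  destruct (contraction_fix A (fun rho => let p := inv (1 + hh * rho) in
     cst q * (hh * (cst (D e0) + hh * pd D (pd D rho * p))) - cst q * (hh * (rho * rho * W p)))) as [rho Hr].
  { intros n f g H. assert (Hp := Hag n f g H). cbv zeta. apply agree_sub; (apply agree_mul; [easy|]); apply agree_hh.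
    - apply agree_add; [easy|]. apply agree_weak, agree_hh, agree_pd. apply agree_mul; [now apply agree_pd|easy].
    - apply agree_mul; [now apply agree_mul|]. unfold W.
      apply agree_add; [apply agree_sub; [easy|]|]; (apply agree_mul; [easy|]); [|easy].
      apply agree_add; apply agree_mul; easy. }
  set (r := 1 + hh * rho) in *. set (p := inv r) in *. cbv zeta in Hr.
  assert (Hrp : r * p = 1) by apply Hinv.
  set (e := cst e0 + pd D r * p).
  assert (HDr : pd D r = hh * pd D rho) by (unfold r; rewrite dvD, dv1, dvM, pd_hh; ring).
  exists r, p. split; [easy|]. split.
  { unfold r. rewrite psD, hhM0. change ((1 : P) O) with (1 : A). ring. }
  exists e. split.
  { unfold e. rewrite psD, HDr, psM0, hhM0. simpl. ring. }
  assert (HDp : pd D p = - (pd D r * p * p)) by (rewrite (dv_inv P (pd D) r p Hrp); ring).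
  assert (HQq : cst (quadQ ci c0 l0 s0) * cst q = 1) by (rewrite <- cstM, HQ; easy).
  split; [|split].
  - rewrite dvM, pd_cst, Hl, cstM. unfold e. transitivity (cst e0 * cst l0 * r + cst l0 * pd D r * (r * p)); [rewrite Hrp; ring|ring].
  - rewrite dvM, pd_cst, Hs, HDp, cstM, cstB, cst1. unfold e. ring.
  - unfold e. rewrite dvD, pd_cst, HDr.
    set (x := hh * rho) in *.
    assert (Ep : p = 1 - x + x * x * p).
    { assert (E1 : p = 1 - x * p) by (rewrite <- Hrp; unfold r; ring).
      rewrite E1 at 1. rewrite E1 at 1. ring. }
    assert (Epp : p * p = 1 - (1 + 1) * x + x * x * ((1 + 1) * p + p * p)).
    { assert (E1 : p = 1 - x * p) by (rewrite <- Hrp; unfold r; ring).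
      transitivity ((1 - x * p) * (1 - x * p)); [now rewrite <- E1|].
      transitivity (1 - (1 + 1) * x * (1 - x + x * x * p) + x * x * (p * p)); [|].
      - rewrite <- Ep. ring.
      - transitivity (1 - (1 + 1) * x + x * x * ((1 + 1) * (1 - x * p) + p * p)); [ring|]. rewrite <- E1. ring. }
    transitivity (cst (potG ci c0 l0 s0) + x * cst (quadQ ci c0 l0 s0) + x * x * W p).
    + rewrite HG. change (cst 0) with (cst (0 : A)). rewrite cst0.
      assert (E3 : rho * cst (quadQ ci c0 l0 s0) = hh * (cst (D e0) + hh * pd D (pd D rho * p)) - hh * (rho * rho * W p)).
      { rewrite <- Hr at 1.
        set (U := hh * (cst (D e0) + hh * pd D (pd D rho * p))). set (V := hh * (rho * rho * W p)).
        transitivity (cst (quadQ ci c0 l0 s0) * cst q * (U - V)); [ring|]. rewrite HQq. ring. }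
      unfold x. replace (hh * pd D rho * p) with (hh * (pd D rho * p)) by ring.
      rewrite (dvM (pd D) hh), pd_hh.
      transitivity (hh * (rho * cst (quadQ ci c0 l0 s0)) + hh * rho * (hh * rho) * W p); [|ring].
      rewrite E3. ring.
    + unfold potG, quadQ, W. repeat (rewrite cstD || rewrite cstB || rewrite cstM). rewrite ?cst1.
      transitivity (cst l0 * cst l0 * (r * r) - cst ci * (cst l0 * r)
        - cst s0 * cst s0 * (1 - (1 + 1) * x + x * x * ((1 + 1) * p + p * p)) + cst c0 * cst s0 * (1 - x + x * x * p)).
      * unfold r. fold x. ring.
      * rewrite <- Epp, <- Ep. ring.
Qed.

End Formal.

(** * The Backlund transformation *)

Section Backlund.
Local Open Scope ca_scope.
Variable A : calg.
Add Ring Ar : (ath A).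
Notation P := (psA A).
Add Ring Pr : (ath P).
Variables D d : deriv A.
Notation hD := (dscale P hh (pd D)).
Notation T := (tshift A d (RtoC 1)).
Variables (ci c0 : A) (l s e : P) (li Yi : P) (q : A).

(* The transformed solution is [T l = s Y / X], [T s = l X / Y] (lemma [backlund]);
   [N] is its factor on WKB solutions. *)
Definition btM : P := hh * e - l - s.
Definition btX : P := btM + cst ci.
Definition btY : P := btM + cst c0 - hh.
Definition btkap : P := cst ci - cst c0 + hh.
Definition btN (sg : P) : P := btkap * (sg - l + s) - btX * btY.

Hypothesis Dd : forall x, D (d x) = d (D x).
Hypothesis Dci : D ci = 0.
Hypothesis Dc0 : D c0 = 0.
Hypothesis dci : d ci = inj (RtoC 1).
Hypothesis dc0 : d c0 = inj (- RtoC 1)%C.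
Hypothesis Hpain : formal_painleve A D (cst ci) (cst c0) l s e.
Hypothesis Hls : T (l * s) = l * s.
Hypothesis Hli : l * li = 1.
Hypothesis HY : btY * Yi = 1.
Hypothesis Hq : quadQ ci c0 (l O) (s O) * q = 1.

Let lh := T l.
Let sh := T s.
Let eh := T e.

Lemma hDhh : hD hh = 0.
Proof. rewrite dscaleE, pd_hh. ring. Qed.
Lemma hDcst a : D a = 0 -> hD (cst a) = 0.
Proof. intro H. rewrite dscaleE, pd_cst, H, cst0. ring. Qed.
Lemma T_ci : T (cst ci) = cst ci + hh.
Proof. rewrite (shift_lin A d _ _ _ dci). replace (RtoC 1 * RtoC 1)%C with (RtoC 1) by ring. rewrite inj1. ring. Qed.
Lemma T_c0 : T (cst c0) = cst c0 - hh.
Proof. rewrite (shift_lin A d _ _ _ dc0). replace (RtoC 1 * - RtoC 1)%C with (- RtoC 1)%C by ring. rewrite injN, inj1. ring. Qed.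

Lemma T_two : T (1 + 1) = 1 + 1.
Proof. rewrite shiftD, shift_1. easy. Qed.

Lemma hat_painleve : formal_painleve A D (cst ci + hh) (cst c0 - hh) lh sh eh.
Proof.
  destruct Hpain as (H1 & H2 & H3). unfold lh, sh, eh. split; [|split].
  - rewrite shift_comm by apply Dd. rewrite H1, shiftM. easy.
  - rewrite shift_comm by apply Dd. rewrite H2, shiftM, shiftB, shift_1. easy.
  - rewrite shift_comm by apply Dd. rewrite <- T_ci, <- T_c0.
    apply (f_equal T) in H3. rewrite !shiftM, shift_hh in H3. rewrite H3. unfold potG.
    rewrite shiftD, !shiftB, !shiftM. easy.
Qed.

Lemma hat_quadQ : T (quadQ (cst ci) (cst c0) l s) = quadQ (cst ci + hh) (cst c0 - hh) lh sh.
Proof. unfold quadQ. rewrite !shiftB, !shiftD, !shiftB, !shiftM, T_two, T_ci, T_c0. easy. Qed.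

Lemma hat_unit : lh * T li = 1.
Proof. unfold lh. rewrite <- shiftM, Hli. apply shift_1. Qed.

Lemma hDl : hD l = (hh * e) * l.
Proof. rewrite dscaleE. destruct Hpain as (H & _). rewrite H. ring. Qed.
Lemma hDs : hD s = (hh - hh * e) * s.
Proof. rewrite dscaleE. destruct Hpain as (_ & H & _). rewrite H. ring. Qed.
Lemma hDe : hD (hh * e) = potG (cst ci) (cst c0) l s.
Proof. destruct Hpain as (_ & _ & H). rewrite <- H, dvM, hDhh, dscaleE. ring. Qed.
Lemma hDM : hD btM = s * btY - l * btX.
Proof. unfold btX, btY. unfold btM at 1. rewrite !dvB, hDl, hDs, hDe. unfold potG, btM. ring. Qed.
Lemma hDX : hD btX = s * btY - l * btX.
Proof. unfold btX at 1. rewrite dvD, hDM, hDcst by easy. ring. Qed.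
Lemma hDY : hD btY = s * btY - l * btX.
Proof. unfold btY at 1. rewrite dvB, dvD, hDM, hDcst, hDhh by easy. ring. Qed.

Lemma cst_0n a : @cst A a O = a. Proof. easy. Qed.
Lemma one_0n : (1 : P) O = (1 : A). Proof. easy. Qed.
Lemma hh_0n : (hh : P) O = (0 : A). Proof. easy. Qed.

Lemma pot_lead : potG ci c0 (l O) (s O) = 0.
Proof.
  destruct Hpain as (_ & _ & H). apply (f_equal (fun F : P => F O)) in H.
  rewrite hhM0 in H. rewrite H. unfold potG. rewrite psD, !psB, !psM0. easy.
Qed.

(** The transformed triple is known only as the Taylor shift, so the algebraic formulas need proof:
    their defects satisfy a homogeneous linear system under h D with invertible determinant, and
    therefore vanish. No division by X occurs, since X vanishes at the double pole. *)
Lemma backlund : hh * eh = hh - btM - lh - sh /\ lh * btX = s * btY /\ sh * btY = l * btX.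
Proof.
  destruct hat_painleve as (A1 & A2 & A3).
  assert (B1 : hD lh = (hh * eh) * lh) by (rewrite dscaleE, A1; ring).
  assert (B2 : hD sh = (hh - hh * eh) * sh) by (rewrite dscaleE, A2; ring).
  assert (B3 : hD (hh * eh) = potG (cst ci + hh) (cst c0 - hh) lh sh) by (rewrite <- A3, dvM, hDhh, dscaleE; ring).
  assert (Hu := hat_unit).
  assert (Hsh : sh = l * s * T li).
  { rewrite <- Hls, shiftM. transitivity ((lh * T li) * sh); [rewrite Hu; ring|]. unfold lh, sh. ring. }
  set (e1 := hh * eh + lh + sh + btM - hh). set (e2 := lh * btX - s * btY).
  (* As T fixes l s, the defect of the relation for T s is a multiple of e2, so two unknowns
     suffice. *)
  assert (Hs3 : sh * btY - l * btX = - (l * T li) * e2).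
  { unfold e2. transitivity (l * T li * s * btY - l * btX * (lh * T li)); [rewrite Hsh, Hu; ring|ring]. }
  assert (Hs4 : s * (l * T li) = sh) by (rewrite Hsh; ring).
  assert (E1 : hh * pd D e1 = (lh - sh) * e1 + (- (1 + l * T li)) * e2).
  { rewrite <- dscaleE. unfold e1 at 1. rewrite dvB, !dvD, B1, B2, B3, hDM, hDhh.
    transitivity ((lh - sh) * e1 - e2 + (sh * btY - l * btX)).
    - unfold potG, e1, e2, btX, btY. ring.
    - rewrite Hs3. ring. }
  assert (E2 : hh * pd D e2 = (s * btY) * e1 + (hh * eh + sh - l) * e2).
  { rewrite <- dscaleE. unfold e2 at 1. rewrite dvB, !dvM, B1, hDX, hDs, hDY.
    transitivity (s * btY * e1 + (hh * eh - l) * e2 - s * (sh * btY - l * btX)).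
    - unfold e1, e2, btX, btY, btM. ring.
    - rewrite Hs3. transitivity (s * btY * e1 + (hh * eh - l) * e2 + (s * (l * T li)) * e2); [ring|rewrite Hs4; ring]. }
  assert (U0 : (l * T li) O = 1).
  { rewrite psM0, shift_0, <- psM0, Hli. easy. }
  assert (Hsh0 : sh O = s O) by apply shift_0.
  assert (Hlh0 : lh O = l O) by apply shift_0.
  assert (Z12 : e1 = 0 /\ e2 = 0); [|destruct Z12 as [Z1 Z2]].
  (* On the curve the determinant is - [quadQ] at order 0, hence the inverse - q. *)
  - refine (linear_unique2 A D _ _ _ _ e1 e2 (- q) _ E1 E2).
    rewrite psB. rewrite (psM0 A (lh - sh)), (psM0 A (- (1 + l * T li))).
    repeat rewrite ?psB, ?psD, ?psN. rewrite hhM0, U0, (psM0 A s). unfold btY, btM.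
    repeat rewrite ?psB, ?psD, ?psN. rewrite hhM0, one_0n, hh_0n, cst_0n, Hsh0, Hlh0.
    assert (G := pot_lead). unfold potG in G.
    transitivity (quadQ ci c0 (l O) (s O) * q); [|exact Hq]. unfold quadQ.
    set (x := l O) in *. set (y := s O) in *.
    transitivity (q * ((1 + 1) * (x * x) - ci * x + (1 + 1) * (y * y) - c0 * y - (x * x - ci * x - y * y + c0 * y))); [ring|].
    rewrite G. ring.
  - assert (Z3 := Hs3). rewrite Z2 in Z3. split; [|split].
    + apply sub_eq0. rewrite <- Z1. unfold e1. ring.
    + apply sub_eq0. exact Z2.
    + apply sub_eq0. rewrite Z3. ring.
Qed.

(** [wkb_shift_id] says that the right side solves the shifted Riccati equation; [T sg] solves it as
    well, with the same leading term, so the two coincide. The only divisions are by Y and by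
    N(sg). *)
Lemma wkb_shift (sg Ni : P) w : formal_riccati A D (cst ci) (cst c0) l s sg ->
  sg O * w = 1 -> btN sg * Ni = 1 ->
  T sg = sg + hh * (pd D (btN sg) * Ni + eh - 1 + e - (1 + 1) * (pd D btY * Yi)).
Proof.
  intros Hr Hw HN. destruct backlund as (B1 & B2 & B3).
  destruct hat_painleve as (A1 & A2 & A3).
  assert (B4 : hD (hh * eh) = potG (cst ci + hh) (cst c0 - hh) lh sh) by (rewrite <- A3, dvM, hDhh, dscaleE; ring).
  assert (HD : hD sg = quadQ (cst ci) (cst c0) l s - sg * sg).
  { rewrite dscaleE, <- Hr. ring. }
  assert (I := wkb_shift_id P hD hh (cst ci) (cst c0) l s (hh * e) lh sh (hh * eh) sg btY Yi (btN sg)).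
  cbv zeta in I. specialize (I eq_refl HY B2 B3 B1 hDhh (hDcst ci Dci) (hDcst c0 Dc0) hDl hDs hDe B4 HD eq_refl).
  set (a := sg + hh * eh - hh + hh * e - (1 + 1) * (hD btY * Yi)) in *.
  set (Qh := quadQ (cst ci + hh) (cst c0 - hh) lh sh) in *.
  assert (Hs : sg + hh * (pd D (btN sg) * Ni + eh - 1 + e - (1 + 1) * (pd D btY * Yi)) = a + hD (btN sg) * Ni).
  { unfold a. rewrite !dscaleE. ring. }
  rewrite Hs.
  apply (riccati_unique A D (cst ci + hh) (cst c0 - hh) lh sh _ _ w).
  - unfold formal_riccati. fold Qh. unfold Qh. rewrite <- hat_quadQ, <- Hr, shiftD, !shiftM, shift_hh, shift_comm by apply Dd. easy.
  - unfold formal_riccati. fold Qh. rewrite <- dscaleE.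
    rewrite dvD, dvM, (dv_inv P hD _ _ HN).
    set (N := btN sg) in *.
    assert (E : a * a + hD a - Qh = - ((1 + 1) * a * hD N + hD (hD N)) * Ni).
    { apply (unit_cancel P N Ni _ _ HN).
      transitivity ((a * a + hD a - Qh) * N + (1 + 1) * a * hD N + hD (hD N) - ((1 + 1) * a * hD N + hD (hD N)) * 1); [ring|].
      rewrite I, <- HN. ring. }
    transitivity ((a * a + hD a - Qh) + Qh + (1 + 1) * a * hD N * Ni + hD (hD N) * Ni); [ring|].
    rewrite E. ring.
  - unfold a. rewrite psD, (psM0 A (hD (btN sg))), (dscaleE P hh _ (btN sg)), hhM0, psB, (psM0 A (1 + 1)), (psM0 A (hD btY)), (dscaleE P hh _ btY), hhM0, psD, psB, psD, !hhM0, hh_0n, shift_0. ring.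
  - rewrite shift_0. easy.
Qed.

(* [btLam f] is the [f]-derivative of the logarithm of the ratio of the shifted
   and the unshifted WKB solutions. *)
Definition btLam (f : deriv A) (N Ni so soi : P) : P :=
  (1 + 1) * (pd f btY * Yi) - pd f l * li - pd f (T l) * T li - pd f N * Ni
  + half * (pd f so * soi) - half * (pd f (T so) * T soi).

(** Subtracting the two Riccati equations gives sg = - so - (h/2) D log so. Inserted into
    [wkb_shift], this makes (T - 1) so equal to h D of a logarithm; applying f and exchanging f with
    D turns that logarithm into the element [btLam]. *)
Lemma btLam_D (f : deriv A) (sp sg Ni soi wi : P) :
  (forall x, f (D x) = D (f x)) -> (forall x, f (d x) = d (f x)) ->
  formal_riccati A D (cst ci) (cst c0) l s sp -> formal_riccati A D (cst ci) (cst c0) l s sg ->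
  sg O * wi O = 1 -> btN sg * Ni = 1 ->
  let so := half * (sp - sg) in so * soi = 1 ->
  hh * pd D (btLam f (btN sg) Ni so soi) = T (pd f so) - pd f so.
Proof.
  intros fD fd Hp Hm Hw HN so Hso.
  assert (Hsh := wkb_shift sg Ni _ Hm Hw HN).
  assert (E1 : so * (sp + sg) = - (hh * pd D so)).
  { unfold so, half. rewrite dvZ, dvB. unfold formal_riccati in Hp, Hm. rewrite <- Hm in Hp.
    transitivity (inj (/ RtoC 2)%C * ((sp * sp + hh * pd D sp) - (sg * sg + hh * pd D sg) - hh * (pd D sp - pd D sg))); [ring|].
    rewrite Hp. ring. }
  assert (E2 : sp + sg = - (hh * (pd D so * soi))).
  { apply (unit_cancel P so soi _ _ Hso). rewrite E1. transitivity (- (hh * pd D so) * (so * soi)); [rewrite Hso; ring|ring]. }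
  assert (E3 : sg = - so - half * (hh * (pd D so * soi))).
  { transitivity (half * (sp + sg) - so); [|rewrite E2; ring].
    unfold so. transitivity ((half + half) * sg); [rewrite half2; ring|ring]. }
  assert (Thalf : T half = half) by apply shift_inj.
  assert (E4 : T so - so = hh * (1 - e - eh + (1 + 1) * (pd D btY * Yi) - pd D (btN sg) * Ni
      + half * (pd D so * soi) - half * (pd D (T so) * T soi))).
  { assert (E5 : T sg = - T so - half * (hh * (pd D (T so) * T soi))).
    { rewrite E3 at 1. rewrite shift_comm by apply Dd.
      rewrite shiftB, shiftN, !shiftM, shift_hh, Thalf. ring. }
    rewrite E5 in Hsh.
    set (n := pd D (btN sg)) in *.
    set (Z := n * Ni + eh - 1 + e - (1 + 1) * (pd D btY * Yi)) in *.
    transitivity (- (- T so - half * (hh * (pd D (T so) * T soi))) - half * (hh * (pd D (T so) * T soi)) - so); [ring|].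
    rewrite Hsh, E3. unfold Z. ring. }
  apply (f_equal (pd f)) in E4. rewrite dvB, dvM, pd_hh, shift_comm in E4 by apply fd.
  rewrite E4.
  assert (fDp : forall x, pd f (pd D x) = pd D (pd f x)) by (intro; apply pd_comm; easy).
  destruct Hpain as (H1 & _). destruct hat_painleve as (A1 & _).
  assert (El : e = pd D l * li) by (rewrite H1; transitivity (e * (l * li)); [rewrite Hli; ring|ring]).
  assert (Hu := hat_unit).
  assert (Elh : eh = pd D lh * T li) by (rewrite A1; transitivity (eh * (lh * T li)); [rewrite Hu; ring|ring]).
  rewrite El, Elh. unfold btLam.
  assert (HTso : T so * T soi = 1) by (rewrite <- shiftM, Hso; apply shift_1).
  assert (d2 : forall (g : deriv P) x, g ((1 + 1) * x) = (1 + 1) * g x) by (intros; rewrite dvM, dvD, dv1; ring).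
  assert (dh : forall (g : deriv P) x, g (half * x) = half * g x) by (intros; apply dvZ).
  repeat rewrite ?dvB, ?dvD, ?d2, ?dh, ?dv1.
  rewrite (dlog_comm P (pd f) (pd D) _ _ fDp HY), (dlog_comm P (pd f) (pd D) _ _ fDp Hli), (dlog_comm P (pd f) (pd D) _ _ fDp Hu),
    (dlog_comm P (pd f) (pd D) _ _ fDp HN), (dlog_comm P (pd f) (pd D) _ _ fDp Hso), (dlog_comm P (pd f) (pd D) _ _ fDp HTso).
  fold lh. ring.
Qed.

(** [so] is half the Wronskian of the two WKB solutions divided by their product. Under the shift
    the Wronskian acquires the determinant of [wronskian_id] and the product acquires N_+ N_-; the
    common gauge factor cancels. *)
Lemma parity (sp sg Nmi Npi w wi : P) :
  formal_riccati A D (cst ci) (cst c0) l s sp -> formal_riccati A D (cst ci) (cst c0) l s sg ->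
  sg O * wi O = 1 -> sp O * w O = 1 -> btN sg * Nmi = 1 -> btN sp * Npi = 1 ->
  let so := half * (sp - sg) in
  btN sp * btN sg * T so = btX * btX * (btY * btY) * so.
Proof.
  intros Hp Hm Hwi Hw HNm HNp so.
  assert (S1 := wkb_shift sg Nmi _ Hm Hwi HNm). assert (S2 := wkb_shift sp Npi _ Hp Hw HNp).
  assert (E1 : T so = so + half * (hD (btN sp) * Npi - hD (btN sg) * Nmi)).
  { unfold so. rewrite shiftM, shiftB, S1, S2. replace (T half) with (half : P) by (symmetry; apply shift_inj).
    rewrite !dscaleE. ring. }
  assert (W := wronskian_id P hD hh (cst ci) (cst c0) l s (hh * e) hDhh (hDcst ci Dci) (hDcst c0 Dc0) hDl hDs hDe).
  cbv zeta in W. fold btM in W. fold btX in W. fold btY in W. fold btkap in W.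
  set (n0 := btkap * (s - l) - btX * btY) in *.
  set (Q := quadQ (cst ci) (cst c0) l s) in *.
  assert (N1 : forall x, btN x = n0 + btkap * x) by (intro; unfold btN, n0; ring).
  assert (Hk : hD btkap = 0) by (unfold btkap; rewrite dvD, dvB, !hDcst, hDhh by easy; ring).
  assert (N2 : forall x, formal_riccati A D (cst ci) (cst c0) l s x -> hD (btN x) = hD n0 + btkap * (Q - x * x)).
  { intros x Hx. rewrite N1, dvD, dvM, Hk. unfold Q. rewrite <- Hx, (dscaleE P hh _ x). ring. }
  rewrite E1, <- W.
  transitivity (btN sp * btN sg * so + half * (btN sg * hD (btN sp) * (btN sp * Npi) - btN sp * hD (btN sg) * (btN sg * Nmi))); [ring|].
  rewrite HNp, HNm, (N2 sp Hp), (N2 sg Hm), !N1. unfold so. ring.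
Qed.

(* By [parity], the two logarithms add up to the logarithm of a constant. *)
Lemma btLam_odd (f : deriv A) (t ti : P) (sp sg Nmi Npi soi w wi : P) :
  formal_riccati A D (cst ci) (cst c0) l s sp -> formal_riccati A D (cst ci) (cst c0) l s sg ->
  sg O * wi O = 1 -> sp O * w O = 1 -> btN sg * Nmi = 1 -> btN sp * Npi = 1 ->
  l * s = t -> t * ti = 1 -> pd f t = 0 ->
  let so := half * (sp - sg) in so * soi = 1 ->
  btLam f (btN sg) Nmi so soi + btLam f (btN sp) Npi (- so) (- soi) = 0.
Proof.
  intros Hp Hm Hwi Hw HNm HNp Ht Hti ft so Hso.
  assert (Hpar := parity sp sg Nmi Npi w wi Hp Hm Hwi Hw HNm HNp). cbv zeta in Hpar. fold so in Hpar.
  destruct backlund as (_ & B2 & _).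
  assert (Hu := hat_unit).
  assert (HTso : T so * T soi = 1) by (rewrite <- shiftM, Hso; apply shift_1).
  (* X is eliminated through lh X = s Y, so that only quantities with given inverses, and the
     constant t, remain under the logarithm. *)
  assert (Hid : (l * l) * (lh * lh) * (btN sp * btN sg * T so) = t * t * (btY * btY * (btY * btY)) * so).
  { rewrite Hpar, <- Ht. transitivity ((l * l) * ((lh * btX) * (lh * btX)) * (btY * btY) * so); [ring|].
    rewrite B2. ring. }
  assert (Hid0 := Hid). apply (f_equal (pd f)) in Hid. rewrite !dvM, ft in Hid.
  set (F := pd f) in *.
  unfold btLam. fold F lh. rewrite !shiftN, !dvN.
  transitivity ((1 + 1) * ((1 + 1) * (F btY * Yi)) - (1 + 1) * (F l * li) - (1 + 1) * (F lh * T li)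
     - F (btN sg) * Nmi - F (btN sp) * Npi + (half + half) * (F so * soi) - (half + half) * (F (T so) * T soi)); [ring|].
  rewrite half2.
  assert (U : (l * l) * (lh * lh) * (btN sp * btN sg * T so) * ((li * li) * (T li * T li) * (Npi * Nmi * T soi)) = 1).
  { transitivity ((l * li) * (l * li) * ((lh * T li) * (lh * T li)) * ((btN sp * Npi) * (btN sg * Nmi) * (T so * T soi))); [ring|].
    rewrite Hli, Hu, HNm, HNp, HTso. ring. }
  assert (V : t * t * (btY * btY * (btY * btY)) * so * (ti * ti * (Yi * Yi * (Yi * Yi)) * soi) = 1).
  { transitivity ((t * ti) * (t * ti) * ((btY * Yi) * (btY * Yi) * ((btY * Yi) * (btY * Yi))) * (so * soi)); [ring|].
    rewrite Hti, HY, Hso. ring. }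
  assert (UV : (li * li) * (T li * T li) * (Npi * Nmi * T soi) = ti * ti * (Yi * Yi * (Yi * Yi)) * soi).
  { apply (unit_cancel P _ _ _ _ U). rewrite U, Hid0, V. easy. }
  apply (f_equal (fun x => x * ((li * li) * (T li * T li) * (Npi * Nmi * T soi)))) in Hid.
  rewrite UV in Hid at 2.
  match type of Hid with ?a = ?b =>
    transitivity (b - a) end.
  2: rewrite Hid; ring.
  assert (R1 := Hli). assert (R2 := Hu). assert (R3 := HNm). assert (R4 := HNp).
  clearbody F lh so. clear -R1 R2 R3 R4 HTso Hti HY Hso.
  set (N1 := btN sg) in *. set (N2 := btN sp) in *. set (Y := btY) in *. set (x1 := T li) in *. set (x2 := T so) in *. set (x3 := T soi) in *.
  clearbody N1 N2 Y x1 x2 x3.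
  ring [R1 R2 R3 R4 HTso Hti HY Hso].
Qed.

End Backlund.

(** * Homogeneity and primitives *)

Record hom (A B : calg) := Hom {
  hm :> A -> B;
  hmD : forall x y, hm (x + y)%A = (hm x + hm y)%A;
  hmM : forall x y, hm (x * y)%A = (hm x * hm y)%A;
  hmI : forall c, hm (inj c) = inj c }.
Arguments hm {A B} _ _. Arguments hmD {A B} _ _ _. Arguments hmM {A B} _ _ _. Arguments hmI {A B} _ _.

Section Homs.
Local Open Scope ca_scope.
Variables A B : calg.
Variable th : hom A B.
Add Ring Ar : (ath A).
Add Ring Br : (ath B).

Lemma hm1 : th 1 = 1.
Proof. rewrite <- !inj1. apply hmI. Qed.
Lemma hm0 : th 0 = 0.
Proof. rewrite <- !inj0. apply hmI. Qed.
Lemma hmB x y : th (x - y) = th x - th y.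
Proof. assert (H : th (x - y) + th y = th x) by (rewrite <- hmD; f_equal; ring).
  rewrite <- H. ring. Qed.
Lemma hmN x : th (- x) = - th x.
Proof. replace (- x) with (0 - x) by ring. rewrite hmB, hm0. ring. Qed.

Lemma hom_psmuln n : forall f g : psA A, th (psmuln n f g) = psmuln n (fun k => th (f k)) (fun k => th (g k)).
Proof.
  induction n; intros f g; cbn [psmuln]; [apply hmM|].
  assert (E : forall f : psA A, (fun k => th (psder f k)) = psder (fun k => th (f k))).
  { intro k. extensionality m. unfold psder, nR. now rewrite hmM, hmI. }
  rewrite hmM, hmD. unfold nI. rewrite hmI, !IHn, !E. easy.
Qed.

Definition pshom : hom (psA A) (psA B).
Proof.
  apply (@Hom (psA A) (psA B) (fun f n => th (f n))).
  - intros. extensionality n. rewrite !psD. apply hmD.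
  - intros. extensionality n. rewrite !psM. apply hom_psmuln.
  - intros. extensionality n. destruct n; simpl; [apply hmI|apply hm0].
Defined.
Lemma pshomE f n : pshom f n = th (f n). Proof. easy. Qed.
Lemma pshom_hh : pshom hh = hh.
Proof. extensionality n. rewrite pshomE. unfold hh. destruct n as [|[|n]]; [apply hm0|apply hm1|apply hm0]. Qed.
Lemma pshom_cst a : pshom (cst a) = cst (th a).
Proof. extensionality n. rewrite pshomE. destruct n; simpl; [easy|apply hm0]. Qed.

Variables (d : deriv A) (d' : deriv B).
Hypothesis Hd : forall x, th (d x) = d' (th x).
Lemma pshom_pd f : pshom (pd d f) = pd d' (pshom f).
Proof. extensionality n. rewrite pshomE, !pdE. apply Hd. Qed.
Lemma pshom_op c : forall f, pshom (op A d c f) = op B d' c (pshom f).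
Proof.
  assert (H : forall n c f, th (opn A d n c f) = opn B d' n c (pshom f)).
  { induction n; intros k f; cbn [opn]; rewrite ?hmD, hmM, hmI; [easy|]. rewrite Hd, IHn. easy. }
  intro f. extensionality n. apply H.
Qed.
Lemma pshom_shift x f : pshom (tshift A d x f) = tshift B d' x (pshom f).
Proof. apply pshom_op. Qed.

End Homs.
Arguments pshom {A B}.

Section HomData.
Local Open Scope ca_scope.
Variables A B : calg.
Variable th : hom A B.
Add Ring Pr : (ath (psA A)).
Variables (D d : deriv A) (D' d' : deriv B).
Hypothesis HD : forall x, th (D x) = D' (th x).
Hypothesis Hd : forall x, th (d x) = d' (th x).
Notation H := (pshom th).

Lemma hom_two : H (1 + 1) = 1 + 1.
Proof. rewrite hmD, hm1. easy. Qed.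

Lemma hom_quadQ ci c0 l s : H (quadQ ci c0 l s) = quadQ (H ci) (H c0) (H l) (H s).
Proof. unfold quadQ. now rewrite !hmB, hmD, hmB, !hmM, !hom_two. Qed.
Lemma hom_painleve ci c0 l s e : formal_painleve A D ci c0 l s e ->
  formal_painleve B D' (H ci) (H c0) (H l) (H s) (H e).
Proof.
  intros (H1 & H2 & H3). split; [|split].
  - rewrite <- (pshom_pd _ _ th _ _ HD), H1, hmM. easy.
  - rewrite <- (pshom_pd _ _ th _ _ HD), H2, hmM, hmB, hm1. easy.
  - rewrite <- (pshom_pd _ _ th _ _ HD). transitivity (H (hh * (hh * pd D e))); [now rewrite !hmM, pshom_hh|].
    rewrite H3. unfold potG. now rewrite hmD, !hmB, !hmM.
Qed.
Lemma hom_riccati ci c0 l s sg : formal_riccati A D ci c0 l s sg ->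
  formal_riccati B D' (H ci) (H c0) (H l) (H s) (H sg).
Proof.
  intro H1. unfold formal_riccati. rewrite <- hom_quadQ, <- H1, hmD, !hmM, pshom_hh, (pshom_pd _ _ th _ _ HD). easy.
Qed.
Lemma hom_btY c0 l s e : H (btY A c0 l s e) = btY B (th c0) (H l) (H s) (H e).
Proof. unfold btY, btM. now rewrite !hmB, hmD, !hmB, hmM, pshom_hh, pshom_cst. Qed.
Lemma hom_btN ci c0 l s e sg : H (btN A ci c0 l s e sg) = btN B (th ci) (th c0) (H l) (H s) (H e) (H sg).
Proof. unfold btN. rewrite hmB, !hmM, hom_btY. unfold btkap, btX, btM.
  now rewrite ?hmD, ?hmB, ?hmD, ?hmB, ?hmM, ?hmD, ?hmB, pshom_hh, !pshom_cst. Qed.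
Lemma hom_btLam (f : deriv A) (f' : deriv B) c0 l s e li Yi N Ni so soi :
  (forall x, th (f x) = f' (th x)) ->
  H (btLam A d c0 l s e li Yi f N Ni so soi)
  = btLam B d' (th c0) (H l) (H s) (H e) (H li) (H Yi) f' (H N) (H Ni) (H so) (H soi).
Proof.
  intro Hf. unfold btLam.
  assert (Eh : H half = half) by apply hmI.
  rewrite ?hmB, ?hmD, ?hmB, ?hmM, hom_two, Eh, !(pshom_pd _ _ th _ _ Hf), !(pshom_shift _ _ th _ _ Hd), hom_btY. easy.
Qed.
End HomData.

Section Antiderivative.
Local Open Scope ca_scope.
Variable A : calg.
Add Ring Ar : (ath A).
Notation P := (psA A).
Add Ring Pr : (ath P).
Notation K := (psA CA).
Add Ring Kr : (ath K).
Variables D d : deriv A.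
Hypothesis Dd : forall x, D (d x) = d (D x).

Definition expquot : K := fun n => RtoC (/ INR (fact (S n))).

Lemma expser_quot : expser (RtoC 1) = 1 + hh * expquot.
Proof.
  extensionality n. rewrite psD. unfold expser.
  assert (H : forall n, Cpow (RtoC 1) n = RtoC 1) by (induction n0; simpl; [easy|rewrite IHn0; ring]).
  rewrite H. destruct n; [rewrite hhM0|rewrite hhMS].
  - simpl. rewrite Rinv_1. change (@eq C (RtoC 1 * RtoC 1)%C (RtoC 1 + RtoC 0)%C). ring.
  - unfold expquot. change (@eq C (RtoC 1 * RtoC (/ INR (fact (S n))))%C (RtoC 0 + RtoC (/ INR (fact (S n))))%C). ring.
Qed.

(* Inverting [(exp(h d) - 1)/(h d)] by the Bernoulli generating series [b]. *)
Lemma antiderivative (b : K) (F L : P) : b * expquot = 1 ->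
  hh * pd D L = tshift A d (RtoC 1) F - F -> pd d F = pd D (op A d b L).
Proof.
  intros Hb HL.
  assert (E : pd D L = pd d (op A d expquot F)).
  { apply hh_cancel. rewrite HL. unfold tshift. rewrite expser_quot, op_addc, op_1, op_hc. ring. }
  rewrite op_comm by apply Dd. rewrite E, <- op_d, op_op, Hb, op_1. easy.
Qed.

End Antiderivative.

Section Euler.
Local Open Scope ca_scope.
Variable A : calg.
Add Ring Ar : (ath A).
Notation P := (psA A).
Add Ring Pr : (ath P).
Variables D E : deriv A.
Hypothesis DE : forall x, E (D x) = D (E x).

(* The Euler field of the grading, in which [h] has degree 1. *)
Definition htot : deriv P.
Proof.
  apply (@Deriv P (fun f => pd E f + hh * hder f)).
  - intros. rewrite !dvD. ring.
  - intros. rewrite !dvM. ring.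
  - intros. rewrite !dvI. ring.
Defined.
Lemma htotE f : htot f = pd E f + hh * hder f. Proof. easy. Qed.
Lemma htot_hh : htot hh = hh.
Proof. rewrite htotE, pd_hh, hder_hh. ring. Qed.
Lemma htot_cst a : htot (cst a) = cst (E a).
Proof. rewrite htotE, pd_cst, hder_cst. ring. Qed.
Lemma htot_D f : htot (pd D f) = pd D (htot f).
Proof. rewrite !htotE, dvD, dvM, pd_hh, <- pd_hder, (pd_comm A E D DE). ring. Qed.
Lemma htot_coef f n : htot f n = E (f n) + inj (RtoC (INR n)) * f n.
Proof.
  rewrite htotE, psD, pdE. destruct n; [rewrite hhM0; simpl; rewrite inj0; ring|].
  rewrite hhMS, hderE. easy.
Qed.

Variables (ci c0 t q : A) (l s e li : P).
Hypothesis Hpain : formal_painleve A D (cst ci) (cst c0) l s e.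
Hypothesis Hli : l * li = 1.
Hypothesis Hls : l * s = cst t.
Hypothesis Eci : E ci = ci.
Hypothesis Ec0 : E c0 = c0.
Hypothesis Et : E t = (1 + 1) * t.
Hypothesis Hq : quadQ ci c0 (l O) (s O) * q = 1.

Lemma quadQ_lead : @quadQ P (cst ci) (cst c0) l s O = quadQ ci c0 (l O) (s O).
Proof. unfold quadQ. rewrite !psB, psD, psB, !psM0. unfold cst, pscst. rewrite psD.
  change ((1 : P) O) with (1 : A). easy. Qed.

Lemma htot_two : htot (1 + 1) = 0.
Proof. rewrite dvD, !dv1. ring. Qed.

(** Applied to the equations, the Euler field shows that the relative defect [dl] of homogeneity
    solves the linearised equation h^2 D^2 dl = [quadQ] dl. As [quadQ] is a unit, the defect is
    0. *)
Lemma euler_painleve : htot l = l /\ htot s = s.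
Proof.
  destruct Hpain as (H1 & H2 & H3).
  set (dl := htot l * li - 1).
  assert (El : htot l = l + dl * l).
  { unfold dl. transitivity (htot l * (l * li)); [rewrite Hli; ring|ring]. }
  assert (Es : htot s = s - dl * s).
  { apply (unit_cancel P l li _ _ Hli).
    assert (X := f_equal htot Hls). rewrite dvM, htot_cst, Et, cstM, cstD, cst1, <- Hls, El in X.
    transitivity ((l + dl * l) * s + l * htot s - (l + dl * l) * s); [ring|]. rewrite X. ring. }
  assert (Ee : htot e = pd D dl).
  { assert (e = pd D l * li) as -> by (rewrite H1; transitivity (e * (l * li)); [rewrite Hli; ring|ring]).
    rewrite (dlog_comm P htot (pd D) _ _ htot_D Hli). unfold dl. rewrite dvB, dv1. ring. }
  assert (X := f_equal htot H3).
  rewrite !dvM, htot_hh, htot_D, Ee in X. unfold potG in X.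
  rewrite dvD, !dvB, !dvM, !htot_cst, Eci, Ec0, El, Es in X.
  destruct (ps_inverse A (@quadQ P (cst ci) (cst c0) l s) q) as [u Hu].
  { rewrite quadQ_lead. exact Hq. }
  assert (Z : dl = 0).
  { apply contraction_zero. intros n Hn. apply (agree_unit A _ _ u _ Hu).
    replace (quadQ (cst ci) (cst c0) l s * dl) with (hh * (hh * pd D (pd D dl))).
    - apply agree_weak, agree_hh0, agree_D0. rewrite <- (dv0 _ (pd D)). now apply agree_pd.
    - transitivity (hh * (hh * pd D e + hh * pd D e + hh * pd D (pd D dl)) - (1 + 1) * (hh * (hh * pd D e))); [ring|].
      transitivity (hh * (hh * pd D e) + hh * (hh * pd D e + hh * pd D (pd D dl)) - (1 + 1) * (hh * (hh * pd D e))); [ring|].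
      rewrite X, H3. unfold potG, quadQ. ring. }
  rewrite El, Es, Z. split; ring.
Qed.

(** The defect htot sg - sg solves the linear equation with symbol - 2 sg, which has only the zero
    solution. *)
Lemma euler_riccati sg w : formal_riccati A D (cst ci) (cst c0) l s sg -> sg O * w = 1 -> htot sg = sg.
Proof.
  intros Hr Hw. destruct euler_painleve as [El Es].
  apply sub_eq0, (linear_unique1 A D (- ((1 + 1) * sg)) _ (- (half * w))).
  - rewrite psN, psM0, psD. change ((1 : P) O) with (1 : A).
    transitivity ((half + half) * (sg O * w)); [ring|]. rewrite half2, Hw. ring.
  - assert (X := f_equal htot Hr). unfold quadQ in X.
    rewrite dvD, !dvM, htot_hh, htot_D, !dvB, dvD, dvB, !dvM, htot_two, El, Es, !htot_cst, Eci, Ec0 in X.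
    rewrite dvB. unfold formal_riccati, quadQ in Hr.
    transitivity ((htot sg * sg + sg * htot sg + (hh * pd D sg + hh * pd D (htot sg)))
      - (1 + 1) * (sg * sg + hh * pd D sg) - (1 + 1) * sg * (htot sg - sg)); [rewrite X, Hr|]; ring.
Qed.

End Euler.

Section Primitive.
Local Open Scope ca_scope.
Variable A : calg.
Add Ring Ar : (ath A).
Variables D dm dp : deriv A.
Variables (a : C) (p m sg Amm Amp App : A).
Hypothesis Ddm : forall x, D (dm x) = dm (D x).
Hypothesis Ddp : forall x, D (dp x) = dp (D x).
Hypothesis dmp : forall x, dm (dp x) = dp (dm x).
Hypothesis Dp : D p = 0.
Hypothesis Dm : D m = 0.
Hypothesis dpp : dp p = 1.
Hypothesis dpm : dp m = 0.
Hypothesis dmp0 : dm p = 0.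
Hypothesis dmm : dm m = 1.
Hypothesis Heuler : p * dp sg + m * dm sg + (1 + 1) * D sg = inj a * sg.
Hypothesis Hmm : dm (dm sg) = D Amm.
Hypothesis Hmp : dm (dp sg) = D Amp.
Hypothesis Hpp : dp (dp sg) = D App.

(** On [sg] the field eu = p dp + m dm acts as a - 2 D. The combination eu^2 - eu consists of second
    derivatives, which are D of the given elements; solving for a (a - 1) sg leaves further D-exact
    terms, collected in the last two summands. *)
Definition primitive : A :=
  p * p * App + (1 + 1) * (p * m) * Amp + m * m * Amm
  + (1 + 1) * ((inj a - 1) * sg) + (1 + 1) * (p * dp sg + m * dm sg).

(* Euler's relation applied twice expresses a(a-1) sg through second derivatives. *)
Lemma primitive_D : D primitive = inj a * (inj a - 1) * sg.
Proof.
  set (eu := p * dp sg + m * dm sg).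
  assert (Eu : eu = inj a * sg - (1 + 1) * D sg) by (rewrite <- Heuler; unfold eu; ring).
  assert (D2 : forall (g : deriv A) x, g ((1 + 1) * x) = (1 + 1) * g x) by (intros; rewrite dvM, dvD, dv1; ring).
  assert (DDp : D (dp sg) = dp (D sg)) by apply Ddp.
  assert (DDm : D (dm sg) = dm (D sg)) by apply Ddm.
  assert (E2 : p * dp eu + m * dm eu = inj a * eu - (1 + 1) * D eu).
  { rewrite Eu at 1 2. rewrite !dvB, !dvZ, !D2. unfold eu. rewrite dvD, !dvM, Dp, Dm, DDp, DDm. ring. }
  assert (E3 : p * dp eu + m * dm eu = eu + (p * p * dp (dp sg) + (1 + 1) * (p * m) * dm (dp sg) + m * m * dm (dm sg))).
  { unfold eu. rewrite !dvD, !dvM, dpp, dpm, dmp0, dmm, <- dmp. ring. }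
  rewrite E2, Hmm, Hmp, Hpp in E3.
  unfold primitive. fold eu. rewrite !dvD, !D2. rewrite !dvM, !dvB, !dvD, ?dvI, ?dv1, Dp, Dm.
  transitivity ((p * p * D App + (1 + 1) * (p * m) * D Amp + m * m * D Amm) + (1 + 1) * ((inj a - 1) * D sg) + (1 + 1) * D eu); [ring|].
  transitivity (inj a * eu - (1 + 1) * D eu - eu + (1 + 1) * ((inj a - 1) * D sg) + (1 + 1) * D eu).
  - rewrite E3. ring.
  - rewrite Eu at 1 3. ring.
Qed.
End Primitive.

(** * Algebras given by generators and relations *)

Section Presented.
Variable gen : Type.

Inductive expr :=
| EV (g : gen) | EC (z : C) | EA (x y : expr) | ES (x y : expr) | EM (x y : expr).

Fixpoint eval (B : calg) (v : gen -> B) (x : expr) : B :=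
  match x with
  | EV g => v g
  | EC z => inj z
  | EA x y => (eval B v x + eval B v y)%A
  | ES x y => (eval B v x - eval B v y)%A
  | EM x y => (eval B v x * eval B v y)%A
  end.

Variable rel : expr -> expr -> Prop.

Inductive eqv : expr -> expr -> Prop :=
| eqv_rel x y : rel x y -> eqv x y
| eqv_refl x : eqv x x
| eqv_sym x y : eqv x y -> eqv y x
| eqv_trans x y z : eqv x y -> eqv y z -> eqv x z
| eqv_A x x' y y' : eqv x x' -> eqv y y' -> eqv (EA x y) (EA x' y')
| eqv_S x x' y y' : eqv x x' -> eqv y y' -> eqv (ES x y) (ES x' y')
| eqv_M x x' y y' : eqv x x' -> eqv y y' -> eqv (EM x y) (EM x' y')
| eqv_add0 x : eqv (EA (EC (RtoC 0)) x) x
| eqv_addC x y : eqv (EA x y) (EA y x)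
| eqv_addA x y z : eqv (EA x (EA y z)) (EA (EA x y) z)
| eqv_mul1 x : eqv (EM (EC (RtoC 1)) x) x
| eqv_mulC x y : eqv (EM x y) (EM y x)
| eqv_mulA x y z : eqv (EM x (EM y z)) (EM (EM x y) z)
| eqv_mulD x y z : eqv (EM (EA x y) z) (EA (EM x z) (EM y z))
| eqv_sub x y : eqv (ES x y) (EA x (ES (EC (RtoC 0)) y))
| eqv_opp x : eqv (EA x (ES (EC (RtoC 0)) x)) (EC (RtoC 0))
| eqv_injD a b : eqv (EC (a + b)%C) (EA (EC a) (EC b))
| eqv_injM a b : eqv (EC (a * b)%C) (EM (EC a) (EC b)).

(** Equivalent expressions have the same class as a predicate, by extensionality, so the choice
    operator picks the same representative for both. The chosen representatives form a quotient with
    Leibniz equality. *)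
Definition canon (x : expr) : expr := epsilon (inhabits (EC (RtoC 0))) (eqv x).

Lemma canon_eqv x : eqv x (canon x).
Proof. unfold canon. apply epsilon_spec. exists x. apply eqv_refl. Qed.

Lemma canon_eq x y : eqv x y -> canon x = canon y.
Proof.
  intro H. unfold canon. f_equal. extensionality z. apply propositional_extensionality.
  split; intro K; [eapply eqv_trans; [apply eqv_sym, H|exact K] | eapply eqv_trans; eassumption].
Qed.

Definition quo := {x : expr | canon x = x}.

Definition cls (x : expr) : quo := exist _ (canon x) (eq_sym (canon_eq _ _ (canon_eqv x))).

Lemma quo_eq (a b : quo) : proj1_sig a = proj1_sig b -> a = b.
Proof. destruct a as [x Hx], b as [y Hy]. simpl. intro E. subst y. f_equal. apply proof_irrelevance. Qed.
Lemma cls_eq x y : eqv x y -> cls x = cls y.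
Proof. intro H. apply quo_eq, canon_eq, H. Qed.
Lemma cls_rep (a : quo) : cls (proj1_sig a) = a.
Proof. apply quo_eq. simpl. apply (proj2_sig a). Qed.
Lemma cls_eqv x : eqv (proj1_sig (cls x)) x.
Proof. apply eqv_sym, canon_eqv. Qed.

Definition qadd (a b : quo) := cls (EA (proj1_sig a) (proj1_sig b)).
Definition qsub (a b : quo) := cls (ES (proj1_sig a) (proj1_sig b)).
Definition qmul (a b : quo) := cls (EM (proj1_sig a) (proj1_sig b)).
Definition qopp (a : quo) := cls (ES (EC (RtoC 0)) (proj1_sig a)).

Lemma clsA x y : cls (EA x y) = qadd (cls x) (cls y).
Proof. apply cls_eq, eqv_sym, eqv_A; apply cls_eqv. Qed.
Lemma clsS x y : cls (ES x y) = qsub (cls x) (cls y).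
Proof. apply cls_eq, eqv_sym, eqv_S; apply cls_eqv. Qed.
Lemma clsM x y : cls (EM x y) = qmul (cls x) (cls y).
Proof. apply cls_eq, eqv_sym, eqv_M; apply cls_eqv. Qed.

Lemma quo_th : ring_theory (cls (EC (RtoC 0))) (cls (EC (RtoC 1))) qadd qmul qsub qopp (@eq quo).
Proof.
  assert (S : forall a : quo, exists x, a = cls x) by (intro q; exists (proj1_sig q); now rewrite cls_rep).
  assert (Ho : forall x, qopp (cls x) = cls (ES (EC (RtoC 0)) x)).
  { intro x. apply cls_eq, eqv_S; [apply eqv_refl|apply cls_eqv]. }
  split; intros; destruct (S x) as [a ->]; try destruct (S y) as [b ->]; try destruct (S z) as [c ->].
  - rewrite <- clsA. apply cls_eq, eqv_add0.
  - rewrite <- !clsA. apply cls_eq, eqv_addC.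
  - rewrite <- !clsA. apply cls_eq, eqv_addA.
  - rewrite <- clsM. apply cls_eq, eqv_mul1.
  - rewrite <- !clsM. apply cls_eq, eqv_mulC.
  - rewrite <- !clsM. apply cls_eq, eqv_mulA.
  - rewrite <- clsA, <- !clsM, <- clsA. apply cls_eq, eqv_mulD.
  - rewrite <- clsS, Ho, <- clsA. apply cls_eq, eqv_sub.
  - rewrite Ho, <- clsA. apply cls_eq, eqv_opp.
Qed.

Definition presented : calg :=
  CAlg quo (cls (EC (RtoC 0))) (cls (EC (RtoC 1))) qadd qmul qsub qopp quo_th (fun z => cls (EC z)) eq_refl
    (fun a b => eq_trans (cls_eq _ _ (eqv_injD a b)) (clsA _ _))
    (fun a b => eq_trans (cls_eq _ _ (eqv_injM a b)) (clsM _ _)).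

Definition gv (g : gen) : presented := cls (EV g).

Lemma eval_gv x : eval presented gv x = cls x.
Proof. induction x; simpl; try easy; rewrite IHx1, IHx2; symmetry; [apply clsA|apply clsS|apply clsM]. Qed.

Lemma presented_rel x y : rel x y -> eval presented gv x = eval presented gv y.
Proof. intro H. rewrite !eval_gv. now apply cls_eq, eqv_rel. Qed.

Lemma presented_ind (Q : presented -> Prop) :
  (forall g, Q (gv g)) -> (forall z, Q (inj z)) ->
  (forall x y, Q x -> Q y -> Q (x + y)%A) -> (forall x y, Q x -> Q y -> Q (x - y)%A) ->
  (forall x y, Q x -> Q y -> Q (x * y)%A) -> forall x, Q x.
Proof.
  intros Hg Hz HA HS HM x. rewrite <- (cls_rep x). generalize (proj1_sig x). clear x. intro e.
  induction e; [apply Hg|apply Hz| rewrite clsA | rewrite clsS | rewrite clsM];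
    [apply HA|apply HS|apply HM]; assumption.
Qed.

Section Lift.
Local Open Scope ca_scope.
Variable B : calg.
Add Ring Br : (ath B).
Variable v : gen -> B.
Hypothesis Hv : forall x y, rel x y -> eval B v x = eval B v y.

Lemma eval_eqv x y : eqv x y -> eval B v x = eval B v y.
Proof.
  induction 1; simpl; try congruence; try (rewrite ?inj0, ?inj1; ring).
  - now apply Hv.
  - apply injD.
  - apply injM.
Qed.

Lemma eval_cls x : eval B v (proj1_sig (cls x)) = eval B v x.
Proof. apply eval_eqv, cls_eqv. Qed.

Definition lift : hom presented B.
Proof.
  apply (@Hom presented B (fun a => eval B v (proj1_sig a))).
  - intros x y. apply (eval_cls (EA _ _)).
  - intros x y. apply (eval_cls (EM _ _)).
  - intro c. apply (eval_cls (EC c)).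
Defined.

Lemma lift_gv g : lift (gv g) = v g.
Proof. apply (eval_cls (EV g)). Qed.
End Lift.

Lemma hom_eval (B B' : calg) (f : hom B B') (v : gen -> B) x : f (eval B v x) = eval B' (fun g => f (v g)) x.
Proof. induction x; simpl; rewrite ?hmI, ?hmD, ?hmM, ?hmB; congruence. Qed.

End Presented.

Section Dual.
Local Open Scope ca_scope.
Variable A : calg.
Add Ring Ar : (ath A).

(* Dual numbers [x + eps y], [eps^2 = 0]: homomorphisms into them are derivations. *)
Definition dual : calg.
Proof.
  refine (@CAlg (A * A) (0, 0) (1, 0) (fun x y => (fst x + fst y, snd x + snd y))
    (fun x y => (fst x * fst y, fst x * snd y + snd x * fst y))
    (fun x y => (fst x - fst y, snd x - snd y)) (fun x => (- fst x, - snd x)) _ (fun c => (inj c, 0)) _ _ _).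
  - split; intros; repeat match goal with x : (_ * _)%type |- _ => destruct x end; simpl; f_equal; ring.
  - now rewrite inj1.
  - intros. rewrite injD. simpl. f_equal. ring.
  - intros. rewrite injM. simpl. f_equal. ring.
Defined.

Lemma dual_sndD (x y : dual) : snd (x + y) = snd x + snd y. Proof. easy. Qed.
Lemma dual_sndB (x y : dual) : snd (x - y) = snd x - snd y. Proof. easy. Qed.
Lemma dual_sndM (x y : dual) : snd (x * y) = fst x * snd y + snd x * fst y. Proof. easy. Qed.
Lemma dual_sndI c : snd (inj c : dual) = 0. Proof. easy. Qed.
Lemma dual_fstD (x y : dual) : fst (x + y) = fst x + fst y. Proof. easy. Qed.
Lemma dual_fstB (x y : dual) : fst (x - y) = fst x - fst y. Proof. easy. Qed.
Lemma dual_fstM (x y : dual) : fst (x * y) = fst x * fst y. Proof. easy. Qed.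
Lemma dual_fstI c : fst (inj c : dual) = inj c. Proof. easy. Qed.

End Dual.

Section DualDerivations.
Local Open Scope ca_scope.
Variables (gen : Type) (rel : expr gen -> expr gen -> Prop).
Notation A := (presented gen rel).
Notation X := (gv gen rel).
Add Ring Ar : (ath A).
Variable v : gen -> dual A.
Hypothesis Hfst : forall g, fst (v g) = X g.
Hypothesis Hv : forall x y, rel x y -> eval gen (dual A) v x = eval gen (dual A) v y.
Let L := lift gen rel (dual A) v Hv.

Lemma dual_fst x : fst (L x) = x.
Proof.
  revert x. apply presented_ind; intros; unfold L in *.
  - rewrite lift_gv. apply Hfst.
  - rewrite hmI. easy.
  - rewrite hmD. simpl in H, H0 |- *. rewrite H, H0. easy.
  - rewrite hmB. simpl in H, H0 |- *. rewrite H, H0. easy.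
  - rewrite hmM. simpl in H, H0 |- *. rewrite H, H0. easy.
Qed.

Definition dual_deriv : deriv A.
Proof.
  apply (@Deriv A (fun x => snd (L x))).
  - intros. rewrite (hmD L). easy.
  - intros. rewrite (hmM L). change (fst (L a) * snd (L b) + snd (L a) * fst (L b) = snd (L a) * b + a * snd (L b)).
    rewrite !dual_fst. ring.
  - intros. rewrite (hmI L). easy.
Defined.

Lemma dual_deriv_eval x : dual_deriv (eval gen A X x) = snd (eval gen (dual A) v x).
Proof.
  change (snd (L (eval gen A X x)) = snd (eval gen (dual A) v x)). rewrite hom_eval. do 2 f_equal.
  extensionality g. apply lift_gv.
Qed.
End DualDerivations.

Section CommuteLemmas.
Local Open Scope ca_scope.
Variable A : calg.
Add Ring Ar : (ath A).

(** A commutator of derivations is again a derivation, so commutation need only be checked on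
    generators. *)
Definition dcomm (d e : deriv A) : deriv A.
Proof.
  apply (@Deriv A (fun x => d (e x) - e (d x))).
  - intros. rewrite !dvD. ring.
  - intros. rewrite !dvM, !dvD, !dvM. ring.
  - intros. rewrite !dvI, !dv0. ring.
Defined.
Lemma dcommE d e x : dcomm d e x = d (e x) - e (d x). Proof. easy. Qed.

(** Serves [gx1] and [gx2], which are inverse to nothing in the local ring: only their derivatives
    are prescribed as if they were, so [dv_inv] does not apply. *)
Lemma dcomm_inv (d e : deriv A) u v : d v = - (v * v * d u) -> e v = - (v * v * e u) ->
  dcomm d e u = 0 -> dcomm d e v = 0.
Proof.
  intros Hd He H. rewrite dcommE in *. rewrite He, Hd, !dvN, !dvM, Hd, He.
  transitivity (- (v * v * (d (e u) - e (d u)))); [ring|]. rewrite H. ring.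
Qed.

Lemma deriv_sqrt (d : deriv A) w wi Q : w * w = Q -> w * wi = 1 -> d w = half * (wi * d Q).
Proof.
  intros HQ Hw. apply (unit_cancel A w wi _ _ Hw).
  rewrite <- HQ, dvM. transitivity ((half + half) * (w * d w)); [rewrite half2; ring|].
  transitivity (half * (w * wi) * (d w * w + w * d w)); [rewrite Hw; ring|ring].
Qed.
End CommuteLemmas.

Section DerivPresented.
Local Open Scope ca_scope.
Variables (gen : Type) (rel : expr gen -> expr gen -> Prop).
Add Ring Ar : (ath (presented gen rel)).
Lemma deriv_presented_eq0 (d : deriv (presented gen rel)) :
  (forall g, d (gv gen rel g) = 0) -> forall x, d x = 0.
Proof.
  intro H. apply presented_ind; intros; rewrite ?dvI, ?dvD, ?dvB, ?dvM; [apply H|easy|..]; rewrite H0, H1; ring.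
Qed.
End DerivPresented.

Lemma hom_deriv_presented gen rel (B : calg) (th : hom (presented gen rel) B) (d : deriv (presented gen rel)) (d' : deriv B) :
  (forall g, th (d (gv gen rel g)) = d' (th (gv gen rel g))) -> forall x, th (d x) = d' (th x).
Proof.
  intro H. apply presented_ind; intros; rewrite ?dvI, ?hmD, ?hmM, ?hmB, ?hmI, ?hm0, ?dvD, ?dvB, ?dvM, ?dvI, ?hmD, ?hmM, ?hmB; congruence.
Qed.

(** * The algebra of the spectral curve *)

(* l = lambda_0, s = t / lambda_0, w = t sqrt(Delta); the remaining generators
   are inverses: wi of w, li of l, and y, n, x of the leading terms of the
   Backlund data Y, N, X for the shifts of c_m (index 1) and c_p (index 2). *)
Inductive gen := gl | gs | gci | gc0 | gw | gwi | gli | gy1 | gn1 | gx1 | gy2 | gn2 | gx2.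

(* [Local_] is the ring near the double pole, [Generic] has X inverted,
   [Pole] is the restriction to the double pole itself. *)
Inductive level := Local_ | Generic | Pole.

Notation ex := (expr gen).
Notation V := (EV gen).
Notation eadd := (EA gen).
Notation esub := (ES gen).
Notation emul := (EM gen).
Definition e0 : ex := EC gen (RtoC 0).
Definition e1 : ex := EC gen (RtoC 1).
Definition eneg (x : ex) : ex := esub e0 x.
Definition eQ : ex :=
  esub (eadd (esub (emul (eadd e1 e1) (emul (V gl) (V gl))) (emul (V gci) (V gl)))
             (emul (eadd e1 e1) (emul (V gs) (V gs)))) (emul (V gc0) (V gs)).
Definition eG : ex :=
  eadd (esub (esub (emul (V gl) (V gl)) (emul (V gci) (V gl))) (emul (V gs) (V gs))) (emul (V gc0) (V gs)).
Definition eX (s : ex) : ex := esub (esub (V gci) (V gl)) s.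
Definition eN (s c0 w : ex) : ex :=
  esub (emul (esub (V gci) c0) (eadd (esub w (V gl)) s)) (emul (eX s) (esub (esub c0 (V gl)) s)).
Definition eX1 := eX (V gs).
Definition eX2 := eX (eneg (V gs)).
Definition eY1 : ex := esub (esub (V gc0) (V gl)) (V gs).
Definition eY2 : ex := esub (esub (eneg (V gc0)) (V gl)) (eneg (V gs)).
Definition eN1 w : ex := eN (V gs) (V gc0) w.
Definition eN2 w : ex := eN (eneg (V gs)) (eneg (V gc0)) w.

(** Of the two factors N only that of sigma_-, with leading term - w, is inverted. At the double
    pole X = 0 and l = w = c_inf, so N(w) = 0 while N(- w) = - 2 c_inf (c_inf - c_0) or - 2 c_inf
    (c_inf + c_0). *)
Inductive rel (lv : level) : ex -> ex -> Prop :=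
| r_G : rel lv eG e0
| r_w : rel lv (emul (V gw) (V gw)) eQ
| r_wi : rel lv (emul (V gw) (V gwi)) e1
| r_li : rel lv (emul (V gl) (V gli)) e1
| r_y1 : rel lv (emul eY1 (V gy1)) e1
| r_y2 : rel lv (emul eY2 (V gy2)) e1
| r_n1 : rel lv (emul (eN1 (eneg (V gw))) (V gn1)) e1
| r_n2 : rel lv (emul (eN2 (eneg (V gw))) (V gn2)) e1
| r_x1 : lv = Generic -> rel lv (emul eX1 (V gx1)) e1
| r_x2 : lv = Generic -> rel lv (emul eX2 (V gx2)) e1
| r_s : lv = Pole -> rel lv (V gs) e0
| r_l : lv = Pole -> rel lv (V gl) (V gci)
| r_wc : lv = Pole -> rel lv (V gw) (V gci).

Ltac eval_unfold := unfold eN1, eN2, eN, eX1, eX2, eX, eY1, eY2, eneg, e0; cbn [eval].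
Ltac eval_unfold_in H := unfold eN1, eN2, eN, eX1, eX2, eX, eY1, eY2, eneg, e0 in H; cbn [eval] in H.

Notation AL lv := (presented gen (rel lv)).
Notation X lv := (gv gen (rel lv)).

Section Level.
Local Open Scope ca_scope.
Variable lv : level.
Notation A := (AL lv).
Notation x := (X lv).
Add Ring Ar : (ath A).
Notation ev := (eval gen A x).

Lemma relE u v : rel lv u v -> ev u = ev v.
Proof. apply presented_rel. Qed.

Lemma ev_e1 : ev e1 = 1. Proof. apply inj1. Qed.
Lemma ev_e0 : ev e0 = 0. Proof. apply inj0. Qed.
Lemma ev_Q : ev eQ = quadQ (x gci) (x gc0) (x gl) (x gs).
Proof. unfold eQ, quadQ. cbn [eval]. rewrite ev_e1. easy. Qed.
Lemma rel_G : potG (x gci) (x gc0) (x gl) (x gs) = 0.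
Proof. assert (H := relE _ _ (r_G lv)). rewrite ev_e0 in H. exact H. Qed.
Lemma rel_w : x gw * x gw = quadQ (x gci) (x gc0) (x gl) (x gs).
Proof. rewrite <- ev_Q. apply (relE _ _ (r_w lv)). Qed.
Lemma rel_wi : x gw * x gwi = 1.
Proof. rewrite <- ev_e1. apply (relE _ _ (r_wi lv)). Qed.
Lemma rel_li : x gl * x gli = 1.
Proof. rewrite <- ev_e1. apply (relE _ _ (r_li lv)). Qed.
Lemma rel_q : quadQ (x gci) (x gc0) (x gl) (x gs) * (x gwi * x gwi) = 1.
Proof. rewrite <- rel_w. transitivity ((x gw * x gwi) * (x gw * x gwi)); [ring|]. rewrite rel_wi. ring. Qed.

Variables al as_ di d0 : A.
Hypothesis HG : al * ((1 + 1) * (x gl * x gl) - x gci * x gl) - di * x gl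
  - as_ * ((1 + 1) * (x gs * x gs) - x gc0 * x gs) + d0 * x gs = 0.
Hypothesis Hpole : lv = Pole -> al * x gl = di.

(** A derivation is prescribed in three layers, to avoid circularity: the coordinates; then w and
    the inverses of expressions in the coordinates; then the inverses whose derivative involves that
    of w. [al] and [as_] are the logarithmic derivatives of l and s, and [HG] says that the curve
    relation is preserved. *)
Definition dbase (g : gen) : dual A :=
  match g with
  | gl => (x gl, al * x gl) | gs => (x gs, as_ * x gs)
  | gci => (x gci, di) | gc0 => (x gc0, d0) | _ => (x g, 0)
  end.
Notation ed v e := (snd (eval gen (dual A) v e)).
Definition dw (g : gen) : dual A :=
  match g with
  | gw => (x gw, half * (x gwi * ed dbase eQ))
  | gli => (x gli, - (x gli * x gli * ed dbase (V gl)))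
  | gy1 => (x gy1, - (x gy1 * x gy1 * ed dbase eY1))
  | gy2 => (x gy2, - (x gy2 * x gy2 * ed dbase eY2))
  | gx1 => (x gx1, - (x gx1 * x gx1 * ed dbase eX1))
  | gx2 => (x gx2, - (x gx2 * x gx2 * ed dbase eX2))
  | _ => dbase g
  end.
Definition dall (g : gen) : dual A :=
  match g with
  | gwi => (x gwi, - (x gwi * x gwi * ed dw (V gw)))
  | gn1 => (x gn1, - (x gn1 * x gn1 * ed dw (eN1 (eneg (V gw)))))
  | gn2 => (x gn2, - (x gn2 * x gn2 * ed dw (eN2 (eneg (V gw)))))
  | _ => dw g
  end.

Lemma dall_fst g : fst (dall g) = x g.
Proof. now destruct g. Qed.

Lemma eval_fst (v : gen -> dual A) : (forall g, fst (v g) = x g) -> forall e, fst (eval gen (dual A) v e) = ev e.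
Proof.
  intros H e. induction e as [g|z|a IHa b IHb|a IHa b IHb|a IHa b IHb]; [apply H|easy|..].
  - change (fst (eval gen (dual A) v a) + fst (eval gen (dual A) v b) = ev a + ev b). now rewrite IHa, IHb.
  - change (fst (eval gen (dual A) v a) - fst (eval gen (dual A) v b) = ev a - ev b). now rewrite IHa, IHb.
  - change (fst (eval gen (dual A) v a) * fst (eval gen (dual A) v b) = ev a * ev b). now rewrite IHa, IHb.
Qed.

Lemma dual_inverse (u : dual A) (U v : A) (y : dual A) : fst u = U -> U * v = 1 ->
  y = (v, - (v * v * snd u)) -> (u * y)%A = (1 : dual A).
Proof.
  intros H H1 ->. apply injective_projections.
  - change (fst u * v = 1). now rewrite H.
  - change (fst u * (- (v * v * snd u)) + snd u * v = 0). rewrite H.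
    transitivity (snd u * v * (1 - U * v)); [ring|]. rewrite H1. ring.
Qed.

Ltac dsimp := rewrite ?dual_sndD, ?dual_sndB, ?dual_sndM, ?dual_sndD, ?dual_sndB, ?dual_sndM, ?dual_sndD, ?dual_sndB, ?dual_sndM, ?dual_sndI,
  ?dual_fstD, ?dual_fstB, ?dual_fstM, ?dual_fstI, ?dual_fstD, ?dual_fstB, ?dual_fstM, ?dual_fstI.

Lemma dall_rel e f : rel lv e f -> eval gen (dual A) dall e = eval gen (dual A) dall f.
Proof.
  intro H. assert (Hr := relE e f H).
  assert (E1 : eval gen (dual A) dall e1 = (1 : dual A)) by apply inj1.
  destruct H as [ | | | | | | | |E|E|E|E|E];
    try (rewrite E1; cbn [eval] in Hr |- *; rewrite ev_e1 in Hr; eapply dual_inverse; [|exact Hr|reflexivity]; (apply (eval_fst dall dall_fst) || apply dall_fst)).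
  - apply injective_projections; [exact Hr|]. rewrite ev_e0 in Hr.
    unfold eG, e0. cbn [eval dall dw dbase]. dsimp. cbn [fst snd]. rewrite <- HG. ring.
  - apply injective_projections; [exact Hr|].
    assert (E2 : ed dall eQ = ed dbase eQ) by reflexivity. rewrite E2.
    change (x gw * (half * (x gwi * ed dbase eQ)) + (half * (x gwi * ed dbase eQ)) * x gw = ed dbase eQ).
    transitivity ((half + half) * (x gw * x gwi) * ed dbase eQ); [ring|]. rewrite half2, rel_wi. ring.
  - apply injective_projections; [exact Hr|]. rewrite ev_e0 in Hr. change (as_ * x gs = 0).
    change (x gs = 0) in Hr. rewrite Hr. ring.
  - apply injective_projections; [exact Hr|]. now apply Hpole.
  - apply injective_projections; [exact Hr|].
    change (half * (x gwi * ed dbase eQ) = di).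
    assert (Hs : x gs = 0) by (rewrite <- ev_e0; apply (relE _ _ (r_s lv E))).
    assert (Hl : x gl = x gci) by apply (relE _ _ (r_l lv E)).
    assert (Hw : x gw = x gci) by apply (relE _ _ (r_wc lv E)).
    assert (Ha := Hpole E).
    assert (E2 : ed dbase eQ = (1 + 1) * (x gw * di)).
    { unfold eQ, e1. cbn [eval dbase]. dsimp. cbn [fst snd]. rewrite !inj1, Ha, Hs, Hl, Hw. ring. }
    rewrite E2. transitivity ((half + half) * (x gw * x gwi) * di); [ring|]. rewrite half2, rel_wi. ring.
Qed.

Definition mkderiv : deriv A := dual_deriv gen (rel lv) dall dall_fst dall_rel.

Lemma mkderiv_ev e : mkderiv (ev e) = snd (eval gen (dual A) dall e).
Proof. apply dual_deriv_eval. Qed.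
Lemma mkderiv_l : mkderiv (x gl) = al * x gl. Proof. apply (mkderiv_ev (V gl)). Qed.
Lemma mkderiv_s : mkderiv (x gs) = as_ * x gs. Proof. apply (mkderiv_ev (V gs)). Qed.
Lemma mkderiv_ci : mkderiv (x gci) = di. Proof. apply (mkderiv_ev (V gci)). Qed.
Lemma mkderiv_c0 : mkderiv (x gc0) = d0. Proof. apply (mkderiv_ev (V gc0)). Qed.
Lemma mkderiv_x1 : mkderiv (x gx1) = - (x gx1 * x gx1 * mkderiv (ev eX1)).
Proof. rewrite (mkderiv_ev eX1). apply (mkderiv_ev (V gx1)). Qed.
Lemma mkderiv_x2 : mkderiv (x gx2) = - (x gx2 * x gx2 * mkderiv (ev eX2)).
Proof. rewrite (mkderiv_ev eX2). apply (mkderiv_ev (V gx2)). Qed.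

End Level.

Section Derivations.
Local Open Scope ca_scope.
Variable lv : level.
Notation A := (AL lv).
Notation x := (X lv).
Add Ring Ar : (ath A).
Notation ev := (eval gen A x).

(** These three are the logarithmic derivatives of l along D, c_m and c_p. Each comes from
    differentiating [potG] = 0 with l s of weight 1, 0 and 0 respectively, and dividing by [quadQ] =
    w^2. *)
Definition ell0 : A := ((1 + 1) * (x gs * x gs) - x gc0 * x gs) * (x gwi * x gwi).
Definition alm : A := (x gl + x gs) * (x gwi * x gwi).
Definition alp : A := (x gl - x gs) * (x gwi * x gwi).

Lemma D_G : ell0 * ((1 + 1) * (x gl * x gl) - x gci * x gl) - 0 * x gl
  - (1 - ell0) * ((1 + 1) * (x gs * x gs) - x gc0 * x gs) + 0 * x gs = 0.
Proof.
  transitivity (ell0 * quadQ (x gci) (x gc0) (x gl) (x gs) - ((1 + 1) * (x gs * x gs) - x gc0 * x gs)); [unfold quadQ; ring|].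
  unfold ell0. set (u := (1 + 1) * (x gs * x gs) - x gc0 * x gs).
  transitivity (u * (quadQ (x gci) (x gc0) (x gl) (x gs) * (x gwi * x gwi)) - u); [ring|]. rewrite rel_q. ring.
Qed.
Lemma dm_G : alm * ((1 + 1) * (x gl * x gl) - x gci * x gl) - 1 * x gl
  - (- alm) * ((1 + 1) * (x gs * x gs) - x gc0 * x gs) + (- (1)) * x gs = 0.
Proof.
  transitivity ((x gl + x gs) * (quadQ (x gci) (x gc0) (x gl) (x gs) * (x gwi * x gwi)) - x gl - x gs); [unfold alm, quadQ; ring|].
  rewrite rel_q. ring.
Qed.
Lemma dp_G : alp * ((1 + 1) * (x gl * x gl) - x gci * x gl) - 1 * x gl
  - (- alp) * ((1 + 1) * (x gs * x gs) - x gc0 * x gs) + 1 * x gs = 0.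
Proof.
  transitivity ((x gl - x gs) * (quadQ (x gci) (x gc0) (x gl) (x gs) * (x gwi * x gwi)) - x gl + x gs); [unfold alp, quadQ; ring|].
  rewrite rel_q. ring.
Qed.

Lemma pole_facts : lv = Pole -> x gs = 0 /\ x gl = x gci /\ x gw = x gci.
Proof.
  intro H. repeat split; [rewrite <- ev_e0; apply (relE _ (V gs) e0) | apply (relE _ (V gl) (V gci)) | apply (relE _ (V gw) (V gci))];
  now constructor.
Qed.
Lemma D_pole : lv = Pole -> ell0 * x gl = 0.
Proof. intro H. destruct (pole_facts H) as (Hs & _ & _). unfold ell0. rewrite Hs. ring. Qed.
Lemma pole_unit : lv = Pole -> x gl * (x gwi * x gwi) * x gl = 1.
Proof. intro H. destruct (pole_facts H) as (Hs & Hl & Hw).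
  transitivity ((x gw * x gwi) * (x gw * x gwi)); [rewrite Hl, Hw; ring|]. rewrite rel_wi. ring. Qed.
Lemma dm_pole : lv = Pole -> alm * x gl = 1.
Proof. intro H. rewrite <- (pole_unit H). destruct (pole_facts H) as (Hs & _). unfold alm. rewrite Hs. ring. Qed.
Lemma dp_pole : lv = Pole -> alp * x gl = 1.
Proof. intro H. rewrite <- (pole_unit H). destruct (pole_facts H) as (Hs & _). unfold alp. rewrite Hs. ring. Qed.

Definition Dt : deriv A := mkderiv lv ell0 (1 - ell0) 0 0 D_G D_pole.
Definition Dm : deriv A := mkderiv lv alm (- alm) 1 (- (1)) dm_G dm_pole.
Definition Dp : deriv A := mkderiv lv alp (- alp) 1 1 dp_G dp_pole.

(* A derivation killing c_inf, c_0 and scaling l, s inversely kills everything,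
   because the potential relation has the invertible differential Q. *)
Lemma dcomm_zero (d e : deriv A) (y : A) :
  dcomm A d e (x gci) = 0 -> dcomm A d e (x gc0) = 0 ->
  dcomm A d e (x gl) = y * x gl -> dcomm A d e (x gs) = - y * x gs ->
  d (x gx1) = - (x gx1 * x gx1 * d (ev eX1)) -> e (x gx1) = - (x gx1 * x gx1 * e (ev eX1)) ->
  d (x gx2) = - (x gx2 * x gx2 * d (ev eX2)) -> e (x gx2) = - (x gx2 * x gx2 * e (ev eX2)) ->
  forall z, d (e z) = e (d z).
Proof.
  intros Hi H0 Hl Hs X1 X1' X2 X2'. set (c := dcomm A d e) in *.
  assert (c2 : c (1 + 1) = 0) by (rewrite dvD, !dv1; ring).
  assert (Y : y = 0).
  { assert (H := f_equal c (rel_G lv)). unfold potG in H. rewrite dv0, dvD, !dvB, !dvM, Hi, H0, Hl, Hs in H.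
    transitivity (y * (quadQ (x gci) (x gc0) (x gl) (x gs) * (x gwi * x gwi))); [rewrite rel_q; ring|].
    transitivity ((x gwi * x gwi) * 0); [rewrite <- H; unfold quadQ; ring|ring]. }
  assert (Cl : c (x gl) = 0) by (rewrite Hl, Y; ring).
  assert (Cs : c (x gs) = 0) by (rewrite Hs, Y; ring).
  assert (Cw : c (x gw) = 0).
  { rewrite (deriv_sqrt A c _ _ _ (rel_w lv) (rel_wi lv)). unfold quadQ.
    rewrite !dvB, dvD, dvB, !dvM, c2, Hi, H0, Cl, Cs. ring. }
  assert (Cinv : forall u v, u * v = 1 -> c u = 0 -> c v = 0).
  { intros u v Huv Hu. rewrite (dv_inv A c u v Huv), Hu. ring. }
  assert (Rel1 : forall u v, rel lv (emul u v) e1 -> ev u * ev v = 1).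
  { intros u v H. rewrite <- ev_e1. apply (relE _ _ _ H). }
  assert (Cneg : forall z, c z = 0 -> c (inj (RtoC 0) - z) = 0) by (intros z Hz; rewrite dvB, dvI, Hz; ring).
  assert (CY1 : c (ev eY1) = 0) by (eval_unfold; rewrite !dvB, H0, Cl, Cs; ring).
  assert (CY2 : c (ev eY2) = 0) by (eval_unfold; rewrite !dvB, !dvI, H0, Cl, Cs; ring).
  assert (CX1 : c (ev eX1) = 0) by (eval_unfold; rewrite !dvB, Hi, Cl, Cs; ring).
  assert (CX2 : c (ev eX2) = 0) by (eval_unfold; rewrite !dvB, !dvI, Hi, Cl, Cs; ring).
  assert (CN1 : c (ev (eN1 (eneg (V gw)))) = 0).
  { eval_unfold. eval_unfold_in CY1. eval_unfold_in CX1. rewrite dvB, !dvM, dvD, CX1, CY1, !dvB, !dvI, Hi, H0, Cl, Cs, Cw. ring. }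
  assert (CN2 : c (ev (eN2 (eneg (V gw)))) = 0).
  { eval_unfold. eval_unfold_in CY2. eval_unfold_in CX2. rewrite dvB, !dvM, dvD, CX2, CY2, !dvB, !dvI, Hi, H0, Cl, Cs, Cw. ring. }
  intro z. apply sub_eq0. rewrite <- dcommE. fold c. revert z. apply deriv_presented_eq0.
  intro g. destruct g; trivial.
  - apply (Cinv _ _ (rel_wi lv) Cw).
  - apply (Cinv _ _ (rel_li lv) Cl).
  - apply (Cinv _ _ (Rel1 eY1 (V gy1) (r_y1 lv)) CY1).
  - apply (Cinv _ _ (Rel1 _ (V gn1) (r_n1 lv)) CN1).
  - apply (dcomm_inv A d e _ _ X1 X1' CX1).
  - apply (Cinv _ _ (Rel1 eY2 (V gy2) (r_y2 lv)) CY2).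
  - apply (Cinv _ _ (Rel1 _ (V gn2) (r_n2 lv)) CN2).
  - apply (dcomm_inv A d e _ _ X2 X2' CX2).
Qed.

Ltac gens := rewrite ?dcommE; unfold Dt, Dm, Dp;
  rewrite ?mkderiv_l, ?mkderiv_s, ?mkderiv_ci, ?mkderiv_c0, ?dvM, ?dvN, ?dvB, ?dv1, ?dv0, ?mkderiv_l, ?mkderiv_s.

Lemma Dt_Dm z : Dt (Dm z) = Dm (Dt z).
Proof.
  apply (dcomm_zero Dt Dm (Dt alm - Dm ell0)); try (gens; ring); apply mkderiv_x1 || apply mkderiv_x2.
Qed.
Lemma Dt_Dp z : Dt (Dp z) = Dp (Dt z).
Proof.
  apply (dcomm_zero Dt Dp (Dt alp - Dp ell0)); try (gens; ring); apply mkderiv_x1 || apply mkderiv_x2.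
Qed.
Lemma Dm_Dp z : Dm (Dp z) = Dp (Dm z).
Proof.
  apply (dcomm_zero Dm Dp (Dm alp - Dp alm)); try (gens; ring); apply mkderiv_x1 || apply mkderiv_x2.
Qed.
End Derivations.

Section HomLevel.
Local Open Scope ca_scope.
Variables (lv : level) (B : calg) (th : hom (AL lv) B).
Notation A := (AL lv).
Notation x := (X lv).
Add Ring Ar : (ath A).
Add Ring Br : (ath B).
Notation ev := (eval gen A x).
Variables (d : deriv A) (d' : deriv B).
Hypothesis Hl : th (d (x gl)) = d' (th (x gl)).
Hypothesis Hs : th (d (x gs)) = d' (th (x gs)).
Hypothesis Hci : th (d (x gci)) = d' (th (x gci)).
Hypothesis Hc0 : th (d (x gc0)) = d' (th (x gc0)).
Hypothesis d1 : d (x gx1) = - (x gx1 * x gx1 * d (ev eX1)).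
Hypothesis d2 : d (x gx2) = - (x gx2 * x gx2 * d (ev eX2)).
Hypothesis d1' : d' (th (x gx1)) = - (th (x gx1) * th (x gx1) * d' (th (ev eX1))).
Hypothesis d2' : d' (th (x gx2)) = - (th (x gx2) * th (x gx2) * d' (th (ev eX2))).

(** The coordinates determine everything else: w through its square, the inverses through their
    relations. Only [gx1] and [gx2] need hypotheses of their own, having no relation in the local
    ring. *)
Lemma hom_level_deriv z : th (d z) = d' (th z).
Proof.
  set (Q := fun z => th (d z) = d' (th z)).
  assert (QD : forall a b, Q a -> Q b -> Q (a + b)) by (intros a b Ha Hb; unfold Q in *; rewrite dvD, !hmD, dvD; congruence).
  assert (QB : forall a b, Q a -> Q b -> Q (a - b)) by (intros a b Ha Hb; unfold Q in *; rewrite dvB, !hmB, dvB; congruence).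
  assert (QM : forall a b, Q a -> Q b -> Q (a * b)) by (intros a b Ha Hb; unfold Q in *; rewrite dvM, hmD, !hmM, dvM; congruence).
  assert (QI : forall c, Q (inj c)) by (intro; unfold Q; rewrite dvI, hmI, hm0, dvI; easy).
  assert (Qinv : forall u v, u * v = 1 -> Q u -> Q v).
  { intros u v Huv Hu. unfold Q in *. rewrite (dv_inv A d u v Huv).
    assert (H := f_equal th Huv). rewrite hmM, hm1 in H. rewrite (dv_inv B d' _ _ H), hmN, !hmM, Hu. easy. }
  assert (Qrel : forall u v, rel lv (emul u v) e1 -> Q (ev u) -> Q (ev v)).
  { intros u v H. apply Qinv. rewrite <- ev_e1. apply (relE lv _ _ H). }
  assert (Q2 : Q (1 + 1)) by (apply QD; rewrite <- inj1; apply QI).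
  assert (Qw : Q (x gw)).
  { unfold Q. rewrite (deriv_sqrt A d _ _ _ (rel_w lv) (rel_wi lv)).
    assert (H := f_equal th (rel_w lv)). assert (H' := f_equal th (rel_wi lv)). rewrite hmM in H, H'. rewrite hm1 in H'.
    rewrite (deriv_sqrt B d' _ _ _ H H'). unfold half. rewrite !hmM, hmI. do 2 f_equal.
    unfold quadQ. apply QB; [apply QD; [apply QB|]|]; repeat (apply QM || assumption). }
  apply hom_deriv_presented. intro g. destruct g; trivial; fold (Q (x gci)).
  - apply (Qinv _ _ (rel_wi lv) Qw).
  - apply (Qinv _ _ (rel_li lv) Hl).
  - apply (Qrel eY1 (V gy1) (r_y1 lv)). eval_unfold. auto.
  - apply (Qrel _ (V gn1) (r_n1 lv)). eval_unfold. auto 20.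
  - rewrite d1, d1', hmN, !hmM. do 2 f_equal. fold (Q (ev eX1)). eval_unfold. auto.
  - apply (Qrel eY2 (V gy2) (r_y2 lv)). eval_unfold. auto.
  - apply (Qrel _ (V gn2) (r_n2 lv)). eval_unfold. auto 20.
  - rewrite d2, d2', hmN, !hmM. do 2 f_equal. fold (Q (ev eX2)). eval_unfold. auto.
Qed.
End HomLevel.

Lemma incl_rel lv e f : rel Local_ e f -> eval gen (AL lv) (X lv) e = eval gen (AL lv) (X lv) f.
Proof. intro H. apply relE. destruct H; try discriminate; constructor. Qed.
Definition incl lv : hom (AL Local_) (AL lv) := lift gen (rel Local_) (AL lv) (X lv) (incl_rel lv).
Lemma incl_gv lv g : incl lv (X Local_ g) = X lv g.
Proof. apply lift_gv. Qed.

(** * The exchange of sheets *)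

Section Conj.
Local Open Scope ca_scope.
Notation A := (AL Generic).
Notation x := (X Generic).
Add Ring Ar : (ath A).
Notation ev := (eval gen A x).

(** The map w -> - w. The inverse of N(- w) must go to an inverse of N(w), which exists only where X
    is invertible: as N(w) N(- w) = (X Y)^2, it is N(- w) / (X Y)^2. *)
Definition vconj (g : gen) : A :=
  match g with
  | gw => - x gw | gwi => - x gwi
  | gn1 => ev (eN1 (eneg (V gw))) * ((x gx1 * x gy1) * (x gx1 * x gy1))
  | gn2 => ev (eN2 (eneg (V gw))) * ((x gx2 * x gy2) * (x gx2 * x gy2))
  | _ => x g
  end.

(** The order-zero form of [parity]: T does not move leading terms, so what remains is N(w) N(- w) =
    (X Y)^2 modulo the two relations of the curve. *)
Lemma conj_norm (ci c0 l s w : A) : potG ci c0 l s = 0 -> w * w = quadQ ci c0 l s ->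
  let X0 := ci - l - s in let Y0 := c0 - l - s in let k := ci - c0 in
  (k * (- - w - l + s) - X0 * Y0) * (k * (- w - l + s) - X0 * Y0) = (X0 * Y0) * (X0 * Y0).
Proof.
  intros HG Hw X0 Y0 k.
  transitivity ((X0 * Y0) * (X0 * Y0) - k * k * (w * w - quadQ ci c0 l s)
    + k * ((1 + 1) * l + (1 + 1) * s - ci - c0) * potG ci c0 l s).
  - unfold X0, Y0, k, quadQ, potG. ring.
  - rewrite HG, Hw. ring.
Qed.

Lemma vconj_rel e f : rel Local_ e f -> eval gen A vconj e = eval gen A vconj f.
Proof.
  assert (HG := rel_G Generic). assert (Hw := rel_w Generic).
  assert (E1 : eval gen A vconj e1 = 1) by apply inj1.
  intro H. destruct H; try discriminate.
  - apply (relE Generic _ _ (r_G _)).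
  - transitivity (- x gw * - x gw); [easy|]. transitivity (x gw * x gw); [ring|]. apply (relE Generic _ _ (r_w _)).
  - rewrite E1. change (- x gw * - x gwi = 1). transitivity (x gw * x gwi); [ring|]. apply rel_wi.
  - apply (relE Generic _ _ (r_li _)).
  - apply (relE Generic _ _ (r_y1 _)).
  - apply (relE Generic _ _ (r_y2 _)).
  - rewrite E1. assert (HX := relE Generic _ _ (r_x1 _ eq_refl)). assert (HY := relE Generic _ _ (r_y1 _)).
    rewrite ev_e1 in HX, HY. eval_unfold_in HX. eval_unfold_in HY. eval_unfold. cbn [vconj]. eval_unfold. rewrite inj0 in *.
    assert (N := conj_norm _ _ _ _ _ HG Hw). cbv zeta in N.
    set (X0 := x gci - x gl - x gs) in *. set (Y0 := x gc0 - x gl - x gs) in *. set (k := x gci - x gc0) in *.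
    transitivity ((k * (- - x gw - x gl + x gs) - X0 * Y0) * (k * (- x gw - x gl + x gs) - X0 * Y0)
       * ((x gx1 * x gy1) * (x gx1 * x gy1))); [ring|].
    rewrite N. transitivity ((X0 * x gx1) * (Y0 * x gy1) * ((X0 * x gx1) * (Y0 * x gy1))); [ring|].
    rewrite HX, HY. ring.
  - rewrite E1. assert (HX := relE Generic _ _ (r_x2 _ eq_refl)). assert (HY := relE Generic _ _ (r_y2 _)).
    rewrite ev_e1 in HX, HY. eval_unfold_in HX. eval_unfold_in HY. eval_unfold. cbn [vconj]. eval_unfold. rewrite inj0 in *.
    assert (N := conj_norm (x gci) (0 - x gc0) (x gl) (0 - x gs) (x gw)). cbv zeta in N.
    set (X0 := x gci - x gl - (0 - x gs)) in *. set (Y0 := 0 - x gc0 - x gl - (0 - x gs)) in *. set (k := x gci - (0 - x gc0)) in *.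
    transitivity ((k * (- - x gw - x gl + (0 - x gs)) - X0 * Y0) * (k * (- x gw - x gl + (0 - x gs)) - X0 * Y0)
       * ((x gx2 * x gy2) * (x gx2 * x gy2))); [ring|].
    rewrite N.
    + transitivity ((X0 * x gx2) * (Y0 * x gy2) * ((X0 * x gx2) * (Y0 * x gy2))); [ring|]. rewrite HX, HY. ring.
    + transitivity (potG (x gci) (x gc0) (x gl) (x gs)); [unfold potG; ring|exact HG].
    + rewrite Hw. unfold quadQ. ring.
Qed.
Definition conj : hom (AL Local_) A := lift gen (rel Local_) A vconj vconj_rel.
Lemma conj_gv g : conj (X Local_ g) = vconj g.
Proof. apply lift_gv. Qed.
End Conj.

Section FixBase.
Local Open Scope ca_scope.
Variables (lv : level) (th : hom (AL Local_) (AL lv)).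
Notation A := (AL lv).
Notation x := (X lv).
Add Ring Ar : (ath A).
Hypothesis Hb : forall g, match g with gl | gs | gci | gc0 => th (X Local_ g) = x g | gx1 | gx2 => th (X Local_ g) = x g \/ th (X Local_ g) = 0 | _ => True end.
Hypothesis Hwi : th (X Local_ gwi) * th (X Local_ gwi) = x gwi * x gwi.

Let Hl := Hb gl. Let Hs := Hb gs. Let Hci := Hb gci. Let Hc0 := Hb gc0. Let Hx1 := Hb gx1. Let Hx2 := Hb gx2.

Lemma th_two : th (1 + 1) = 1 + 1. Proof. rewrite hmD, hm1. easy. Qed.
Lemma th_ell0 : th (ell0 Local_) = ell0 lv.
Proof. unfold ell0. now rewrite hmM, (hmM th (X Local_ gwi)), Hwi, hmB, !hmM, th_two, Hs, Hc0. Qed.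
Lemma th_alm : th (alm Local_) = alm lv.
Proof. unfold alm. now rewrite hmM, (hmM th (X Local_ gwi)), Hwi, hmD, Hs, Hl. Qed.
Lemma th_alp : th (alp Local_) = alp lv.
Proof. unfold alp. now rewrite hmM, (hmM th (X Local_ gwi)), Hwi, hmB, Hs, Hl. Qed.
Lemma th_X1 : th (eval gen _ (X Local_) eX1) = eval gen A x eX1.
Proof. eval_unfold. now rewrite !hmB, Hl, Hs, Hci. Qed.
Lemma th_X2 : th (eval gen _ (X Local_) eX2) = eval gen A x eX2.
Proof. eval_unfold. now rewrite !hmB, hmI, Hl, Hs, Hci. Qed.

Ltac fixd := unfold Dt, Dm, Dp; first
  [ rewrite ?mkderiv_l, ?mkderiv_s, ?mkderiv_ci, ?mkderiv_c0, ?hmM, ?hmB, ?hmN, ?hmB, ?hmN, ?hm1, ?hm0, ?th_ell0, ?th_alm, ?th_alp, ?Hl, ?Hs, ?Hci, ?Hc0,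
      ?mkderiv_l, ?mkderiv_s, ?mkderiv_ci, ?mkderiv_c0; easy
  | apply mkderiv_x1 | apply mkderiv_x2 | destruct Hx1 as [E|E]; rewrite E; [rewrite th_X1; apply mkderiv_x1|rewrite dv0; ring]
  | destruct Hx2 as [E|E]; rewrite E; [rewrite th_X2; apply mkderiv_x2|rewrite dv0; ring] ].

(** The logarithmic derivatives of the coordinates involve w only through w^(-2), so a homomorphism
    fixing these respects the derivations. This covers the inclusions, the exchange of sheets and
    the map that kills [gx1] and [gx2]. *)
Lemma th_Dt z : th (Dt Local_ z) = Dt lv (th z).
Proof. apply hom_level_deriv; fixd. Qed.
Lemma th_Dm z : th (Dm Local_ z) = Dm lv (th z).
Proof. apply hom_level_deriv; fixd. Qed.
Lemma th_Dp z : th (Dp Local_ z) = Dp lv (th z).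
Proof. apply hom_level_deriv; fixd. Qed.
End FixBase.

Section Reduct.
Local Open Scope ca_scope.
Notation A := (AL Local_).

(* At the level [Local_] the generators [gx1], [gx2] are free, so they can be
   sent to 0; the formal solutions do not involve them. *)
Definition vreduct (g : gen) : A := match g with gx1 | gx2 => 0 | _ => X Local_ g end.
Lemma vreduct_rel e f : rel Local_ e f -> eval gen A vreduct e = eval gen A vreduct f.
Proof.
  intro H. assert (E := relE Local_ _ _ H). destruct H; try discriminate; exact E.
Qed.
Definition reduct : hom A A := lift gen (rel Local_) A vreduct vreduct_rel.
Lemma reduct_gv g : reduct (X Local_ g) = vreduct g.
Proof. apply lift_gv. Qed.
End Reduct.

(** * The primitive of sigma_odd *)

(* [vl], [vs], [ve] stand for lambda, s, D log lambda, and [vp], [vm] for the two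
   solutions sigma_+, sigma_- of the linearisation; [w0] selects the sheet.  The
   other fields are the inverses needed for the Backlund transformation. *)
Record sol (lv : level) (w0 : AL lv) := Sol {
  vl : psA (AL lv); vs : psA (AL lv); ve : psA (AL lv); vli : psA (AL lv);
  vp : psA (AL lv); vm : psA (AL lv); voi : psA (AL lv);
  vY1 : psA (AL lv); vN1 : psA (AL lv); vY2 : psA (AL lv); vN2 : psA (AL lv);
  sol_pain : formal_painleve (AL lv) (Dt lv) (cst (X lv gci)) (cst (X lv gc0)) vl vs ve;
  sol_l0 : vl O = X lv gl;
  sol_s0 : vs O = X lv gs;
  sol_ls : (vl * vs)%A = cst (X lv gl * X lv gs)%A;
  sol_li : (vl * vli)%A = 1%A;
  sol_p : formal_riccati (AL lv) (Dt lv) (cst (X lv gci)) (cst (X lv gc0)) vl vs vp;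
  sol_m : formal_riccati (AL lv) (Dt lv) (cst (X lv gci)) (cst (X lv gc0)) vl vs vm;
  sol_p0 : vp O = w0;
  sol_m0 : vm O = (- w0)%A;
  sol_oi : (half * (vp - vm) * voi)%A = 1%A;
  sol_Y1 : (btY (AL lv) (X lv gc0) vl vs ve * vY1)%A = 1%A;
  sol_N1 : (btN (AL lv) (X lv gci) (X lv gc0) vl vs ve vm * vN1)%A = 1%A;
  sol_Y2 : (btY (AL lv) (- X lv gc0)%A vl (- vs)%A ve * vY2)%A = 1%A;
  sol_N2 : (btN (AL lv) (X lv gci) (- X lv gc0)%A vl (- vs)%A ve vm * vN2)%A = 1%A }.
Arguments vl {lv w0} _. Arguments vs {lv w0} _. Arguments ve {lv w0} _. Arguments vli {lv w0} _.
Arguments vp {lv w0} _. Arguments vm {lv w0} _. Arguments voi {lv w0} _. Arguments vY1 {lv w0} _.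
Arguments vN1 {lv w0} _. Arguments vY2 {lv w0} _. Arguments vN2 {lv w0} _.

Section Sol.
Local Open Scope ca_scope.
Variable lv : level.
Notation A := (AL lv).
Notation x := (X lv).
Notation P := (psA A).
Add Ring Ar : (ath A).
Add Ring Pr : (ath P).
Notation D := (Dt lv).
Notation dm := (Dm lv).
Notation dp := (Dp lv).
Variable b : psA CA.
Hypothesis Hb : b * expquot = 1.
Variables (w0 w0i : A).
Hypothesis Hw0 : w0 * w0i = 1.
Variable S : sol lv w0.

Definition vo : P := half * (vp S - vm S).
Definition lam1 (f : deriv A) : P :=
  btLam A dm (x gc0) (vl S) (vs S) (ve S) (vli S) (vY1 S) f
    (btN A (x gci) (x gc0) (vl S) (vs S) (ve S) (vm S)) (vN1 S) vo (voi S).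
Definition lam2 (f : deriv A) : P :=
  btLam A dp (- x gc0) (vl S) (- vs S) (ve S) (vli S) (vY2 S) f
    (btN A (x gci) (- x gc0) (vl S) (- vs S) (ve S) (vm S)) (vN2 S) vo (voi S).
Definition cp : A := half * (x gci + x gc0).
Definition cm : A := half * (x gci - x gc0).
(** The coefficient of h^k in a series homogeneous of degree 1 has degree a = 1 - k, and the
    prefactor divides by a (a - 1) = k (k - 1). *)
Definition vW (k : nat) : A :=
  inj (/ (RtoC (INR k) * (RtoC (INR k) - RtoC 1)))%C *
  primitive A dm dp (RtoC 1 - RtoC (INR k))%C cp cm (vo k)
    (op A dm b (lam1 dm) k) (op A dm b (lam1 dp) k) (op A dp b (lam2 dp) k).

Lemma D_ci : D (x gci) = 0. Proof. apply mkderiv_ci. Qed.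
Lemma D_c0 : D (x gc0) = 0. Proof. apply mkderiv_c0. Qed.
Lemma dm_ci : dm (x gci) = 1. Proof. apply mkderiv_ci. Qed.
Lemma dm_c0 : dm (x gc0) = - (1). Proof. apply mkderiv_c0. Qed.
Lemma dp_ci : dp (x gci) = 1. Proof. apply mkderiv_ci. Qed.
Lemma dp_c0 : dp (x gc0) = 1. Proof. apply mkderiv_c0. Qed.
Lemma inj_m1 : - (1) = inj (- RtoC 1)%C :> A.
Proof. rewrite injN, inj1. easy. Qed.
Lemma halfE (d : deriv A) z : d (half * z) = half * d z. Proof. apply dvZ. Qed.
Lemma D_cp : D cp = 0. Proof. unfold cp. rewrite halfE, dvD, D_ci, D_c0. ring. Qed.
Lemma D_cm : D cm = 0. Proof. unfold cm. rewrite halfE, dvB, D_ci, D_c0. ring. Qed.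
Lemma dp_cp : dp cp = 1. Proof. unfold cp. rewrite halfE, dvD, dp_ci, dp_c0. transitivity (half + half : A); [ring|apply half2]. Qed.
Lemma dp_cm : dp cm = 0. Proof. unfold cm. rewrite halfE, dvB, dp_ci, dp_c0. ring. Qed.
Lemma dm_cp : dm cp = 0. Proof. unfold cp. rewrite halfE, dvD, dm_ci, dm_c0. ring. Qed.
Lemma dm_cm : dm cm = 1. Proof. unfold cm. rewrite halfE, dvB, dm_ci, dm_c0. transitivity (half + half : A); [ring|apply half2]. Qed.
Lemma cpm_ci : cp + cm = x gci.
Proof. unfold cp, cm. transitivity ((half + half) * x gci); [ring|]. rewrite half2. ring. Qed.
Lemma cpm_c0 : cp - cm = x gc0.
Proof. unfold cp, cm. transitivity ((half + half) * x gc0); [ring|]. rewrite half2. ring. Qed.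
Lemma D_l : D (x gl) = ell0 lv * x gl. Proof. apply mkderiv_l. Qed.
Lemma D_s : D (x gs) = (1 - ell0 lv) * x gs. Proof. apply mkderiv_s. Qed.
Lemma D_t : D (x gl * x gs) = x gl * x gs.
Proof. rewrite dvM, D_l, D_s. ring. Qed.
Lemma dm_t : dm (x gl * x gs) = 0.
Proof. unfold Dm. rewrite dvM, mkderiv_l, mkderiv_s. ring. Qed.
Lemma dp_t : dp (x gl * x gs) = 0.
Proof. unfold Dp. rewrite dvM, mkderiv_l, mkderiv_s. ring. Qed.

Lemma cstN (a : A) : cst (- a) = - cst a.
Proof. extensionality n. rewrite psN. destruct n; [easy|]. change ((0 : A) = - 0). ring. Qed.
(** The sign change of s and c_0 exchanges c_p and c_m, so the results on the shift of c_m also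
    yield those on the shift of c_p. *)
Lemma painleve_flip : formal_painleve A D (cst (x gci)) (cst (- x gc0)) (vl S) (- vs S) (ve S).
Proof.
  destruct (sol_pain _ _ S) as (H1 & H2 & H3). split; [easy|split].
  - rewrite dvN, H2. ring.
  - rewrite H3. unfold potG. rewrite cstN. ring.
Qed.
Lemma riccati_flip sg : formal_riccati A D (cst (x gci)) (cst (x gc0)) (vl S) (vs S) sg ->
  formal_riccati A D (cst (x gci)) (cst (- x gc0)) (vl S) (- vs S) sg.
Proof. unfold formal_riccati. intro H. rewrite H. unfold quadQ. rewrite cstN. ring. Qed.
Lemma quadQ_unit : quadQ (x gci) (x gc0) (vl S O) (vs S O) * (x gwi * x gwi) = 1.
Proof. rewrite sol_l0, sol_s0. apply rel_q. Qed.
Lemma quadQ_unit_flip : quadQ (x gci) (- x gc0) (vl S O) ((- vs S) O) * (x gwi * x gwi) = 1.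
Proof. rewrite psN, sol_l0, sol_s0. transitivity (quadQ (x gci) (x gc0) (x gl) (x gs) * (x gwi * x gwi)); [unfold quadQ; ring|apply rel_q]. Qed.
Lemma vm_unit : vm S O * - w0i = 1.
Proof. rewrite sol_m0. transitivity (w0 * w0i); [ring|exact Hw0]. Qed.
Lemma vp_unit : vp S O * w0i = 1.
Proof. now rewrite sol_p0. Qed.
Lemma shift_ls : tshift A dm (RtoC 1) (vl S * vs S) = vl S * vs S.
Proof. rewrite sol_ls. apply shift_cst, dm_t. Qed.
Lemma shift_ls_flip : tshift A dp (RtoC 1) (vl S * - vs S) = vl S * - vs S.
Proof. replace (vl S * - vs S) with (- (vl S * vs S)) by ring. rewrite shiftN, sol_ls. f_equal. apply shift_cst, dp_t. Qed.

Lemma lam1_D (f : deriv A) : (forall z, f (D z) = D (f z)) -> (forall z, f (dm z) = dm (f z)) ->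
  pd dm (pd f vo) = pd D (op A dm b (lam1 f)).
Proof.
  intros fD fd. apply antiderivative; [intro; apply Dt_Dm|exact Hb|].
  apply (btLam_D A D dm (x gci) (x gc0) (vl S) (vs S) (ve S) (vli S) (vY1 S) (x gwi * x gwi)
     (Dt_Dm lv) D_ci D_c0 (eq_trans dm_ci (eq_sym (inj1 A))) (eq_trans dm_c0 inj_m1)
     (sol_pain _ _ S) shift_ls (sol_li _ _ S) (sol_Y1 _ _ S) quadQ_unit f (vp S) (vm S) (vN1 S) (voi S) (cst (- w0i))
     fD fd (sol_p _ _ S) (sol_m _ _ S) vm_unit (sol_N1 _ _ S) (sol_oi _ _ S)).
Qed.
Lemma lam2_D (f : deriv A) : (forall z, f (D z) = D (f z)) -> (forall z, f (dp z) = dp (f z)) ->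
  pd dp (pd f vo) = pd D (op A dp b (lam2 f)).
Proof.
  intros fD fd. apply antiderivative; [intro; apply Dt_Dp|exact Hb|].
  assert (E0 : D (- x gc0) = 0) by (rewrite dvN, D_c0; ring).
  assert (E1 : dp (- x gc0) = inj (- RtoC 1)%C) by (rewrite dvN, dp_c0; apply inj_m1).
  apply (btLam_D A D dp (x gci) (- x gc0) (vl S) (- vs S) (ve S) (vli S) (vY2 S) (x gwi * x gwi)
     (Dt_Dp lv) D_ci E0 (eq_trans dp_ci (eq_sym (inj1 A))) E1
     painleve_flip shift_ls_flip (sol_li _ _ S) (sol_Y2 _ _ S) quadQ_unit_flip f (vp S) (vm S) (vN2 S) (voi S) (cst (- w0i))
     fD fd (riccati_flip _ (sol_p _ _ S)) (riccati_flip _ (sol_m _ _ S)) vm_unit (sol_N2 _ _ S) (sol_oi _ _ S)).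
Qed.

Definition deul : deriv A.
Proof.
  apply (@Deriv A (fun z => cp * dp z + cm * dm z + (1 + 1) * D z)).
  - intros. rewrite !dvD. ring.
  - intros. rewrite !dvM. ring.
  - intros. rewrite !dvI. ring.
Defined.
Lemma deulE z : deul z = cp * dp z + cm * dm z + (1 + 1) * D z. Proof. easy. Qed.
Lemma deul_D z : deul (D z) = D (deul z).
Proof.
  assert (D (1 + 1) = 0) by (rewrite dvD, !dv1; ring).
  rewrite !deulE, !dvD, !dvM, D_cp, D_cm, H, Dt_Dm, Dt_Dp. ring.
Qed.

Lemma vo_euler k : cp * dp (vo k) + cm * dm (vo k) + (1 + 1) * D (vo k) = inj (RtoC 1 - RtoC (INR k))%C * vo k.
Proof.
  assert (Eci : deul (x gci) = x gci) by (rewrite deulE, dp_ci, dm_ci, D_ci, <- cpm_ci; ring).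
  assert (Ec0 : deul (x gc0) = x gc0) by (rewrite deulE, dp_c0, dm_c0, D_c0, <- cpm_c0; ring).
  assert (Et : deul (x gl * x gs) = (1 + 1) * (x gl * x gs)) by (rewrite deulE, dp_t, dm_t, D_t; ring).
  assert (R := fun sg w => euler_riccati A D deul deul_D (x gci) (x gc0) (x gl * x gs) (x gwi * x gwi)
     (vl S) (vs S) (ve S) (vli S) (sol_pain _ _ S) (sol_li _ _ S) (sol_ls _ _ S) Eci Ec0 Et quadQ_unit sg w).
  assert (H : htot A deul vo = vo).
  { unfold vo, half. rewrite dvZ, dvB, (R _ _ (sol_p _ _ S) vp_unit), (R _ _ (sol_m _ _ S) vm_unit). easy. }
  apply (f_equal (fun F : P => F k)) in H. rewrite htot_coef in H. rewrite <- deulE, injB, inj1.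
  transitivity (deul (vo k) + inj (RtoC (INR k)) * vo k - inj (RtoC (INR k)) * vo k); [ring|].
  rewrite H. ring.
Qed.

Lemma vW_D k : (2 <= k)%nat -> D (vW k) = vo k.
Proof.
  intro Hk. unfold vW. rewrite dvZ.
  rewrite (primitive_D A D dm dp _ cp cm (vo k)).
  - assert (E : (/ (RtoC (INR k) * (RtoC (INR k) - RtoC 1)) * ((RtoC 1 - RtoC (INR k)) * (RtoC 1 - RtoC (INR k) - RtoC 1)) = RtoC 1)%C).
    { assert (H1 := le_INR 2 k Hk). simpl in H1.
      assert (N1 : RtoC (INR k) <> RtoC 0) by (intro E; apply RtoC_inj in E; lra).
      assert (N2 : (RtoC (INR k) - RtoC 1)%C <> RtoC 0) by (rewrite <- RtoC_minus; intro E; apply RtoC_inj in E; lra).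
      field. auto. }
    transitivity (inj (/ (RtoC (INR k) * (RtoC (INR k) - RtoC 1)) * ((RtoC 1 - RtoC (INR k)) * (RtoC 1 - RtoC (INR k) - RtoC 1)))%C * vo k).
    + rewrite !injM, (injB A _ (RtoC 1)), (inj1 A). ring.
    + rewrite E, inj1. ring.
  - apply Dt_Dm.
  - apply Dt_Dp.
  - apply Dm_Dp.
  - apply D_cp.
  - apply D_cm.
  - apply dp_cp.
  - apply dp_cm.
  - apply dm_cp.
  - apply dm_cm.
  - apply vo_euler.
  (* The shift of c_m accounts for the second derivatives along c_m, c_m and c_m, c_p; the one along
     c_p, c_p takes the shift of c_p. *)
  - apply (f_equal (fun F : P => F k) (lam1_D dm (fun z => eq_sym (Dt_Dm lv z)) (fun z => eq_refl))).
  - apply (f_equal (fun F : P => F k) (lam1_D dp (fun z => eq_sym (Dt_Dp lv z)) (fun z => eq_sym (Dm_Dp lv z)))).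
  - apply (f_equal (fun F : P => F k) (lam2_D dp (fun z => eq_sym (Dt_Dp lv z)) (fun z => eq_refl))).
Qed.

End Sol.

Section Existence.
Local Open Scope ca_scope.
Notation A := (AL Local_).
Notation x := (X Local_).
Notation P := (psA A).
Add Ring Ar : (ath A).
Add Ring Pr : (ath P).

(** A series is invertible as soon as its leading term is, and the inverse generators of the local
    ring are precisely the inverses of the leading terms required. *)
Lemma sol_exists : inhabited (sol Local_ (x gw)).
Proof.
  destruct (painleve_exists A (Dt Local_) (x gci) (x gc0) (x gl) (x gs) (ell0 Local_) (x gwi * x gwi)
    (D_l _) (D_s _) (rel_G _) (rel_q _)) as (r & p & Hrp & Hr0 & e & He0 & Hpain).
  assert (Hp0 : p O = 1).
  { assert (H := f_equal (fun F : P => F O) Hrp). cbv beta in H. rewrite psM0, Hr0 in H. transitivity (1 * p O); [ring|exact H]. }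
  set (l := cst (x gl) * r) in *. set (s := cst (x gs) * p) in *.
  assert (Hl0 : l O = x gl) by (unfold l; rewrite psM0, Hr0; change (x gl * 1 = x gl); ring).
  assert (Hs0 : s O = x gs) by (unfold s; rewrite psM0, Hp0; change (x gs * 1 = x gs); ring).
  assert (Hls : l * s = cst (x gl * x gs)).
  { unfold l, s. rewrite cstM. transitivity (cst (x gl) * cst (x gs) * (r * p)); [ring|]. rewrite Hrp. ring. }
  assert (Hli : l * (cst (x gli) * p) = 1).
  { unfold l. transitivity (cst (x gl) * cst (x gli) * (r * p)); [ring|]. rewrite Hrp, <- cstM, rel_li, cst1. ring. }
  assert (Q0 : @quadQ P (cst (x gci)) (cst (x gc0)) l s O = x gw * x gw).
  { rewrite quadQ_lead, Hl0, Hs0, rel_w. easy. }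
  destruct (riccati_exists A (Dt Local_) _ _ _ _ _ _ Q0 (rel_wi _)) as (sp & Hsp & Hsp0).
  assert (Q0' : @quadQ P (cst (x gci)) (cst (x gc0)) l s O = - x gw * - x gw) by (rewrite Q0; ring).
  assert (Hwi' : - x gw * - x gwi = 1) by (rewrite <- (rel_wi Local_); ring).
  destruct (riccati_exists A (Dt Local_) _ _ _ _ _ _ Q0' Hwi') as (sg & Hsg & Hsg0).
  assert (R1 : forall u v, rel Local_ (emul u v) e1 -> eval gen A x u * eval gen A x v = 1).
  { intros u v H. rewrite <- ev_e1. apply (relE Local_ _ _ H). }
  destruct (ps_inverse A (half * (sp - sg)) (x gwi)) as [oi Hoi].
  { rewrite psM0, psB, Hsp0, Hsg0. change ((half * (x gw - - x gw)) * x gwi = 1).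
    transitivity ((half + half) * (x gw * x gwi)); [ring|]. rewrite half2, rel_wi. ring. }
  assert (LY : forall c0 s', s' O * 1 = s' O -> btY A c0 l s' e O = c0 - x gl - s' O).
  { intros c0 s' _. unfold btY, btM. rewrite psB, psD, !psB, hhM0, Hl0. change (0 - x gl - s' O + c0 - 0 = c0 - x gl - s' O). ring. }
  assert (LX : forall s', btX A (x gci) l s' e O = x gci - x gl - s' O).
  { intros s'. unfold btX, btM. rewrite psD, !psB, hhM0, Hl0. change (0 - x gl - s' O + x gci = x gci - x gl - s' O). ring. }
  assert (LN : forall c0 s', btN A (x gci) c0 l s' e sg O = (x gci - c0) * (- x gw - x gl + s' O) - (x gci - x gl - s' O) * (c0 - x gl - s' O)).
  { intros c0 s'. unfold btN. rewrite psB, !psM0, LY, LX, psD, psB, Hl0, Hsg0 by ring. unfold btkap. rewrite psD, psB.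
    change ((x gci - c0 + 0) * (- x gw - x gl + s' O) - (x gci - x gl - s' O) * (c0 - x gl - s' O) =
       (x gci - c0) * (- x gw - x gl + s' O) - (x gci - x gl - s' O) * (c0 - x gl - s' O)). ring. }
  assert (Hns : (- s) O = - x gs) by (rewrite psN, Hs0; easy).
  destruct (ps_inverse A (btY A (x gc0) l s e) (x gy1)) as [Y1 HY1].
  { rewrite LY, Hs0 by ring. apply (R1 _ _ (r_y1 _)). }
  destruct (ps_inverse A (btY A (- x gc0) l (- s) e) (x gy2)) as [Y2 HY2].
  { rewrite LY, Hns by ring. rewrite <- (R1 _ _ (r_y2 _)). eval_unfold. rewrite inj0. ring. }
  destruct (ps_inverse A (btN A (x gci) (x gc0) l s e sg) (x gn1)) as [N1 HN1].
  { rewrite LN, Hs0. rewrite <- (R1 _ _ (r_n1 _)). eval_unfold. rewrite inj0. ring. }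
  destruct (ps_inverse A (btN A (x gci) (- x gc0) l (- s) e sg) (x gn2)) as [N2 HN2].
  { rewrite LN, Hns. rewrite <- (R1 _ _ (r_n2 _)). eval_unfold. rewrite inj0. ring. }
  constructor.
  exact (Sol Local_ (x gw) l s e _ sp sg oi Y1 N1 Y2 N2 Hpain Hl0 Hs0 Hls Hli Hsp Hsg Hsp0 Hsg0 Hoi HY1 HN1 HY2 HN2).
Qed.
End Existence.

Section Image.
Local Open Scope ca_scope.
Variables (lv : level) (th : hom (AL Local_) (AL lv)).
Notation A := (AL lv).
Notation x := (X lv).
Notation H := (pshom th).
Add Ring Ar : (ath A).
Add Ring Pr : (ath (psA A)).
Hypothesis Hb : forall g, match g with gl | gs | gci | gc0 => th (X Local_ g) = x g | gx1 | gx2 => th (X Local_ g) = x g \/ th (X Local_ g) = 0 | _ => True end.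
Hypothesis Hwi : th (X Local_ gwi) * th (X Local_ gwi) = x gwi * x gwi.
Variable w0 : A.
Hypothesis Hw0 : th (X Local_ gw) = w0.
Variable S : sol Local_ (X Local_ gw).
Let HDt := th_Dt lv th Hb Hwi.
Let HDm := th_Dm lv th Hb Hwi.
Let HDp := th_Dp lv th Hb Hwi.

Lemma th_half : H half = half. Proof. apply hmI. Qed.
Lemma im_cst g : th (X Local_ g) = x g -> H (cst (X Local_ g)) = cst (x g).
Proof. intro E. now rewrite pshom_cst, E. Qed.
Lemma th_unit u v : u * v = 1 -> H u * H v = 1.
Proof. intro E. now rewrite <- hmM, E, hm1. Qed.

Definition sol_image : sol lv w0.
Proof.
  destruct S as [l s e li p m oi Y1 N1 Y2 N2 Hpain Hl0 Hs0 Hls Hli Hp Hm Hp0 Hm0 Hoi HY1 HN1 HY2 HN2].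
  refine (Sol lv w0 (H l) (H s) (H e) (H li) (H p) (H m) (H oi) (H Y1) (H N1) (H Y2) (H N2) _ _ _ _ _ _ _ _ _ _ _ _ _ _).
  - rewrite <- !im_cst by (apply (Hb gci) || apply (Hb gc0)). now apply (hom_painleve _ _ th (Dt Local_) _ HDt).
  - rewrite pshomE, Hl0. apply (Hb gl).
  - rewrite pshomE, Hs0. apply (Hb gs).
  - rewrite <- hmM, Hls, pshom_cst, hmM, (Hb gl), (Hb gs). easy.
  - now apply th_unit.
  - rewrite <- !im_cst by (apply (Hb gci) || apply (Hb gc0)). now apply (hom_riccati _ _ th (Dt Local_) _ HDt).
  - rewrite <- !im_cst by (apply (Hb gci) || apply (Hb gc0)). now apply (hom_riccati _ _ th (Dt Local_) _ HDt).
  - rewrite pshomE, Hp0. exact Hw0.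
  - rewrite pshomE, Hm0, hmN, Hw0. easy.
  - rewrite <- th_half, <- hmB, <- hmM. now apply th_unit.
  - rewrite <- (Hb gc0), <- hom_btY. now apply th_unit.
  - rewrite <- (Hb gc0), <- (Hb gci), <- hom_btN. now apply th_unit.
  - rewrite <- (Hb gc0), <- hmN, <- (hmN _ _ H), <- hom_btY. now apply th_unit.
  - rewrite <- (Hb gc0), <- (Hb gci), <- hmN, <- (hmN _ _ H), <- hom_btN. now apply th_unit.
Defined.

Lemma image_fields : vl sol_image = H (vl S) /\ vs sol_image = H (vs S) /\ ve sol_image = H (ve S) /\
  vli sol_image = H (vli S) /\ vp sol_image = H (vp S) /\ vm sol_image = H (vm S) /\ voi sol_image = H (voi S) /\
  vY1 sol_image = H (vY1 S) /\ vN1 sol_image = H (vN1 S) /\ vY2 sol_image = H (vY2 S) /\ vN2 sol_image = H (vN2 S).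
Proof. unfold sol_image. destruct S. repeat split. Qed.

Lemma image_vo : vo lv w0 sol_image = H (vo Local_ _ S).
Proof. destruct image_fields as (_ & _ & _ & _ & E1 & E2 & _). unfold vo. now rewrite E1, E2, hmM, hmB, th_half. Qed.

Lemma image_lam1 (f : deriv (AL Local_)) (f' : deriv A) : (forall z, th (f z) = f' (th z)) ->
  H (lam1 Local_ _ S f) = lam1 lv w0 sol_image f'.
Proof.
  intro Hf. destruct image_fields as (E1 & E2 & E3 & E4 & E5 & E6 & E7 & E8 & E9 & E10 & E11).
  unfold lam1. rewrite (hom_btLam _ _ th _ _ HDm f f') by exact Hf.
  rewrite hom_btN, image_vo, E1, E2, E3, E4, E6, E7, E8, E9, (Hb gci), (Hb gc0). easy.
Qed.
Lemma image_lam2 (f : deriv (AL Local_)) (f' : deriv A) : (forall z, th (f z) = f' (th z)) ->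
  H (lam2 Local_ _ S f) = lam2 lv w0 sol_image f'.
Proof.
  intro Hf. destruct image_fields as (E1 & E2 & E3 & E4 & E5 & E6 & E7 & E8 & E9 & E10 & E11).
  unfold lam2. rewrite (hom_btLam _ _ th _ _ HDp f f') by exact Hf.
  rewrite hom_btN, image_vo, E1, E2, E3, E4, E6, E7, E10, E11, !hmN, (Hb gci), (Hb gc0). easy.
Qed.

(** The primitive is built from ring operations and the three derivations, all respected by [th]. It
    can thus be studied in the generic ring for its parity and in the ring of the pole for its
    value. *)
Lemma image_vW b k : th (vW Local_ b _ S k) = vW lv b w0 sol_image k.
Proof.
  unfold vW, primitive.
  assert (Ecp : th (cp Local_) = cp lv) by (unfold cp, half; rewrite hmM, hmI, hmD, (Hb gci), (Hb gc0); easy).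
  assert (Ecm : th (cm Local_) = cm lv) by (unfold cm, half; rewrite hmM, hmI, hmB, (Hb gci), (Hb gc0); easy).
  assert (E2 : th (1 + 1) = 1 + 1) by (rewrite hmD, hm1; easy).
  assert (Eo : th (vo Local_ _ S k) = vo lv w0 sol_image k) by (rewrite image_vo; easy).
  repeat rewrite ?hmD, ?hmM, ?hmB, ?hmI, ?HDm, ?HDp, ?Ecp, ?Ecm, ?hm1.
  rewrite Eo.
  rewrite <- !(pshomE _ _ th (op _ _ _ _)), (pshom_op _ _ th _ _ HDm), (pshom_op _ _ th _ _ HDm), (pshom_op _ _ th _ _ HDp).
  rewrite (image_lam1 _ _ HDm), (image_lam1 _ _ HDp), (image_lam2 _ _ HDp). easy.
Qed.
End Image.

(** * Parity of the primitive under the exchange of sheets *)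

Section Odd.
Local Open Scope ca_scope.
Notation A := (AL Generic).
Notation x := (X Generic).
Notation P := (psA A).
Add Ring Ar : (ath A).
Add Ring Pr : (ath P).
Variable b : psA CA.
Variables (w0 w0i : A).
Hypothesis Hw0 : w0 * w0i = 1.

Lemma inverse_unique (R : calg) (u v v' : R) : u * v = 1 -> u * v' = 1 -> v = v'.
Proof. intros H1 H2. apply (unit_cancel R u v); congruence. Qed.

(** On the curve s Y = l X, so s is a unit once X is. *)
Lemma t_unit : exists ti, (x gl * x gs) * ti = 1.
Proof.
  assert (HX := relE Generic _ _ (r_x1 _ eq_refl)). assert (HY := relE Generic _ _ (r_y1 _)).
  rewrite ev_e1 in HX, HY. eval_unfold_in HX. eval_unfold_in HY.
  assert (HG := rel_G Generic). assert (Hl := rel_li Generic).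
  exists (x gli * ((x gc0 - x gl - x gs) * x gli * x gx1)).
  assert (E : x gs * (x gc0 - x gl - x gs) = x gl * (x gci - x gl - x gs)).
  { apply sub_eq0. rewrite <- HG. unfold potG. ring. }
  transitivity ((x gl * x gli) * (x gs * (x gc0 - x gl - x gs)) * x gli * x gx1); [ring|].
  rewrite E. transitivity ((x gl * x gli) * (x gl * x gli) * ((x gci - x gl - x gs) * x gx1)); [ring|].
  rewrite HX, Hl. ring.
Qed.

(** Uniqueness of formal solutions: reversing the leading term interchanges sigma_+ and sigma_- and
    leaves lambda, s and e alone. *)
Lemma sol_flip (S : sol Generic w0) (S' : sol Generic (- w0)) :
  vl S' = vl S /\ vs S' = vs S /\ ve S' = ve S /\ vli S' = vli S /\ vp S' = vm S /\ vm S' = vp S /\ voi S' = - voi S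
  /\ vY1 S' = vY1 S /\ vY2 S' = vY2 S.
Proof.
  destruct S as [l s e li p m oi Y1 N1 Y2 N2 Hpain Hl0 Hs0 Hls Hli Hp Hm Hp0 Hm0 Hoi HY1 HN1 HY2 HN2].
  destruct S' as [l' s' e' li' p' m' oi' Y1' N1' Y2' N2' Hpain' Hl0' Hs0' Hls' Hli' Hp' Hm' Hp0' Hm0' Hoi' HY1' HN1' HY2' HN2'].
  cbn [vl vs ve vli vp vm voi vY1 vY2].
  destruct (painleve_unique A (Dt Generic) _ _ l s e l' s' e' (x gli) (x gwi * x gwi) Hpain Hpain') as (El & Es & Ee).
  - congruence.
  - congruence.
  - rewrite Hl0. apply rel_li.
  - congruence.
  - rewrite quadQ_lead, Hl0, Hs0. apply rel_q.
  - subst l' s' e'.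
    assert (Ep : p' = m).
    { apply (riccati_unique A (Dt Generic) _ _ _ _ _ _ (- w0i) Hp' Hm); rewrite Hp0'; [now rewrite Hm0|]. rewrite <- Hw0. ring. }
    assert (Em : m' = p).
    { apply (riccati_unique A (Dt Generic) _ _ _ _ _ _ w0i Hm' Hp); rewrite Hm0'; [rewrite Hp0; ring|]. rewrite <- Hw0. ring. }
    subst p' m'. repeat split.
    + now apply (inverse_unique P l).
    + apply (inverse_unique P (half * (m - p))); [exact Hoi'|]. rewrite <- Hoi. ring.
    + now apply (inverse_unique P (btY A (x gc0) l s e)).
    + now apply (inverse_unique P (btY A (- x gc0) l (- s) e)).
Qed.

(** The three logarithmic terms are odd by [btLam_odd], whose hypothesis holds because c_m and c_p
    are varied at fixed t. The other terms are linear in sigma_odd, which changes sign. *)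
Lemma vW_odd k (S : sol Generic w0) (S' : sol Generic (- w0)) :
  vW Generic b _ S k + vW Generic b _ S' k = 0.
Proof.
  destruct (sol_flip S S') as (E1 & E2 & E3 & E4 & E5 & E6 & E7 & E8 & E9).
  assert (Eo : vo Generic _ S' = - vo Generic _ S) by (unfold vo; rewrite E5, E6; ring).
  destruct t_unit as [ti Hti].
  assert (HT : cst (x gl * x gs) * cst ti = 1) by (rewrite <- cstM, Hti, cst1; easy).
  assert (L1 : forall f : deriv A, f (x gl * x gs) = 0 -> lam1 Generic _ S f + lam1 Generic _ S' f = 0).
  { intros f Hf. unfold lam1. rewrite Eo, E1, E2, E3, E4, E6, E7, E8.
    assert (HN := sol_N1 _ _ S'). rewrite E1, E2, E3, E6 in HN.
    apply (btLam_odd A (Dt Generic) (Dm Generic) (x gci) (x gc0) (vl S) (vs S) (ve S) (vli S) (vY1 S) (x gwi * x gwi)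
     (Dt_Dm _) (D_ci _) (D_c0 _) (eq_trans (dm_ci _) (eq_sym (inj1 A))) (eq_trans (dm_c0 _) (inj_m1 _))
     (sol_pain _ _ S) (shift_ls _ _ S) (sol_li _ _ S) (sol_Y1 _ _ S) (quadQ_unit _ _ S)
     f (cst (x gl * x gs)) (cst ti) (vp S) (vm S) (vN1 S) (vN1 S') (voi S) (cst w0i) (cst (- w0i))
     (sol_p _ _ S) (sol_m _ _ S) (vm_unit _ _ _ Hw0 S) (vp_unit _ _ _ Hw0 S) (sol_N1 _ _ S) HN (sol_ls _ _ S) HT).
    - rewrite pd_cst, Hf. apply cst0.
    - apply (sol_oi _ _ S). }
  assert (L2 : forall f : deriv A, f (x gl * x gs) = 0 -> lam2 Generic _ S f + lam2 Generic _ S' f = 0).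
  { intros f Hf. unfold lam2. rewrite Eo, E1, E2, E3, E4, E6, E7, E9.
    assert (HN := sol_N2 _ _ S'). rewrite E1, E2, E3, E6 in HN.
    assert (B0 : Dt Generic (- x gc0) = 0) by (rewrite dvN, D_c0; ring).
    assert (B1 : Dp Generic (- x gc0) = inj (- RtoC 1)%C) by (rewrite dvN, dp_c0; apply inj_m1).
    assert (Hls : vl S * - vs S = - cst (x gl * x gs)) by (rewrite <- (sol_ls _ _ S); ring).
    assert (HT' : - cst (x gl * x gs) * - cst ti = 1) by (rewrite <- HT; ring).
    apply (btLam_odd A (Dt Generic) (Dp Generic) (x gci) (- x gc0) (vl S) (- vs S) (ve S) (vli S) (vY2 S) (x gwi * x gwi)
     (Dt_Dp _) (D_ci _) B0 (eq_trans (dp_ci _) (eq_sym (inj1 A))) B1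
     (painleve_flip _ _ S) (shift_ls_flip _ _ S) (sol_li _ _ S) (sol_Y2 _ _ S) (quadQ_unit_flip _ _ S)
     f (- cst (x gl * x gs)) (- cst ti) (vp S) (vm S) (vN2 S) (vN2 S') (voi S) (cst w0i) (cst (- w0i))
     (riccati_flip _ _ S _ (sol_p _ _ S)) (riccati_flip _ _ S _ (sol_m _ _ S)) (vm_unit _ _ _ Hw0 S) (vp_unit _ _ _ Hw0 S) (sol_N2 _ _ S) HN Hls HT').
    - rewrite dvN, pd_cst, Hf, cst0. ring.
    - apply (sol_oi _ _ S). }
  assert (O : forall d c F G, F + G = 0 -> op A d c F k + op A d c G k = 0).
  { intros d c F G H. rewrite <- psD, <- op_addf, H.
    assert (Z : op A d c 0 = 0).
    { replace (0 : P) with (inj (RtoC 0) * 0 : P) by (rewrite inj0; ring). rewrite op_scalf, inj0. ring. }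
    rewrite Z. easy. }
  assert (M1 := O (Dm Generic) b _ _ (L1 (Dm Generic) (dm_t _))).
  assert (M2 := O (Dm Generic) b _ _ (L1 (Dp Generic) (dp_t _))).
  assert (M3 := O (Dp Generic) b _ _ (L2 (Dp Generic) (dp_t _))).
  unfold vW, primitive.
  assert (Eok : vo Generic _ S' k = - vo Generic _ S k) by (rewrite Eo; easy). rewrite Eok, !dvN.
  set (a1 := op A (Dm Generic) b (lam1 _ _ S (Dm Generic)) k) in *. set (a2 := op A (Dm Generic) b (lam1 _ _ S (Dp Generic)) k) in *.
  set (a3 := op A (Dp Generic) b (lam2 _ _ S (Dp Generic)) k) in *.
  set (b1 := op A (Dm Generic) b (lam1 _ _ S' (Dm Generic)) k) in *. set (b2 := op A (Dm Generic) b (lam1 _ _ S' (Dp Generic)) k) in *.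
  set (b3 := op A (Dp Generic) b (lam2 _ _ S' (Dp Generic)) k) in *.
  transitivity (inj (/ (RtoC (INR k) * (RtoC (INR k) - RtoC 1)))%C *
    (cp Generic * cp Generic * (a3 + b3) + (1 + 1) * (cp Generic * cm Generic) * (a2 + b2) + cm Generic * cm Generic * (a1 + b1))); [ring|].
  rewrite M1, M2, M3. ring.
Qed.
End Odd.

(** * The value at the double pole *)

Fixpoint apow {A : calg} (u : A) (n : nat) : A := match n with O => 1%A | S m => (u * apow u m)%A end.

Section IterInverse.
Local Open Scope ca_scope.
Variable A : calg.
Add Ring Ar : (ath A).
(** The factorial produced here cancels the one in the Bernoulli generating series, leaving the bare
    Bernoulli numbers. *)
Lemma iter_inverse (d : deriv A) u v n : u * v = 1 -> d u = 1 ->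
  Nat.iter n d v = inj (Cpow (RtoC (-1)) n * RtoC (INR (fact n)))%C * apow v (S n).
Proof.
  intros Huv Hu. assert (Hv : d v = - (v * v)) by (rewrite (dv_inv A d u v Huv), Hu; ring).
  assert (Hp : forall k, d (apow v (S k)) = - (nR k * apow v (S (S k)))).
  { induction k; [simpl; rewrite dvM, Hv, dv1, nR0; ring|].
    change (apow v (S (S k))) with (v * apow v (S k)). rewrite dvM, Hv, IHk, nRS.
    change (apow v (S (S (S k)))) with (v * (v * apow v (S k))). change (apow v (S (S k))) with (v * apow v (S k)). ring. }
  induction n; simpl Nat.iter.
  - simpl. replace (RtoC 1 * RtoC 1)%C with (RtoC 1) by ring. rewrite inj1. ring.
  - rewrite IHn, dvZ, Hp. unfold nR. cbn [Cpow]. change (fact (S n)) with (S n * fact n)%nat. rewrite mult_INR, RtoC_mult.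
    replace (RtoC (-1)) with (- RtoC 1)%C by (rewrite <- RtoC_opp; easy).
    rewrite !injM, injN, inj1. ring.
Qed.
End IterInverse.

Section PoleValue.
Local Open Scope ca_scope.
Notation A := (AL Pole).
Notation x := (X Pole).
Notation P := (psA A).
Add Ring Ar : (ath A).
Add Ring Pr : (ath P).
Notation D := (Dt Pole).
Variable b : psA CA.

Lemma pole_s : x gs = 0. Proof. apply (pole_facts Pole eq_refl). Qed.
Lemma pole_l : x gl = x gci. Proof. apply (pole_facts Pole eq_refl). Qed.
Lemma pole_w : x gw = x gci. Proof. apply (pole_facts Pole eq_refl). Qed.
Lemma pci_unit : x gci * x gli = 1. Proof. rewrite <- pole_l. apply rel_li. Qed.
Lemma pole_rel_unit u v : rel Pole (emul u v) e1 -> eval gen A x u * eval gen A x v = 1.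
Proof. intro H. rewrite <- ev_e1. apply (relE Pole _ _ H). Qed.
Lemma pc0_unit : (x gci - x gc0) * - x gy1 = 1.
Proof. assert (H := pole_rel_unit _ _ (r_y1 Pole)). eval_unfold_in H. rewrite pole_l, pole_s in H. rewrite <- H. ring. Qed.
Lemma pcp_unit : (x gci + x gc0) * - x gy2 = 1.
Proof. assert (H := pole_rel_unit _ _ (r_y2 Pole)). eval_unfold_in H. rewrite pole_l, pole_s, inj0 in H. rewrite <- H. ring. Qed.

(** The double pole lies over t = 0, where t d/dt annihilates every function. *)
Lemma D_pole_zero z : D z = 0.
Proof.
  revert z. apply deriv_presented_eq0.
  assert (Dl : D (x gl) = 0) by (rewrite pole_l; apply D_ci).
  assert (Ds : D (x gs) = 0) by (rewrite pole_s; apply dv0).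
  assert (Dci := D_ci Pole). assert (Dc0 := D_c0 Pole).
  assert (Dw : D (x gw) = 0) by (rewrite pole_w; apply D_ci).
  assert (Cinv : forall u v, u * v = 1 -> D u = 0 -> D v = 0).
  { intros u v Huv Hu. rewrite (dv_inv A D u v Huv), Hu. ring. }
  intro g; destruct g; trivial.
  - apply (Cinv _ _ (rel_wi _) Dw).
  - apply (Cinv _ _ (rel_li _) Dl).
  - apply (Cinv _ _ (pole_rel_unit _ _ (r_y1 _))). eval_unfold. rewrite !dvB, Dc0, Dl, Ds. ring.
  - apply (Cinv _ _ (pole_rel_unit _ _ (r_n1 _))). eval_unfold. rewrite dvB, !dvM, dvD, !dvB, dvI, Dci, Dc0, Dl, Ds, Dw. ring.
  - unfold Dt. rewrite mkderiv_x1. fold D. eval_unfold. rewrite !dvB, Dci, Dl, Ds. ring.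
  - apply (Cinv _ _ (pole_rel_unit _ _ (r_y2 _))). eval_unfold. rewrite !dvB, !dvI, Dc0, Dl, Ds. ring.
  - apply (Cinv _ _ (pole_rel_unit _ _ (r_n2 _))). eval_unfold. rewrite dvB, !dvM, dvD, !dvB, !dvI, Dci, Dc0, Dl, Ds, Dw. ring.
  - unfold Dt. rewrite mkderiv_x2. fold D. eval_unfold. rewrite !dvB, !dvI, Dci, Dl, Ds. ring.
Qed.
Lemma pdD_zero (f : P) : pd D f = 0.
Proof. extensionality n. apply D_pole_zero. Qed.

Variable So : sol Pole (x gw).

(** With D = 0 the formal equations become algebraic and free of h, so the leading terms solve them
    to all orders. *)
Lemma pole_fields : vl So = cst (x gci) /\ vs So = 0 /\ ve So = 0 /\ vli So = cst (x gli) /\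
  vp So = cst (x gci) /\ vm So = - cst (x gci).
Proof.
  destruct (sol_pain _ _ So) as (H1 & H2 & H3). rewrite pdD_zero in H1, H2, H3.
  assert (Hs : vs So = 0).
  { apply (unit_cancel P _ _ _ _ (sol_li _ _ So)). rewrite (sol_ls _ _ So), pole_s.
    replace (x gl * 0) with (0 : A) by ring. rewrite cst0. ring. }
  assert (Hl : vl So = cst (x gci)).
  { apply (unit_cancel P _ _ _ _ (sol_li _ _ So)). unfold potG in H3. rewrite Hs in H3.
    transitivity (vl So * vl So - cst (x gci) * vl So - 0 * 0 + cst (x gc0) * 0 + cst (x gci) * vl So); [ring|].
    rewrite <- H3. ring. }
  assert (He : ve So = 0).
  { apply (unit_cancel P _ _ _ _ (sol_li _ _ So)). transitivity (ve So * vl So); [ring|]. rewrite <- H1. ring. }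
  assert (Hcl : cst (x gci) * cst (x gli) = 1) by (rewrite <- cstM, pci_unit, cst1; easy).
  assert (Rp : forall r : P, r * r = cst (x gci) * cst (x gci) -> formal_riccati A D (cst (x gci)) (cst (x gc0)) (vl So) (vs So) r).
  { intros r Hr. unfold formal_riccati. rewrite pdD_zero, Hr, Hl, Hs. unfold quadQ. ring. }
  split; [easy|]. split; [easy|]. split; [easy|]. split; [|split].
  - apply (inverse_unique P (vl So)); [apply sol_li|]. now rewrite Hl.
  - apply (riccati_unique A D _ _ _ _ _ _ (x gli) (sol_p _ _ So)); [apply Rp; ring| |].
    + rewrite sol_p0. apply pole_w.
    + rewrite sol_p0, pole_w. apply pci_unit.
  - apply (riccati_unique A D _ _ _ _ _ _ (- x gli) (sol_m _ _ So)); [apply Rp; ring| |].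
    + rewrite sol_m0, pole_w. easy.
    + rewrite sol_m0, pole_w, <- pci_unit. ring.
Qed.

Lemma pole_vo : vo Pole _ So = cst (x gci).
Proof.
  destruct pole_fields as (_ & _ & _ & _ & E1 & E2). unfold vo. rewrite E1, E2.
  transitivity ((half + half) * cst (x gci)); [ring|]. rewrite half2. ring.
Qed.
Lemma pole_voi : voi So = cst (x gli).
Proof.
  apply (inverse_unique P (vo Pole _ So)); [apply sol_oi|]. rewrite pole_vo, <- cstM, pci_unit. easy.
Qed.

(* At the pole the formal solution is constant, and the logarithm becomes
   [log kap - 3/2 log c_inf - 3/2 log (c_inf + h)]. *)
Lemma pole_btLam (d f : deriv A) (c0 : A) (s Yi N Ni ki : P) (g : C) :
  d (x gci) = 1 -> f (x gci) = 1 -> f c0 = inj (RtoC 1 - g)%C ->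
  s = 0 ->
  let kap := cst (x gci) - cst c0 + hh in
  kap * ki = 1 ->
  btY A c0 (vl So) s (ve So) * Yi = 1 -> N = btN A (x gci) c0 (vl So) s (ve So) (vm So) -> N * Ni = 1 ->
  let vi := cst (x gli) in
  btLam A d c0 (vl So) s (ve So) (vli So) Yi f N Ni (vo Pole _ So) (voi So)
  = inj g * ki - (1 + half) * (vi + tshift A d (RtoC 1) vi).
Proof.
  intros Hd Hf Hf0 Hs kap Hki HY HN HNi vi.
  destruct pole_fields as (El & _ & Ee & Eli & _ & Em).
  assert (Hcl : cst (x gci) * vi = 1) by (unfold vi; rewrite <- cstM, pci_unit, cst1; easy).
  assert (EY : btY A c0 (vl So) s (ve So) = - kap).
  { unfold btY, btM. rewrite El, Ee, Hs. unfold kap. ring. }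
  assert (EN : N = - ((1 + 1) * (kap * cst (x gci)))).
  { rewrite HN. unfold btN. rewrite EY. unfold btX, btM. rewrite El, Ee, Hs, Em. unfold btkap. fold kap. ring. }
  assert (EYi : Yi = - ki).
  { apply (inverse_unique P (- kap)); [now rewrite <- EY|]. rewrite <- Hki. ring. }
  assert (ENi : Ni = - (half * (ki * vi))).
  { apply (inverse_unique P N); [easy|]. rewrite EN.
    transitivity ((half + half) * (kap * ki) * (cst (x gci) * vi)); [ring|]. rewrite half2, Hki, Hcl. ring. }
  assert (Fci : pd f (cst (x gci)) = 1) by (rewrite pd_cst, Hf; apply cst1).
  assert (Fk : pd f kap = inj g).
  { unfold kap. rewrite dvD, dvB, Fci, pd_cst, Hf0, pd_hh, cst_inj, injB, inj1. ring. }
  assert (Tci : tshift A d (RtoC 1) (cst (x gci)) = cst (x gci) + hh).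
  { rewrite (shift_lin A d _ _ (RtoC 1)) by (rewrite Hd; symmetry; apply inj1).
    replace (RtoC 1 * RtoC 1)%C with (RtoC 1) by ring. rewrite inj1. ring. }
  unfold btLam. rewrite pole_vo, pole_voi, EY, EN, EYi, ENi, El, Eli, Tci. fold vi.
  rewrite !dvN, (dvM (pd f) (1 + 1)), (dvM (pd f) kap), !dvD, dv1, Fk, Fci, pd_hh.
  set (T := tshift A d (RtoC 1) vi).
  transitivity ((1 + 1) * (inj g * ki) - (1 + 1) * vi + vi - T + half * vi - half * T
     - (half + half) * (inj g * ki * (cst (x gci) * vi) + (kap * ki) * vi)); [ring|].
  rewrite half2, Hki, Hcl.
  transitivity (inj g * ki - vi - T - half * T - (half + half) * vi + half * vi); [rewrite half2; ring|ring].
Qed.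

(** 2 / (2 u + h) = 1 / (u + h/2) is the half-step translate of 1/u; this half step produces the
    powers of 2 in the coefficients of F. *)
Lemma half_shift (d : deriv A) (u ui : A) (ki : P) : d u = 1 -> u * ui = 1 ->
  ((1 + 1) * cst u + hh) * ki = 1 -> (1 + 1) * ki = tshift A d (/ RtoC 2)%C (cst ui).
Proof.
  intros Hu Hui Hk. apply (inverse_unique P (cst u + half * hh)).
  - transitivity ((1 + 1) * cst u * ki + (half + half) * (hh * ki)); [ring|]. rewrite half2.
    transitivity (((1 + 1) * cst u + hh) * ki); [ring|exact Hk].
  - assert (E : tshift A d (/ RtoC 2)%C (cst u) = cst u + half * hh).
    { rewrite (shift_lin A d _ _ (RtoC 1)) by (rewrite Hu; symmetry; apply inj1).
      rewrite Cmult_1_r. easy. }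
    rewrite <- E, <- shiftM, <- cstM, Hui. apply shift_1.
Qed.

(** With [b] the Bernoulli series these are the symbols w e^(w/2) / (e^w - 1) and w (e^w + 1) / (e^w
    - 1). *)
Definition gamF : psA CA := b * expser (/ RtoC 2)%C.
Definition gamG : psA CA := b * (1 + expser (RtoC 1)).
Definition cpi : A := (1 + 1) * - x gy2.
Definition cmi : A := (1 + 1) * - x gy1.
Lemma cp_unit : cp Pole * cpi = 1.
Proof. unfold cp, cpi. transitivity ((half + half) * ((x gci + x gc0) * - x gy2)); [ring|]. rewrite half2, pcp_unit. ring. Qed.
Lemma cm_unit : cm Pole * cmi = 1.
Proof. unfold cm, cmi. transitivity ((half + half) * ((x gci - x gc0) * - x gy1)); [ring|]. rewrite half2, pc0_unit. ring. Qed.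

Lemma op_G (d : deriv A) k : d (x gci) = 1 ->
  op A d b ((1 + half) * (cst (x gli) + tshift A d (RtoC 1) (cst (x gli)))) k
  = (1 + half) * (inj (gamG k * (Cpow (RtoC (-1)) k * RtoC (INR (fact k))))%C * apow (x gli) (S k)).
Proof.
  intro Hd.
  replace (cst (x gli) + tshift A d (RtoC 1) (cst (x gli))) with (op A d (1 + expser (RtoC 1)) (cst (x gli)))
    by (rewrite op_addc, op_1; easy).
  replace ((1 + half) : P) with (inj (RtoC 1 + / RtoC 2)%C : P) by (rewrite injD, inj1; easy).
  rewrite op_scalf, op_op, injM_n, op_cst, (iter_inverse A d (x gci)) by (trivial; apply pci_unit).
  fold gamG. rewrite injD, inj1, !injM. unfold half. ring.
Qed.

Lemma op_F (d : deriv A) u ui k (ki : P) : d u = 1 -> u * ui = 1 ->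
  ((1 + 1) * cst u + hh) * ki = 1 ->
  op A d b (inj (RtoC 2) * ki) k = inj (gamF k * (Cpow (RtoC (-1)) k * RtoC (INR (fact k))))%C * apow ui (S k).
Proof.
  intros Hu Hui Hk. rewrite inj2, (half_shift d u ui ki Hu Hui Hk). unfold tshift.
  rewrite op_op, op_cst, (iter_inverse A d u ui) by trivial. fold gamF. rewrite !injM. ring.
Qed.

Lemma pole_vW k : (1 <= k)%nat ->
  vW Pole b _ So k = inj (/ (RtoC (INR k) * (RtoC (INR k) - RtoC 1)))%C *
   (inj (Cpow (RtoC (-1)) k * RtoC (INR (fact k)))%C *
    (inj (gamF k) * (cp Pole * cp Pole * apow cpi (S k) + cm Pole * cm Pole * apow cmi (S k))
     - (1 + half) * (inj (gamG k) * (x gci * x gci * apow (x gli) (S k))))).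
Proof.
  intro Hk. unfold vW. f_equal.
  destruct pole_fields as (El & Es & Ee & Eli & Ep & Em).
  assert (Es2 : - vs So = 0) by (rewrite Es; ring).
  assert (Dci1 := dm_ci Pole). assert (Dc01 := dm_c0 Pole). assert (Dci2 := dp_ci Pole). assert (Dc02 := dp_c0 Pole).
  set (k1 := - vY1 So). set (k2 := - vY2 So).
  assert (K1 : (cst (x gci) - cst (x gc0) + hh) * k1 = 1).
  { rewrite <- (sol_Y1 _ _ So). unfold k1, btY, btM. rewrite El, Es, Ee. ring. }
  assert (K2 : (cst (x gci) - cst (- x gc0) + hh) * k2 = 1).
  { rewrite <- (sol_Y2 _ _ So). unfold k2, btY, btM. rewrite El, Es, Ee. ring. }
  (* Here kap is 2 c_m + h or 2 c_p + h. Its derivative is 2 along the shifted parameter and 0 along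
     the other, so the mixed term has no F part. *)
  assert (G1 : (- (1) : A) = inj (RtoC 1 - RtoC 2)%C) by (rewrite injB, inj1, inj2; ring).
  assert (G2 : (1 : A) = inj (RtoC 1 - RtoC 0)%C) by (rewrite injB, inj1, inj0; ring).
  assert (L1 : lam1 Pole _ So (Dm Pole) = inj (RtoC 2) * k1 - (1 + half) * (cst (x gli) + tshift A (Dm Pole) (RtoC 1) (cst (x gli)))).
  { apply pole_btLam; trivial; [now rewrite Dc01 | apply sol_Y1 | apply sol_N1]. }
  assert (L2 : lam1 Pole _ So (Dp Pole) = inj (RtoC 0) * k1 - (1 + half) * (cst (x gli) + tshift A (Dm Pole) (RtoC 1) (cst (x gli)))).
  { apply pole_btLam; trivial; [now rewrite Dc02 | apply sol_Y1 | apply sol_N1]. }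
  assert (L3 : lam2 Pole _ So (Dp Pole) = inj (RtoC 2) * k2 - (1 + half) * (cst (x gli) + tshift A (Dp Pole) (RtoC 1) (cst (x gli)))).
  { apply pole_btLam; trivial; [rewrite dvN, Dc02; exact G1 | apply sol_Y2 | apply sol_N2]. }
  assert (U1 : ((1 + 1) * cst (cm Pole) + hh) * k1 = 1).
  { replace ((1 + 1) * cst (cm Pole)) with (cst (x gci) - cst (x gc0)); [exact K1|].
    transitivity (cst ((1 + 1) * cm Pole)); [|now rewrite cstM, cstD, cst1]. rewrite <- cstB. f_equal. unfold cm.
    transitivity ((half + half) * (x gci - x gc0)); [rewrite half2; ring|ring]. }
  assert (U2 : ((1 + 1) * cst (cp Pole) + hh) * k2 = 1).
  { replace ((1 + 1) * cst (cp Pole)) with (cst (x gci) - cst (- x gc0)); [exact K2|].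
    transitivity (cst ((1 + 1) * cp Pole)); [|now rewrite cstM, cstD, cst1]. rewrite <- cstB. f_equal. unfold cp.
    transitivity ((half + half) * (x gci + x gc0)); [rewrite half2; ring|ring]. }
  assert (Z : vo Pole _ So k = 0).
  { rewrite pole_vo. destruct k; [lia|easy]. }
  rewrite L1, L2, L3, Z. rewrite !op_subf, !psB.
  rewrite (op_F _ _ _ k k1 (dm_cm Pole) cm_unit U1), (op_F _ _ _ k k2 (dp_cp Pole) cp_unit U2).
  rewrite (op_G (Dm Pole) k Dci1), (op_G (Dp Pole) k Dci2).
  (* The three logarithms share their G part, which enters with weights c_p^2, 2 c_p c_m and c_m^2;
     these add up to c_inf^2. *)
  rewrite op_scalf, injM_n, inj0. unfold primitive. rewrite !dv0, <- (cpm_ci Pole), !injM. ring.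
Qed.
End PoleValue.

(** * Bernoulli numbers *)

Ltac toC := match goal with |- @eq _ ?a ?b => change (@eq C a b) end.

Section CauchyProduct.
Local Open Scope C_scope.

Lemma csum_ext f g n : (forall k, (k <= n)%nat -> f k = g k) -> csum f n = csum g n.
Proof. induction n; intro H; simpl; [apply H; lia|]. rewrite IHn, H by (auto; intros; apply H; lia). easy. Qed.
Lemma csum_plus f g n : csum (fun k => f k + g k) n = csum f n + csum g n.
Proof. induction n; simpl; [easy|]. rewrite IHn. ring. Qed.
Lemma csum_scal c f n : csum (fun k => c * f k) n = c * csum f n.
Proof. induction n; simpl; [easy|]. rewrite IHn. ring. Qed.
Lemma csum_first f n : csum f (S n) = f O + csum (fun k => f (S k)) n.
Proof. induction n; [easy|]. change (csum f (S (S n))) with (csum f (S n) + f (S (S n))). rewrite IHn. simpl. ring. Qed.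

(** Weighting the terms of the Cauchy sum of order n + 1 by n + 1 = j + (n + 1 - j) gives the
    recursion that defines [psmuln]. *)
Lemma smul_psmul (a b : psA CA) n : smul a b n = psmuln n a b.
Proof.
  revert a b. induction n; intros a b; [easy|].
  cbn [psmuln]. rewrite <- !IHn. unfold nI, smul.
  change (@inj CA) with (fun c : C => c). cbv beta. change (amul CA) with Cmult. change (aadd CA) with Cplus.
  assert (H0 : RtoC (INR (S n)) <> RtoC 0) by (intro E; apply RtoC_inj in E; revert E; now apply not_0_INR).
  transitivity (RtoC (/ INR (S n)) * csum (fun j => RtoC (INR (S n)) * (a j * b (S n - j)%nat)) (S n)).
  - rewrite csum_scal, RtoC_inv by now apply not_0_INR. field. exact H0.
  - f_equal.
    transitivity (csum (fun j => RtoC (INR j) * (a j * b (S n - j)%nat) + RtoC (INR (S n - j)) * (a j * b (S n - j)%nat)) (S n)).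
    + apply csum_ext. intros k Hk. rewrite minus_INR, RtoC_minus by lia. ring.
    + rewrite csum_plus. f_equal.
      * rewrite csum_first. change (INR 0) with 0. rewrite Cmult_0_l, Cplus_0_l. apply csum_ext. intros k Hk.
        unfold psder, nR. change (@inj CA) with (fun c : C => c). cbv beta. change (amul CA) with Cmult.
        replace (S n - S k)%nat with (n - k)%nat by lia. ring.
      * cbn [csum]. replace (S n - S n)%nat with O by lia. change (INR 0) with 0. rewrite Cmult_0_l, Cplus_0_r.
        apply csum_ext. intros k Hk. unfold psder, nR. change (@inj CA) with (fun c : C => c). cbv beta. change (amul CA) with Cmult.
        replace (S n - k)%nat with (S (n - k)) by lia. ring.
Qed.
End CauchyProduct.

Lemma Re_mult_real (z : C) r : Re (z * RtoC r)%C = Re z * r.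
Proof. unfold Re, Cmult, RtoC. simpl. ring. Qed.

Lemma Re_csum f n : Re (csum f n) = sum_f_R0 (fun k => Re (f k)) n.
Proof. induction n; simpl; [easy|]. now rewrite <- IHn. Qed.

Definition quot_coef (n : nat) : R := / INR (fact (S n)).

(** The inverse series is obtained over C; as the coefficients of (e^w - 1)/w are real, its real
    parts satisfy the same recursion. *)
Lemma bernoulli_coefs : exists beta : nat -> R, forall n,
  sum_f_R0 (fun k => beta k * quot_coef (n - k)) n = match n with O => 1 | _ => 0 end.
Proof.
  destruct (ps_inverse CA expquot (RtoC 1)) as [w Hw].
  { unfold expquot. simpl. rewrite Rinv_1. change (@eq C (RtoC 1 * RtoC 1)%C (RtoC 1)). ring. }
  exists (fun n => Re (w n)). intro n.
  assert (H : smul w expquot n = (1%A : psA CA) n).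
  { rewrite smul_psmul, <- psM. apply (f_equal (fun F : psA CA => F n)). rewrite <- Hw. apply (Rmul_comm (ath _)). }
  apply (f_equal Re) in H. unfold smul in H. rewrite Re_csum in H.
  replace (match n with O => 1 | _ => 0 end) with (Re ((1%A : psA CA) n)) by now destruct n.
  rewrite <- H. apply sum_eq. intros k Hk. unfold expquot. now rewrite Re_mult_real.
Qed.

Lemma pow2_fact n : 2 ^ n <= INR (fact (S n)).
Proof.
  induction n; [simpl; lra|]. change (fact (S (S n))) with (S (S n) * fact (S n))%nat. rewrite mult_INR.
  simpl pow. apply Rmult_le_compat; try lra. { apply pow_le. lra. }
  rewrite !S_INR. assert (H := pos_INR n). lra.
Qed.

(** By induction, since 2^j <= (j+1)! and the sum of 2^(-j) over j >= 1 stays below 1. A crude bound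
    is enough: it gives a radius of convergence of at least 1. *)
Lemma bernoulli_coefs_bound beta : (forall n,
  sum_f_R0 (fun k => beta k * quot_coef (n - k)) n = match n with O => 1 | _ => 0 end) ->
  forall n, Rabs (beta n) <= 1.
Proof.
  intros H n. induction n as [n IH] using (well_founded_induction lt_wf). destruct n.
  - specialize (H O). unfold quot_coef in H. simpl in H. rewrite Rinv_1, Rmult_1_r in H. rewrite H, Rabs_R1. lra.
  - specialize (H (S n)). cbn [sum_f_R0] in H. replace (S n - S n)%nat with O in H by lia.
    unfold quot_coef at 2 in H. simpl (fact 1) in H. simpl (INR 1) in H. rewrite Rinv_1, Rmult_1_r in H.
    replace (beta (S n)) with (- sum_f_R0 (fun k => beta k * quot_coef (S n - k)) n) by lra.
    rewrite Rabs_Ropp.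
    apply Rle_trans with (sum_f_R0 (fun k => / 2 ^ (S n - k)) n).
    + eapply Rle_trans; [apply Rsum_abs|]. apply sum_Rle. intros k Hk. rewrite Rabs_mult.
      assert (Hq : 0 < quot_coef (S n - k)) by (apply Rinv_0_lt_compat, INR_fact_lt_0).
      rewrite (Rabs_pos_eq (quot_coef _)) by lra.
      apply Rle_trans with (1 * quot_coef (S n - k)).
      * apply Rmult_le_compat_r; [lra|]. apply IH. lia.
      * rewrite Rmult_1_l. apply Rinv_le_contravar; [apply pow_lt; lra|]. apply pow2_fact.
    + clear. assert (E : sum_f_R0 (fun k => / 2 ^ (S n - k)) n = 1 - / 2 ^ S n).
      { induction n; [simpl; field|]. rewrite decomp_sum by lia. cbn [pred].
        rewrite (sum_eq _ (fun k => / 2 ^ (S n - k))) by (intros; f_equal; f_equal; lia).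
        rewrite IHn. replace (S (S n) - 0)%nat with (S (S n)) by lia. simpl. field. apply pow_nonzero. lra. }
      rewrite E. assert (0 < / 2 ^ S n) by (apply Rinv_0_lt_compat, pow_lt; lra). lra.
Qed.

Lemma CV_radius_ge_1 (a : nat -> R) : (forall n, Rabs (a n) <= 1) -> Rbar_le 1 (CV_radius a).
Proof.
  intro H. destruct (CV_radius_bounded a) as [Hub _]. apply Hub. exists 1. intro n. rewrite pow1, Rmult_1_r. apply H.
Qed.

Lemma bern_gen_series beta : (forall n,
  sum_f_R0 (fun k => beta k * quot_coef (n - k)) n = match n with O => 1 | _ => 0 end) ->
  forall x, Rabs x < 1 -> bern_gen x = PSeries beta x.
Proof.
  intros H x Hx.
  assert (Hb := bernoulli_coefs_bound beta H).
  assert (Hq : forall n, Rabs (quot_coef n) <= 1).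
  { intro n. unfold quot_coef. rewrite Rabs_pos_eq by (left; apply Rinv_0_lt_compat, INR_fact_lt_0).
    rewrite <- Rinv_1. apply Rinv_le_contravar; [lra|]. apply (le_INR 1). apply Nat.le_trans with (1 := le_n 1). apply lt_O_fact. }
  assert (R1 : Rbar_lt (Rabs x) (CV_radius beta)) by (eapply Rbar_lt_le_trans; [|apply CV_radius_ge_1; exact Hb]; exact Hx).
  assert (R2 : Rbar_lt (Rabs x) (CV_radius quot_coef)) by (eapply Rbar_lt_le_trans; [|apply CV_radius_ge_1; exact Hq]; exact Hx).
  assert (E1 : PSeries beta x * PSeries quot_coef x = 1).
  { rewrite <- PSeries_mult by assumption.
    rewrite (PSeries_ext _ (fun n => match n with O => 1 | _ => 0 end)).
    - rewrite PSeries_decr_1.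
      + rewrite (PSeries_ext (PS_decr_1 _) (fun _ => 0)) by (intro; easy). rewrite PSeries_const_0. ring.
      + apply CV_radius_inside. eapply Rbar_lt_le_trans; [|apply CV_radius_ge_1; intros [|n]; rewrite ?Rabs_R1, ?Rabs_R0; lra]. exact Hx.
    - intro n. unfold PS_mult. rewrite H. easy. }
  assert (E2 : exp x = 1 + x * PSeries quot_coef x).
  { rewrite exp_Reals. rewrite PSeries_decr_1.
    - simpl. rewrite Rinv_1. easy.
    - eexists. apply is_exp_Reals. }
  unfold bern_gen. destruct (Req_EM_T x 0) as [->|Hx0].
  - rewrite PSeries_0. specialize (H O). unfold quot_coef in H. simpl in H. rewrite Rinv_1 in H. lra.
  - rewrite E2. replace (1 + x * PSeries quot_coef x - 1) with (x * PSeries quot_coef x) by ring.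
    assert (PSeries quot_coef x <> 0) by (intro E; rewrite E in E1; lra).
    apply Rmult_eq_reg_r with (PSeries quot_coef x); trivial. rewrite E1. field. auto.
Qed.

Definition bser : psA CA := fun n => RtoC (bernoulli n / INR (fact n)).

(** Here the analytic definition by derivatives at 0 meets the formal inverse series, through the
    convergent expansion of [bern_gen] near 0. *)
Lemma bernoulli_beta beta : (forall n,
  sum_f_R0 (fun k => beta k * quot_coef (n - k)) n = match n with O => 1 | _ => 0 end) ->
  forall n, bernoulli n / INR (fact n) = beta n.
Proof.
  intros H n. unfold bernoulli.
  rewrite (Derive_n_ext_loc _ (PSeries beta)).
  - rewrite Derive_n_coef.
    + field. apply INR_fact_neq_0.
    + eapply Rbar_lt_le_trans; [|apply CV_radius_ge_1, bernoulli_coefs_bound, H]. simpl. lra.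
  - exists (mkposreal 1 Rlt_0_1). intros y Hy. apply bern_gen_series; trivial.
    unfold ball in Hy; simpl in Hy; unfold AbsRing_ball, abs, minus, plus, opp in Hy; simpl in Hy.
    now rewrite Ropp_0, Rplus_0_r in Hy.
Qed.

Section BernoulliSeries.
Local Open Scope ca_scope.
Notation K := (psA CA).
Add Ring Kr : (ath K).

Lemma bser_quot : bser * expquot = 1.
Proof.
  destruct bernoulli_coefs as [beta H].
  extensionality n. rewrite psM, <- smul_psmul. unfold smul.
  transitivity (RtoC (sum_f_R0 (fun k => beta k * quot_coef (n - k))%R n)).
  - clear - H. assert (E : forall f m, csum (fun k => RtoC (f k)) m = RtoC (sum_f_R0 f m)).
    { intros f m. induction m; simpl; [easy|]. now rewrite IHm, RtoC_plus. }
    rewrite <- E. apply csum_ext. intros k Hk. unfold bser, expquot, quot_coef.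
    rewrite (bernoulli_beta beta H), <- RtoC_mult. easy.
  - rewrite H. now destruct n.
Qed.

Lemma expser_unique (x : C) (f : K) : f O = RtoC 1 -> hder f = inj x * f -> f = expser x.
Proof.
  intros H0 H. extensionality n. induction n; [now rewrite H0, expser0|].
  apply (nRcancel CA n). rewrite <- !hderE. rewrite H, expser_der, !(injM_n CA), IHn. easy.
Qed.

Definition scale (x : C) (f : K) : K := fun n => (Cpow x n * f n)%C.
Lemma scale_der x f : hder (scale x f) = inj x * scale x (hder f).
Proof.
  extensionality n. rewrite hderE, (injM_n CA). unfold scale. rewrite hderE. cbn [Cpow].
  change (@inj CA x) with x. change (amul CA) with Cmult. toC. ring.
Qed.
Lemma scaleM x f g : scale x (f * g) = scale x f * scale x g.
Proof.
  extensionality n. revert f g. induction n; intros f g.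
  - unfold scale at 1. rewrite !psM0. unfold scale. cbn [Cpow]. change (amul CA) with Cmult.
    toC. ring.
  - apply (nRcancel CA n). rewrite <- !hderE, dvM, !scale_der, (injM_n CA).
    replace (scale x (hder (f * g)) n) with ((scale x (hder f) * scale x g + scale x f * scale x (hder g)) n).
    + rewrite <- (injM_n CA). apply (f_equal (fun F : K => F n)). ring.
    + rewrite psD, <- !IHn, dvM. unfold scale. rewrite psD. change (aadd CA) with Cplus.
      toC. ring.
Qed.
Lemma scaleB x f g : scale x (f - g) = scale x f - scale x g.
Proof. extensionality n. unfold scale. rewrite !psB. change (asub CA) with Cminus.
  toC. ring. Qed.
Lemma scale1 x : scale x 1 = 1.
Proof. extensionality n. unfold scale. destruct n.
  - cbn [Cpow]. change (@eq C (RtoC 1 * RtoC 1)%C (RtoC 1)). ring.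
  - change (@eq C (Cpow x (S n) * RtoC 0)%C (RtoC 0)). ring. Qed.
Lemma scale_hh x : scale x hh = inj x * hh.
Proof. extensionality n. rewrite (injM_n CA). unfold scale, hh. change (@inj CA x) with x. destruct n as [|[|n]]; cbn [Cpow]; change (amul CA) with Cmult;
  change (azero CA) with (RtoC 0); change (aone CA) with (RtoC 1); toC; ring. Qed.
Lemma scale_exp x : scale x (expser (RtoC 1)) = expser x.
Proof.
  extensionality n. unfold scale, expser. assert (H : Cpow (RtoC 1) n = RtoC 1) by (induction n; simpl; [easy|rewrite IHn; ring]).
  rewrite H. toC. ring.
Qed.
Lemma expser_half : expser (/ RtoC 2)%C * expser (/ RtoC 2)%C = expser (RtoC 1).
Proof.
  apply expser_unique.
  - rewrite psM0, expser0. change (@eq C (RtoC 1 * RtoC 1)%C (RtoC 1)). ring.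
  - rewrite dvM, expser_der. change (inj (/ RtoC 2)%C : K) with (half : K).
    transitivity ((half + half) * (expser (/ RtoC 2)%C * expser (/ RtoC 2)%C)); [ring|].
    rewrite half2, inj1. easy.
Qed.

(** This is w e^(w/2) / (e^w - 1) = w / (e^(w/2) - 1) - w / (e^w - 1), obtained from e^w - 1 =
    (e^(w/2) - 1)(e^(w/2) + 1). *)
Lemma gamF_series : gamF bser = (1 + 1) * scale (/ RtoC 2)%C bser - bser.
Proof.
  set (b := bser). set (g := expquot). set (h2 := (/ RtoC 2)%C).
  assert (Hb : b * g = 1) by apply bser_quot.
  set (eh := expser h2).
  assert (E1 : expser (RtoC 1) = 1 + hh * g) by apply expser_quot.
  assert (E2 : scale h2 b * scale h2 g = 1) by (rewrite <- scaleM, Hb; apply scale1).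
  assert (E3 : half * hh * scale h2 g = eh - 1).
  { unfold eh. rewrite <- (scale_exp h2). change (half : K) with (inj h2 : K). rewrite <- scale_hh, <- scaleM.
    rewrite <- (scale1 h2), <- scaleB. f_equal. rewrite E1. ring. }
  assert (E4 : g = half * scale h2 g * (eh + 1)).
  { apply hh_cancel. transitivity ((half * hh * scale h2 g) * (eh + 1)); [|ring]. rewrite E3.
    transitivity (expser (RtoC 1) - 1); [rewrite E1; ring|]. rewrite <- expser_half. fold h2. fold eh. ring. }
  assert (E5 : ((1 + 1) * scale h2 b - b) * g = eh).
  { transitivity ((1 + 1) * scale h2 b * g - b * g); [ring|]. rewrite Hb, E4.
    transitivity ((half + half) * (scale h2 b * scale h2 g) * (eh + 1) - 1); [ring|]. rewrite half2, E2. ring. }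
  unfold gamF. fold h2. fold eh. rewrite <- E5.
  transitivity (((1 + 1) * scale h2 b - b) * (b * g)); [ring|]. rewrite Hb. ring.
Qed.

(** From w (e^w + 1) / (e^w - 1) = 2 w / (e^w - 1) + w; the extra w affects only the coefficient of
    order 1. *)
Lemma gamG_series : gamG bser = (1 + 1) * bser + hh.
Proof.
  unfold gamG. rewrite expser_quot. transitivity (bser + bser + hh * (bser * expquot)); [ring|].
  rewrite bser_quot. ring.
Qed.
End BernoulliSeries.

Lemma gamF_coef n : gamF bser n = (RtoC (2 * / 2 ^ n - 1) * bser n)%C.
Proof.
  rewrite gamF_series, psB. replace ((1 + 1)%A : psA CA) with (inj (RtoC 2) : psA CA) by apply inj2.
  rewrite (injM_n CA). unfold scale.
  assert (H : Cpow (/ RtoC 2)%C n = RtoC (/ 2 ^ n)).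
  { induction n; simpl; [now rewrite Rinv_1|]. rewrite IHn, Rinv_mult, RtoC_mult, (RtoC_inv 2) by lra. easy. }
  rewrite H. change (@inj CA) with (fun c : C => c). cbv beta. change (amul CA) with Cmult. change (asub CA) with Cminus.
  rewrite RtoC_minus, RtoC_mult. toC. ring.
Qed.
Lemma gamG_coef n : (2 <= n)%nat -> gamG bser n = (RtoC 2 * bser n)%C.
Proof.
  intro Hn. rewrite gamG_series, psD. replace ((1 + 1)%A : psA CA) with (inj (RtoC 2) : psA CA) by apply inj2.
  rewrite (injM_n CA). destruct n as [|[|n]]; try lia. change (@eq C (RtoC 2 * bser (S (S n)) + RtoC 0)%C (RtoC 2 * bser (S (S n)))%C). ring.
Qed.

(** * Complex derivatives *)

Notation Cd := (is_derive (K := C_AbsRing) (V := C_NormedModule)).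

(** C carries two uniform structures, the product one and that of the modulus, in which complex
    derivatives are taken. Their balls differ by at most a factor sqrt 2. *)
Lemma C_locally_disc (z : C) (P : C -> Prop) d : 0 < d ->
  (forall z', Cmod (z' - z)%C < d -> P z') -> locally (T := C_UniformSpace) z P.
Proof.
  intros Hd H. exists (mkposreal (d / 2) (Rdiv_lt_0_compat _ _ Hd Rlt_0_2)). intros [a b] [H1 H2]. apply H.
  unfold ball, AbsRing_ball, abs, minus, plus, opp in H1, H2; simpl in H1, H2.
  unfold ball, AbsRing_ball, abs, minus, plus, opp in H1, H2; simpl in H1, H2.
  eapply Rle_lt_trans; [apply Cmod_2Rmax|]. destruct z as [x y]. simpl in *.
  assert (S2 : sqrt 2 < 2).
  { replace 2 with (sqrt (2 * 2)) at 2 by (apply sqrt_square; lra). apply sqrt_lt_1; lra. }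
  assert (S0 := sqrt_lt_R0 2 Rlt_0_2).
  apply Rlt_le_trans with (2 * (d / 2)); [|lra].
  apply Rmult_le_0_lt_compat; try lra.
  - eapply Rle_trans; [apply Rabs_pos|apply Rmax_l].
  - apply Rmax_lub_lt; assumption.
Qed.

Lemma C_disc_locally (z : C) (P : C -> Prop) : locally (T := C_UniformSpace) z P ->
  exists d, 0 < d /\ forall z', Cmod (z' - z)%C < d -> P z'.
Proof.
  intros [d Hd]. exists d. split; [apply cond_pos|]. intros z' H. apply Hd.
  assert (M := Rmax_Cmod (z' - z)%C). destruct z as [x y], z' as [x' y']. simpl in *.
  split; unfold ball; simpl; unfold AbsRing_ball, abs, minus, plus, opp; simpl;
    (eapply Rle_lt_trans; [|exact H]); (eapply Rle_trans; [|exact M]); [apply Rmax_l|apply Rmax_r].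
Qed.

Lemma locally_absring (z : C) (P : C -> Prop) :
  locally (T := AbsRing_UniformSpace C_AbsRing) z P <-> locally (T := C_UniformSpace) z P.
Proof.
  split.
  - intros [d Hd]. apply (C_locally_disc z P d); [apply cond_pos|]. intros z' H. apply Hd. exact H.
  - intro H. apply C_disc_locally in H. destruct H as (d & Hd & H). exists (mkposreal d Hd). intros z' Hz. apply H, Hz.
Qed.

Lemma Cd_eps f z l : Cd f z l <-> forall eps, 0 < eps -> exists d, 0 < d /\ forall z', Cmod (z' - z)%C < d ->
  Cmod (f z' - f z - l * (z' - z))%C <= eps * Cmod (z' - z)%C.
Proof.
  split.
  - intros [_ H] eps Heps. specialize (H z (fun P HP => HP) (mkposreal eps Heps)).
    destruct H as [d Hd]. exists d. split; [apply cond_pos|]. intros z' Hz.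
    specialize (Hd z' Hz). unfold minus, plus, opp, scal in Hd; simpl in Hd.
    unfold mult in Hd; simpl in Hd. unfold Cminus. replace (l * (z' + - z))%C with ((z' + - z) * l)%C by ring. exact Hd.
  - intro H. split; [apply is_linear_scal_l|]. intros y Hy eps.
    apply (is_filter_lim_locally_unique (V := AbsRing_NormedModule C_AbsRing)) in Hy. subst y.
    destruct (H eps (cond_pos eps)) as (d & Hd & Hz). exists (mkposreal d Hd). intros z' Hz'.
    specialize (Hz z' Hz'). unfold minus, plus, opp, scal; simpl. unfold mult; simpl.
    unfold Cminus in Hz. replace (l * (z' + - z))%C with ((z' + - z) * l)%C in Hz by ring. exact Hz.
Qed.

Lemma Cd_unique f z l l' : Cd f z l -> Cd f z l' -> l = l'.
Proof. intros H H'. apply is_C_derive_unique in H, H'. congruence. Qed.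

Lemma Cderiv_eq f z l : Cd f z l -> Cderiv f z = l.
Proof.
  intro H. apply (Cd_unique f z); [|exact H]. unfold Cderiv. apply epsilon_spec. now exists l.
Qed.

Lemma Cd_ext_disc f g z l d : 0 < d -> (forall z', Cmod (z' - z)%C < d -> f z' = g z') -> Cd f z l -> Cd g z l.
Proof.
  intros Hd H. apply is_derive_ext_loc. apply locally_absring, (C_locally_disc z _ d Hd). exact H.
Qed.

Lemma Cderiv_ext_disc f g z d : 0 < d -> (forall z', Cmod (z' - z)%C < d -> f z' = g z') -> Cderiv f z = Cderiv g z.
Proof.
  intros Hd H. unfold Cderiv. f_equal. extensionality l. apply propositional_extensionality.
  split; apply Cd_ext_disc with d; trivial. intros z' Hz. symmetry. now apply H.
Qed.

Lemma Cd_const (c : C) z : Cd (fun _ => c) z (RtoC 0).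
Proof. apply Cd_eps. intros eps He. exists 1. split; [lra|]. intros z' _.
  replace (c - c - 0 * (z' - z))%C with (RtoC 0) by ring. rewrite Cmod_0. apply Rmult_le_pos; [lra|apply Cmod_ge_0]. Qed.
Lemma Cd_id z : Cd (fun x => x) z (RtoC 1).
Proof. apply Cd_eps. intros eps He. exists 1. split; [lra|]. intros z' _.
  replace (z' - z - 1 * (z' - z))%C with (RtoC 0) by ring. rewrite Cmod_0. apply Rmult_le_pos; [lra|apply Cmod_ge_0]. Qed.
Lemma Cd_plus f g z a b : Cd f z a -> Cd g z b -> Cd (fun x => f x + g x)%C z (a + b)%C.
Proof. apply (is_derive_plus (K := C_AbsRing) (V := C_NormedModule)). Qed.
Lemma Cd_minus f g z a b : Cd f z a -> Cd g z b -> Cd (fun x => f x - g x)%C z (a - b)%C.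
Proof. apply (is_derive_minus (K := C_AbsRing) (V := C_NormedModule)). Qed.

Lemma Cd_lip f z l : Cd f z l -> exists d, 0 < d /\ forall z', Cmod (z' - z)%C < d ->
  Cmod (f z' - f z)%C <= (Cmod l + 1) * Cmod (z' - z)%C.
Proof.
  intro H. destruct (proj1 (Cd_eps f z l) H 1 Rlt_0_1) as (d & Hd & Hz). exists d. split; [easy|].
  intros z' Hz'. specialize (Hz z' Hz').
  replace (f z' - f z)%C with (l * (z' - z) + (f z' - f z - l * (z' - z)))%C by ring.
  eapply Rle_trans; [apply Cmod_triangle|]. rewrite Cmod_mult. lra.
Qed.

Lemma Cd_continuous f z l : Cd f z l -> continuous (T := C_UniformSpace) (U := C_UniformSpace) f z.
Proof.
  intro H. destruct (Cd_lip f z l H) as (d & Hd & Hz). intros P HP. apply C_disc_locally in HP. destruct HP as (e & He & HP).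
  assert (HK : 0 < Cmod l + 1) by (assert (h := Cmod_ge_0 l); lra).
  apply (C_locally_disc z _ (Rmin d (e / (Cmod l + 1)))).
  - apply Rmin_pos; [easy|]. now apply Rdiv_lt_0_compat.
  - intros z' Hz'. apply HP. eapply Rle_lt_trans; [apply Hz|].
    + eapply Rlt_le_trans; [exact Hz'|apply Rmin_l].
    + apply Rlt_le_trans with ((Cmod l + 1) * (e / (Cmod l + 1))).
      * apply Rmult_lt_compat_l; [easy|]. eapply Rlt_le_trans; [exact Hz'|apply Rmin_r].
      * right. field. lra.
Qed.

Lemma Cd_mult f g z a b : Cd f z a -> Cd g z b -> Cd (fun x => f x * g x)%C z (a * g z + f z * b)%C.
Proof.
  intros Hf Hg. apply Cd_eps. intros eps He.
  set (K := Cmod (f z) + Cmod (g z) + Cmod a + 1).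
  assert (P1 := Cmod_ge_0 (f z)). assert (P2 := Cmod_ge_0 (g z)). assert (P3 := Cmod_ge_0 a). assert (P4 := Cmod_ge_0 b).
  assert (HK : 0 < K) by (unfold K; lra).
  destruct (proj1 (Cd_eps f z a) Hf (eps / (3 * K))) as (d1 & Hd1 & H1). { apply Rdiv_lt_0_compat; lra. }
  destruct (proj1 (Cd_eps g z b) Hg (eps / (3 * K))) as (d2 & Hd2 & H2). { apply Rdiv_lt_0_compat; lra. }
  destruct (Cd_lip f z a Hf) as (d3 & Hd3 & H3). destruct (Cd_lip g z b Hg) as (d4 & Hd4 & H4).
  set (d5 := eps / (3 * ((Cmod a + 1) * (Cmod b + 1)))).
  assert (Hab : 0 < (Cmod a + 1) * (Cmod b + 1)) by (apply Rmult_lt_0_compat; lra).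
  assert (Hd5 : 0 < d5) by (apply Rdiv_lt_0_compat; lra).
  exists (Rmin d1 (Rmin d2 (Rmin d3 (Rmin d4 d5)))). split; [repeat apply Rmin_pos; easy|].
  intros z' Hz.
  assert (Z1 : Cmod (z' - z) < d1) by (eapply Rlt_le_trans; [exact Hz|apply Rmin_l]).
  assert (Hz2 := Rlt_le_trans _ _ _ Hz (Rmin_r _ _)).
  assert (Z2 : Cmod (z' - z) < d2) by (eapply Rlt_le_trans; [exact Hz2|apply Rmin_l]).
  assert (Hz3 := Rlt_le_trans _ _ _ Hz2 (Rmin_r _ _)).
  assert (Z3 : Cmod (z' - z) < d3) by (eapply Rlt_le_trans; [exact Hz3|apply Rmin_l]).
  assert (Hz4 := Rlt_le_trans _ _ _ Hz3 (Rmin_r _ _)).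
  assert (Z4 : Cmod (z' - z) < d4) by (eapply Rlt_le_trans; [exact Hz4|apply Rmin_l]).
  assert (Z5 := Rlt_le_trans _ _ _ Hz4 (Rmin_r _ _)).
  specialize (H1 z' Z1). specialize (H2 z' Z2). specialize (H3 z' Z3). specialize (H4 z' Z4).
  set (dz := Cmod (z' - z)) in *. assert (P5 : 0 <= dz) by apply Cmod_ge_0.
  replace (f z' * g z' - f z * g z - (a * g z + f z * b) * (z' - z))%C with
    (((f z' - f z - a * (z' - z)) * g z + f z * (g z' - g z - b * (z' - z))) + (f z' - f z) * (g z' - g z))%C by ring.
  eapply Rle_trans; [apply Cmod_triangle|]. rewrite Cmod_mult.
  eapply Rle_trans; [apply Rplus_le_compat_r, Cmod_triangle|]. rewrite !Cmod_mult.
  assert (T1 : Cmod (f z' - f z - a * (z' - z)) * Cmod (g z) <= eps / 3 * dz).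
  { apply Rle_trans with ((eps / (3 * K) * dz) * K).
    - apply Rmult_le_compat; trivial; [apply Cmod_ge_0|unfold K; lra].
    - right. field. lra. }
  assert (T2 : Cmod (f z) * Cmod (g z' - g z - b * (z' - z)) <= eps / 3 * dz).
  { apply Rle_trans with (K * (eps / (3 * K) * dz)).
    - apply Rmult_le_compat; trivial; [apply Cmod_ge_0|unfold K; lra].
    - right. field. lra. }
  assert (T3 : Cmod (f z' - f z) * Cmod (g z' - g z) <= eps / 3 * dz).
  { apply Rle_trans with (((Cmod a + 1) * dz) * ((Cmod b + 1) * dz)).
    - apply Rmult_le_compat; trivial; apply Cmod_ge_0.
    - apply Rle_trans with (((Cmod a + 1) * (Cmod b + 1)) * d5 * dz).
      + replace ((Cmod a + 1) * dz * ((Cmod b + 1) * dz)) with ((Cmod a + 1) * (Cmod b + 1) * dz * dz) by ring.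
        apply Rmult_le_compat_r; trivial. apply Rmult_le_compat_l; lra.
      + right. unfold d5. field. lra. }
  lra.
Qed.

Lemma Cd_Cinv (c : C) : c <> RtoC 0 -> Cd (fun x => / x)%C c (- (/ c * / c))%C.
Proof.
  intro Hz. apply Cd_eps. intros eps He.
    assert (Pc : 0 < Cmod c) by now apply Cmod_gt_0.
    set (M := Cmod c * Cmod c * Cmod c).
    assert (PM : 0 < M) by (repeat apply Rmult_lt_0_compat; easy).
    exists (Rmin (Cmod c / 2) (eps * M / 2)). split.
    - apply Rmin_pos; [lra|]. assert (0 < eps * M) by now apply Rmult_lt_0_compat. lra.
    - intros y Hy. assert (Y1 := Rlt_le_trans _ _ _ Hy (Rmin_l _ _)). assert (Y2 := Rlt_le_trans _ _ _ Hy (Rmin_r _ _)).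
      assert (Hyc : Cmod c / 2 < Cmod y).
      { assert (T := Cmod_triangle (- (y - c)) y). replace (- (y - c) + y)%C with c in T by ring. rewrite Cmod_opp in T. lra. }
      assert (Hy0 : y <> RtoC 0) by (intro E; rewrite E, Cmod_0 in Hyc; lra).
      replace (/ y - / c - - (/ c * / c) * (y - c))%C with ((y - c) * (y - c) * (/ (c * c * y)))%C by (field; auto).
      rewrite !Cmod_mult, Cmod_inv, !Cmod_mult by (repeat apply Cmult_neq_0; auto).
      set (dy := Cmod (y - c)) in *. assert (Pd : 0 <= dy) by apply Cmod_ge_0.
      apply Rle_trans with (dy * dy * / (M / 2)).
      + apply Rmult_le_compat_l; [now apply Rmult_le_pos|]. apply Rinv_le_contravar; [lra|]. unfold M.
        replace (Cmod c * Cmod c * Cmod c / 2) with (Cmod c * Cmod c * (Cmod c / 2)) by field.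
        apply Rmult_le_compat_l; [apply Rmult_le_pos; lra|lra].
      + apply Rle_trans with (dy * (eps * M / 2) * / (M / 2)).
        * apply Rmult_le_compat_r; [left; apply Rinv_0_lt_compat; lra|]. apply Rmult_le_compat_l; lra.
        * right. field. lra.
Qed.

Lemma Cd_inv f z a : Cd f z a -> f z <> RtoC 0 -> Cd (fun x => / f x)%C z (- (/ f z * / f z * a))%C.
Proof.
  intros Hf Hz. assert (Hi := Cd_Cinv (f z) Hz).
  apply Cd_eps. intros eps He.
  assert (Pa := Cmod_ge_0 a). set (k := (- (/ f z * / f z))%C). assert (Pk := Cmod_ge_0 k).
  destruct (proj1 (Cd_eps _ _ _) Hi (eps / (2 * (Cmod a + 1)))) as (d1 & Hd1 & H1). { apply Rdiv_lt_0_compat; lra. }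
  destruct (proj1 (Cd_eps _ _ _) Hf (eps / (2 * (Cmod k + 1)))) as (d2 & Hd2 & H2). { apply Rdiv_lt_0_compat; lra. }
  destruct (Cd_lip f z a Hf) as (d3 & Hd3 & H3).
  exists (Rmin d2 (Rmin d3 (d1 / (Cmod a + 1)))). split.
  { repeat apply Rmin_pos; trivial. apply Rdiv_lt_0_compat; lra. }
  intros z' Hz'. assert (Z2 := Rlt_le_trans _ _ _ Hz' (Rmin_l _ _)). assert (Z' := Rlt_le_trans _ _ _ Hz' (Rmin_r _ _)).
  assert (Z3 := Rlt_le_trans _ _ _ Z' (Rmin_l _ _)). assert (Z1 := Rlt_le_trans _ _ _ Z' (Rmin_r _ _)).
  specialize (H2 z' Z2). specialize (H3 z' Z3).
  set (dz := Cmod (z' - z)) in *. assert (P5 : 0 <= dz) by apply Cmod_ge_0.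
  assert (Hd : Cmod (f z' - f z) < d1).
  { eapply Rle_lt_trans; [exact H3|]. apply Rlt_le_trans with ((Cmod a + 1) * (d1 / (Cmod a + 1))).
    - apply Rmult_lt_compat_l; lra.
    - right. field. lra. }
  specialize (H1 (f z') Hd). fold k in H1.
  replace (/ f z' - / f z - - (/ f z * / f z * a) * (z' - z))%C with
    ((/ f z' - / f z - k * (f z' - f z)) + k * (f z' - f z - a * (z' - z)))%C by (unfold k; ring).
  eapply Rle_trans; [apply Cmod_triangle|]. rewrite Cmod_mult.
  assert (T1 : Cmod (/ f z' - / f z - k * (f z' - f z)) <= eps / 2 * dz).
  { eapply Rle_trans; [exact H1|]. apply Rle_trans with (eps / (2 * (Cmod a + 1)) * ((Cmod a + 1) * dz)).
    - apply Rmult_le_compat_l; [left; apply Rdiv_lt_0_compat; lra|exact H3].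
    - right. field. lra. }
  assert (T2 : Cmod k * Cmod (f z' - f z - a * (z' - z)) <= eps / 2 * dz).
  { apply Rle_trans with ((Cmod k + 1) * (eps / (2 * (Cmod k + 1)) * dz)).
    - apply Rmult_le_compat; trivial; [apply Cmod_ge_0|lra].
    - right. field. lra. }
  lra.
Qed.

(** * Points of the curve *)

Section Points.
Local Open Scope C_scope.
Notation evC v := (eval gen CA v).

Definition vbase (L S ci c0 W : C) (g : gen) : CA :=
  match g with gl => L | gs => S | gci => ci | gc0 => c0 | gw => W | _ => RtoC 0 end.
(** A point of the curve extended to the inverse generators by total inversion; the relations are
    respected only once the denominators are known not to vanish. *)
Definition mkpt (L S ci c0 W : C) (g : gen) : CA :=
  let v := vbase L S ci c0 W in
  match g with
  | gwi => / W | gli => / L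
  | gy1 => / (evC v eY1 : C) | gy2 => / (evC v eY2 : C)
  | gn1 => / (evC v (eN1 (eneg (V gw))) : C) | gn2 => / (evC v (eN2 (eneg (V gw))) : C)
  | gx1 => / (evC v eX1 : C) | gx2 => / (evC v eX2 : C)
  | _ => v g
  end.

Definition curve (L S ci c0 W : C) : Prop :=
  L * L - ci * L - S * S + c0 * S = RtoC 0 /\
  W * W = RtoC 2 * (L * L) - ci * L + RtoC 2 * (S * S) - c0 * S.

Lemma evC_Y1 L S ci c0 W : evC (vbase L S ci c0 W) eY1 = (c0 - L - S : C). Proof. easy. Qed.
Lemma evC_Y2 L S ci c0 W : evC (vbase L S ci c0 W) eY2 = ((RtoC 0 - c0) - L - (RtoC 0 - S) : C). Proof. easy. Qed.
Lemma evC_N1 L S ci c0 W : evC (vbase L S ci c0 W) (eN1 (eneg (V gw))) =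
  ((ci - c0) * ((RtoC 0 - W) - L + S) - (ci - L - S) * (c0 - L - S) : C). Proof. easy. Qed.
Lemma evC_N2 L S ci c0 W : evC (vbase L S ci c0 W) (eN2 (eneg (V gw))) =
  ((ci - (RtoC 0 - c0)) * ((RtoC 0 - W) - L + (RtoC 0 - S)) - (ci - L - (RtoC 0 - S)) * ((RtoC 0 - c0) - L - (RtoC 0 - S)) : C). Proof. easy. Qed.

Section Valid.
Variables L S ci c0 W : C.
Notation v := (vbase L S ci c0 W).
Notation pt := (mkpt L S ci c0 W).
Hypothesis Hc : curve L S ci c0 W.
Hypothesis HW : W <> RtoC 0.
Hypothesis HL : L <> RtoC 0.
Hypothesis HY1 : (evC v eY1 : C) <> RtoC 0.
Hypothesis HY2 : (evC v eY2 : C) <> RtoC 0.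
Hypothesis HN1 : (evC v (eN1 (eneg (V gw))) : C) <> RtoC 0.
Hypothesis HN2 : (evC v (eN2 (eneg (V gw))) : C) <> RtoC 0.

Lemma valid_gen lv :
  (lv = Generic -> (evC v eX1 : C) <> RtoC 0 /\ (evC v eX2 : C) <> RtoC 0) ->
  (lv = Pole -> S = RtoC 0 /\ L = ci /\ W = ci) ->
  forall e f, rel lv e f -> evC pt e = evC pt f.
Proof.
  intros Hg Hp e f H. destruct Hc as [HG HQ]. destruct H as [ | | | | | | | |E|E|E|E|E].
  - exact HG.
  - change (W * W = (RtoC 1 + RtoC 1) * (L * L) - ci * L + (RtoC 1 + RtoC 1) * (S * S) - c0 * S).
    rewrite HQ. replace (RtoC 2) with (RtoC 1 + RtoC 1) by (rewrite <- RtoC_plus; f_equal; lra). ring.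
  - apply (Cinv_r W HW).
  - apply (Cinv_r L HL).
  - apply (Cinv_r _ HY1).
  - apply (Cinv_r _ HY2).
  - apply (Cinv_r _ HN1).
  - apply (Cinv_r _ HN2).
  - apply (Cinv_r _ (proj1 (Hg E))).
  - apply (Cinv_r _ (proj2 (Hg E))).
  - apply (Hp E).
  - apply (Hp E).
  - apply (Hp E).
Qed.
End Valid.

(** Numerical form of [conj_norm], which keeps N(- W) away from 0 wherever X and Y are nonzero. *)
Lemma curve_norm L S ci c0 W : curve L S ci c0 W ->
  ((ci - c0) * ((RtoC 0 - W) - L + S) - (ci - L - S) * (c0 - L - S)) *
  ((ci - c0) * (W - L + S) - (ci - L - S) * (c0 - L - S))
  = ((ci - L - S) * (c0 - L - S)) * ((ci - L - S) * (c0 - L - S)).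
Proof.
  intros [HG HW].
  transitivity (((ci - L - S) * (c0 - L - S)) * ((ci - L - S) * (c0 - L - S))
    - (ci - c0) * (ci - c0) * (W * W - (RtoC 2 * (L * L) - ci * L + RtoC 2 * (S * S) - c0 * S))
    + (ci - c0) * (RtoC 2 * L + RtoC 2 * S - ci - c0) * (L * L - ci * L - S * S + c0 * S)).
  - ring.
  - rewrite HG, HW. ring.
Qed.

(** On the curve L X = S Y, so X and Y can only vanish together, and X - Y = c_inf - c_0. *)
Lemma curve_XY L S ci c0 : L * L - ci * L - S * S + c0 * S = RtoC 0 -> L <> RtoC 0 -> S <> RtoC 0 -> ci - c0 <> RtoC 0 ->
  (ci - L - S) <> RtoC 0 /\ (c0 - L - S) <> RtoC 0.
Proof.
  intros HG HL HS Hm.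
  assert (E : L * (ci - L - S) = S * (c0 - L - S)).
  { transitivity (S * (c0 - L - S) - (L * L - ci * L - S * S + c0 * S)); [ring|]. rewrite HG. ring. }
  assert (K : forall a b : C, a * b = RtoC 0 -> a <> RtoC 0 -> b = RtoC 0).
  { intros a b H Ha. destruct (Ceq_dec b (RtoC 0)) as [|Hb]; trivial. now apply (Cmult_neq_0 a b Ha) in Hb. }
  split; intro H; apply Hm.
  - assert (H2 : c0 - L - S = RtoC 0) by (apply (K S); trivial; rewrite <- E, H; ring).
    transitivity ((ci - L - S) - (c0 - L - S)); [ring|]. rewrite H, H2. ring.
  - assert (H2 : ci - L - S = RtoC 0) by (apply (K L); trivial; rewrite E, H; ring).
    transitivity ((ci - L - S) - (c0 - L - S)); [ring|]. rewrite H, H2. ring.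
Qed.

Lemma valid_generic L S ci c0 W lv : curve L S ci c0 W -> W <> RtoC 0 -> L <> RtoC 0 -> S <> RtoC 0 ->
  ci * ci - c0 * c0 <> RtoC 0 -> lv <> Pole -> forall e f, rel lv e f -> evC (mkpt L S ci c0 W) e = evC (mkpt L S ci c0 W) f.
Proof.
  intros Hc HW HL HS Hm Hlv.
  assert (Hm1 : ci - c0 <> RtoC 0) by (intro E; apply Hm; transitivity ((ci - c0) * (ci + c0)); [ring|rewrite E; ring]).
  assert (Hm2 : ci - (RtoC 0 - c0) <> RtoC 0) by (intro E; apply Hm; transitivity ((ci - c0) * (ci - (RtoC 0 - c0))); [ring|rewrite E; ring]).
  destruct (curve_XY L S ci c0 (proj1 Hc) HL HS Hm1) as [X1 Y1].
  assert (Hc2 : curve L (RtoC 0 - S) ci (RtoC 0 - c0) W).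
  { destruct Hc as [A B]. split; [etransitivity; [|exact A]; ring|rewrite B; ring]. }
  assert (HS2 : RtoC 0 - S <> RtoC 0) by (intro E; apply HS; transitivity (RtoC 0 - (RtoC 0 - S)); [ring|rewrite E; ring]).
  destruct (curve_XY L (RtoC 0 - S) ci (RtoC 0 - c0) (proj1 Hc2) HL HS2 Hm2) as [X2 Y2].
  apply valid_gen; trivial.
  - rewrite evC_N1. intro E. assert (N := curve_norm _ _ _ _ _ Hc). rewrite E, Cmult_0_l in N. symmetry in N. revert N.
    repeat apply Cmult_neq_0; assumption.
  - rewrite evC_N2. intro E. assert (N := curve_norm _ _ _ _ _ Hc2). rewrite E, Cmult_0_l in N. symmetry in N. revert N.
    repeat apply Cmult_neq_0; assumption.
  - now split.
  - now intro.
Qed.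

Lemma valid_pole ci c0 : ci <> RtoC 0 -> ci * ci - c0 * c0 <> RtoC 0 ->
  forall e f, rel Pole e f -> evC (mkpt ci (RtoC 0) ci c0 ci) e = evC (mkpt ci (RtoC 0) ci c0 ci) f.
Proof.
  intros Hci Hm.
  assert (Hm1 : ci - c0 <> RtoC 0) by (intro E; apply Hm; transitivity ((ci - c0) * (ci + c0)); [ring|rewrite E; ring]).
  assert (Hm2 : ci + c0 <> RtoC 0) by (intro E; apply Hm; transitivity ((ci - c0) * (ci + c0)); [ring|rewrite E; ring]).
  assert (H2 : RtoC 2 <> RtoC 0) by (intro E; apply RtoC_inj in E; lra).
  apply valid_gen; trivial; try easy.
  - split; [ring|]. replace (RtoC 2) with (RtoC 1 + RtoC 1) by (rewrite <- RtoC_plus; f_equal; lra). ring.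
  - rewrite evC_Y1. intro E. apply Hm1. transitivity (RtoC 0 - (c0 - ci - RtoC 0)); [ring|rewrite E; ring].
  - rewrite evC_Y2. intro E. apply Hm2. transitivity (RtoC 0 - (RtoC 0 - c0 - ci - (RtoC 0 - RtoC 0))); [ring|rewrite E; ring].
  - rewrite evC_N1. intro E. apply (Cmult_neq_0 _ _ (Cmult_neq_0 _ _ H2 Hm1) Hci).
    transitivity (RtoC 0 - RtoC 0); [rewrite <- E at 2|ring].
    replace (RtoC 2) with (RtoC 1 + RtoC 1) by (rewrite <- RtoC_plus; f_equal; lra). ring.
  - rewrite evC_N2. intro E. apply (Cmult_neq_0 _ _ (Cmult_neq_0 _ _ H2 Hm2) Hci).
    transitivity (RtoC 0 - RtoC 0); [rewrite <- E at 2|ring].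
    replace (RtoC 2) with (RtoC 1 + RtoC 1) by (rewrite <- RtoC_plus; f_equal; lra). ring.
Qed.

(* Evaluation of a presented element, meaningful when the valuation respects the relations. *)
Definition evr (lv : level) (u : gen -> CA) (x : AL lv) : C := eval gen CA u (proj1_sig x).

Section Evr.
Variables (lv : level) (u : gen -> CA).
Hypothesis Hu : forall e f, rel lv e f -> evC u e = evC u f.
Let th := lift gen (rel lv) CA u Hu.
Lemma evr_gv g : evr lv u (X lv g) = u g. Proof. apply (lift_gv _ _ CA u Hu). Qed.
Lemma evrD x y : evr lv u (x + y)%A = evr lv u x + evr lv u y. Proof. apply (hmD th). Qed.
Lemma evrM x y : evr lv u (x * y)%A = evr lv u x * evr lv u y. Proof. apply (hmM th). Qed.
Lemma evrB x y : evr lv u (x - y)%A = evr lv u x - evr lv u y. Proof. apply (hmB _ _ th). Qed.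
Lemma evrN x : evr lv u (- x)%A = - evr lv u x. Proof. apply (hmN _ _ th). Qed.
Lemma evrI c : evr lv u (inj c) = c. Proof. apply (hmI th). Qed.
End Evr.

Lemma mkpt_conj L S ci c0 W (HG : forall e f, rel Generic e f -> evC (mkpt L S ci c0 W) e = evC (mkpt L S ci c0 W) f)
  (HL : forall e f, rel Local_ e f -> evC (mkpt L S ci c0 (- W)) e = evC (mkpt L S ci c0 (- W)) f) x :
  evr Generic (mkpt L S ci c0 W) (conj x) = evr Local_ (mkpt L S ci c0 (- W)) x.
Proof.
  set (u := mkpt L S ci c0 W) in *. set (u' := mkpt L S ci c0 (- W)) in *.
  revert x. apply presented_ind.
  - assert (Inv : forall a b b' : C, a * b = RtoC 1 -> a * b' = RtoC 1 -> b = b').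
    { intros a b b' H1 H2. transitivity (b * (a * b')); [rewrite H2; ring|]. transitivity ((a * b) * b'); [ring|]. rewrite H1; ring. }
    assert (base : forall g, match g with gwi | gn1 | gn2 => True | _ => evr Generic u (conj (X Local_ g)) = evr Local_ u' (X Local_ g) end).
    { intro g. rewrite conj_gv, (evr_gv _ _ HL). destruct g; trivial; cbn [vconj]; rewrite ?(evrN _ _ HG), ?(evr_gv _ _ HG); try reflexivity. }
    assert (Hn : forall e, evr Generic u (conj (eval gen _ (X Local_) e)) = evr Local_ u' (eval gen _ (X Local_) e) ->
       forall g, rel Local_ (emul e (V g)) e1 -> evr Generic u (conj (X Local_ g)) = evr Local_ u' (X Local_ g)).
    { intros e He g Hr. assert (H1 := relE Local_ _ _ Hr). rewrite ev_e1 in H1.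
      apply (Inv (evr Local_ u' (eval gen _ (X Local_) e))).
      - rewrite <- He, <- (evrM _ _ HG), <- hmM. change (X Local_ g) with (eval gen _ (X Local_) (V g)).
        change (amul (AL Local_) (eval gen _ (X Local_) e) (eval gen _ (X Local_) (V g))) with (eval gen _ (X Local_) (emul e (V g))).
        rewrite H1, hm1. rewrite <- (inj1 (AL Generic)). apply (evrI _ _ HG).
      - rewrite <- (evrM _ _ HL). change (X Local_ g) with (eval gen _ (X Local_) (V g)).
        change (amul (AL Local_) (eval gen _ (X Local_) e) (eval gen _ (X Local_) (V g))) with (eval gen _ (X Local_) (emul e (V g))).
        rewrite H1. rewrite <- (inj1 (AL Local_)). apply (evrI _ _ HL). }
    intro g. destruct g; try exact (base gl); try exact (base gs); try exact (base gci); try exact (base gc0); try exact (base gw);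
      try exact (base gli); try exact (base gy1); try exact (base gy2); try exact (base gx1); try exact (base gx2).
    + apply (Hn (V gw) (base gw) gwi (r_wi _)).
    + apply (Hn (eN1 (eneg (V gw)))); [|apply r_n1]. eval_unfold.
      repeat rewrite ?hmB, ?hmD, ?hmM, ?hmI, ?(evrB _ _ HG), ?(evrD _ _ HG), ?(evrM _ _ HG), ?(evrI _ _ HG), ?(evrB _ _ HL), ?(evrD _ _ HL), ?(evrM _ _ HL), ?(evrI _ _ HL).
      rewrite (base gl), (base gs), (base gci), (base gc0), (base gw). easy.
    + apply (Hn (eN2 (eneg (V gw)))); [|apply r_n2]. eval_unfold.
      repeat rewrite ?hmB, ?hmD, ?hmM, ?hmI, ?(evrB _ _ HG), ?(evrD _ _ HG), ?(evrM _ _ HG), ?(evrI _ _ HG), ?(evrB _ _ HL), ?(evrD _ _ HL), ?(evrM _ _ HL), ?(evrI _ _ HL).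
      rewrite (base gl), (base gs), (base gci), (base gc0), (base gw). easy.
  - intro z. rewrite hmI, (evrI _ _ HG), (evrI _ _ HL). easy.
  - intros a b Ha Hb. now rewrite hmD, (evrD _ _ HG), (evrD _ _ HL), Ha, Hb.
  - intros a b Ha Hb. now rewrite hmB, (evrB _ _ HG), (evrB _ _ HL), Ha, Hb.
  - intros a b Ha Hb. now rewrite hmM, (evrM _ _ HG), (evrM _ _ HL), Ha, Hb.
Qed.

Lemma mkpt_incl lv u (HG : forall e f, rel lv e f -> evC u e = evC u f) x :
  evr lv u (incl lv x) = evr Local_ u x.
Proof.
  assert (HL : forall e f, rel Local_ e f -> evC u e = evC u f).
  { intros e f H. apply HG. destruct H; try discriminate; constructor. }
  revert x. apply presented_ind; intros; rewrite ?hmI, ?hmD, ?hmB, ?hmM, ?(evrI _ _ HG), ?(evrD _ _ HG), ?(evrB _ _ HG), ?(evrM _ _ HG),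
    ?(evrI _ _ HL), ?(evrD _ _ HL), ?(evrB _ _ HL), ?(evrM _ _ HL), ?H, ?H0; trivial.
  rewrite incl_gv, (evr_gv _ _ HG), (evr_gv _ _ HL). easy.
Qed.
End Points.

Definition ell (L S ci c0 W : C) : C := ((RtoC 2 * (S * S) - c0 * S) * (/ W * / W))%C.

Section EvrDerivative.
Local Open Scope C_scope.
Variables (ci c0 z0 : C) (d : R) (L S W : C -> C).
Notation disc z := (Cmod (z - z0)%C < d).
Hypothesis Hd : 0 < d.
Hypothesis Hm : ci * ci - c0 * c0 <> RtoC 0.
Hypothesis Hz : forall z, disc z -> z <> RtoC 0.
Hypothesis Hcurve : forall z, disc z -> curve (L z) (S z) ci c0 (W z).
Hypothesis HL0 : forall z, disc z -> L z <> RtoC 0.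
Hypothesis HS0 : forall z, disc z -> S z <> RtoC 0.
Hypothesis HW0 : forall z, disc z -> W z <> RtoC 0.
Hypothesis HL : forall z, disc z -> Cd L z (ell (L z) (S z) ci c0 (W z) * L z / z).
Hypothesis HS : forall z, disc z -> Cd S z ((RtoC 1 - ell (L z) (S z) ci c0 (W z)) * S z / z).
Hypothesis HW : forall z, disc z -> exists w : C, Cd W z w.

Let u z := mkpt (L z) (S z) ci c0 (W z).
Notation A := (AL Local_).
Notation D := (Dt Local_).

Lemma valid_disc lv z : disc z -> lv <> Pole -> forall e f, rel lv e f -> eval gen CA (u z) e = eval gen CA (u z) f.
Proof. intros H Hlv. apply valid_generic; auto. Qed.
Lemma valid_disc_local z : disc z -> forall e f, rel Local_ e f -> eval gen CA (u z) e = eval gen CA (u z) f.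
Proof. intro H. now apply valid_disc. Qed.

Lemma disc_open z : disc z -> exists e, 0 < e /\ forall z', (Cmod (z' - z)%C < e)%R -> disc z'.
Proof.
  intro H. exists (d - Cmod (z - z0))%R. split; [lra|]. intros z' H'.
  replace (z' - z0)%C with ((z' - z) + (z - z0))%C by ring. eapply Rle_lt_trans; [apply Cmod_triangle|]. lra.
Qed.

Notation Ev z x := (evr Local_ (u z) x).
Let Q (x : A) := forall z, disc z -> Cd (fun y => Ev y x) z (Ev z (D x) / z).

Lemma Cd_val f z a b : Cd f z a -> a = b -> Cd f z b.
Proof. now intros H <-. Qed.
Lemma Cd_ext f g z a : disc z -> (forall y, disc y -> f y = g y) -> Cd f z a -> Cd g z a.
Proof. intros Hzd H. destruct (disc_open z Hzd) as (e & He & Ho). apply Cd_ext_disc with e; auto. Qed.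

Lemma QI c : Q (inj c).
Proof. intros z Hzd. apply (Cd_ext (fun _ => c)); trivial.
  - intros y Hy. symmetry. apply (evrI _ _ (valid_disc_local y Hy)).
  - eapply Cd_val; [apply Cd_const|]. rewrite dvI, <- (inj0 A), (evrI _ _ (valid_disc_local z Hzd)). toC; field; auto. Qed.
Lemma QD x y : Q x -> Q y -> Q (x + y)%A.
Proof. intros Hx Hy z Hzd. apply (Cd_ext (fun t => Ev t x + Ev t y)); trivial.
  - intros t Ht. symmetry. apply (evrD _ _ (valid_disc_local t Ht)).
  - eapply Cd_val; [apply Cd_plus; [apply Hx|apply Hy]; trivial|].
    rewrite dvD, (evrD _ _ (valid_disc_local z Hzd)). toC; field; auto. Qed.
Lemma QB x y : Q x -> Q y -> Q (x - y)%A.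
Proof. intros Hx Hy z Hzd. apply (Cd_ext (fun t => Ev t x - Ev t y)); trivial.
  - intros t Ht. symmetry. apply (evrB _ _ (valid_disc_local t Ht)).
  - eapply Cd_val; [apply Cd_minus; [apply Hx|apply Hy]; trivial|].
    rewrite dvB, (evrB _ _ (valid_disc_local z Hzd)). toC; field; auto. Qed.
Lemma QM x y : Q x -> Q y -> Q (x * y)%A.
Proof. intros Hx Hy z Hzd. apply (Cd_ext (fun t => Ev t x * Ev t y)); trivial.
  - intros t Ht. symmetry. apply (evrM _ _ (valid_disc_local t Ht)).
  - eapply Cd_val; [apply Cd_mult; [apply Hx|apply Hy]; trivial|].
    rewrite dvM, (evrD _ _ (valid_disc_local z Hzd)), !(evrM _ _ (valid_disc_local z Hzd)). toC; field; auto. Qed.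

Lemma evr_one z : disc z -> Ev z (1%A : A) = RtoC 1.
Proof. intro H. rewrite <- (inj1 A). apply (evrI _ _ (valid_disc_local z H)). Qed.

Lemma Cinv_eq (a b : C) : a * b = RtoC 1 -> a <> RtoC 0 /\ b = / a.
Proof.
  intro H. assert (Ha : a <> RtoC 0) by (intro E; rewrite E, Cmult_0_l in H; apply RtoC_inj in H; lra).
  split; trivial. transitivity (/ a * (a * b)); [field; auto|]. rewrite H. ring.
Qed.

(** Meant for [gx1] and [gx2]: they are inverse to X at each point of the disc, but not in the local
    ring. *)
Lemma Qinv_num (x y : A) : (forall z, disc z -> Ev z x * Ev z y = RtoC 1) -> D y = (- (y * y * D x))%A -> Q x -> Q y.
Proof.
  intros H HDy Hx z Hzd. apply (Cd_ext (fun t => / Ev t x)); trivial.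
  - intros t Ht. symmetry. apply Cinv_eq, H, Ht.
  - destruct (Cinv_eq _ _ (H z Hzd)) as [Hne Hy].
    eapply Cd_val; [apply Cd_inv; [apply Hx|]; trivial|].
    rewrite HDy, (evrN _ _ (valid_disc_local z Hzd)), !(evrM _ _ (valid_disc_local z Hzd)), Hy. toC; field; auto.
Qed.
Lemma Qinv (x y : A) : (x * y)%A = 1%A -> Q x -> Q y.
Proof.
  intros H. apply Qinv_num; [|now apply dv_inv].
  intros z Hzd. rewrite <- (evrM _ _ (valid_disc_local z Hzd)), H. now apply evr_one.
Qed.

Lemma Ev_gv z g : disc z -> Ev z (X Local_ g) = u z g.
Proof. intro H. apply (evr_gv _ _ (valid_disc_local z H)). Qed.
Lemma two_C : RtoC 2 = RtoC 1 + RtoC 1.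
Proof. now rewrite <- RtoC_plus. Qed.

Lemma Ev_ell z : disc z -> Ev z (ell0 Local_) = ell (L z) (S z) ci c0 (W z).
Proof.
  intro H. assert (Hv := valid_disc_local z H). unfold ell0, ell.
  rewrite !(evrM _ _ Hv), (evrB _ _ Hv), !(evrM _ _ Hv), (evrD _ _ Hv), !Ev_gv, evr_one by trivial. rewrite two_C. easy.
Qed.
Lemma Ql : Q (X Local_ gl).
Proof.
  intros z Hzd. apply (Cd_ext L); trivial; [intros y Hy; now rewrite Ev_gv|].
  eapply Cd_val; [apply HL; trivial|]. rewrite D_l, (evrM _ _ (valid_disc_local z Hzd)), Ev_gv, Ev_ell by trivial. easy.
Qed.
Lemma Qs : Q (X Local_ gs).
Proof.
  intros z Hzd. apply (Cd_ext S); trivial; [intros y Hy; now rewrite Ev_gv|].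
  eapply Cd_val; [apply HS; trivial|].
  rewrite D_s, (evrM _ _ (valid_disc_local z Hzd)), (evrB _ _ (valid_disc_local z Hzd)), Ev_gv, Ev_ell, evr_one by trivial. easy.
Qed.
Lemma Qci : Q (X Local_ gci).
Proof.
  intros z Hzd. apply (Cd_ext (fun _ => ci)); trivial; [intros y Hy; now rewrite Ev_gv|].
  eapply Cd_val; [apply Cd_const|]. rewrite D_ci, <- (inj0 A), (evrI _ _ (valid_disc_local z Hzd)). toC; field; auto.
Qed.
Lemma Qc0 : Q (X Local_ gc0).
Proof.
  intros z Hzd. apply (Cd_ext (fun _ => c0)); trivial; [intros y Hy; now rewrite Ev_gv|].
  eapply Cd_val; [apply Cd_const|]. rewrite D_c0, <- (inj0 A), (evrI _ _ (valid_disc_local z Hzd)). toC; field; auto.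
Qed.
Lemma Qw : Q (X Local_ gw).
Proof.
  assert (Q2 : Q (1 + 1)%A) by (apply QD; rewrite <- (inj1 A); apply QI).
  assert (Qq : Q (quadQ (X Local_ gci) (X Local_ gc0) (X Local_ gl) (X Local_ gs))).
  { assert (h1 := Ql). assert (h2 := Qs). assert (h3 := Qci). assert (h4 := Qc0).
    exact (QB _ _ (QD _ _ (QB _ _ (QM _ _ Q2 (QM _ _ h1 h1)) (QM _ _ h3 h1)) (QM _ _ Q2 (QM _ _ h2 h2))) (QM _ _ h4 h2)). }
  intros z Hzd. assert (Hv := valid_disc_local z Hzd). destruct (HW z Hzd) as [w Hw].
  apply (Cd_ext W); trivial; [intros y Hy; now rewrite Ev_gv|].
  eapply Cd_val; [exact Hw|].
  assert (E : w * W z + W z * w = Ev z (D (quadQ (X Local_ gci) (X Local_ gc0) (X Local_ gl) (X Local_ gs))) / z).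
  { apply (Cd_unique (fun y => W y * W y) z); [apply Cd_mult; trivial|].
    eapply Cd_ext; [trivial| |apply (Qq z Hzd)]. intros y Hy. rewrite <- (rel_w Local_).
    rewrite (evrM _ _ (valid_disc_local y Hy)), Ev_gv by trivial. easy. }
  rewrite (deriv_sqrt A D _ _ _ (rel_w Local_) (rel_wi Local_)).
  unfold half. rewrite !(evrM _ _ Hv), (evrI _ _ Hv), Ev_gv by trivial. change (u z gwi) with (/ W z).
  assert (N2 : RtoC 2 <> RtoC 0) by (intro H0; apply RtoC_inj in H0; lra).
  assert (E2 : w = (Ev z (D (quadQ (X Local_ gci) (X Local_ gc0) (X Local_ gl) (X Local_ gs))) / z) / (RtoC 2 * W z)).
  { rewrite <- E, two_C. rewrite two_C in N2. toC. field. auto. }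
  rewrite E2. toC. field. auto.
Qed.

(** D is t d/dt on values. It suffices to check generators: l and s by hypothesis, w by
    differentiating w^2 = Q, the inverses by the quotient rule. *)
Lemma evr_deriv x : Q x.
Proof.
  assert (h1 := Ql). assert (h2 := Qs). assert (h3 := Qci). assert (h4 := Qc0). assert (h5 := Qw).
  assert (Qz : Q (inj (RtoC 0))) by apply QI.
  assert (Hr : forall e f, rel Local_ (emul e f) e1 -> (eval gen A (X Local_) e * eval gen A (X Local_) f)%A = 1%A).
  { intros e f H. rewrite <- ev_e1. apply (relE Local_ _ _ H). }
  assert (Hgen : forall z e g, disc z -> rel Generic (emul e (V g)) e1 ->
     Ev z (eval gen A (X Local_) e) * Ev z (X Local_ g) = RtoC 1).
  { intros z e g Hzd H. assert (Hv := valid_disc_local z Hzd).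
    assert (H2 := valid_disc Generic z Hzd ltac:(easy) _ _ H).
    unfold evr in *. change (X Local_ g) with (eval gen A (X Local_) (V g)).
    assert (Ee : forall t, eval gen CA (u z) (proj1_sig (eval gen A (X Local_) t)) = eval gen CA (u z) t).
    { intro t. rewrite eval_gv. apply eval_cls. exact Hv. }
    rewrite !Ee. exact H2. }
  revert x. apply presented_ind; [|intro; apply QI|intros; now apply QD|intros; now apply QB|intros; now apply QM].
  assert (QY1 : Q (eval gen A (X Local_) eY1)) by exact (QB _ _ (QB _ _ h4 h1) h2).
  assert (QY2 : Q (eval gen A (X Local_) eY2)) by exact (QB _ _ (QB _ _ (QB _ _ Qz h4) h1) (QB _ _ Qz h2)).
  assert (QX1 : Q (eval gen A (X Local_) eX1)) by exact (QB _ _ (QB _ _ h3 h1) h2).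
  assert (QX2 : Q (eval gen A (X Local_) eX2)) by exact (QB _ _ (QB _ _ h3 h1) (QB _ _ Qz h2)).
  intro g; destruct g; trivial.
  - apply (Qinv _ _ (rel_wi _) h5).
  - apply (Qinv _ _ (rel_li _) h1).
  - apply (Qinv _ _ (Hr _ _ (r_y1 _)) QY1).
  - apply (Qinv _ _ (Hr _ _ (r_n1 _))).
    exact (QB _ _ (QM _ _ (QB _ _ h3 h4) (QD _ _ (QB _ _ (QB _ _ Qz h5) h1) h2)) (QM _ _ QX1 QY1)).
  - apply (Qinv_num (eval gen A (X Local_) eX1)); [intros z Hzd; apply Hgen; [trivial|now apply r_x1]|apply mkderiv_x1|exact QX1].
  - apply (Qinv _ _ (Hr _ _ (r_y2 _)) QY2).
  - apply (Qinv _ _ (Hr _ _ (r_n2 _))).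
    exact (QB _ _ (QM _ _ (QB _ _ h3 (QB _ _ Qz h4)) (QD _ _ (QB _ _ (QB _ _ Qz h5) h1) (QB _ _ Qz h2))) (QM _ _ QX2 QY2)).
  - apply (Qinv_num (eval gen A (X Local_) eX2)); [intros z Hzd; apply Hgen; [trivial|now apply r_x2]|apply mkderiv_x2|exact QX2].
Qed.
End EvrDerivative.

(** * Germs of solutions *)

Notation PC := (psA CA).

Lemma smulE (a b : PC) : smul a b = (a * b)%A.
Proof. extensionality n. rewrite smul_psmul. easy. Qed.

Lemma nth_inv_upto a n : forall i, (i <= n)%nat -> nth i (inv_upto a n) (RtoC 0) = sinv a (n - i).
Proof.
  induction n; intros i Hi.
  - assert (i = O) by lia. subst i. easy.
  - destruct i.
    + replace (S n - 0)%nat with (S n) by lia. unfold sinv. simpl. easy.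
    + change (inv_upto a (S n)) with (Cmult (Copp (Cinv (a O))) (csum (fun j => match j with O => RtoC 0
                            | S i => Cmult (a j) (nth i (inv_upto a n) (RtoC 0)) end) (S n)) :: inv_upto a n).
      cbn [nth]. rewrite IHn by lia. f_equal.
Qed.

Lemma sinv_mul (a : PC) : (a O : C) <> RtoC 0 -> (a * sinv a)%A = (1%A : PC).
Proof.
  intro Ha. rewrite <- smulE. extensionality n. unfold smul. destruct n.
  - change (@eq C (a O * / a O)%C (RtoC 1)). field. exact Ha.
  - rewrite csum_first. replace (S n - 0)%nat with (S n) by lia.
    assert (E : sinv a (S n) = (- / a O * csum (fun i => a (S i) * sinv a (n - i)%nat)%C n)%C).
    { change (sinv a (S n)) with (Cmult (Copp (Cinv (a O))) (csum (fun j => match j with O => RtoC 0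
                            | S i => Cmult (a j) (nth i (inv_upto a n) (RtoC 0)) end) (S n))).
      rewrite csum_first, Cplus_0_l. f_equal. apply csum_ext. intros k Hk. now rewrite nth_inv_upto. }
    rewrite E. change ((1%A : PC) (S n)) with (RtoC 0).
    change (csum (fun k => (a (S k) * sinv a (S n - S k)%nat)%C) n) with (csum (fun i => (a (S i) * sinv a (n - i)%nat)%C) n).
    set (T := csum _ n). clearbody T. toC. field. exact Ha.
Qed.

Section Numeric.
Local Open Scope ca_scope.
Add Ring Pr : (ath PC).

Lemma hh2_coef (f : PC) m : (hh * (hh * f)) m = match m with O | S O => RtoC 0 | S (S j) => f j end.
Proof. destruct m as [|[|m]]; [now rewrite hhM0|now rewrite hhMS, hhM0|now rewrite !hhMS]. Qed.
Lemma hh1_coef (f : PC) m : (hh * f) m = match m with O => RtoC 0 | S j => f j end.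
Proof. destruct m as [|m]; [now rewrite hhM0|now rewrite hhMS]. Qed.
Lemma cC (a : C) (f : PC) n : (cst (a : CA) * f) n = (a * f n)%C. Proof. apply (cstM_n CA). Qed.
Lemma psD_C (f g : PC) n : (f + g) n = (f n + g n)%C. Proof. easy. Qed.
Lemma psB_C (f g : PC) n : (f - g) n = (f n - g n)%C. Proof. easy. Qed.
Lemma cstC (a : C) n : cst (a : CA) n = match n with O => a | _ => RtoC 0 end. Proof. now destruct n. Qed.

(** Since l s = t, the inverse of lambda is s / t, and the equations become polynomial in l and
    s. *)
Lemma sinv_of (l s : PC) (z : C) : z <> RtoC 0 -> l * s = cst (z : CA) -> sinv l = cst (/ z : CA)%C * s.
Proof.
  intros Hz Hls.
  assert (Hl0 : (l O : C) <> RtoC 0).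
  { intro E. apply Hz. assert (H := f_equal (fun F : PC => F O) Hls). cbv beta in H. rewrite psM0, E in H.
    change (@eq C (RtoC 0 * s O)%C z) in H. rewrite <- H. ring. }
  apply (inverse_unique PC l); [now apply sinv_mul|].
  transitivity (cst (/ z : CA)%C * (l * s)); [ring|]. rewrite Hls, <- cstM.
  change ((/ z : CA)%C * (z : CA))%A with (/ z * z)%C. rewrite Cinv_l by easy. easy.
Qed.

Variables (ci c0 z : C).
Hypothesis Hz : z <> RtoC 0.
Variables (lam : nat -> C -> C) (l s e dl de : PC).
Hypothesis Hl : forall k, lam k z = l k.
Hypothesis Hdl : forall k, Cderiv (lam k) z = (dl k / z)%C.
Hypothesis E1 : dl = e * l.
Hypothesis E3 : hh * (hh * de) = potG (cst (ci : CA)) (cst (c0 : CA)) l s.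
Hypothesis E4 : l * s = cst (z : CA).

Notation iz := (cst (/ z : CA)%C).
Lemma izz : iz * cst (z : CA) = 1.
Proof. rewrite <- cstM. change ((/ z : CA)%C * (z : CA))%A with (/ z * z)%C. rewrite Cinv_l by easy. easy. Qed.

Lemma LE : (fun k => lam k z) = l. Proof. extensionality k. apply Hl. Qed.
Lemma L1E : (fun k => Cderiv (lam k) z) = iz * dl.
Proof. extensionality k. rewrite Hdl, cC. unfold Cdiv. ring. Qed.

(** Multiplying h^2 D e = [potG] by l / t^2 and using l s = t gives the second-order equation for
    lambda; the factor h^2 is the index shift by 2. *)
Lemma num_painleve : (forall k, Cderiv (Cderiv (lam k)) z = (((de * l + e * dl)%A k - dl k) / (z * z))%C) ->
  painleve_eq ci c0 lam z.
Proof.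
  intros Hddl m. unfold Fser. cbv zeta. rewrite LE, L1E.
  assert (L2E : (fun k => Cderiv (Cderiv (lam k)) z) = iz * iz * (de * l + e * dl - dl)).
  { extensionality k. rewrite Hddl. replace (iz * iz) with (cst (/ z * / z : CA)%C) by (rewrite <- cstM; easy).
    rewrite cC, psB_C. set (p := (de * l + e * dl) k). clearbody p. toC. field. auto. }
  rewrite (sinv_of l s z Hz E4), !smulE.
  set (I := iz * s).
  set (Xs := iz * iz * (de * l + e * dl - dl) - iz * dl * (iz * dl) * I + iz * (iz * dl)).
  transitivity ((iz * iz * (l * l * l) - cst (ci : CA) * (iz * iz * (l * l)) + cst (c0 : CA) * iz - I) m).
  - rewrite psB_C, psD_C, psB_C, cC. replace (iz * iz) with (cst (/ z * / z : CA)%C) by (rewrite <- cstM; easy). rewrite !cC, cstC.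
    set (a := (l * l * l) m). set (b := (l * l) m). clearbody a b. destruct m; toC; field; auto.
  - transitivity ((hh * (hh * Xs)) m).
    + apply (f_equal (fun F : PC => F m)).
      transitivity (iz * iz * l * (hh * (hh * de)) + hh * (hh * (iz * iz * (e * (e * l) - e * (e * l) * (iz * (l * s)))))).
      * rewrite E3, E4, izz. unfold potG, I. transitivity (iz * iz * (l * l * l) - cst (ci : CA) * (iz * iz * (l * l))
          + cst (c0 : CA) * iz * (iz * (l * s)) - iz * s * (iz * (l * s))); [rewrite E4, izz; ring|ring].
      * unfold Xs, I. rewrite E1. ring.
    + rewrite hh2_coef. destruct m as [|[|j]]; trivial. unfold Xs, I. rewrite psD_C, psB_C, cC.
      change (Cderiv (Cderiv (lam j)) z) with ((fun k => Cderiv (Cderiv (lam k)) z) j). rewrite L2E.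
      rewrite Hdl. rewrite cC. unfold Cdiv.
      set (p := (iz * iz * (de * l + e * dl - dl)) j). set (q := (iz * dl * (iz * dl) * (iz * s)) j). clearbody p q. toC. ring.
Qed.

(** The substitution is h t R = sigma + h e. Passing from d/dt to D absorbs the coefficient - 1/t,
    and adding e = D log lambda absorbs 2 lambda'/lambda. *)
Lemma num_riccati (rho : nat -> C -> C) (sg dsg : PC) :
  (forall k, rho k z = ((sg + hh * e)%A k / z)%C) ->
  (forall k, Cderiv (rho k) z = (((dsg + hh * de)%A k - (sg + hh * e)%A k) / (z * z))%C) ->
  sg * sg + hh * dsg = quadQ (cst (ci : CA)) (cst (c0 : CA)) l s ->
  riccati_eq ci c0 lam rho z.
Proof.
  intros Hr Hdr Hric m. cbv zeta. unfold dFser. cbv zeta. rewrite LE, L1E.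
  assert (PE : (fun k => rho k z) = iz * (sg + hh * e)).
  { extensionality k. rewrite Hr, cC. unfold Cdiv. ring. }
  assert (P1E : forall k, Cderiv (rho k) z = (iz * iz * (dsg + hh * de - (sg + hh * e))) k).
  { intro k. rewrite Hdr. replace (iz * iz) with (cst (/ z * / z : CA)%C) by (rewrite <- cstM; easy).
    rewrite cC, psB_C. set (p := (dsg + hh * de) k). set (q := (sg + hh * e) k). clearbody p q. toC. field. auto. }
  rewrite PE, (sinv_of l s z Hz E4), !smulE.
  set (B := iz * dl * (iz * s)).
  assert (BE : B = iz * e).
  { unfold B. rewrite E1. transitivity (iz * e * (iz * (l * s))); [ring|]. rewrite E4, izz. ring. }
  rewrite BE.
  set (As := (1 + 1) * (iz * e) - iz).
  assert (AE : (fun j : nat => (RtoC 2 * (iz * e)%A j - match j with O => / z | _ => RtoC 0 end)%C) = As).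
  { extensionality j. unfold As. replace (1 + 1) with (inj (RtoC 2) : PC) by apply inj2. rewrite psB_C, (injM_n CA), cstC. easy. }
  rewrite AE.
  set (I := iz * s).
  transitivity ((iz * (sg + hh * e) * (iz * (sg + hh * e)) + hh * (iz * iz * (dsg + hh * de - (sg + hh * e)))) m).
  { rewrite psD_C, hh1_coef. destruct m; [easy|]. rewrite P1E. easy. }
  transitivity ((hh * (As * (iz * (sg + hh * e))) +
    (inj (RtoC 3) * (iz * iz * (l * l)) - inj (RtoC 2) * (cst (ci : CA) * (iz * iz * l)) + I * I) - hh * (hh * (iz * e * (iz * e)))) m).
  - apply (f_equal (fun F : PC => F m)).
    replace (inj (RtoC 3) : PC) with (1 + 1 + 1 : PC).
    2:{ replace (RtoC 3) with (RtoC 2 + RtoC 1)%C by (rewrite <- RtoC_plus; f_equal; lra). rewrite injD, inj2, inj1. easy. }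
    rewrite inj2.
    transitivity (iz * iz * (sg * sg + hh * dsg + hh * (hh * de) + (1 + 1) * (hh * e * sg) + hh * hh * (e * e) - hh * sg - hh * hh * e)); [ring|].
    rewrite Hric, E3. unfold As, I, quadQ, potG.
    transitivity (iz * iz * ((1 + 1 + 1) * (l * l) - (1 + 1) * (cst (ci : CA) * l) + s * s
       + (1 + 1) * (hh * e * sg) + hh * hh * (e * e) - hh * sg - hh * hh * e)); [ring|].
    ring.
  - rewrite psB_C, psD_C, psD_C, psB_C, hh1_coef, hh2_coef, !(injM_n CA), cC.
    replace (iz * iz) with (cst (/ z * / z : CA)%C) by (rewrite <- cstM; easy). rewrite !cC.
    change (@inj CA) with (fun c : C => c). cbv beta. change (amul CA) with Cmult.
    set (a := (l * l) m). set (b := (I * I) m). clearbody a b. rewrite Hl.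
    destruct m as [|[|j]]; toC.
    + field. auto.
    + set (p := (As * (iz * (sg + hh * e))) O). clearbody p. field. auto.
    + set (p := (As * (iz * (sg + hh * e))) (S j)). set (q := (iz * e * (iz * e)) j). clearbody p q. field. auto.
Qed.

End Numeric.

(** * Order-by-order uniqueness of the coefficient germs *)

Section TopCoefficient.
Local Open Scope ca_scope.
Add Ring Pr : (ath PC).

Lemma top_mul n : forall u g : PC, agree n u 0 -> (u * g) n = (u n * g O)%C.
Proof.
  induction n; intros u g H; [easy|].
  assert (U0 : u O = RtoC 0) by (apply (H O); lia).
  rewrite (pstailE CA u) at 1. rewrite U0.
  replace (cst (RtoC 0 : CA)) with (0 : PC) by (symmetry; apply (cst0 CA)).
  replace ((0 + hh * pstail u) * g) with (hh * (pstail u * g)) by ring.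
  rewrite hhMS. rewrite IHn; [easy|]. intros k Hk. apply (H (S k)). lia.
Qed.

Lemma agree_diff n (f f' : PC) : agree n f f' -> agree n (f - f') 0.
Proof. intros H k Hk. rewrite psB, (H k Hk). change (@eq C (f' k - f' k)%C (RtoC 0)). ring. Qed.

Lemma mul_diff n (f f' g g' : PC) : agree n f f' -> agree n g g' ->
  ((f * g)%A n - (f' * g')%A n = (f n - f' n) * g O + f' O * (g n - g' n))%C.
Proof.
  intros Hf Hg. change ((f * g)%A n - (f' * g')%A n)%C with ((f * g - f' * g')%A n).
  replace (f * g - f' * g') with ((f - f') * g + (g - g') * f') by ring.
  rewrite psD_C, !top_mul by now apply agree_diff. rewrite !psB_C. toC. ring.
Qed.

Lemma inv_agree n (L L' J J' : PC) : L * J = 1 -> L' * J' = 1 -> agree n L L' -> agree n J J'.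
Proof.
  intros I I' Hag.
  assert (E : J = J' + J * J' * (L' - L)).
  { transitivity (J' + J * (L' * J') - J' * (L * J)); [rewrite I, I'; ring|ring]. }
  rewrite E. intros k Hk. rewrite psD_C.
  assert (Z : (J * J' * (L' - L)) k = RtoC 0).
  { refine (agree_mul0 CA n _ _ _ k Hk). apply agree_diff. intros j Hj. symmetry. now apply Hag. }
  rewrite Z. toC. ring.
Qed.
Lemma inv_diff n (L L' J J' : PC) : L * J = 1 -> L' * J' = 1 -> agree n L L' ->
  (J n - J' n = - ((J O : C) * (J' O : C)) * (L n - L' n))%C.
Proof.
  intros I I' Hag.
  change (J n - J' n)%C with ((J - J')%A n).
  replace (J - J') with ((L - L') * (- (J * J'))).
  - rewrite top_mul by now apply agree_diff. rewrite psB_C.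
    change (@eq C ((L n - L' n) * (- (J O * J' O)))%C (- (J O * J' O) * (L n - L' n))%C). ring.
  - transitivity (J * (L' * J') - J' * (L * J)); [ring|]. rewrite I, I'. ring.
Qed.
End TopCoefficient.

Section NumericUnique.
Local Open Scope C_scope.
Variables (ci c0 z0 : C) (d : R).
Notation disc z := (Cmod (z - z0)%C < d).
Variables (lam lam' : nat -> C -> C).
Hypothesis Hz : forall z, disc z -> z <> RtoC 0.
Hypothesis H0 : forall z, disc z -> lam O z = lam' O z.
Hypothesis Hn0 : forall z, disc z -> lam O z <> RtoC 0.

Lemma disc_sub z : disc z -> exists e, (0 < e)%R /\ forall y, (Cmod (y - z)%C < e)%R -> disc y.
Proof. apply disc_open. Qed.

Lemma Cderiv_ext_on (f g : C -> C) : (forall z, disc z -> f z = g z) -> forall z, disc z -> Cderiv f z = Cderiv g z.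
Proof.
  intros H z Hd. destruct (disc_sub z Hd) as (e & He & Ho). apply Cderiv_ext_disc with e; auto.
Qed.

(** The series agree below order n, so products and inverses contribute to the n-th difference only
    through their linearisation at the leading term; together these form the derivative of F. *)
Lemma Fser_diff z n : disc z -> (1 <= n)%nat -> agree (A := CA) n (fun k => lam k z) (fun k => lam' k z) ->
  Fser ci c0 lam z n - Fser ci c0 lam' z n = dFv ci c0 (lam O z) z * (lam n z - lam' n z).
Proof.
  intros Hd Hn Hag. unfold Fser. cbv zeta. set (L := (fun k => lam k z) : PC) in *. set (L' := (fun k => lam' k z) : PC) in *.
  assert (E0 : L O = L' O) by (apply (Hag O); lia).
  assert (N0 : (L O : C) <> RtoC 0) by (apply Hn0, Hd).
  rewrite !smulE.
  assert (N0' : (L' O : C) <> RtoC 0) by (rewrite <- E0; exact N0).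
  assert (HI := inv_diff n L L' (sinv L) (sinv L') (sinv_mul L N0) (sinv_mul L' N0') Hag).
  change (sinv L O) with (/ (L O : C))%C in HI. change (sinv L' O) with (/ (L' O : C))%C in HI.
  assert (H2 := mul_diff n L L' L L' Hag Hag).
  assert (H3 := mul_diff n (L * L)%A (L' * L')%A L L' (agree_mul CA n _ _ _ _ Hag Hag) Hag).
  rewrite H2 in H3. rewrite !psM0 in H3. change (amul CA) with Cmult in H3.
  rewrite <- E0 in HI, H2, H3.
  change (lam O z) with (L O : C). change (lam n z) with (L n : C). change (lam' n z) with (L' n : C). unfold dFv.
  set (x := L O : C) in *. set (a := L n : C) in *. set (a' := L' n : C) in *.
  set (p := (L * L * L)%A n : C) in *. set (p' := (L' * L' * L')%A n : C) in *.
  set (q := (L * L)%A n : C) in *. set (q' := (L' * L')%A n : C) in *.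
  set (i := sinv L n : C) in *. set (i' := sinv L' n : C) in *.
  destruct n; [lia|].
  assert (Z := Hz z Hd).
  transitivity ((p - p') / (z * z) - ci * (q - q') / (z * z) - (i - i')); [unfold Cdiv; ring|].
  rewrite H3, H2, HI. replace (RtoC 3) with (RtoC 1 + RtoC 1 + RtoC 1) by (rewrite <- !RtoC_plus; f_equal; lra).
  replace (RtoC 2) with (RtoC 1 + RtoC 1) by (rewrite <- RtoC_plus; f_equal; lra). clearbody x a a'.
  field. auto.
Qed.

Hypothesis HdF : forall z, disc z -> dFv ci c0 (lam O z) z <> RtoC 0.
Hypothesis Hp : forall z, disc z -> painleve_eq ci c0 lam z.
Hypothesis Hp' : forall z, disc z -> painleve_eq ci c0 lam' z.

Lemma C_cancel (a x y : C) : a <> RtoC 0 -> a * (x - y) = RtoC 0 -> x = y.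
Proof.
  intros Ha H. destruct (Ceq_dec (x - y) (RtoC 0)) as [E|E].
  - transitivity (x - y + y); [ring|]. rewrite E. ring.
  - destruct (Cmult_neq_0 a (x - y) Ha E H).
Qed.

(** At order m the unknown is multiplied by the nonzero derivative of F at lambda_0, while the right
    side involves orders up to m - 2 only. Agreement is carried on the whole disc because
    derivatives of the lower coefficients enter. *)
Lemma lam_unique n : forall z, disc z -> lam n z = lam' n z.
Proof.
  induction n as [n IH] using (well_founded_induction lt_wf). intros z Hd.
  destruct n; [now apply H0|].
  assert (Hag : forall m, (m <= S n)%nat -> agree (A := CA) m (fun k => lam k z) (fun k => lam' k z)).
  { intros m Hm k Hk. apply IH; [lia|easy]. }
  apply (C_cancel (dFv ci c0 (lam O z) z)); [now apply HdF|].
  rewrite <- Fser_diff by (trivial; try lia; apply Hag; lia).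
  rewrite (Hp z Hd (S n)), (Hp' z Hd (S n)).
  destruct n as [|j]; [ring|].
  assert (D1 : forall k, (k <= j)%nat -> forall y, disc y -> Cderiv (lam k) y = Cderiv (lam' k) y).
  { intros k Hk. apply Cderiv_ext_on. intros y Hy. apply IH; [lia|easy]. }
  assert (D2 : Cderiv (Cderiv (lam j)) z = Cderiv (Cderiv (lam' j)) z).
  { apply Cderiv_ext_on; trivial. intros y Hy. now apply D1. }
  assert (D3 : agree (A := CA) (S j) (fun k => Cderiv (lam k) z) (fun k => Cderiv (lam' k) z)).
  { intros k Hk. apply D1; [lia|easy]. }
  rewrite D2, D1 by (trivial; lia). rewrite !smulE.
  assert (Ds : agree (A := CA) (S j) (sinv (fun k => lam k z)) (sinv (fun k => lam' k z))).
  { refine (inv_agree (S j) _ _ _ _ (sinv_mul _ _) (sinv_mul _ _) (Hag (S j) _)); [now apply Hn0|rewrite <- H0 by easy; now apply Hn0|lia]. }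
  assert (E : forall f1 f2 s1 s2 : PC, agree (S j) f1 f2 -> agree (S j) s1 s2 -> (f1 * f1 * s1)%A j = (f2 * f2 * s2)%A j).
  { intros f1 f2 s1 s2 Hf Hs. apply (agree_mul CA (S j)); [now apply agree_mul|exact Hs|lia]. }
  rewrite (E _ _ _ _ D3 Ds). toC. ring.
Qed.

Variables (rho rho' : nat -> C -> C).
Hypothesis Hr0 : forall z, disc z -> rho O z = rho' O z.
Hypothesis Hrn0 : forall z, disc z -> rho O z <> RtoC 0.
Hypothesis Hr : forall z, disc z -> riccati_eq ci c0 lam rho z.
Hypothesis Hr' : forall z, disc z -> riccati_eq ci c0 lam' rho' z.

Lemma rho_unique n : forall z, disc z -> rho n z = rho' n z.
Proof.
  induction n as [n IH] using (well_founded_induction lt_wf). intros z Hd.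
  destruct n; [now apply Hr0|].
  assert (E1 := Hr z Hd (S n)). assert (E2 := Hr' z Hd (S n)). cbv zeta in E1, E2.
  assert (EL : forall y, disc y -> (fun k => lam k y) = (fun k => lam' k y)).
  { intros y Hy. extensionality k. now apply lam_unique. }
  assert (EL1 : (fun k => Cderiv (lam k) z) = (fun k => Cderiv (lam' k) z)).
  { extensionality k. apply Cderiv_ext_on; trivial. intros y Hy. now apply lam_unique. }
  unfold dFser in E1, E2. cbv zeta in E1, E2.
  rewrite EL in E1 by easy. rewrite EL1 in E1. rewrite lam_unique in E1 by easy.
  set (L := fun k => lam' k z) in *. set (L1 := fun k => Cderiv (lam' k) z) in *.
  set (B := smul L1 (sinv L)) in *.
  set (As := fun j : nat => RtoC 2 * B j - match j with O => / z | _ => RtoC 0 end) in *.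
  assert (D1 : Cderiv (rho n) z = Cderiv (rho' n) z).
  { apply Cderiv_ext_on; trivial. intros y Hy. apply IH; [lia|easy]. }
  assert (Hag : agree (A := CA) (S n) (fun k => rho k z) (fun k => rho' k z)).
  { intros k Hk. apply IH; [lia|easy]. }
  assert (E3 : smul As (fun k => rho k z) n = smul As (fun k => rho' k z) n).
  { rewrite !smulE. apply (agree_mul CA (S n)); [easy|exact Hag|lia]. }
  rewrite E3, D1, <- E2 in E1.
  apply (C_cancel (RtoC 2 * rho O z)).
  - apply Cmult_neq_0; [intro E; apply RtoC_inj in E; lra|now apply Hrn0].
  - assert (M := mul_diff (S n) _ _ _ _ Hag Hag). cbv beta in M. rewrite <- (Hr0 z Hd) in M.
    rewrite !smulE in E1.
    transitivity ((rho (S n) z - rho' (S n) z) * rho O z + rho O z * (rho (S n) z - rho' (S n) z)); [rewrite two_C; ring|].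
    rewrite <- M.
    assert (K : forall p q r : C, p + r = q + r -> p - q = RtoC 0).
    { intros p q r H. transitivity ((p + r) - (q + r)); [ring|]. rewrite H. ring. }
    exact (K _ _ _ E1).
Qed.
End NumericUnique.

Section Core.
Local Open Scope C_scope.
Variables (ci c0 z0 : C) (d : R) (L S W : C -> C).
Notation disc z := (Cmod (z - z0)%C < d).
Hypothesis Hd : (0 < d)%R.
Hypothesis Hm : ci * ci - c0 * c0 <> RtoC 0.
Hypothesis Hz : forall z, disc z -> z <> RtoC 0.
Hypothesis Hcurve : forall z, disc z -> curve (L z) (S z) ci c0 (W z).
Hypothesis HL0 : forall z, disc z -> L z <> RtoC 0.
Hypothesis HS0 : forall z, disc z -> S z <> RtoC 0.
Hypothesis HW0 : forall z, disc z -> W z <> RtoC 0.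
Hypothesis HL : forall z, disc z -> Cd L z (ell (L z) (S z) ci c0 (W z) * L z / z).
Hypothesis HS : forall z, disc z -> Cd S z ((RtoC 1 - ell (L z) (S z) ci c0 (W z)) * S z / z).
Hypothesis HW : forall z, disc z -> exists w : C, Cd W z w.
Hypothesis HLS : forall z, disc z -> L z * S z = z.
Variable So : sol Local_ (X Local_ gw).

Notation A := (AL Local_).
Notation D := (Dt Local_).
Let u z := mkpt (L z) (S z) ci c0 (W z).
Notation Ev z x := (evr Local_ (u z) x).
Let deriv_ev := evr_deriv ci c0 z0 d L S W Hm Hz Hcurve HL0 HS0 HW0 HL HS HW.

Definition series_at (f : psA A) (k : nat) (z : C) : C := Ev z (f k).

Lemma Cderiv_series f k z : disc z -> Cderiv (series_at f k) z = Ev z (D (f k)) / z.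
Proof. intro H. apply Cderiv_eq. apply (deriv_ev (f k) z H). Qed.

Lemma Cd_over_z (x : A) z : disc z -> Cd (fun y => Ev y x / y) z ((Ev z (D x) - Ev z x) / (z * z)).
Proof.
  intro H. eapply Cd_val.
  - apply Cd_mult; [apply (deriv_ev x z H)|]. apply Cd_inv; [apply Cd_id|auto].
  - assert (Z := Hz z H). cbv beta. fold (u z). set (a := Ev z (D x)). set (b := Ev z x). clearbody a b. toC. field. auto.
Qed.

Lemma Cderiv2_series f k z : disc z ->
  Cderiv (Cderiv (series_at f k)) z = (Ev z (D (D (f k))) - Ev z (D (f k))) / (z * z).
Proof.
  intro H. rewrite (Cderiv_ext_on z0 d _ (fun y => Ev y (D (f k)) / y) (Cderiv_series f k) z H).
  apply Cderiv_eq, Cd_over_z, H.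
Qed.

Section AtPoint.
Variable z : C.
Hypothesis Hzd : disc z.
Let Hv := valid_disc_local ci c0 z0 d L S W Hm Hcurve HL0 HS0 HW0 z Hzd.
Let H : hom (psA A) PC := pshom (lift gen (rel Local_) CA (u z) Hv).

Lemma H_cst g : H (cst (X Local_ g)) = cst (u z g).
Proof. unfold H. rewrite pshom_cst. f_equal. apply lift_gv. Qed.
Lemma H_hh : H hh = hh. Proof. apply pshom_hh. Qed.

Local Open Scope ca_scope.
Add Ring Pr : (ath PC).
Add Ring Pa : (ath (psA A)).

Lemma core_ls : H (vl So) * H (vs So) = cst (z : CA).
Proof.
  rewrite <- hmM, (sol_ls _ _ So), cstM, hmM, !H_cst, <- cstM. f_equal. apply (HLS z Hzd).
Qed.
Lemma core_D1 : H (pd D (vl So)) = H (ve So) * H (vl So).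
Proof. rewrite <- hmM. f_equal. apply (sol_pain _ _ So). Qed.
Lemma core_D2 : H (pd D (vs So)) = (1 - H (ve So)) * H (vs So).
Proof. rewrite <- hm1 with (th := H), <- hmB, <- hmM. f_equal. apply (sol_pain _ _ So). Qed.
Lemma core_D3 : hh * (hh * H (pd D (ve So))) = potG (cst (ci : CA)) (cst (c0 : CA)) (H (vl So)) (H (vs So)).
Proof.
  destruct (sol_pain _ _ So) as (_ & _ & E). apply (f_equal H) in E. rewrite !hmM, H_hh in E. rewrite E.
  unfold potG. rewrite hmD, !hmB, !hmM, !H_cst. easy.
Qed.
Lemma core_ric sg : formal_riccati A D (cst (X Local_ gci)) (cst (X Local_ gc0)) (vl So) (vs So) sg ->
  H sg * H sg + hh * H (pd D sg) = quadQ (cst (ci : CA)) (cst (c0 : CA)) (H (vl So)) (H (vs So)).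
Proof.
  intro E. apply (f_equal H) in E. rewrite hmD, !hmM, H_hh in E. rewrite E.
  unfold quadQ. rewrite !hmB, hmD, hmB, !hmM, !hmD, hm1, !H_cst. easy.
Qed.
Lemma core_DD1 : H (pd D (pd D (vl So))) = H (pd D (ve So)) * H (vl So) + H (ve So) * H (pd D (vl So)).
Proof. rewrite <- !hmM, <- hmD, <- dvM. do 2 f_equal. apply (sol_pain _ _ So). Qed.
Lemma core_DD2 : H (pd D (pd D (vs So))) = (- H (pd D (ve So))) * H (vs So) + (1 - H (ve So)) * H (pd D (vs So)).
Proof.
  rewrite <- hm1 with (th := H), <- hmB, <- hmN, <- !hmM, <- hmD.
  f_equal. destruct (sol_pain _ _ So) as (_ & E & _). rewrite E at 1. rewrite dvM, dvB, dv1. rewrite E. ring.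
Qed.

Lemma painleve_A : painleve_eq ci c0 (series_at (vl So)) z.
Proof.
  apply (num_painleve ci c0 z (Hz z Hzd) _ (H (vl So)) (H (vs So)) (H (ve So)) (H (pd D (vl So))) (H (pd D (ve So)))).
  - easy.
  - intro k. now apply Cderiv_series.
  - apply core_D1.
  - apply core_D3.
  - apply core_ls.
  - intro k. rewrite <- core_DD1. now apply Cderiv2_series.
Qed.
(** For the exchanged constants s takes the role of lambda, and e that of 1 - e, as D log l + D log
    s = 1. *)
Lemma painleve_B : painleve_eq c0 ci (series_at (vs So)) z.
Proof.
  apply (num_painleve c0 ci z (Hz z Hzd) _ (H (vs So)) (H (vl So)) (1 - H (ve So)) (H (pd D (vs So))) (- H (pd D (ve So)))).
  - easy.
  - intro k. now apply Cderiv_series.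
  - apply core_D2.
  - transitivity (- (hh * (hh * H (pd D (ve So))))); [ring|]. rewrite core_D3. unfold potG. ring.
  - rewrite <- core_ls. ring.
  - intro k. rewrite <- core_DD2. now apply Cderiv2_series.
Qed.

Lemma riccati_A sg : formal_riccati A D (cst (X Local_ gci)) (cst (X Local_ gc0)) (vl So) (vs So) sg ->
  riccati_eq ci c0 (series_at (vl So)) (fun k y => series_at (sg + hh * ve So)%A k y / y)%C z.
Proof.
  intro E.
  apply (num_riccati ci c0 z (Hz z Hzd) _ (H (vl So)) (H (vs So)) (H (ve So)) (H (pd D (vl So))) (H (pd D (ve So)))) with (sg := H sg) (dsg := H (pd D sg)).
  - easy.
  - intro k. now apply Cderiv_series.
  - apply core_D1.
  - apply core_D3.
  - apply core_ls.
  - intro k. rewrite <- H_hh, <- hmM, <- hmD. easy.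
  - intro k. rewrite <- H_hh, <- !hmM, <- !hmD.
    replace (pd D sg + hh * pd D (ve So)) with (pd D (sg + hh * ve So)) by (rewrite dvD, dvM, pd_hh; ring).
    apply Cderiv_eq, Cd_over_z, Hzd.
  - now apply core_ric.
Qed.
Lemma riccati_B sg : formal_riccati A D (cst (X Local_ gci)) (cst (X Local_ gc0)) (vl So) (vs So) sg ->
  riccati_eq c0 ci (series_at (vs So)) (fun k y => series_at (sg + hh * (1 - ve So))%A k y / y)%C z.
Proof.
  intro E.
  apply (num_riccati c0 ci z (Hz z Hzd) _ (H (vs So)) (H (vl So)) (1 - H (ve So)) (H (pd D (vs So))) (- H (pd D (ve So)))) with (sg := H sg) (dsg := H (pd D sg)).
  - easy.
  - intro k. now apply Cderiv_series.
  - apply core_D2.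
  - transitivity (- (hh * (hh * H (pd D (ve So))))); [ring|]. rewrite core_D3. unfold potG. ring.
  - rewrite <- core_ls. ring.
  - intro k. rewrite <- H_hh, <- hm1 with (th := H), <- hmB, <- hmM, <- hmD. easy.
  - intro k. rewrite <- H_hh, <- hm1 with (th := H), <- hmB, <- hmN, <- !hmM, <- !hmD.
    replace (pd D sg + hh * - pd D (ve So)) with (pd D (sg + hh * (1 - ve So))) by (rewrite dvD, dvM, pd_hh, dvB, dv1; ring).
    apply Cderiv_eq, Cd_over_z, Hzd.
  - rewrite (core_ric sg E). unfold quadQ. ring.
Qed.

Lemma series_odd n : (series_at (vp So) n z - series_at (vm So) n z = RtoC 2 * series_at (vo Local_ _ So) n z)%C.
Proof.
  change (Ev z (vp So n) - Ev z (vm So n) = RtoC 2 * Ev z (vo Local_ _ So n))%C.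
  unfold vo, half. rewrite (injM_n A), psB, (evrM _ _ Hv), (evrB _ _ Hv), (evrI _ _ Hv). fold (u z). toC. field.
Qed.
Lemma series_lead : series_at (vl So) O z = L z /\ series_at (vs So) O z = S z /\
  series_at (vp So) O z = W z /\ series_at (vm So) O z = (- W z)%C.
Proof.
  unfold series_at. rewrite (sol_l0 _ _ So), (sol_s0 _ _ So), (sol_p0 _ _ So), (sol_m0 _ _ So).
  rewrite (evrN _ _ Hv), !(evr_gv _ _ Hv). easy.
Qed.
Lemma series_add (f g : psA A) n : series_at (f + g) n z = (series_at f n z + series_at g n z)%C.
Proof. unfold series_at. rewrite psD. apply (evrD _ _ Hv). Qed.
Lemma series_hh0 (f : psA A) : series_at (hh * f) O z = RtoC 0.
Proof. unfold series_at. rewrite hhM0, <- inj0. apply (evrI _ _ Hv). Qed.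
End AtPoint.
End Core.

(* The point of the curve given by t = z, lambda_0 = l, sqrt(Delta) = r; for
   the end point 0_{c_0} the roles of (lambda_0, c_inf) and (t/lambda_0, c_0)
   are exchanged. *)
Definition spt (e : dpole) (plus : bool) (ci c0 l r z : C) : gen -> CA :=
  match e with
  | Pinf => mkpt l (z / l)%C ci c0 (sgn plus * (z * r))%C
  | P0 => mkpt (z / l)%C l c0 ci (sgn plus * (z * r))%C
  end.

Section Link.
Local Open Scope C_scope.
Variables (ci c0 z0 : C) (d : R) (lam rp rm : nat -> C -> C).
Notation disc z := (Cmod (z - z0)%C < d).
Hypothesis Hm : ci * ci - c0 * c0 <> RtoC 0.
Hypothesis Hloc : forall z, disc z ->
  z <> RtoC 0 /\
  (forall l, Cholo (lam l) z /\ Cholo (rp l) z /\ Cholo (rm l) z) /\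
  lam O z <> RtoC 0 /\ rp O z <> RtoC 0 /\
  rm O z = Copp (rp O z) /\
  Cmult (rp O z) (rp O z) = dFv ci c0 (lam O z) z /\
  painleve_eq ci c0 lam z /\ riccati_eq ci c0 lam rp z /\ riccati_eq ci c0 lam rm z.
Variable plus : bool.

Let l z := lam O z.
Let s z := z / lam O z.
(** With this sign W tends to c_* itself at either of the two end points over the same branch, so a
    single point of the curve serves both. *)
Let W z := sgn plus * (z * rp O z).

Lemma sgn_sq : sgn plus * sgn plus = RtoC 1.
Proof. destruct plus; simpl; rewrite <- RtoC_mult; f_equal; lra. Qed.
Lemma sgn_n0 : sgn plus <> RtoC 0.
Proof. intro E. assert (H := sgn_sq). rewrite E, Cmult_0_l in H. apply RtoC_inj in H. lra. Qed.

Lemma loc_z z : disc z -> z <> RtoC 0. Proof. intro H. apply (Hloc z H). Qed.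
Lemma loc_l z : disc z -> l z <> RtoC 0. Proof. intro H. apply (Hloc z H). Qed.
Lemma loc_r z : disc z -> rp O z <> RtoC 0. Proof. intro H. apply (Hloc z H). Qed.
Lemma loc_s z : disc z -> s z <> RtoC 0.
Proof. intros H E. apply (loc_z z H). transitivity (s z * l z); [unfold s; fold (l z); field; now apply loc_l|rewrite E; ring]. Qed.
Lemma loc_W z : disc z -> W z <> RtoC 0.
Proof. intro H. apply Cmult_neq_0; [apply sgn_n0|]. apply Cmult_neq_0; [now apply loc_z|now apply loc_r]. Qed.
Lemma loc_ls z : disc z -> l z * s z = z.
Proof. intro H. unfold s. fold (l z). field. now apply loc_l. Qed.

Lemma loc_G z : disc z -> l z * l z - ci * l z - s z * s z + c0 * s z = RtoC 0.
Proof.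
  intro H. destruct (Hloc z H) as (Z & _ & N & _ & _ & _ & P & _).
  assert (E := P O). unfold Fser in E. cbv zeta in E.
  change (lam O z * lam O z * lam O z / (z * z) - ci * (lam O z * lam O z) / (z * z) + c0 / z - / lam O z = RtoC 0) in E.
  unfold s. fold (l z) in *.
  transitivity ((l z * l z * l z / (z * z) - ci * (l z * l z) / (z * z) + c0 / z - / l z) * (z * z / l z)).
  - field. auto.
  - rewrite E. ring.
Qed.
Lemma loc_W2 z : disc z -> W z * W z = RtoC 2 * (l z * l z) - ci * l z + RtoC 2 * (s z * s z) - c0 * s z.
Proof.
  intro H. destruct (Hloc z H) as (Z & _ & N & _ & _ & R & _). fold (l z) in *.
  transitivity (sgn plus * sgn plus * (z * z) * (rp O z * rp O z)); [unfold W; ring|].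
  rewrite sgn_sq, R. unfold dFv.
  transitivity (RtoC 3 * (l z * l z) - RtoC 2 * ci * l z + s z * s z - (l z * l z - ci * l z - s z * s z + c0 * s z)).
  - rewrite loc_G by easy. unfold s. fold (l z). field. auto.
  - replace (RtoC 3) with (RtoC 1 + RtoC 1 + RtoC 1) by (rewrite <- !RtoC_plus; f_equal; lra). rewrite two_C. ring.
Qed.
Lemma loc_curve z : disc z -> curve (l z) (s z) ci c0 (W z).
Proof. intro H. split; [now apply loc_G|now apply loc_W2]. Qed.
Lemma loc_curve' z : disc z -> curve (s z) (l z) c0 ci (W z).
Proof.
  intro H. split.
  - transitivity (- (l z * l z - ci * l z - s z * s z + c0 * s z)); [ring|]. rewrite loc_G by easy. ring.
  - rewrite loc_W2 by easy. ring.
Qed.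

Lemma ell_swap z : disc z -> ell (s z) (l z) c0 ci (W z) = RtoC 1 - ell (l z) (s z) ci c0 (W z).
Proof.
  intro H. unfold ell. assert (N := loc_W z H).
  transitivity ((W z * W z - (RtoC 2 * (s z * s z) - c0 * s z)) * (/ W z * / W z)).
  - rewrite loc_W2 by easy. ring.
  - field. auto.
Qed.

(** Implicit differentiation of the curve relation with s = t / l; the coefficient of the unknown
    derivative is W^2 up to units. *)
Lemma loc_dl z : disc z -> Cd l z (ell (l z) (s z) ci c0 (W z) * l z / z).
Proof.
  intro H. destruct (Hloc z H) as (Z & Hol & N & _). fold (l z) in N.
  assert (exists a : C, Cd l z a) as [a Ha] by apply (Hol O).
  assert (Hs : Cd s z (RtoC 1 * / l z + z * - (/ l z * / l z * a))).
  { apply (Cd_mult (fun y => y) (fun y => / l y)); [apply Cd_id|]. now apply Cd_inv. }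
  set (b := RtoC 1 * / l z + z * - (/ l z * / l z * a)) in *.
  assert (HG : Cd (fun y => l y * l y - ci * l y - s y * s y + c0 * s y) z
     (a * l z + l z * a - (RtoC 0 * l z + ci * a) - (b * s z + s z * b) + (RtoC 0 * s z + c0 * b))).
  { apply Cd_plus; [apply Cd_minus; [apply Cd_minus|]|].
    - now apply Cd_mult.
    - apply Cd_mult; [apply Cd_const|easy].
    - now apply Cd_mult.
    - apply Cd_mult; [apply Cd_const|easy]. }
  assert (E : a * l z + l z * a - (RtoC 0 * l z + ci * a) - (b * s z + s z * b) + (RtoC 0 * s z + c0 * b) = RtoC 0).
  { apply (Cd_unique _ z _ _ HG). apply (Cd_ext z0 d (fun _ => RtoC 0)); trivial; [|apply Cd_const].
    intros y Hy. symmetry. now apply loc_G. }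
  eapply Cd_val; [exact Ha|].
  assert (NW := loc_W z H). assert (Hw := loc_W2 z H).
  assert (Eq : a * (W z * W z) = (RtoC 2 * (s z * s z) - c0 * s z) * l z / z).
  { rewrite Hw. transitivity ((a * l z + l z * a - (RtoC 0 * l z + ci * a) - (b * s z + s z * b) + (RtoC 0 * s z + c0 * b)) * l z
       + (RtoC 2 * (s z * s z) - c0 * s z) * l z / z); [|rewrite E; ring].
    rewrite two_C. unfold b. unfold s. fold (l z). field. auto. }
  unfold ell. transitivity (a * (W z * W z) * (/ W z * / W z)); [toC; field; auto|]. rewrite Eq. toC; field. auto.
Qed.
Lemma loc_ds z : disc z -> Cd s z ((RtoC 1 - ell (l z) (s z) ci c0 (W z)) * s z / z).
Proof.
  intro H. assert (N := loc_l z H). assert (Z := loc_z z H). eapply Cd_val.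
  - apply Cd_mult; [apply Cd_id|]. apply Cd_inv; [now apply loc_dl|exact N].
  - fold (l z). unfold s. fold (l z). set (k := ell _ _ _ _ _). clearbody k. toC. field. auto.
Qed.
Lemma loc_dl' z : disc z -> Cd s z (ell (s z) (l z) c0 ci (W z) * s z / z).
Proof. intro H. rewrite ell_swap by easy. now apply loc_ds. Qed.
Lemma loc_ds' z : disc z -> Cd l z ((RtoC 1 - ell (s z) (l z) c0 ci (W z)) * l z / z).
Proof. intro H. rewrite ell_swap by easy. eapply Cd_val; [now apply loc_dl|]. set (k := ell _ _ _ _ _). clearbody k. toC. field. now apply loc_z. Qed.
Lemma loc_dW z : disc z -> exists w : C, Cd W z w.
Proof.
  intro H. destruct (Hloc z H) as (_ & Hol & _). destruct (Hol O) as (_ & [a Ha] & _).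
  eexists. apply Cd_mult; [apply Cd_const|]. apply Cd_mult; [apply Cd_id|exact Ha].
Qed.
Lemma Hm' : c0 * c0 - ci * ci <> RtoC 0.
Proof. intro E. apply Hm. transitivity (- (c0 * c0 - ci * ci)); [ring|]. rewrite E. ring. Qed.
Lemma loc_ls' z : disc z -> s z * l z = z.
Proof. intro H. rewrite Cmult_comm. now apply loc_ls. Qed.
Lemma loc_dF z : disc z -> dFv ci c0 (lam O z) z <> RtoC 0.
Proof. intro H. destruct (Hloc z H) as (_ & _ & _ & R & _ & E & _). rewrite <- E. now apply Cmult_neq_0. Qed.

Variable So : sol Local_ (X Local_ gw).
Variable e : dpole.
Let pt z := spt e plus ci c0 (lam O z) (rp O z) z.

Lemma evr_spt_deriv (x : AL Local_) z : disc z -> Cd (fun y => evr Local_ (pt y) x) z (evr Local_ (pt z) (Dt Local_ x) / z).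
Proof.
  intro H. unfold pt, spt. destruct e.
  - apply (evr_deriv ci c0 z0 d l s W Hm loc_z loc_curve loc_l loc_s loc_W loc_dl loc_ds loc_dW x z H).
  - apply (evr_deriv c0 ci z0 d s l W Hm' loc_z loc_curve' loc_s loc_l loc_W loc_dl' loc_ds' loc_dW x z H).
Qed.

(** By uniqueness the given R_+ is the evaluated series of sigma_+ or of sigma_-, according to the
    sign of the end point, and R_- is the other one; hence the factor [sgn plus]. The common term E,
    from D log lambda, cancels in the difference. *)
Lemma Rodd_of_germs (lam' : nat -> C -> C) (rhoP rhoM vpz vmz E : nat -> C -> C) (vo : nat -> C -> C) :
  (forall z, disc z -> lam' O z = lam O z) ->
  (forall z, disc z -> painleve_eq ci c0 lam' z) ->
  (forall z, disc z -> riccati_eq ci c0 lam' rhoP z) ->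
  (forall z, disc z -> riccati_eq ci c0 lam' rhoM z) ->
  (forall z k, disc z -> rhoP k z = (vpz k z + E k z) / z) ->
  (forall z k, disc z -> rhoM k z = (vmz k z + E k z) / z) ->
  (forall z, disc z -> vpz O z = W z /\ vmz O z = - W z /\ E O z = RtoC 0) ->
  (forall z n, disc z -> vpz n z - vmz n z = RtoC 2 * vo n z) ->
  forall z n, disc z -> Rodd rp rm n z = sgn plus * vo (2 * n)%nat z / z.
Proof.
  intros Hl Hp Hrp Hrm HvP HvM H0 Hvo z n Hd.
  assert (HP : forall y, disc y -> painleve_eq ci c0 lam y) by (intros y Hy; apply (Hloc y Hy)).
  assert (HR : forall y, disc y -> riccati_eq ci c0 lam rp y) by (intros y Hy; apply (Hloc y Hy)).
  assert (HRm : forall y, disc y -> riccati_eq ci c0 lam rm y) by (intros y Hy; apply (Hloc y Hy)).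
  assert (Hl' : forall y, disc y -> lam O y = lam' O y) by (intros; symmetry; auto).
  assert (Hrm0 : forall y, disc y -> rm O y = - rp O y) by (intros y Hy; apply (Hloc y Hy)).
  assert (Hrmn : forall y, disc y -> rm O y <> RtoC 0).
  { intros y Hy E1. apply (loc_r y Hy). rewrite Hrm0 in E1 by easy. transitivity (- - rp O y); [ring|]. rewrite E1. ring. }
  assert (U := rho_unique ci c0 z0 d lam lam' loc_z Hl' loc_l loc_dF HP Hp).
  assert (Z := loc_z z Hd).
  assert (key : (rp (2 * n)%nat z - rm (2 * n)%nat z) = sgn plus * (RtoC 2 * vo (2 * n)%nat z) / z).
  { rewrite <- Hvo by easy. destruct plus.
    - rewrite (U rp rhoP) by (trivial; try exact loc_r;
        intros y Hy; destruct (H0 y Hy) as (A1 & A2 & A3); rewrite HvP by easy; rewrite A1, A3; unfold W; simpl; field; now apply loc_z).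
      rewrite (U rm rhoM) by (trivial;
        intros y Hy; destruct (H0 y Hy) as (A1 & A2 & A3); rewrite HvM by easy; rewrite A2, A3, Hrm0 by easy; unfold W; simpl; field; now apply loc_z).
      rewrite HvP, HvM by easy. simpl. field. exact Z.
    - assert (Em1 : RtoC (-1) = - RtoC 1) by (now rewrite <- RtoC_opp).
      rewrite (U rp rhoM) by (trivial; try exact loc_r;
        intros y Hy; destruct (H0 y Hy) as (A1 & A2 & A3); rewrite HvM by easy; rewrite A2, A3; unfold W; simpl; rewrite Em1; field; now apply loc_z).
      rewrite (U rm rhoP) by (trivial;
        intros y Hy; destruct (H0 y Hy) as (A1 & A2 & A3); rewrite HvP by easy; rewrite A1, A3, Hrm0 by easy; unfold W; simpl; rewrite Em1; field; now apply loc_z).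
      rewrite HvP, HvM by easy. simpl. rewrite Em1. field. exact Z. }
  unfold Rodd. rewrite key. field. exact Z.
Qed.

Lemma Rodd_evr z n : disc z -> Rodd rp rm n z = sgn plus * evr Local_ (pt z) (vo Local_ _ So (2 * n)%nat) / z.
Proof.
  intro H. unfold pt, spt. destruct e.
  - set (sa := series_at ci c0 l s W).
    assert (Hadd := series_add ci c0 z0 d l s W Hm loc_curve loc_l loc_s loc_W).
    apply (Rodd_of_germs (sa (vl So)) (fun k y => sa (vp So + hh * ve So)%A k y / y) (fun k y => sa (vm So + hh * ve So)%A k y / y)
      (sa (vp So)) (sa (vm So)) (sa (hh * ve So)%A) (sa (vo Local_ _ So))); trivial; unfold sa.
    + intros y Hy. apply (series_lead ci c0 z0 d l s W Hm loc_curve loc_l loc_s loc_W So y Hy).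
    + apply (painleve_A ci c0 z0 d l s W Hm loc_z loc_curve loc_l loc_s loc_W loc_dl loc_ds loc_dW loc_ls So).
    + intros y Hy. apply (riccati_A ci c0 z0 d l s W Hm loc_z loc_curve loc_l loc_s loc_W loc_dl loc_ds loc_dW loc_ls So y Hy), sol_p.
    + intros y Hy. apply (riccati_A ci c0 z0 d l s W Hm loc_z loc_curve loc_l loc_s loc_W loc_dl loc_ds loc_dW loc_ls So y Hy), sol_m.
    + intros y k Hy. now rewrite Hadd.
    + intros y k Hy. now rewrite Hadd.
    + intros y Hy. destruct (series_lead ci c0 z0 d l s W Hm loc_curve loc_l loc_s loc_W So y Hy) as (_ & _ & A1 & A2).
      split; [exact A1|split; [exact A2|]]. apply (series_hh0 ci c0 z0 d l s W Hm loc_curve loc_l loc_s loc_W y Hy).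
    + intros y k Hy. apply (series_odd ci c0 z0 d l s W Hm loc_curve loc_l loc_s loc_W So y Hy).
  - set (sa := series_at c0 ci s l W).
    assert (Hadd := series_add c0 ci z0 d s l W Hm' loc_curve' loc_s loc_l loc_W).
    apply (Rodd_of_germs (sa (vs So)) (fun k y => sa (vp So + hh * (1 - ve So))%A k y / y) (fun k y => sa (vm So + hh * (1 - ve So))%A k y / y)
      (sa (vp So)) (sa (vm So)) (sa (hh * (1 - ve So))%A) (sa (vo Local_ _ So))); trivial; unfold sa.
    + intros y Hy. apply (series_lead c0 ci z0 d s l W Hm' loc_curve' loc_s loc_l loc_W So y Hy).
    + apply (painleve_B c0 ci z0 d s l W Hm' loc_z loc_curve' loc_s loc_l loc_W loc_dl' loc_ds' loc_dW loc_ls' So).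
    + intros y Hy. apply (riccati_B c0 ci z0 d s l W Hm' loc_z loc_curve' loc_s loc_l loc_W loc_dl' loc_ds' loc_dW loc_ls' So y Hy), sol_p.
    + intros y Hy. apply (riccati_B c0 ci z0 d s l W Hm' loc_z loc_curve' loc_s loc_l loc_W loc_dl' loc_ds' loc_dW loc_ls' So y Hy), sol_m.
    + intros y k Hy. now rewrite Hadd.
    + intros y k Hy. now rewrite Hadd.
    + intros y Hy. destruct (series_lead c0 ci z0 d s l W Hm' loc_curve' loc_s loc_l loc_W So y Hy) as (_ & _ & A1 & A2).
      split; [exact A1|split; [exact A2|]]. apply (series_hh0 c0 ci z0 d s l W Hm' loc_curve' loc_s loc_l loc_W y Hy).
    + intros y k Hy. apply (series_odd c0 ci z0 d s l W Hm' loc_curve' loc_s loc_l loc_W So y Hy).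
Qed.

Lemma spt_on_curve z : disc z -> exists L S a b,
  pt z = mkpt L S a b (W z) /\ spt e plus ci c0 (lam O z) (- rp O z) z = mkpt L S a b (- W z) /\
  curve L S a b (W z) /\ W z <> RtoC 0 /\ L <> RtoC 0 /\ S <> RtoC 0 /\ a * a - b * b <> RtoC 0.
Proof.
  intro H. assert (E : sgn plus * (z * - rp O z) = - W z) by (unfold W; ring).
  unfold pt, spt. destruct e; rewrite E.
  - exists (l z), (s z), ci, c0. split; [reflexivity|]. split; [reflexivity|]. split; [now apply loc_curve|]. auto using loc_W, loc_l, loc_s.
  - exists (s z), (l z), c0, ci. split; [reflexivity|]. split; [reflexivity|]. split; [now apply loc_curve'|]. auto using loc_W, loc_l, loc_s, Hm'.
Qed.
End Link.

(** * Integration along a path *)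

Lemma Cmod_le_parts (z : C) : Cmod z <= Rabs (Re z) + Rabs (Im z).
Proof.
  replace z with (RtoC (Re z) + Ci * RtoC (Im z))%C by (destruct z; unfold Ci, RtoC, Cplus, Cmult; simpl; f_equal; ring).
  eapply Rle_trans; [apply Cmod_triangle|]. rewrite Cmod_mult, !Cmod_R.
  assert (Cmod Ci = 1) as -> by (unfold Cmod, Ci; simpl; replace (0 * (0 * 1) + 1 * (1 * 1)) with 1 by ring; apply sqrt_1).
  destruct z as [x y]; simpl. apply Req_le. replace (x + (0 * y - 1 * 0)) with x by ring. replace (0 + (0 * 0 + 1 * y)) with y by ring. ring.
Qed.
Lemma im_le_Cmod (z : C) : Rabs (Im z) <= Cmod z.
Proof. eapply Rle_trans; [apply Rmax_r|apply Rmax_Cmod]. Qed.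

Lemma is_derive_eps (f : R -> R) x l : is_derive f x l <-> forall eps, 0 < eps -> exists d, 0 < d /\
  forall y, Rabs (y - x) < d -> Rabs (f y - f x - l * (y - x)) <= eps * Rabs (y - x).
Proof.
  rewrite is_derive_Reals. split.
  - intros H eps He. destruct (H eps He) as [d Hd]. exists d. split; [apply cond_pos|]. intros y Hy.
    destruct (Req_dec (y - x) 0) as [E|N].
    + replace y with x by lra. replace (f x - f x - l * (x - x)) with 0 by ring. rewrite Rabs_R0, Rminus_diag, Rabs_R0. lra.
    + specialize (Hd (y - x) N Hy). replace (x + (y - x)) with y in Hd by ring.
      replace (f y - f x - l * (y - x)) with (((f y - f x) / (y - x) - l) * (y - x)) by (field; exact N).
      rewrite Rabs_mult. apply Rmult_le_compat_r; [apply Rabs_pos|lra].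
  - intros H eps He. destruct (H (eps / 2)) as (d & Hd & Hy); [lra|]. exists (mkposreal d Hd). intros h Hh Hhd.
    specialize (Hy (x + h)). replace (x + h - x) with h in Hy by ring. specialize (Hy Hhd).
    replace ((f (x + h) - f x) / h - l) with ((f (x + h) - f x - l * h) / h) by (field; exact Hh).
    unfold Rdiv. rewrite Rabs_mult, Rabs_inv. assert (Ph := Rabs_pos_lt h Hh).
    apply Rle_lt_trans with (eps / 2); [|lra]. apply Rmult_le_reg_r with (Rabs h); [exact Ph|].
    rewrite Rmult_assoc, Rinv_l, Rmult_1_r by lra. exact Hy.
Qed.

Definition Pd (p : R -> C) (u : R) (q : C) : Prop := forall eps, 0 < eps -> exists d, 0 < d /\
  forall v, Rabs (v - u) < d -> Cmod (p v - p u - q * RtoC (v - u))%C <= eps * Rabs (v - u).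

Lemma Pd_parts p u q : Pd p u q <-> is_derive (fun v => Re (p v)) u (Re q) /\ is_derive (fun v => Im (p v)) u (Im q).
Proof.
  rewrite !is_derive_eps.
  assert (ER : forall v, Re (p v - p u - q * RtoC (v - u))%C = Re (p v) - Re (p u) - Re q * (v - u)).
  { intro v. destruct (p v), (p u), q. simpl. ring. }
  assert (EI : forall v, Im (p v - p u - q * RtoC (v - u))%C = Im (p v) - Im (p u) - Im q * (v - u)).
  { intro v. destruct (p v), (p u), q. simpl. ring. }
  split.
  - intro H. split; intros eps He; destruct (H eps He) as (d & Hd & Hv); exists d; (split; [exact Hd|]); intros v Hvd;
      specialize (Hv v Hvd); (eapply Rle_trans; [|exact Hv]).
    + rewrite <- ER. apply re_le_Cmod.
    + rewrite <- EI. apply im_le_Cmod.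
  - intros [H1 H2] eps He. destruct (H1 (eps / 2)) as (d1 & Hd1 & K1); [lra|]. destruct (H2 (eps / 2)) as (d2 & Hd2 & K2); [lra|].
    exists (Rmin d1 d2). split; [now apply Rmin_pos|]. intros v Hv.
    eapply Rle_trans; [apply Cmod_le_parts|]. rewrite ER, EI.
    specialize (K1 v (Rlt_le_trans _ _ _ Hv (Rmin_l _ _))). specialize (K2 v (Rlt_le_trans _ _ _ Hv (Rmin_r _ _))). lra.
Qed.

Lemma Pd_lip p u q : Pd p u q -> exists d, 0 < d /\ forall v, Rabs (v - u) < d -> Cmod (p v - p u)%C <= (Cmod q + 1) * Rabs (v - u).
Proof.
  intro H. destruct (H 1 Rlt_0_1) as (d & Hd & K). exists d. split; [exact Hd|]. intros v Hv. specialize (K v Hv).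
  replace (p v - p u)%C with ((p v - p u - q * RtoC (v - u)) + q * RtoC (v - u))%C by ring.
  eapply Rle_trans; [apply Cmod_triangle|]. rewrite Cmod_mult, Cmod_R. lra.
Qed.

Lemma Pd_comp H p u h q : Cd H (p u) h -> Pd p u q -> Pd (fun v => H (p v)) u (h * q)%C.
Proof.
  intros HH Hp eps He. destruct (Pd_lip p u q Hp) as (d1 & Hd1 & K1).
  set (K := Cmod q + 1). set (N := Cmod h + 1).
  assert (PK : 0 < K) by (unfold K; assert (t := Cmod_ge_0 q); lra).
  assert (PN : 0 < N) by (unfold N; assert (t := Cmod_ge_0 h); lra).
  destruct (proj1 (Cd_eps H (p u) h) HH (eps / 2 / K)) as (d2 & Hd2 & K2).
  { apply Rdiv_lt_0_compat; lra. }
  destruct (Hp (eps / 2 / N)) as (d3 & Hd3 & K3).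
  { apply Rdiv_lt_0_compat; lra. }
  exists (Rmin d1 (Rmin d3 (d2 / K))). split.
  { repeat apply Rmin_pos; trivial. now apply Rdiv_lt_0_compat. }
  intros v Hv.
  assert (V1 : Rabs (v - u) < d1) by (eapply Rlt_le_trans; [exact Hv|apply Rmin_l]).
  assert (V3 : Rabs (v - u) < d3) by (eapply Rlt_le_trans; [exact Hv|eapply Rle_trans; [apply Rmin_r|apply Rmin_l]]).
  assert (V2 : Rabs (v - u) < d2 / K) by (eapply Rlt_le_trans; [exact Hv|eapply Rle_trans; [apply Rmin_r|apply Rmin_r]]).
  specialize (K1 v V1). specialize (K3 v V3). fold K in K1.
  assert (C2 : Cmod (p v - p u)%C < d2).
  { eapply Rle_lt_trans; [exact K1|]. apply Rmult_lt_reg_r with (/ K); [now apply Rinv_0_lt_compat|].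
    replace (K * Rabs (v - u) * / K) with (Rabs (v - u)) by (field; lra). exact V2. }
  specialize (K2 (p v) C2).
  replace (H (p v) - H (p u) - h * q * RtoC (v - u))%C with
    ((H (p v) - H (p u) - h * (p v - p u)) + h * (p v - p u - q * RtoC (v - u)))%C by ring.
  eapply Rle_trans; [apply Cmod_triangle|]. rewrite Cmod_mult.
  assert (A : Cmod (H (p v) - H (p u) - h * (p v - p u))%C <= eps / 2 * Rabs (v - u)).
  { eapply Rle_trans; [exact K2|]. replace (eps / 2 * Rabs (v - u)) with (eps / 2 / K * (K * Rabs (v - u))) by (field; lra).
    apply Rmult_le_compat_l; [|exact K1]. apply Rlt_le, Rdiv_lt_0_compat; lra. }
  assert (B : Cmod h * Cmod (p v - p u - q * RtoC (v - u))%C <= eps / 2 * Rabs (v - u)).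
  { replace (eps / 2 * Rabs (v - u)) with (N * (eps / 2 / N * Rabs (v - u))) by (field; lra).
    apply Rmult_le_compat; trivial; try apply Cmod_ge_0. unfold N; lra. }
  lra.
Qed.

Lemma Pd_ext p p' u q : locally u (fun v => p v = p' v) -> Pd p u q -> Pd p' u q.
Proof.
  intros L H. assert (E := locally_singleton _ _ L). apply Pd_parts in H. destruct H as [H1 H2]. apply Pd_parts. split.
  - eapply is_derive_ext_loc; [|exact H1]. apply (filter_imp _ _ (fun v Hv => f_equal Re Hv) L).
  - eapply is_derive_ext_loc; [|exact H2]. apply (filter_imp _ _ (fun v Hv => f_equal Im Hv) L).
Qed.

Lemma Pd_cont p u q : Pd p u q -> continuous (fun v => Re (p v)) u /\ continuous (fun v => Im (p v)) u.
Proof.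
  intro H. apply Pd_parts in H. destruct H. split; apply (ex_derive_continuous (V := R_NormedModule)); eexists; eassumption.
Qed.

Section Path.
Variables (p : R -> C) (a b : R) (Phi phi : R -> C -> C).
Hypothesis Hab : a <= b.
Hypothesis Hp : forall u, a <= u <= b ->
  ex_derive (fun v => Re (p v)) u /\ ex_derive (fun v => Im (p v)) u /\
  continuous (fun v => Derive (fun w => Re (p w)) v) u /\
  continuous (fun v => Derive (fun w => Im (p w)) v) u.
Hypothesis HPhi : forall u, a <= u <= b -> Cd (Phi u) (p u) (phi u (p u)).
Hypothesis Hphi : forall u, a <= u <= b -> exists w : C, Cd (phi u) (p u) w.
Hypothesis Hglue : forall u, a <= u <= b -> exists e, 0 < e /\ forall u', a <= u' <= b -> Rabs (u' - u) < e ->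
  Phi u' (p u') = Phi u (p u') /\ phi u' (p u') = phi u (p u').

(* Germs are only given for parameters in [a, b]; clamping extends them, so
   that two-sided derivatives make sense at both ends. *)
Let cl u := Rmax a (Rmin b u).

Lemma clamp_id u : a <= u <= b -> cl u = u.
Proof. intro H. unfold cl. rewrite Rmin_right, Rmax_right; lra. Qed.
Lemma clamp_locally u : a <= u <= b -> locally u (fun v => (a <= v <= b) \/ cl v = u).
Proof.
  intro H.
  assert (L : locally u (fun v => a <= v \/ cl v = u)).
  { destruct (Req_dec u a) as [E|N].
    - exists (mkposreal 1 Rlt_0_1). intros v _. destruct (Rle_dec a v); [now left|right].
      unfold cl. rewrite Rmin_right by lra. rewrite Rmax_left; lra.
    - assert (P : 0 < u - a) by lra. exists (mkposreal _ P). intros v Hv. left. unfold ball in Hv; simpl in Hv.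
      unfold AbsRing_ball, abs, minus, plus, opp in Hv; simpl in Hv. apply Rabs_def2 in Hv. lra. }
  assert (U : locally u (fun v => v <= b \/ cl v = u)).
  { destruct (Req_dec u b) as [E|N].
    - exists (mkposreal 1 Rlt_0_1). intros v _. destruct (Rle_dec v b); [now left|right].
      unfold cl. rewrite Rmin_left by lra. rewrite Rmax_right; lra.
    - assert (P : 0 < b - u) by lra. exists (mkposreal _ P). intros v Hv. left. unfold ball in Hv; simpl in Hv.
      unfold AbsRing_ball, abs, minus, plus, opp in Hv; simpl in Hv. apply Rabs_def2 in Hv. lra. }
  generalize (filter_and _ _ L U). apply filter_imp. intros v [[H1|H1] [H2|H2]]; auto.
Qed.

Lemma clamp_glue u : a <= u <= b ->
  locally u (fun v => Phi u (p v) = Phi (cl v) (p v) /\ phi u (p v) = phi (cl v) (p v)).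
Proof.
  intro H. destruct (Hglue u H) as (e & He & G).
  assert (L : locally u (fun v => Rabs (v - u) < e)) by (exists (mkposreal e He); now intros v Hv).
  generalize (filter_and _ _ (clamp_locally u H) L). apply filter_imp. intros v [[Hv| ->] Hve]; [|easy].
  rewrite (clamp_id v Hv). destruct (G v Hv Hve). now split.
Qed.

Lemma Pd_path u : a <= u <= b -> Pd p u (pderiv p u).
Proof.
  intro H. destruct (Hp u H) as (H1 & H2 & _). apply Pd_parts. split; now apply Derive_correct.
Qed.

Let integrand v := (phi (cl v) (p v) * pderiv p v)%C.

(** Near u the moving germ coincides along the path with the fixed germ [Phi u], to which the chain
    rule applies. *)
Lemma Pd_primitive u : a <= u <= b -> Pd (fun v => Phi (cl v) (p v)) u (integrand u).
Proof.
  intro H. apply Pd_ext with (fun v => Phi u (p v)).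
  - apply (filter_imp _ _ (fun v K => proj1 K) (clamp_glue u H)).
  - unfold integrand. rewrite clamp_id by easy. apply Pd_comp; [now apply HPhi|now apply Pd_path].
Qed.

Lemma integrand_cont u : a <= u <= b -> continuous (fun v => Re (integrand v)) u /\ continuous (fun v => Im (integrand v)) u.
Proof.
  intro H. destruct (Hphi u H) as [w Hw]. destruct (Hp u H) as (_ & _ & C1 & C2).
  assert (P : Pd (fun v => phi (cl v) (p v)) u (w * pderiv p u)%C).
  { apply Pd_ext with (fun v => phi u (p v)).
    - apply (filter_imp _ _ (fun v K => proj2 K) (clamp_glue u H)).
    - apply Pd_comp; [exact Hw|now apply Pd_path]. }
  destruct (Pd_cont _ _ _ P) as [P1 P2]. split.
  - apply (continuous_minus (V := R_NormedModule) (fun v => Re (phi (cl v) (p v)) * Derive (fun w => Re (p w)) v)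
       (fun v => Im (phi (cl v) (p v)) * Derive (fun w => Im (p w)) v)); now apply (continuous_mult (K := R_AbsRing)).
  - apply (continuous_plus (V := R_NormedModule) (fun v => Re (phi (cl v) (p v)) * Derive (fun w => Im (p w)) v)
       (fun v => Im (phi (cl v) (p v)) * Derive (fun w => Re (p w)) v)); now apply (continuous_mult (K := R_AbsRing)).
Qed.

Lemma path_FTC : CRInt (fun u => phi u (p u) * pderiv p u)%C a b = (Phi b (p b) - Phi a (p a))%C.
Proof.
  assert (Hmm : forall x, Rmin a b <= x <= Rmax a b -> a <= x <= b) by (intro x; rewrite Rmin_left, Rmax_right by lra; lra).
  assert (Hcl : forall u, a <= u <= b -> (phi u (p u) * pderiv p u)%C = integrand u) by (intros u Hu; unfold integrand; now rewrite clamp_id).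
  replace (Phi b (p b) - Phi a (p a))%C with (Phi (cl b) (p b) - Phi (cl a) (p a))%C by (rewrite !clamp_id by lra; reflexivity).
  unfold CRInt. rewrite (RInt_ext _ (fun u => Re (integrand u))) by (intros x Hx; rewrite Hcl by (apply Hmm; lra); reflexivity).
  rewrite (RInt_ext (fun x => Im (phi x (p x) * pderiv p x)%C) (fun u => Im (integrand u))) by (intros x Hx; rewrite Hcl by (apply Hmm; lra); reflexivity).
  apply injective_projections; simpl; apply is_RInt_unique.
  - apply (is_RInt_derive (V := R_CompleteNormedModule) (fun v => Re (Phi (cl v) (p v))) (fun u => Re (integrand u))).
    + intros x Hx. apply (Pd_parts _ _ _), Pd_primitive. auto.
    + intros x Hx. now apply integrand_cont, Hmm.
  - apply (is_RInt_derive (V := R_CompleteNormedModule) (fun v => Im (Phi (cl v) (p v))) (fun u => Im (integrand u))).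
    + intros x Hx. apply (Pd_parts _ _ _), Pd_primitive. auto.
    + intros x Hx. now apply integrand_cont, Hmm.
Qed.
End Path.

Definition primF (So : sol Local_ (X Local_ gw)) (e : dpole) (plus : bool) (ci c0 : C) (n : nat) (l r z : C) : C :=
  (sgn plus * evr Local_ (spt e plus ci c0 l r z) (vW Local_ bser (X Local_ gw) So (2 * n)%nat))%C.

Lemma path_integral So e plus ci c0 n (p : R -> C) (I : R -> Prop) lam rp rm a b :
  (ci * ci - c0 * c0)%C <> RtoC 0 -> lift_ok ci c0 p I lam rp rm -> a <= b -> (forall u, a <= u <= b -> I u) -> (1 <= n)%nat ->
  (forall u, a <= u <= b ->
  ex_derive (fun v => Re (p v)) u /\ ex_derive (fun v => Im (p v)) u /\
  continuous (fun v => Derive (fun w => Re (p w)) v) u /\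
  continuous (fun v => Derive (fun w => Im (p w)) v) u) ->
  CRInt (fun u => Rodd (rp u) (rm u) n (p u) * pderiv p u)%C a b =
  (primF So e plus ci c0 n (lam b O (p b)) (rp b O (p b)) (p b) - primF So e plus ci c0 n (lam a O (p a)) (rp a O (p a)) (p a))%C.
Proof.
  intros Hm [Hloc Hglue] Hab HI Hn Hp.
  set (x := vW Local_ bser (X Local_ gw) So (2 * n)%nat).
  set (ev := fun u z y => evr Local_ (spt e plus ci c0 (lam u O z) (rp u O z) z) y).
  set (Phi := fun u z => (sgn plus * ev u z x)%C).
  set (phi := fun u z => (sgn plus * ev u z (Dt Local_ x) / z)%C).
  assert (Dx : Dt Local_ x = vo Local_ _ So (2 * n)%nat).
  { apply (vW_D Local_ bser bser_quot _ (X Local_ gwi)); [|lia]. apply rel_wi. }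
  assert (Hev : forall u, a <= u <= b -> forall y, Cd (fun z => ev u z y) (p u) (ev u (p u) (Dt Local_ y) / p u)%C).
  { intros u Hu y. destruct (Hloc u (HI u Hu)) as (d & Hd & H).
    apply (evr_spt_deriv ci c0 (p u) d (lam u) (rp u) (rm u) Hm H plus e y (p u)).
    replace (p u - p u)%C with (RtoC 0) by ring. rewrite Cmod_0. exact Hd. }
  assert (Hnz : forall u, a <= u <= b -> p u <> RtoC 0).
  { intros u Hu. destruct (Hloc u (HI u Hu)) as (d & Hd & H). apply H.
    replace (p u - p u)%C with (RtoC 0) by ring. rewrite Cmod_0. exact Hd. }
  assert (E : CRInt (fun u => Rodd (rp u) (rm u) n (p u) * pderiv p u)%C a b = CRInt (fun u => phi u (p u) * pderiv p u)%C a b).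
  { assert (Hmm : forall x, Rmin a b < x < Rmax a b -> a <= x <= b) by (intro t; rewrite Rmin_left, Rmax_right by lra; lra).
    assert (K : forall u, a <= u <= b -> Rodd (rp u) (rm u) n (p u) = phi u (p u)).
    { intros u Hu. destruct (Hloc u (HI u Hu)) as (d & Hd & H).
      rewrite (Rodd_evr ci c0 (p u) d (lam u) (rp u) (rm u) Hm H plus So e (p u) n).
      - unfold phi. rewrite Dx. reflexivity.
      - replace (p u - p u)%C with (RtoC 0) by ring. rewrite Cmod_0. exact Hd. }
    unfold CRInt. f_equal; apply RInt_ext; intros u Hu; now rewrite K by auto. }
  rewrite E. apply (path_FTC p a b Phi phi Hab Hp).
  - intros u Hu. unfold Phi, phi. eapply Cd_val; [apply Cd_mult; [apply Cd_const|now apply Hev]|]. cbv beta. toC. field. auto.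
  - intros u Hu. eexists. unfold phi. apply Cd_mult; [apply Cd_mult; [apply Cd_const|now apply Hev]|]. apply (Cd_inv (fun z => z)); [apply Cd_id|auto].
  - intros u Hu. destruct (Hglue u (HI u Hu)) as (eps & He & G). exists eps. split; [exact He|]. intros u' Hu' Hd.
    destruct (G u' (HI u' Hu') Hd) as (d & Hd2 & Gz). specialize (Gz (p u')).
    replace (p u' - p u')%C with (RtoC 0) in Gz by ring. rewrite Cmod_0 in Gz. destruct (Gz Hd2) as [G1 G2].
    unfold Phi, phi, ev. rewrite G1, G2. now split.
Qed.

Section OppSq.
Variable A : calg.
Add Ring Ar : (ath A).
Lemma opp_sq (a : A) : (- a * - a = a * a)%A.
Proof. ring. Qed.
End OppSq.

Section Values.
Local Open Scope C_scope.
Variable So : sol Local_ (X Local_ gw).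

(** The value at - W is the value at W of the conjugate element. In the generic ring the conjugate
    is the primitive of the solution with leading term - w, and [vW_odd] applies. *)
Lemma primitive_odd L S ci c0 W k : curve L S ci c0 W -> W <> RtoC 0 -> L <> RtoC 0 -> S <> RtoC 0 -> ci * ci - c0 * c0 <> RtoC 0 ->
  evr Local_ (mkpt L S ci c0 (- W)) (vW Local_ bser _ So k) = - evr Local_ (mkpt L S ci c0 W) (vW Local_ bser _ So k).
Proof.
  intros Hc HW HL HS Hm.
  assert (HW' : - W <> RtoC 0) by (intro E; apply HW; transitivity (- - W); [ring|rewrite E; ring]).
  assert (Hc' : curve L S ci c0 (- W)) by (destruct Hc as [A B]; split; [exact A|rewrite <- B; ring]).
  assert (VG := valid_generic L S ci c0 W Generic Hc HW HL HS Hm ltac:(discriminate)).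
  assert (VL := valid_generic L S ci c0 (- W) Local_ Hc' HW' HL HS Hm ltac:(discriminate)).
  rewrite <- (mkpt_conj L S ci c0 W VG VL), <- (mkpt_incl Generic _ VG).
  assert (B1 : forall g, match g with gl | gs | gci | gc0 => incl Generic (X Local_ g) = X Generic g | gx1 | gx2 => incl Generic (X Local_ g) = X Generic g \/ incl Generic (X Local_ g) = 0%A | _ => True end)
    by (intro g; destruct g; trivial; rewrite incl_gv; now try left).
  assert (B2 : forall g, match g with gl | gs | gci | gc0 => conj (X Local_ g) = X Generic g | gx1 | gx2 => conj (X Local_ g) = X Generic g \/ conj (X Local_ g) = 0%A | _ => True end)
    by (intro g; destruct g; trivial; rewrite conj_gv; now try left).
  assert (W1 : (incl Generic (X Local_ gwi) * incl Generic (X Local_ gwi))%A = (X Generic gwi * X Generic gwi)%A) by (now rewrite incl_gv).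
  assert (W2 : (conj (X Local_ gwi) * conj (X Local_ gwi))%A = (X Generic gwi * X Generic gwi)%A).
  { rewrite conj_gv. cbn [vconj]. apply opp_sq. }
  rewrite (image_vW Generic (incl Generic) B1 W1 (X Generic gw) (incl_gv _ _) So), (image_vW Generic conj B2 W2 (- X Generic gw)%A (conj_gv _) So).
  match goal with |- ?l = - ?r => match l with evr _ _ ?b' => match r with evr _ _ ?a' => set (b := b'); set (a := a') end end end.
  assert (E : (a + b)%A = 0%A) by (apply (vW_odd bser (X Generic gw) (X Generic gwi) (rel_wi Generic))).
  apply (f_equal (evr Generic (mkpt L S ci c0 W))) in E. rewrite (evrD _ _ VG), <- (inj0 (AL Generic)), (evrI _ _ VG) in E.
  transitivity (- evr Generic (mkpt L S ci c0 W) a + (evr Generic (mkpt L S ci c0 W) a + evr Generic (mkpt L S ci c0 W) b)); [ring|].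
  rewrite E. ring.
Qed.

Lemma evr_apow lv u (Hu : forall e f, rel lv e f -> eval gen CA u e = eval gen CA u f) x n :
  evr lv u (apow x n) = Cpow (evr lv u x) n.
Proof.
  induction n; cbn [apow Cpow].
  - rewrite <- inj1. apply (evrI _ _ Hu).
  - now rewrite (evrM _ _ Hu), IHn.
Qed.

Lemma Cpow_inv (c : C) n : c <> RtoC 0 -> Cpow (/ c) n = / Cpow c n /\ Cpow c n <> RtoC 0.
Proof.
  intro H. induction n as [|n [IH N]]; simpl.
  - split; [field|]. intro E. apply RtoC_inj in E. lra.
  - split; [rewrite IH; field; auto|now apply Cmult_neq_0].
Qed.
Lemma Cpow_m1 n : Cpow (RtoC (-1)) (2 * n) = RtoC 1.
Proof.
  induction n; trivial. replace (2 * Datatypes.S n)%nat with (Datatypes.S (Datatypes.S (2 * n))) by lia. simpl Cpow. simpl in IHn. rewrite IHn.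
  rewrite <- !RtoC_mult. f_equal. ring.
Qed.

Lemma pole_value ci c0 n : (1 <= n)%nat -> ci <> RtoC 0 -> ci * ci - c0 * c0 <> RtoC 0 ->
  evr Local_ (mkpt ci (RtoC 0) ci c0 ci) (vW Local_ bser _ So (2 * n)%nat) =
  calF_coef ((ci + c0) / RtoC 2) n + calF_coef ((ci - c0) / RtoC 2) n - RtoC 3 * calG_coef ci n.
Proof.
  intros Hn Hci Hm.
  assert (VP := valid_pole ci c0 Hci Hm).
  assert (B : forall g, match g with gl | gs | gci | gc0 => incl Pole (X Local_ g) = X Pole g | gx1 | gx2 => incl Pole (X Local_ g) = X Pole g \/ incl Pole (X Local_ g) = 0%A | _ => True end)
    by (intro g; destruct g; trivial; rewrite incl_gv; now try left).
  assert (W1 : (incl Pole (X Local_ gwi) * incl Pole (X Local_ gwi))%A = (X Pole gwi * X Pole gwi)%A) by (now rewrite incl_gv).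
  rewrite <- (mkpt_incl Pole _ VP), (image_vW Pole (incl Pole) B W1 (X Pole gw) (incl_gv _ _) So).
  rewrite pole_vW by lia. set (k := (2 * n)%nat).
  assert (Hm1 : ci - c0 <> RtoC 0) by (intro E; apply Hm; transitivity ((ci - c0) * (ci + c0)); [ring|rewrite E; ring]).
  assert (Hm2 : ci + c0 <> RtoC 0) by (intro E; apply Hm; transitivity ((ci - c0) * (ci + c0)); [ring|rewrite E; ring]).
  assert (E1 : evr Pole (mkpt ci 0 ci c0 ci) 1%A = RtoC 1) by (rewrite <- inj1; apply (evrI _ _ VP)).
  unfold cp, cm, half.
  repeat rewrite ?(evrM _ _ VP), ?(evrB _ _ VP), ?(evrD _ _ VP), ?(evrI _ _ VP), ?(evr_apow _ _ VP).
  unfold cpi, cmi. repeat rewrite ?(evrM _ _ VP), ?(evrD _ _ VP), ?(evrN _ _ VP), ?(evr_gv _ _ VP), ?E1.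
  rewrite gamF_coef, gamG_coef by (unfold k; lia).
set (P := (ci + c0) / RtoC 2). set (M := (ci - c0) / RtoC 2).
  assert (H2 : RtoC 2 <> RtoC 0) by (intro E; apply RtoC_inj in E; lra).
  assert (HP : P <> RtoC 0) by (intro E; apply Hm2; transitivity (P * RtoC 2); [unfold P; field; exact H2|rewrite E; ring]).
  assert (HM : M <> RtoC 0) by (intro E; apply Hm1; transitivity (M * RtoC 2); [unfold M; field; exact H2|rewrite E; ring]).
  replace ((RtoC 1 + RtoC 1) * - mkpt ci 0 ci c0 ci gy2) with (/ P).
  2: { unfold mkpt. rewrite evC_Y2, <- two_C. unfold P. field. repeat split; trivial.
    intro E; apply Hm2; transitivity (- (- c0 - ci)); [ring|rewrite E; ring]. }
  replace ((RtoC 1 + RtoC 1) * - mkpt ci 0 ci c0 ci gy1) with (/ M).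
  2: { unfold mkpt. rewrite evC_Y1, <- two_C. unfold M. field. split; trivial.
    intro E; apply Hm1; transitivity (- (c0 - ci)); [ring|rewrite E; ring]. }
  change (mkpt ci 0 ci c0 ci gci) with ci. change (mkpt ci 0 ci c0 ci gc0) with c0. change (mkpt ci 0 ci c0 ci gli) with (/ ci).
  replace (/ RtoC 2 * (ci + c0)) with P by (unfold P; field; exact H2).
  replace (/ RtoC 2 * (ci - c0)) with M by (unfold M; field; exact H2).
  replace (Cpow (RtoC (-1)) k) with (RtoC 1) by (symmetry; apply Cpow_m1). unfold calF_coef, calG_coef. fold k.
  assert (Ek : k = S (k - 1)) by (unfold k; lia). set (j := (k - 1)%nat) in *.
  assert (Kp : forall c : C, c <> RtoC 0 -> c * c * Cpow (/ c) (S k) = / Cpow c j).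
  { intros c Hc. rewrite Ek. cbn [Cpow]. rewrite (proj1 (Cpow_inv c j Hc)). field. split; trivial. now apply Cpow_inv. }
  rewrite !Kp by trivial.
  set (a := / Cpow P j). set (b := / Cpow M j). set (g := / Cpow ci j). clearbody a b g.
  assert (Nk : INR k <> 0%R) by (apply not_0_INR; lia).
  assert (Nj : INR j <> 0%R) by (apply not_0_INR; lia).
  assert (Nf : INR (fact k) <> 0%R) by apply INR_fact_neq_0.
  unfold bser. set (B' := bernoulli k).
  assert (E0 : / (RtoC (INR k) * (RtoC (INR k) - RtoC 1)) * RtoC (INR (fact k)) * RtoC (B' / INR (fact k)) = RtoC (B' / (INR k * INR j))).
  { assert (Ej : INR j = (INR k - 1)%R) by (rewrite Ek, S_INR; ring).
    rewrite <- RtoC_minus, <- Ej, <- RtoC_mult, <- RtoC_inv, <- !RtoC_mult by (now apply Rmult_integral_contrapositive). f_equal. field. auto. }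
  assert (E2 : RtoC ((/ 2 ^ j - 1) / (INR k * INR j) * B') = RtoC (2 * / 2 ^ k - 1) * RtoC (B' / (INR k * INR j))).
  { rewrite <- RtoC_mult. f_equal. rewrite Ek. cbn [pow]. field. repeat split; trivial; try (now rewrite <- Ek). apply pow_nonzero. lra. }
  (* The factor 3 of G is the 1 + 1/2 of [pole_btLam] times the 2 of [gamG_coef]. *)
  rewrite E2. rewrite <- E0. replace (RtoC 3) with (RtoC 1 + RtoC 2) by (rewrite <- RtoC_plus; f_equal; lra).
  set (f1 := RtoC (B' / INR (fact k))). set (f2 := RtoC (INR (fact k))). set (f3 := / _). field.
Qed.
Lemma evr_reduct u (Hu : forall e f, rel Local_ e f -> eval gen CA u e = eval gen CA u f) x :
  evr Local_ u (reduct x) = evr Local_ (fun g => match g with gx1 | gx2 => RtoC 0 | _ => u g end) x.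
Proof.
  set (u0 := fun g => match g with gx1 | gx2 => RtoC 0 | _ => u g end).
  assert (H0 : forall e f, rel Local_ e f -> eval gen CA u0 e = eval gen CA u0 f).
  { intros e f H. assert (E := Hu e f H). destruct H; try discriminate; exact E. }
  revert x. apply presented_ind; intros; rewrite ?hmI, ?hmD, ?hmB, ?hmM, ?(evrI _ _ Hu), ?(evrD _ _ Hu), ?(evrB _ _ Hu), ?(evrM _ _ Hu),
    ?(evrI _ _ H0), ?(evrD _ _ H0), ?(evrB _ _ H0), ?(evrM _ _ H0), ?H, ?H1; trivial.
  rewrite reduct_gv, (evr_gv _ _ H0). destruct g; cbn [vreduct u0]; rewrite <- ?(inj0 (AL Local_)), ?(evrI _ _ Hu), ?(evr_gv _ _ Hu); easy.
Qed.
End Values.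

(** [gx1] and [gx2] take the values 1/X, unbounded near the pole. Elements in the image of [reduct]
    can be evaluated with these generators set to 0, so that their values have limits. *)
Lemma reduced_sol_exists : exists So : sol Local_ (X Local_ gw), forall b k, exists x,
  vW Local_ b (X Local_ gw) So k = reduct x.
Proof.
  destruct sol_exists as [S].
  assert (Hb : forall g, match g with gl | gs | gci | gc0 => reduct (X Local_ g) = X Local_ g
    | gx1 | gx2 => reduct (X Local_ g) = X Local_ g \/ reduct (X Local_ g) = 0%A | _ => True end)
    by (intro g; destruct g; trivial; rewrite reduct_gv; now try right).
  assert (W1 : (reduct (X Local_ gwi) * reduct (X Local_ gwi))%A = (X Local_ gwi * X Local_ gwi)%A) by (now rewrite reduct_gv).
  exists (sol_image Local_ reduct Hb W1 (X Local_ gw) (reduct_gv _) S).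
  intros b k. eexists. symmetry. apply image_vW.
Qed.

(** * The limit at the double pole *)

Section Limits.
Local Open Scope C_scope.
Context {T : Type} (F : (T -> Prop) -> Prop) {FF : Filter F}.
Definition Clim (f : T -> C) (l : C) : Prop := filterlim f F (locally (T := C_UniformSpace) l).

Lemma Clim_absring f l : Clim f l <-> filterlim f F (locally (T := AbsRing_UniformSpace C_AbsRing) l).
Proof. split; intros H P HP; apply H, locally_absring, HP. Qed.
Lemma Clim_const c : Clim (fun _ => c) c.
Proof. apply filterlim_const. Qed.
Lemma Clim_plus f g a b : Clim f a -> Clim g b -> Clim (fun t => f t + g t) (a + b).
Proof.
  rewrite !Clim_absring. intros H1 H2.
  apply (filterlim_comp_2 f g (fun x y => plus x y) H1 H2), (filterlim_plus (K := C_AbsRing) (V := AbsRing_NormedModule C_AbsRing)).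
Qed.
Lemma Clim_mult f g a b : Clim f a -> Clim g b -> Clim (fun t => f t * g t) (a * b).
Proof.
  rewrite !Clim_absring. intros H1 H2.
  apply (filterlim_comp_2 f g (fun x y => mult x y) H1 H2), (filterlim_mult (K := C_AbsRing)).
Qed.
Lemma Clim_minus f g a b : Clim f a -> Clim g b -> Clim (fun t => f t - g t) (a - b).
Proof.
  intros H1 H2. apply Clim_plus; trivial.
  replace (- b) with (RtoC (-1) * b) by (replace (RtoC (-1)) with (- RtoC 1) by (rewrite <- RtoC_opp; easy); ring).
  apply filterlim_ext with (fun t => RtoC (-1) * g t).
  - intro t. replace (RtoC (-1)) with (- RtoC 1) by (rewrite <- RtoC_opp; easy). ring.
  - apply Clim_mult; trivial. apply Clim_const.
Qed.
Lemma Clim_inv f a : a <> RtoC 0 -> Clim f a -> Clim (fun t => / f t) (/ a).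
Proof.
  intros Ha H. apply (filterlim_comp _ _ _ f Cinv F _ _ H). apply (Cd_continuous Cinv a _ (Cd_Cinv a Ha)).
Qed.
Lemma Clim_eps f l : (forall eps : R, (0 < eps)%R -> F (fun t => (Cmod (f t - l) < eps)%R)) -> Clim f l.
Proof.
  intros H P HP. apply C_disc_locally in HP. destruct HP as (d & Hd & HP).
  unfold filtermap. generalize (H d Hd). apply filter_imp. intros t Ht. now apply HP.
Qed.
Lemma Clim_dist f l : Clim f l -> forall eps : R, (0 < eps)%R -> F (fun t => (Cmod (f t - l) < eps)%R).
Proof. intros H eps He. apply (H (fun z => Cmod (z - l) < eps)%R), (C_locally_disc l _ eps He). easy. Qed.
Lemma Clim_bound f l (g : T -> C) K : Clim g (RtoC 0) -> F (fun t => (Cmod (f t - l) <= K * Cmod (g t))%R) -> Clim f l.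
Proof.
  intros Hg H. apply Clim_eps. intros eps He.
  assert (PK : (0 < Rabs K + 1)%R) by (assert (h := Rabs_pos K); lra).
  generalize (filter_and _ _ H (Clim_dist g _ Hg (eps / (Rabs K + 1))%R (Rdiv_lt_0_compat _ _ He PK))).
  apply filter_imp. intros t [H1 H2]. replace (g t - RtoC 0) with (g t) in H2 by ring.
  eapply Rle_lt_trans; [exact H1|]. apply Rle_lt_trans with ((Rabs K + 1) * Cmod (g t))%R.
  - apply Rmult_le_compat_r; [apply Cmod_ge_0|]. assert (h := Rle_abs K). lra.
  - apply Rmult_lt_reg_r with (/ (Rabs K + 1))%R; [now apply Rinv_0_lt_compat|].
    replace ((Rabs K + 1) * Cmod (g t) * / (Rabs K + 1))%R with (Cmod (g t)) by (field; lra). exact H2.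
Qed.

Lemma eval_lim (u : T -> gen -> C) (v : gen -> C) : (forall g, Clim (fun t => u t g) (v g)) ->
  forall e, Clim (fun t => eval gen CA (u t) e) (eval gen CA v e).
Proof.
  intros H e. induction e.
  - apply H.
  - apply Clim_const.
  - now apply Clim_plus.
  - now apply Clim_minus.
  - now apply Clim_mult.
Qed.

Definition drop_x (u : gen -> C) (g : gen) : C := match g with gx1 | gx2 => RtoC 0 | _ => u g end.

Lemma unit_neq0 (a b : C) : a * b = RtoC 1 -> a <> RtoC 0.
Proof. intros E Ha. rewrite Ha, Cmult_0_l in E. apply RtoC_inj in E. lra. Qed.

(** Without [gx1] and [gx2] every remaining denominator is nonzero at the pole, as the relations
    valid there show. *)
Lemma mkpt_lim ci c0 (L S W : T -> C) : ci <> RtoC 0 -> ci * ci - c0 * c0 <> RtoC 0 ->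
  Clim L ci -> Clim S (RtoC 0) -> Clim W ci ->
  forall e, Clim (fun t => eval gen CA (drop_x (mkpt (L t) (S t) ci c0 (W t))) e) (eval gen CA (drop_x (mkpt ci (RtoC 0) ci c0 ci)) e).
Proof.
  intros Hci Hm HL HS HW. assert (VP := valid_pole ci c0 Hci Hm).
  assert (HB : forall e, Clim (fun t => eval gen CA (vbase (L t) (S t) ci c0 (W t)) e) (eval gen CA (vbase ci (RtoC 0) ci c0 ci) e)).
  { apply eval_lim. intros []; try apply Clim_const; assumption. }
  apply eval_lim. intros []; try apply Clim_const; cbn [drop_x mkpt]; try assumption; apply Clim_inv; trivial; try apply HB.
  - apply (unit_neq0 _ (mkpt ci (RtoC 0) ci c0 ci gy1)). exact (VP _ _ (r_y1 Pole)).
  - apply (unit_neq0 _ (mkpt ci (RtoC 0) ci c0 ci gn1)). exact (VP _ _ (r_n1 Pole)).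
  - apply (unit_neq0 _ (mkpt ci (RtoC 0) ci c0 ci gy2)). exact (VP _ _ (r_y2 Pole)).
  - apply (unit_neq0 _ (mkpt ci (RtoC 0) ci c0 ci gn2)). exact (VP _ _ (r_n2 Pole)).
Qed.
End Limits.

Lemma at_left_interval x d (P : R -> Prop) : 0 < d -> (forall s, x - d < s < x -> P s) -> at_left x P.
Proof.
  intros Hd H. exists (mkposreal d Hd). intros s Hs Hlt. apply H.
  unfold ball in Hs; simpl in Hs. unfold AbsRing_ball, abs, minus, plus, opp in Hs; simpl in Hs. apply Rabs_def2 in Hs. lra.
Qed.

(** Exchanging c_inf and c_0 sends c_m to - c_m; this oddness is the minus sign in front of F(c_m)
    at the end point 0_{c_0}. *)
Lemma calF_odd (c : C) n : c <> RtoC 0 -> (1 <= n)%nat -> calF_coef (- c)%C n = (- calF_coef c n)%C.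
Proof.
  intros Hc Hn. unfold calF_coef.
  assert (E : forall m, Cpow (- c)%C (S (2 * m)) = (- Cpow c (S (2 * m)))%C).
  { induction m; [cbn; ring|]. replace (S (2 * S m)) with (S (S (S (2 * m)))) by lia. cbn [Cpow] in *. rewrite IHm. ring. }
  replace (2 * n - 1)%nat with (S (2 * (n - 1))) by lia. rewrite E.
  assert (N := proj2 (Cpow_inv c (S (2 * (n - 1))) Hc)). field. exact N.
Qed.

Lemma circ_period tau w k : circ tau w k 0 = (tau + w)%C /\ circ tau w k 1 = (tau + w)%C.
Proof.
  assert (Hn : forall m : nat, cos (2 * PI * INR m) = 1 /\ sin (2 * PI * INR m) = 0).
  { intro m. replace (2 * PI * INR m) with (0 + 2 * INR m * PI) by ring. rewrite cos_period, sin_period, cos_0, sin_0. now split. }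
  assert (Hk : cos (2 * PI * IZR k) = 1 /\ sin (2 * PI * IZR k) = 0).
  { destruct (Z_le_gt_dec 0 k) as [H|H].
    - rewrite <- (Z2Nat.id k H), <- INR_IZR_INZ. apply Hn.
    - destruct (Hn (Z.to_nat (- k))) as [A B]. rewrite INR_IZR_INZ, Z2Nat.id, opp_IZR in A, B by lia.
      replace (2 * PI * - IZR k) with (- (2 * PI * IZR k)) in A, B by ring. rewrite cos_neg in A. rewrite sin_neg in B. split; lra. }
  unfold circ. rewrite Rmult_0_r, Rmult_1_r, cos_0, sin_0. destruct Hk as [-> ->].
  change ((1, 0) : C) with (RtoC 1). split; ring.
Qed.

Lemma circ_smooth tau w k u :
  ex_derive (fun v => Re (circ tau w k v)) u /\ ex_derive (fun v => Im (circ tau w k v)) u /\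
  continuous (fun v => Derive (fun x => Re (circ tau w k x)) v) u /\
  continuous (fun v => Derive (fun x => Im (circ tau w k x)) v) u.
Proof.
  set (m := 2 * PI * IZR k). destruct tau as [t1 t2], w as [w1 w2].
  assert (E1 : forall v, is_derive (fun x => Re (circ (t1, t2) (w1, w2) k x)) v (w1 * (- sin (m * v) * m) - w2 * (cos (m * v) * m))).
  { intro v. apply (is_derive_ext (fun x => t1 + (w1 * cos (m * x) - w2 * sin (m * x)))); [intro x; reflexivity|]. auto_derive; [easy|ring]. }
  assert (E2 : forall v, is_derive (fun x => Im (circ (t1, t2) (w1, w2) k x)) v (w1 * (cos (m * v) * m) + w2 * (- sin (m * v) * m))).
  { intro v. apply (is_derive_ext (fun x => t2 + (w1 * sin (m * x) + w2 * cos (m * x)))); [intro x; reflexivity|]. auto_derive; [easy|ring]. }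
  repeat split.
  - eexists; apply E1.
  - eexists; apply E2.
  - apply continuous_ext with (fun v => w1 * (- sin (m * v) * m) - w2 * (cos (m * v) * m)).
    + intro v. symmetry. apply is_derive_unique, E1.
    + apply (ex_derive_continuous (V := R_NormedModule)). auto_derive. easy.
  - apply continuous_ext with (fun v => w1 * (cos (m * v) * m) + w2 * (- sin (m * v) * m)).
    + intro v. symmetry. apply is_derive_unique, E2.
    + apply (ex_derive_continuous (V := R_NormedModule)). auto_derive. easy.
Qed.

Section AlongPath.
Local Open Scope C_scope.
Variables (ci c0 : C) (p : R -> C) (I : R -> Prop) (lam rp rm : R -> nat -> C -> C).
Hypothesis Hci : ci <> RtoC 0.
Hypothesis Hc0 : c0 <> RtoC 0.
Hypothesis Hm : ci * ci - c0 * c0 <> RtoC 0.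
Hypothesis Hlift : lift_ok ci c0 p I lam rp rm.
Variables (So : sol Local_ (X Local_ gw)) (e : dpole) (plus : bool) (n : nat).
Hypothesis Hn : (1 <= n)%nat.
Notation F l r z := (primF So e plus ci c0 n l r z).

Lemma primF_odd u : I u -> F (lam u O (p u)) (- rp u O (p u)) (p u) = - F (lam u O (p u)) (rp u O (p u)) (p u).
Proof.
  intro Hu. destruct (proj1 Hlift u Hu) as (d & Hd & Hloc).
  assert (Hz : (Cmod (p u - p u) < d)%R) by (replace (p u - p u) with (RtoC 0) by ring; rewrite Cmod_0; exact Hd).
  destruct (spt_on_curve ci c0 (p u) d (lam u) (rp u) (rm u) Hm Hloc plus e (p u) Hz) as (L & S & a & b & E1 & E2 & Hc & HW & HL & HS & Hab).
  unfold primF. cbv beta in E1. rewrite E1, E2, primitive_odd by trivial. ring.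
Qed.

Hypothesis Hred : exists x, vW Local_ bser (X Local_ gw) So (2 * n)%nat = reduct x.
Hypothesis HI : forall s, (0 < s < 1)%R -> I s.
Hypothesis Hp0 : filterlim p (at_left 1) (locally (RtoC 0)).
Hypothesis Hend : endpoint_cond ci c0 e plus p lam rp.

Lemma along_nz s : (0 < s < 1)%R -> p s <> RtoC 0 /\ lam s O (p s) <> RtoC 0.
Proof.
  intro Hs. destruct (proj1 Hlift s (HI s Hs)) as (d & Hd & Hloc).
  assert (Hz : (Cmod (p s - p s) < d)%R) by (replace (p s - p s) with (RtoC 0) by ring; rewrite Cmod_0; exact Hd).
  destruct (Hloc (p s) Hz) as (Z & _ & N & _). now split.
Qed.
Lemma at_left_1 (P : R -> Prop) : (forall s, (0 < s < 1)%R -> P s) -> at_left 1 P.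
Proof. intro H. apply (at_left_interval 1 1); [lra|]. intros s Hs. apply H. lra. Qed.

Lemma endpoint_lim : Clim (at_left 1) (fun s => F (lam s O (p s)) (rp s O (p s)) (p s)) (voros_rhs ci c0 e plus n).
Proof.
  destruct Hred as [x Hx]. assert (FF : Filter (at_left 1)) by typeclasses eauto.
  assert (Hm' : c0 * c0 - ci * ci <> RtoC 0) by (intro E; apply Hm; transitivity (- (c0 * c0 - ci * ci)); [ring|rewrite E; ring]).
  assert (Hs2 : sgn plus * sgn plus = RtoC 1) by (destruct plus; simpl; rewrite <- RtoC_mult; f_equal; lra).
  (* At either kind of end point the point (L, S, W) of the curve tends to (a, 0, a), where a is the
     constant of that end point and b the other one. *)
  assert (core : forall (L S W : R -> C) a b, a <> RtoC 0 -> a * a - b * b <> RtoC 0 ->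
     (forall s, spt e plus ci c0 (lam s O (p s)) (rp s O (p s)) (p s) = mkpt (L s) (S s) a b (W s)) ->
     Clim (at_left 1) L a -> Clim (at_left 1) S (RtoC 0) -> Clim (at_left 1) W a ->
     Clim (at_left 1) (fun s => F (lam s O (p s)) (rp s O (p s)) (p s))
       (sgn plus * (calF_coef ((a + b) / RtoC 2) n + calF_coef ((a - b) / RtoC 2) n - RtoC 3 * calG_coef a n))).
  { intros L S W a b Ha Hab Hpt HL HS HW. assert (VP := valid_pole a b Ha Hab).
    assert (VL : forall e f, rel Local_ e f -> eval gen CA (mkpt a (RtoC 0) a b a) e = eval gen CA (mkpt a (RtoC 0) a b a) f).
    { intros e1 f H. apply VP. destruct H; try discriminate; constructor. }
    rewrite <- (pole_value So a b n Hn Ha Hab), Hx, (evr_reduct _ VL).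
    eapply filterlim_ext_loc.
    2: { apply (@Clim_mult R (at_left 1) FF); [apply (@Clim_const R (at_left 1) FF)|]. apply (@mkpt_lim R (at_left 1) FF a b L S W Ha Hab HL HS HW (proj1_sig x)). }
    apply at_left_1. intros s Hs. unfold primF. rewrite Hx, evr_reduct; [now rewrite Hpt|].
    destruct (proj1 Hlift s (HI s Hs)) as (d & Hd & Hloc).
    assert (Hz : (Cmod (p s - p s) < d)%R) by (replace (p s - p s) with (RtoC 0) by ring; rewrite Cmod_0; exact Hd).
    destruct (spt_on_curve ci c0 (p s) d (lam s) (rp s) (rm s) Hm Hloc plus e (p s) Hz) as (L' & S' & a' & b' & E1 & _ & Hc & HW' & HL' & HS' & Hab').
    cbv beta in E1. rewrite E1. apply valid_generic; trivial. discriminate. }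
  destruct Hend as (K & d & Hd & HE). cbv zeta in HE.
  assert (HW : forall a, (forall s, (1 - d < s < 1)%R -> (Cmod (p s * rp s O (p s) - sgn plus * a) <= K * Cmod (p s))%R) ->
     Clim (at_left 1) (fun s => sgn plus * (p s * rp s O (p s))) a).
  { intros a H. replace a with (sgn plus * (sgn plus * a)) by (rewrite Cmult_assoc, Hs2; ring).
    apply (@Clim_mult R (at_left 1) FF); [apply (@Clim_const R (at_left 1) FF)|]. apply (@Clim_bound R (at_left 1) FF _ _ p K Hp0). now apply (at_left_interval 1 d). }
  destruct e.
  - apply (core (fun s => lam s O (p s)) (fun s => p s / lam s O (p s)) (fun s => sgn plus * (p s * rp s O (p s))) ci c0); trivial.
    + apply (@Clim_bound R (at_left 1) FF _ _ p K Hp0). apply (at_left_interval 1 d); trivial. intros s Hs. apply (HE s Hs).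
    + replace (RtoC 0) with (RtoC 0 * / ci) by ring. apply (@Clim_mult R (at_left 1) FF); [exact Hp0|]. apply Clim_inv; trivial.
      apply (@Clim_bound R (at_left 1) FF _ _ p K Hp0). apply (at_left_interval 1 d); trivial. intros s Hs. apply (HE s Hs).
    + apply HW. intros s Hs. apply (HE s Hs).
  (* The bound on lambda_0 is of order t^2, so it survives a division by t; this yields the limit
     c_0 of t / lambda_0. *)
  - assert (Q : Clim (at_left 1) (fun s => lam s O (p s) / p s) (/ c0)).
    { apply (@Clim_bound R (at_left 1) FF _ _ p K Hp0).
      generalize (filter_and _ _ (at_left_interval 1 d _ Hd HE) (at_left_1 _ along_nz)). apply filter_imp.
      intros s [[H _] [Z _]]. assert (PZ := proj1 (Cmod_gt_0 _) Z).
      replace (lam s O (p s) / p s - / c0) with ((lam s O (p s) - p s / c0) * / p s) by (field; auto).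
      rewrite Cmod_mult, Cmod_inv by exact Z. apply Rmult_le_reg_r with (Cmod (p s)); [exact PZ|].
      rewrite Rmult_assoc, Rinv_l, Rmult_1_r by lra. rewrite Rmult_assoc. exact H. }
    replace (voros_rhs ci c0 P0 plus n) with
      (sgn plus * (calF_coef ((c0 + ci) / RtoC 2) n + calF_coef ((c0 - ci) / RtoC 2) n - RtoC 3 * calG_coef c0 n)).
    + apply (core (fun s => p s / lam s O (p s)) (fun s => lam s O (p s)) (fun s => sgn plus * (p s * rp s O (p s))) c0 ci); trivial.
      * apply filterlim_ext_loc with (fun s => / (lam s O (p s) / p s)).
        -- apply at_left_1. intros s Hs. destruct (along_nz s Hs). field. auto.
        -- replace c0 with (/ / c0) by (field; auto). apply Clim_inv; trivial.
           intro E. apply Hc0. transitivity (c0 * c0 * / c0); [field; auto|]. rewrite E. ring.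
      * apply filterlim_ext_loc with (fun s => lam s O (p s) / p s * p s).
        -- apply at_left_1. intros s Hs. destruct (along_nz s Hs). field. auto.
        -- replace (RtoC 0) with (/ c0 * RtoC 0) by ring. now apply (@Clim_mult R (at_left 1) FF).
      * apply HW. intros s Hs. apply (HE s Hs).
    + unfold voros_rhs. rewrite (Cplus_comm c0 ci).
      replace ((c0 - ci) / RtoC 2) with (- ((ci - c0) / RtoC 2)) by (unfold Cdiv; ring).
      rewrite calF_odd; [ring| |exact Hn].
      intro E. apply Hm. transitivity ((ci - c0) / RtoC 2 * (RtoC 2 * (ci + c0))); [field|rewrite E; ring].
Qed.
End AlongPath.
Theorem theorem3p2
  (cinf c0 : C)
  (Hinf : cinf <> RtoC 0) (H0 : c0 <> RtoC 0)
  (Hm : (cinf * cinf - c0 * c0)%C <> RtoC 0)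
  (Hp : (cinf * cinf + c0 * c0)%C <> RtoC 0)
  (e : dpole) (plus : bool)
  (tau : C) (Gam : R -> C) (lamG rpG rmG : R -> nat -> C -> C)
  (a : R) (k : Z) (lamC rpC rmC : R -> nat -> C -> C) :
  (* Gam is a (C^1) path from tau to the double pole t = 0 *)
  Gam 0 = tau -> Gam 1 = RtoC 0 ->
  filterlim Gam (at_right 0) (locally tau) ->
  filterlim Gam (at_left 1) (locally (RtoC 0)) ->
  (forall s, 0 < s < 1 ->
     ex_derive (fun u => Re (Gam u)) s /\ ex_derive (fun u => Im (Gam u)) s /\
     continuous (fun u => Derive (fun v => Re (Gam v)) u) s /\
     continuous (fun u => Derive (fun v => Im (Gam v)) u) s) ->
  (* analytic continuation of lambda^(0), R_+, R_- along Gam *)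
  lift_ok cinf c0 Gam (fun s => 0 < s < 1) lamG rpG rmG ->
  (* tau is a turning point (zero tau <> 0 of Delta) or the simple pole
     for the branch lambda_0 along Gam *)
  ((tau <> RtoC 0 /\
    filterlim (fun s => dFv cinf c0 (lamG s O (Gam s)) (Gam s))
              (at_right 0) (locally (RtoC 0))) \/
   (tau = RtoC 0 /\
    filterlim (fun s => (lamG s O (Gam s) * lamG s O (Gam s) / Gam s)%C)
              (at_right 0) (locally (c0 / cinf)%C))) ->
  (* the end point is 0_{c_*, +-} *)
  endpoint_cond cinf c0 e plus Gam lamG rpG ->
  (* the contour on the Riemann surface of sqrt Delta encircling tau:
     Gam^{-1} on the other sheet from 0 to Gam a, the circle
     |t - tau| = |Gam a - tau| (k times round), then Gam from Gam a to 0;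
     the closed disc contains no singular point other than tau and
     contains Gam([0,a]) *)
  0 < a < 1 -> Gam a <> tau ->
  (forall s, 0 <= s <= a -> Cmod (Gam s - tau)%C <= Cmod (Gam a - tau)%C) ->
  (forall z : C, 0 < Cmod (z - tau)%C <= Cmod (Gam a - tau)%C ->
     regular_point cinf c0 z) ->
  k <> 0%Z ->
  lift_ok cinf c0 (circ tau (Gam a - tau)%C k) (fun th => 0 <= th <= 1)
          lamC rpC rmC ->
  (exists d, 0 < d /\ forall z : C, Cmod (z - Gam a)%C < d ->
     lamC 0 O z = lamG a O z /\ rpC 0 O z = Copp (rpG a O z) /\
     lamC 1 O z = lamG a O z /\ rpC 1 O z = rpG a O z) ->
  (* conclusion: the coefficient of eta^{1-2n} of the Voros coefficient,
     1/2 * (contour integral of R_{2n-1})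
       = int_{Gam|[a,1]} R_{2n-1} dt + 1/2 int_{circle} R_{2n-1} dt,
     equals the coefficient of eta^{1-2n} of the right-hand side *)
  forall n : nat, (1 <= n)%nat ->
  filterlim
    (fun b => CRInt (fun s => (Rodd (rpG s) (rmG s) n (Gam s) * pderiv Gam s)%C) a b)
    (at_left 1)
    (locally (voros_rhs cinf c0 e plus n
              - / RtoC 2 *
                CRInt (fun th => (Rodd (rpC th) (rmC th) n
                                    (circ tau (Gam a - tau)%C k th)
                                  * pderiv (circ tau (Gam a - tau)%C k) th)%C) 0 1)%C).
Proof.
  intros G0 G1 Gtau Gend Gsm HG Htau Hend Ha Hat Hdisc Hreg Hk HC Hglue n Hn.
  destruct reduced_sol_exists as [So Hred]. assert (FF : Filter (at_left 1)) by typeclasses eauto.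
  set (F := primF So e plus cinf c0 n).
  set (Fa := F (lamG a O (Gam a)) (rpG a O (Gam a)) (Gam a)).
  assert (Hcirc : CRInt (fun th => (Rodd (rpC th) (rmC th) n (circ tau (Gam a - tau)%C k th) * pderiv (circ tau (Gam a - tau)%C k) th)%C) 0 1
    = (RtoC 2 * Fa)%C).
  { rewrite (path_integral So e plus cinf c0 n _ _ lamC rpC rmC 0 1 Hm HC); trivial; [|lra|intros; apply circ_smooth].
    destruct (circ_period tau (Gam a - tau)%C k) as [-> ->].
    replace (tau + (Gam a - tau))%C with (Gam a) by ring.
    destruct Hglue as (d & Hd & Hz). destruct (Hz (Gam a)) as (-> & -> & -> & ->).
    { replace (Gam a - Gam a)%C with (RtoC 0) by ring. rewrite Cmod_0. exact Hd. }
    (* The circle starts on the sheet of - sqrt(Delta) and ends on that of [Gam], so the boundary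
       terms - Fa and Fa differ by 2 Fa. *)
    rewrite (primF_odd cinf c0 Gam _ lamG rpG rmG Hm HG So e plus n a Ha). fold F. fold Fa. ring. }
  rewrite Hcirc. replace (/ RtoC 2 * (RtoC 2 * Fa))%C with Fa by (field; intro E; apply RtoC_inj in E; lra).
  apply filterlim_ext_loc with (fun b => (F (lamG b O (Gam b)) (rpG b O (Gam b)) (Gam b) - Fa)%C).
  - apply (at_left_interval 1 (1 - a)); [lra|]. intros b Hb. symmetry.
    apply (path_integral So e plus cinf c0 n Gam _ lamG rpG rmG a b Hm HG); trivial; [lra|intros; lra|].
    intros u Hu. apply Gsm. lra.
  - apply (@Clim_minus R (at_left 1) FF); [|apply (@Clim_const R (at_left 1) FF)].
    now apply (endpoint_lim cinf c0 Gam _ lamG rpG rmG Hinf H0 Hm HG So e plus n).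
Qed.
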